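(* Let $\hat W(\alpha_1,\alpha_2)$ be a function satisfying the angular simplified formulation ASF (see context). Then $\hat W$ (continued analytically) has the following properties, which compose the stencil formulation StF: StF1. $\big[(\alpha_1+\alpha_2+\tfrac{\pi}{2})(\alpha_1+\alpha_2-\tfrac{5\pi}{2})(\alpha_1-\alpha_2-\tfrac{3\pi}{2})(\alpha_1-\alpha_2+\tfrac{3\pi}{2})\big]^{-1/2}\hat W(\alpha_1,\alpha_2)$ is analytic on $\Omega\cup\Omega_{+-}\cup\Omega_{-+}\cup\Omega_{--}$. StF2. For $(\alpha_1,\alpha_2)\in m^-\times m^-$, $$\hat W(\alpha_1,\alpha_2)+\hat W(2\pi+\alpha_1,2\pi+\alpha_2)-\hat W(\alpha_1,2\pi+\alpha_2)-\hat W(2\pi+\alpha_1,\alpha_2)=0 .$$ StF3. For $(\alpha_1,\alpha_2)\in m^-\times m^-$, $\hat W(\alpha_1,\alpha_2)=\hat W(\pi-\alpha_1,\alpha_2)$, $\hat W(\alpha_1,\alpha_2)=\hat W(\alpha_1,\pi-\alpha_2)$ and $\hat W(\alpha_1,\alpha_2)=\hat W(\pi-\alpha_1,\pi-\alpha_2)$. StF4. $\hat W$ satisfies the growth condition ASF5 (see context). Conversely, if a function satisfies the stencil formulation StF, then it satisfies the angular simplified formulation ASF.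
   Context: $k\in\mathbb C$ has $\mathrm{Re}[k]>0$ and vanishingly small positive imaginary part. $\hat H^{\pm}$ are the upper and lower half-planes; $h^{\pm}$ is the image of the real axis under $\xi\mapsto\pm\sqrt{k^2-\xi^2}$ (root with positive imaginary part), a curve from $\pm k$ to $\pm i\infty$; $H^\pm=\hat H^\pm\setminus h^\pm$. The angular variable is $\alpha=\arcsin(\xi/k)$, i.e. $\xi=k\sin\alpha$, with the branch $\arcsin0=0$ continued analytically from the real axis to $H^\pm$. $\Gamma_\alpha$ is the image of the real axis; $M^\pm$ are the (curved) strips that are the images of $H^\pm$; $m^\pm=\Gamma_\alpha\pm\pi/2$ are the images of the two shores of $h^\pm$. The common boundary $\Gamma_\alpha$ of $M^+$ and $M^-$ belongs to $M^+\cup M^-$ (so $M^+\cup M^-$ is the strip between $m^-$ and $m^+$), and functions are continuous up to $m^\pm$. $m^-$ is invariant under $\alpha\mapsto-\pi-\alpha$ and $m^+$ under $\alpha\mapsto\pi-\alpha$. For a set $A$, $\pi-A=\{\pi-\alpha:\alpha\in A\}$. $\Omega=(M^+\cup M^-)\times(M^+\cup M^-)$, $\Omega_{+-}=(M^+\cup M^-)\times(\pi-(M^+\cup M^-))$, $\Omega_{-+}=(\pi-(M^+\cup M^-))\times(M^+\cup M^-)$, $\Omega_{--}=(\pi-(M^+\cup M^-))\times(\pi-(M^+\cup M^-))$. $\hat K(\alpha_1,\alpha_2)=k^{-1}(1-\sin^2\alpha_1-\sin^2\alpha_2)^{-1/2}$, with $\hat K(0,0)=1/k$ continued along $\Gamma_\alpha\times\Gamma_\alpha$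 (where it is non-singular); on $m^-\times m^-$ it is fixed by continuity from $\hat K(-\tfrac\pi2,-\tfrac\pi2)=-i/k$. Formulation ASF for $\hat W$: ASF1: $\hat W$ is analytic in $(M^+\times(M^+\cup M^-))\cup((M^+\cup M^-)\times M^+)$. ASF2: $\hat W(\alpha_1,\alpha_2)=\hat W(\pi-\alpha_1,\alpha_2)$ and $\hat W(\alpha_1,\alpha_2)=\hat W(\alpha_1,\pi-\alpha_2)$ on $m^+\times m^+$. ASF3: $\hat U=-i\hat K\hat W$ (defined initially on $\Gamma_\alpha\times\Gamma_\alpha$) is analytic on, i.e. continues analytically to, $M^-\times M^-$. ASF4: on $m^-\times m^-$, $\hat U(\alpha_1,\alpha_2)+\hat U(-\pi-\alpha_1,-\pi-\alpha_2)=\hat U(\alpha_1,-\pi-\alpha_2)+\hat U(-\pi-\alpha_1,\alpha_2)$. ASF5: there is a constant $\mu$ such that for real $\alpha_{1,0},\alpha_{2,0},\alpha'_{1,0},\alpha'_{2,0}$ with $(\alpha'_{1,0})^2+(\alpha'_{2,0})^2=1$, chosen such that the points $(\alpha_{1,0}+i\Lambda\alpha'_{1,0},\alpha_{2,0}+i\Lambda\alpha'_{2,0})$ lie in the domains of analyticity of ASF1 and ASF3, one has $|\hat W(\alpha_{1,0}+i\Lambda\alpha'_{1,0},\alpha_{2,0}+i\Lambda\alpha'_{2,0})|<\exp\{\mu\Lambda\}$ for large enough $\Lambda>0$. Branches in StF2 and StF3. $\hat W$ is branching but is single-valued on each of the four sets $m^-\times m^-$, $(2\pi+m^-)\times m^-$,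 $m^-\times(2\pi+m^-)$, $(2\pi+m^-)\times(2\pi+m^-)$; its values there are fixed by continuity from the reference points $(-\tfrac\pi2,-\tfrac\pi2)$, $(\tfrac{3\pi}2,-\tfrac\pi2)$, $(-\tfrac\pi2,\tfrac{3\pi}2)$, $(\tfrac{3\pi}2,\tfrac{3\pi}2)$ respectively. The value at $(-\tfrac\pi2,-\tfrac\pi2)$ is obtained by continuation from $(\tfrac\pi2,\tfrac\pi2)$ along a path close to the real plane bypassing the branch line $\alpha_1+\alpha_2=-\pi/2$ on the side $\mathrm{Im}[\alpha_1+\alpha_2]>0$ (the side on which $\hat K(-\tfrac\pi2,-\tfrac\pi2)=-i/k$); the other three reference points are reached from $(\tfrac\pi2,\tfrac\pi2)$ along the images of this path under $\alpha_1\mapsto\pi-\alpha_1$, under $\alpha_2\mapsto\pi-\alpha_2$, and under both. *)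

(* Defs.v *)
From Stdlib Require Import Reals.
From Coquelicot Require Export Coquelicot.

Open Scope C_scope.

(** * Sets and functions of one and two complex variables *)

Definition cup {T : Type} (A B : T -> Prop) : T -> Prop := fun x => A x \/ B x.

Definition prodset (A B : C -> Prop) : C * C -> Prop :=
  fun p => A (fst p) /\ B (snd p).

(* c + A *)
Definition shift (c : C) (A : C -> Prop) : C -> Prop := fun z => A (z - c).

(* PI - A *)
Definition pi_minus (A : C -> Prop) : C -> Prop := fun z => A (PI - z).

Definition Csin (z : C) : C :=
  (sin (Re z) * cosh (Im z), cos (Re z) * sinh (Im z))%R.

(* "f is analytic on A" for an arbitrary, not necessarily open, set A: f agrees
   on A with a function holomorphic on an open set containing A.  Only the
   values of f on A matter. *)
Definition analytic_on (A : C * C -> Prop) (f : C * C -> C) : Prop :=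
  exists (O : C * C -> Prop) (F : C * C -> C),
    open O /\ (forall p, A p -> O p) /\
    (forall p, O p -> ex_filterdiff (K := C_AbsRing) F (locally p)) /\
    (forall p, A p -> F p = f p).

(** * The angular variable and the strips *)

(* [h_plus] is the image of the real axis under sqrt (k^2 - xi^2), the root
   having positive imaginary part. *)
Definition h_plus (k : C) : C -> Prop :=
  fun eta => exists xi : R, eta ^ 2 = k ^ 2 - (RtoC xi) ^ 2 /\ (0 < Im eta)%R.

Definition h_minus (k : C) : C -> Prop := fun eta => h_plus k (- eta).

(* [a] is xi |-> arcsin (xi / k), with arcsin 0 = 0, continued analytically to
   the (connected) complement of the two cuts; this determines [a] there. *)
Definition angular_branch (k : C) (a : C -> C) : Prop :=
  a 0 = 0 /\
  forall xi, ~ h_plus k xi -> ~ h_minus k xi ->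
    ex_derive (K := C_AbsRing) a xi /\ k * Csin (a xi) = xi.

Definition Gamma (a : C -> C) : C -> Prop :=
  fun alpha => exists xi : R, alpha = a (RtoC xi).

(* The common boundary [Gamma] is counted in both M+ and M-, whereas the outer
   boundaries m+ and m- are not. *)
Definition M_plus (k : C) (a : C -> C) : C -> Prop :=
  fun alpha => exists xi, (0 <= Im xi)%R /\ ~ h_plus k xi /\ alpha = a xi.

Definition M_minus (k : C) (a : C -> C) : C -> Prop :=
  fun alpha => exists xi, (Im xi <= 0)%R /\ ~ h_minus k xi /\ alpha = a xi.

Definition m_plus (a : C -> C) : C -> Prop := shift (PI / 2) (Gamma a).
Definition m_minus (a : C -> C) : C -> Prop := shift (- (PI / 2)) (Gamma a).

Definition strip (k : C) (a : C -> C) : C -> Prop :=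
  cup (M_plus k a) (M_minus k a).

(** * Domains *)

(* The radicand k^2 (1 - sin^2 alpha1 - sin^2 alpha2) of 1 / K. *)
Definition K_radicand (k : C) (p : C * C) : C :=
  k ^ 2 * (1 - Csin (fst p) ^ 2 - Csin (snd p) ^ 2).

(* Points of the outer boundary at which K is singular.  They all have one
   coordinate on m- or 2 PI + m- and the other on Gamma or PI - Gamma: there
   branch lines of K reach the edge of the domains, and no boundary values are
   prescribed. *)
Definition singular_edge (k : C) (a : C -> C) (p : C * C) : Prop :=
  let e := cup (m_minus a) (shift (2 * PI) (m_minus a)) in
  (e (fst p) \/ e (snd p)) /\ K_radicand k p = 0.

(* (M+ x (M+ u M-)) u ((M+ u M-) x M+) *)
Definition dom_W (k : C) (a : C -> C) : C * C -> Prop :=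
  cup (prodset (M_plus k a) (strip k a)) (prodset (strip k a) (M_plus k a)).

(* [dom_W] together with its boundary on m+ and m-. *)
Definition dom_W_closed (k : C) (a : C -> C) : C * C -> Prop :=
  let Mp := cup (M_plus k a) (m_plus a) in
  let S := cup (strip k a) (cup (m_plus a) (m_minus a)) in
  fun p => cup (prodset Mp S) (prodset S Mp) p /\ ~ singular_edge k a p.

Definition dom_U (k : C) (a : C -> C) : C * C -> Prop :=
  prodset (M_minus k a) (M_minus k a).

Definition dom_U_closed (k : C) (a : C -> C) : C * C -> Prop :=
  let Mm := cup (M_minus k a) (m_minus a) in
  fun p => prodset Mm Mm p /\ ~ singular_edge k a p.

(* The union of the four sets Omega.  Each of them contains the edges it has on
   m+, so that the union is a domain: the values of W on different Omega's are
   connected by continuation across m+. *)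
Definition Omega_all (k : C) (a : C -> C) : C * C -> Prop :=
  let S := cup (strip k a) (m_plus a) in
  let S' := pi_minus S in
  cup (cup (prodset S S) (prodset S S')) (cup (prodset S' S) (prodset S' S')).

Definition Omega_all_closed (k : C) (a : C -> C) : C * C -> Prop :=
  let S := cup (strip k a) (cup (m_plus a) (m_minus a)) in
  let S' := pi_minus S in
  fun p =>
    cup (cup (prodset S S) (prodset S S')) (cup (prodset S' S) (prodset S' S')) p
    /\ ~ singular_edge k a p.

(** * The kernel *)

(* K = k^-1 (1 - sin^2 alpha1 - sin^2 alpha2)^(-1/2) on the two sets where its
   branch is specified. *)
Definition K_branch (k : C) (a : C -> C) (K : C * C -> C) : Prop :=
  let G2 := prodset (Gamma a) (Gamma a) in
  let m2 := prodset (m_minus a) (m_minus a) in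
  (forall p, cup G2 m2 p -> K p ^ 2 * K_radicand k p = 1) /\
  continuous_on G2 K /\ K (RtoC 0, RtoC 0) = / k /\
  continuous_on m2 K /\ K (- (PI / 2), - (PI / 2)) = - Ci / k.

(** * The growth condition *)

(* [val p w] means that p belongs to the domain of interest and that w is a
   value at p of the (possibly two-valued) function under consideration. *)
Definition growth (val : C * C -> C -> Prop) : Prop :=
  exists mu : R, forall a1 a2 b1 b2 : R, (b1 ^ 2 + b2 ^ 2 = 1)%R ->
  exists Lambda0 : R, forall Lambda : R, (0 < Lambda)%R -> (Lambda0 < Lambda)%R ->
  forall w : C,
    val (RtoC a1 + Ci * (Lambda * b1)%R, RtoC a2 + Ci * (Lambda * b2)%R) w ->
    (Cmod w < exp (mu * Lambda))%R.

(** * The angular simplified formulation *)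

Definition ASF1 (k : C) (a : C -> C) (W : C * C -> C) : Prop :=
  analytic_on (dom_W k a) W /\ continuous_on (dom_W_closed k a) W.

Definition ASF2 (a : C -> C) (W : C * C -> C) : Prop :=
  forall x y : C, m_plus a x -> m_plus a y ->
    W (x, y) = W (PI - x, y) /\ W (x, y) = W (x, PI - y).

(* [U] is the continuation of - i K W from Gamma x Gamma. *)
Definition ASF3 (k : C) (a : C -> C) (K W U : C * C -> C) : Prop :=
  (forall x y : C, Gamma a x -> Gamma a y ->
     U (x, y) = - Ci * K (x, y) * W (x, y)) /\
  analytic_on (dom_U k a) U /\ continuous_on (dom_U_closed k a) U.

Definition ASF4 (a : C -> C) (U : C * C -> C) : Prop :=
  forall x y : C, m_minus a x -> m_minus a y ->
    U (x, y) + U (- PI - x, - PI - y) = U (x, - PI - y) + U (- PI - x, y).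

(* On M- x M- the values of W are the w with U = - i K w, for either value of
   K at the point. *)
Definition ASF5 (k : C) (a : C -> C) (W U : C * C -> C) : Prop :=
  growth (fun p w =>
    (dom_W k a p /\ w = W p) \/
    (dom_U k a p /\
       exists kappa : C, kappa ^ 2 * K_radicand k p = 1 /\ U p = - Ci * kappa * w)).

Definition ASF (k : C) (a : C -> C) (K W : C * C -> C) : Prop :=
  ASF1 k a W /\ ASF2 a W /\
  exists U : C * C -> C, ASF3 k a K W U /\ ASF4 a U /\ ASF5 k a W U.

(** * The stencil formulation *)

Definition radicand (p : C * C) : C :=
  let (x, y) := p in
  (x + y + PI / 2) * (x + y - 5 * PI / 2) *
  (x - y - 3 * PI / 2) * (x - y + 3 * PI / 2).

(* A path from (PI/2, PI/2) to (-PI/2, -PI/2), at distance of order eps from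
   the real plane, which passes the line x + y = -PI/2 on the side
   Im (x + y) > 0. *)
Definition bypass (eps t : R) : C * C :=
  let z := RtoC (PI / 2 * cos (PI * t))%R + Ci * (eps * sin (PI * t))%R in (z, z).

(* alpha1 |-> PI - alpha1 if b1, and alpha2 |-> PI - alpha2 if b2. *)
Definition reflect (b1 b2 : bool) (p : C * C) : C * C :=
  (if b1 then PI - fst p else fst p, if b2 then PI - snd p else snd p).

(* m- x m-, (2 PI + m-) x m-, m- x (2 PI + m-), (2 PI + m-) x (2 PI + m-);
   the reference point is [reflect b1 b2 (-PI/2, -PI/2)]. *)
Definition corner (a : C -> C) (b1 b2 : bool) : C * C -> Prop :=
  let m b := if b : bool then shift (2 * PI) (m_minus a) else m_minus a in
  prodset (m b1) (m b2).

(* The value of [r] at the end of [gamma] is that of the square root of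
   [radicand] continued along [gamma] from the value of [r] at its start. *)
Definition root_continued_along (gamma : R -> C * C) (r : C * C -> C) : Prop :=
  exists rho : R -> C,
    continuous_on (fun t : R => (0 <= t <= 1)%R) rho /\
    (forall t : R, (0 <= t <= 1)%R -> rho t ^ 2 = radicand (gamma t)) /\
    rho 0%R = r (gamma 0%R) /\ rho 1%R = r (gamma 1%R).

Definition stencil_set (k : C) (a : C -> C) (p : C * C) : Prop :=
  dom_W_closed k a p \/ exists b1 b2, corner a b1 b2 p.

(* [r] is the branch of the square root of [radicand] which is continuous on
   [dom_W_closed] (where it is fixed up to a global sign) and on each corner
   set, where it is fixed by continuation from (PI/2, PI/2) to the reference
   point along the (reflected) bypass. *)
Definition root_branch (k : C) (a : C -> C) (r : C * C -> C) : Prop :=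
  (forall p, stencil_set k a p -> r p ^ 2 = radicand p) /\
  continuous_on (dom_W_closed k a) r /\
  forall b1 b2 : bool,
    continuous_on (corner a b1 b2) r /\
    exists eps0 : R, (0 < eps0)%R /\
      forall eps : R, (0 < eps < eps0)%R ->
        root_continued_along (fun t => reflect b1 b2 (bypass eps t)) r.

(* [V] is radicand^(-1/2) W.  The continuation of W from [dom_W] is the
   two-valued function radicand^(1/2) V, and W itself stands for its branch on
   [stencil_set]. *)
Definition StF1 (k : C) (a : C -> C) (r W V : C * C -> C) : Prop :=
  (forall p, stencil_set k a p -> W p = r p * V p) /\
  analytic_on (Omega_all k a) V /\ continuous_on (Omega_all_closed k a) V.

Definition StF2 (a : C -> C) (W : C * C -> C) : Prop :=
  forall x y : C, m_minus a x -> m_minus a y ->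
    W (x, y) + W (2 * PI + x, 2 * PI + y)
      - W (x, 2 * PI + y) - W (2 * PI + x, y) = 0.

Definition StF3 (a : C -> C) (W : C * C -> C) : Prop :=
  forall x y : C, m_minus a x -> m_minus a y ->
    W (x, y) = W (PI - x, y) /\ W (x, y) = W (x, PI - y) /\
    W (x, y) = W (PI - x, PI - y).

Definition StF4 (k : C) (a : C -> C) (V : C * C -> C) : Prop :=
  growth (fun p w =>
    (dom_W k a p \/ dom_U k a p) /\
    exists rho : C, rho ^ 2 = radicand p /\ w = rho * V p).

Definition StF (k : C) (a : C -> C) (W : C * C -> C) : Prop :=
  exists r V : C * C -> C,
    root_branch k a r /\
    StF1 k a r W V /\ StF2 a W /\ StF3 a W /\ StF4 k a V.

(* Main.v *)
Require Import Defs.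
From Stdlib Require Import Reals Lra Psatz ClassicalChoice List.
From Coquelicot Require Import Coquelicot.

Local Open Scope C_scope.

(** Let [Gamma] be the graph Re z = g (Im z) and put u z = Re z - g (Im z) ([gcurve],
[ucoord]).  Since Im (k sin z) is a positive multiple of sin (u z), and k sin and [a]
are inverse to each other between the slab |u| < pi/2 and the plane with the two cuts
([a_Csin], [a_in_strip]), the sets of the problem are described by u alone: M+ and M-
are 0 <= u < pi/2 and -pi/2 < u <= 0, the curves m+ and m- are u = pi/2 and u = -pi/2,
the reflection z |-> pi - z is u |-> pi - u, and the union of the four Omega's is T x T,
where T is -pi/2 < u < 3 pi/2.

The radicand of 1 / K is k^2 cos (x + y) cos (x - y).  It can only vanish where x + y
or x - y is real, and then this number is u x + u y or u x - u y ([Re_plus_real],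
[Re_minus_real]).  Hence its only zeros in M- x M- lie on x + y = -pi/2, and the four
factors of the radicand of StF1 are, up to sign, the images of x + y + pi/2 under the
reflections.

From ASF to StF.  On the domain of W put V = radicand^(-1/2) W.  As U = - i K W there
should be V = i k U (cos (x + y) cos (x - y) / radicand)^(1/2) on M- x M-, where the
quotient under the root has neither zeros nor poles.  These two definitions agree on
Gamma x Gamma by the value of K there ([K_Gamma]), hence on Gamma x M- and M- x Gamma,
because a holomorphic function is determined by its boundary values on a curve
([boundary_uniqueness], [V_agree]).  The reflection symmetry ASF2 of W is given for
m+ x m+ only, but both of its sides are holomorphic in the other variable, so that it
holds on all of m+ x (M+ u M-) by the same uniqueness ([reflection_spreads]).
Therefore the extension of V to T x T by reflections is continuous, and in each variable
it is holomorphic off the curves u = 0, pi/2, pi.  Such curves are removable for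
continuous functions by a theorem of Painleve ([Cdiff_curve], [separate_Cdiff]), and a
continuous, separately holomorphic function is holomorphic ([Osgood]); this is StF1.

On the corner m- x m- the bypass turns the root of x + y + pi/2 into i times the
principal root of its opposite, and the value -i/k of K at the reference point means
that K is continued in the same way ([root_bypass_1], [K_corner]).  So U = - i K W also
holds for the corner values of W.  V and the root at the corners are invariant under the
reflections, which is StF3; and as 2 pi + x = pi - (- pi - x), StF3 turns the four terms
of StF2 into those of ASF4, the factor - i K being common because K is symmetric on
m- x m- ([ASF4_iff_StF2]).

From StF to ASF.  The root in StF1 is determined up to one global sign
([root_branch_unique]), and U is again the product of V with the root of a function
without zeros.  For ASF2 consider the difference of V and its reflection: it vanishes on
m- x m- by StF3, hence everywhere, since m- x m- is a set of uniqueness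
([corner_uniqueness]).  In both directions the growth conditions bound the moduli of the
same numbers.

The complex analysis starts from Goursat's theorem for rectangles in which some
horizontal lines are exempted from differentiability ([Goursat_except]).  In logarithmic
coordinates it is the mean value property ([circle_mean]), which applied to a divided
difference gives Cauchy's formula for functions that are continuous on a disc and
holomorphic off a diameter ([cauchy_repr_disc]).  Painleve's theorem, limits of
holomorphic functions, the identity principle and Osgood's lemma follow from it.  Signs
of square roots are always found in the same manner: two continuous roots of a function
without zeros that agree at one end of a path agree at the other ([path_root]). *)

(** * Limits of complex functions *)

Notation Clim f F l := (@filterlim _ C f F (@locally C_UniformSpace l)).
Notation Ccont f z := (@continuous C_UniformSpace C_UniformSpace f z).
Notation Cdiff f z := (@ex_derive C_AbsRing C_NormedModule f z).

Ltac as_C := lazymatch goal with |- @eq _ ?x ?y => change (@eq C x y) end.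
Ltac Cring := as_C; ring.
Ltac Cfield := as_C; field.

Lemma Cminus_eq (w z : C) : w - z = 0 -> w = z.
Proof. intro H. replace w with (w - z + z) by ring. rewrite H. ring. Qed.

Lemma Cminus_neq (w z : C) : w <> z -> w - z <> 0.
Proof. intros H E. apply H. now apply Cminus_eq. Qed.

Lemma ball_C_Cmod (l z : C) (eps : R) : (Cmod (z - l) < eps)%R -> @ball C_UniformSpace l eps z.
Proof. exact (C_NormedModule_mixin_compat1 l z eps). Qed.

Lemma Cmod_ball_C (l z : C) (eps : posreal) :
  @ball C_UniformSpace l eps z -> (Cmod (z - l) < 2 * eps)%R.
Proof.
intro H. apply Rlt_trans with (sqrt 2 * eps)%R.
- exact (C_NormedModule_mixin_compat2 l z eps H).
- apply Rmult_lt_compat_r; [apply cond_pos|].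
  rewrite <- (sqrt_square 2) at 2 by lra. apply sqrt_lt_1; lra.
Qed.

Lemma Clim_iff {T : Type} {F : (T -> Prop) -> Prop} {FF : Filter F} (f : T -> C) (l : C) :
  Clim f F l <-> forall eps : R, (0 < eps)%R -> F (fun x => (Cmod (f x - l) < eps)%R).
Proof.
split.
- intros H eps He.
  assert (He2 : (0 < eps / 2)%R) by lra.
  generalize (proj1 (filterlim_locally (U := C_UniformSpace) f l) H (mkposreal _ He2)).
  apply filter_imp. intros x Hx. apply Cmod_ball_C in Hx. simpl in Hx. lra.
- intros H. apply filterlim_locally. intros eps.
  generalize (H eps (cond_pos eps)). apply filter_imp.
  intros x Hx. now apply ball_C_Cmod.
Qed.

Lemma locally_C_iff (z : C) (P : C -> Prop) :
  @locally C_UniformSpace z P <->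
  exists del : R, (0 < del)%R /\ forall z', (Cmod (z' - z) < del)%R -> P z'.
Proof.
split.
- intros [e He]. exists e. split; [apply cond_pos|].
  intros z' Hz. apply He. now apply ball_C_Cmod.
- intros [d [Hd H]]. assert (Hd2 : (0 < d / 2)%R) by lra.
  exists (mkposreal _ Hd2). intros y Hy. apply H. apply Cmod_ball_C in Hy. simpl in Hy. lra.
Qed.

Section Limits.
Context {T : Type} {F : (T -> Prop) -> Prop} {FF : Filter F}.

Lemma Clim_plus (f g : T -> C) (a b : C) :
  Clim f F a -> Clim g F b -> Clim (fun x => f x + g x) F (a + b).
Proof.
intros Hf Hg.
eapply filterlim_comp_2; [exact Hf|exact Hg|].
exact (@filterlim_plus C_AbsRing C_NormedModule a b).
Qed.

Lemma Clim_opp (f : T -> C) (a : C) : Clim f F a -> Clim (fun x => - f x) F (- a).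
Proof.
intros Hf. eapply filterlim_comp. exact Hf.
exact (@filterlim_opp C_AbsRing C_NormedModule a).
Qed.

Lemma Clim_minus (f g : T -> C) (a b : C) :
  Clim f F a -> Clim g F b -> Clim (fun x => f x - g x) F (a - b).
Proof. intros Hf Hg. apply Clim_plus; [easy|]. now apply Clim_opp. Qed.

Lemma Clim_const (a : C) : Clim (fun _ : T => a) F a.
Proof. apply filterlim_const. Qed.

Lemma Clim_pair (f g : T -> R) (a b : R) :
  filterlim f F (locally a) -> filterlim g F (locally b) ->
  Clim (fun x => ((f x, g x) : C)) F ((a, b) : C).
Proof.
intros Hf Hg. apply filterlim_locally. intros eps.
generalize (proj1 (filterlim_locally f a) Hf eps).
generalize (proj1 (filterlim_locally g b) Hg eps).
intros H1 H2. generalize (filter_and _ _ H1 H2). apply filter_imp.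
intros x [Hx Hy]. now split.
Qed.

Lemma Clim_Re (f : T -> C) (a : C) : Clim f F a -> filterlim (fun x => Re (f x)) F (locally (Re a)).
Proof.
intros Hf. apply filterlim_locally. intros eps.
generalize (proj1 (filterlim_locally (U := C_UniformSpace) f a) Hf eps).
apply filter_imp. now intros x [Hx _].
Qed.

Lemma Clim_Im (f : T -> C) (a : C) : Clim f F a -> filterlim (fun x => Im (f x)) F (locally (Im a)).
Proof.
intros Hf. apply filterlim_locally. intros eps.
generalize (proj1 (filterlim_locally (U := C_UniformSpace) f a) Hf eps).
apply filter_imp. now intros x [_ Hx].
Qed.

Lemma Rlim_plus (f g : T -> R) (a b : R) :
  filterlim f F (locally a) -> filterlim g F (locally b) ->
  filterlim (fun x => (f x + g x)%R) F (locally (a + b)%R).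
Proof.
intros Hf Hg. eapply filterlim_comp_2; [exact Hf|exact Hg|].
exact (@filterlim_plus R_AbsRing R_NormedModule a b).
Qed.

Lemma Rlim_opp (f : T -> R) (a : R) :
  filterlim f F (locally a) -> filterlim (fun x => (- f x)%R) F (locally (- a)%R).
Proof.
intros Hf. eapply filterlim_comp. exact Hf.
exact (@filterlim_opp R_AbsRing R_NormedModule a).
Qed.

Lemma Rlim_mult (f g : T -> R) (a b : R) :
  filterlim f F (locally a) -> filterlim g F (locally b) ->
  filterlim (fun x => (f x * g x)%R) F (locally (a * b)%R).
Proof.
intros Hf Hg. eapply filterlim_comp_2; [exact Hf|exact Hg|].
exact (@filterlim_mult R_AbsRing a b).
Qed.

Lemma Rlim_comp (h : R -> R) (f : T -> R) (a : R) :
  continuous h a -> filterlim f F (locally a) ->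
  filterlim (fun x => h (f x)) F (locally (h a)).
Proof. intros Hh Hf. eapply filterlim_comp. exact Hf. exact Hh. Qed.

Lemma Clim_mult (f g : T -> C) (a b : C) :
  Clim f F a -> Clim g F b -> Clim (fun x => f x * g x) F (a * b).
Proof.
intros Hf Hg. unfold Cmult.
assert (H1 := Clim_Re _ _ Hf). assert (H2 := Clim_Im _ _ Hf).
assert (H3 := Clim_Re _ _ Hg). assert (H4 := Clim_Im _ _ Hg).
apply Clim_pair; unfold Rminus; repeat first [apply Rlim_plus | apply Rlim_opp | apply Rlim_mult]; assumption.
Qed.

Lemma Clim_RtoC (f : T -> R) (a : R) :
  filterlim f F (locally a) -> Clim (fun x => RtoC (f x)) F (RtoC a).
Proof. intros Hf. apply Clim_pair; [easy|apply filterlim_const]. Qed.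

Lemma Clim_inv (f : T -> C) (a : C) : a <> 0 -> Clim f F a -> Clim (fun x => / f x) F (/ a).
Proof.
intros Ha Hf. unfold Cinv.
assert (H1 := Clim_Re _ _ Hf). assert (H2 := Clim_Im _ _ Hf).
assert (Hn : (fst a ^ 2 + snd a ^ 2 <> 0)%R).
{ intro H. apply Ha. destruct a as [a1 a2]; simpl in *. apply injective_projections; simpl; nra. }
assert (Hd : filterlim (fun x => (fst (f x) ^ 2 + snd (f x) ^ 2)%R) F (locally (fst a ^ 2 + snd a ^ 2)%R)).
{ apply Rlim_plus; apply (Rlim_comp (fun t => t ^ 2)%R); try assumption;
  apply (ex_derive_continuous (fun t => (t ^ 2)%R)); auto_derive; easy. }
assert (Hi : filterlim (fun x => / (fst (f x) ^ 2 + snd (f x) ^ 2))%R F (locally (/ (fst a ^ 2 + snd a ^ 2))%R)).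
{ apply (Rlim_comp Rinv); [|easy]. apply (ex_derive_continuous Rinv). auto_derive. easy. }
apply Clim_pair; apply Rlim_mult; try apply Rlim_opp; assumption.
Qed.

Lemma Clim_div (f g : T -> C) (a b : C) :
  b <> 0 -> Clim f F a -> Clim g F b -> Clim (fun x => f x / g x) F (a / b).
Proof. intros Hb Hf Hg. apply Clim_mult; [easy|]. now apply Clim_inv. Qed.

Lemma Clim_comp (h : C -> C) (f : T -> C) (a : C) :
  Ccont h a -> Clim f F a -> Clim (fun x => h (f x)) F (h a).
Proof. intros Hh Hf. eapply filterlim_comp. exact Hf. exact Hh. Qed.

Lemma Clim_Cmod (f : T -> C) (a : C) : Clim f F a -> filterlim (fun x => Cmod (f x)) F (locally (Cmod a)).
Proof.
intros Hf. unfold Cmod. apply (Rlim_comp sqrt). apply continuous_sqrt.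
assert (H1 := Clim_Re _ _ Hf). assert (H2 := Clim_Im _ _ Hf).
apply Rlim_plus; apply (Rlim_comp (fun t => t ^ 2)%R); try assumption;
  apply (ex_derive_continuous (fun t => (t ^ 2)%R)); auto_derive; easy.
Qed.

End Limits.

Lemma Ccont_id (z : C) : Ccont (fun w => w) z.
Proof. apply continuous_id. Qed.

Lemma Clim_unique {T : Type} {F : (T -> Prop) -> Prop} {FF : ProperFilter F} (f : T -> C) (a b : C) :
  Clim f F a -> Clim f F b -> a = b.
Proof. intros Ha Hb. exact (@filterlim_locally_unique T C_AbsRing C_NormedModule F _ f a b Ha Hb). Qed.

Lemma Ccont_eps (f : C -> C) (z : C) : Ccont f z -> forall eps : R, (0 < eps)%R ->
  exists del, (0 < del)%R /\ forall z', (Cmod (z' - z) < del)%R -> (Cmod (f z' - f z) < eps)%R.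
Proof.
intros H eps He. apply locally_C_iff.
exact (proj1 (Clim_iff (F := @locally C_UniformSpace z) f (f z)) H eps He).
Qed.

Lemma Ccont_ext_loc (f g : C -> C) (z : C) :
  @locally C_UniformSpace z (fun w => f w = g w) -> Ccont f z -> Ccont g z.
Proof.
intros H Hf. unfold continuous. rewrite <- (locally_singleton (T := C_UniformSpace) z _ H).
exact (filterlim_ext_loc f g H Hf).
Qed.

(** * Complex derivatives *)

Lemma Cdiff_eps (f : C -> C) (z l : C) :
  (forall eps : R, (0 < eps)%R -> @locally C_UniformSpace z
     (fun w => (Cmod (f w - f z - (w - z) * l) <= eps * Cmod (w - z))%R)) -> Cdiff f z.
Proof.
intros H. exists l. split.
- apply (@is_linear_scal_l C_AbsRing C_NormedModule).
- intros x Hx eps.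
  assert (x = z) as ->.
  { apply (@is_filter_lim_locally_unique C_AbsRing (AbsRing_NormedModule C_AbsRing)) in Hx.
    symmetry; exact Hx. }
  apply (proj1 (locally_C z _)). exact (H eps (cond_pos eps)).
Qed.

(** Caratheodory's form of differentiability: it turns every rule of calculus into an
algebraic identity between slopes that are continuous at the point. *)
Lemma Cdiff_iff (f : C -> C) (z : C) :
  Cdiff f z <-> exists phi : C -> C, Ccont phi z /\ forall z', f z' = f z + (z' - z) * phi z'.
Proof.
split.
- intros [l [_ Hl]].
  specialize (Hl z (fun P H => H)).
  exists (fun w => if Ceq_dec w z then l else (f w - f z) / (w - z)). split.
  + unfold continuous. apply Clim_iff. intros eps He.
    assert (He2 : (0 < eps / 2)%R) by lra.
    specialize (Hl (mkposreal _ He2)). simpl in Hl.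
    apply (proj2 (locally_C z _)) in Hl.
    revert Hl. apply filter_imp. intros w Hw.
    destruct (Ceq_dec z z) as [_|n]; [|now elim n].
    destruct (Ceq_dec w z) as [->|Hn].
    * replace (l - l) with (RtoC 0) by Cring. rewrite Cmod_0. lra.
    * change (Cmod ((f w - f z) - (w - z) * l) <= eps / 2 * Cmod (w - z))%R in Hw.
      assert (Hwz : w - z <> 0) by (now apply Cminus_neq).
      replace ((f w - f z) / (w - z) - l) with (((f w - f z) - (w - z) * l) / (w - z)) by (Cfield; easy).
      rewrite Cmod_div by easy.
      apply Cmod_gt_0 in Hwz.
      apply Rle_lt_trans with (eps / 2)%R; [|lra].
      apply Rle_div_l; lra.
  + intros z'. destruct (Ceq_dec z' z) as [->|Hn]; [Cring|].
    Cfield. now apply Cminus_neq.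
- intros [phi [Hc Hphi]]. apply (Cdiff_eps f z (phi z)). intros eps He.
  generalize (proj1 (Clim_iff (F := @locally C_UniformSpace z) phi (phi z)) Hc eps He).
  apply filter_imp. intros w Hw. rewrite (Hphi w).
  replace (f z + (w - z) * phi w - f z - (w - z) * phi z) with ((phi w - phi z) * (w - z)) by Cring.
  rewrite Cmod_mult. apply Rmult_le_compat_r; [apply Cmod_ge_0|lra].
Qed.

Lemma Cdiff_cont (f : C -> C) (z : C) : Cdiff f z -> Ccont f z.
Proof.
intros H. apply Cdiff_iff in H. destruct H as [phi [Hc H]].
apply (continuous_ext (fun w => f z + (w - z) * phi w)); [intro; now rewrite <- H|].
unfold continuous. replace (f z + (z - z) * phi z) with (f z + (z - z) * phi z) by Cring.
apply Clim_plus; [apply Clim_const|]. apply Clim_mult; [|exact Hc].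
apply Clim_minus; [apply Ccont_id|apply Clim_const].
Qed.

Lemma Cdiff_ext_loc (f g : C -> C) (z : C) :
  @locally C_UniformSpace z (fun w => f w = g w) -> Cdiff f z -> Cdiff g z.
Proof.
intros H [l Hl]. exists l.
apply (is_derive_ext_loc f); [|easy]. exact (proj1 (locally_C z _) H).
Qed.

Lemma Cdiff_ext (f g : C -> C) (z : C) : (forall w, f w = g w) -> Cdiff f z -> Cdiff g z.
Proof. intros H. apply Cdiff_ext_loc. now apply filter_forall. Qed.

Lemma Cdiff_const (c z : C) : Cdiff (fun _ => c) z.
Proof. apply Cdiff_iff. exists (fun _ => 0). split; [apply continuous_const|]. intros; Cring. Qed.

Lemma Cdiff_id (z : C) : Cdiff (fun w => w) z.
Proof. apply Cdiff_iff. exists (fun _ => 1). split; [apply continuous_const|]. intros; Cring. Qed.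

Lemma Cdiff_plus (f g : C -> C) (z : C) : Cdiff f z -> Cdiff g z -> Cdiff (fun w => f w + g w) z.
Proof.
intros Hf Hg. apply Cdiff_iff in Hf. apply Cdiff_iff in Hg.
destruct Hf as [p [Hp Hf]], Hg as [q [Hq Hg]]. apply Cdiff_iff.
exists (fun w => p w + q w). split; [now apply Clim_plus|].
intros w. rewrite (Hf w), (Hg w). Cring.
Qed.

Lemma Cdiff_mult (f g : C -> C) (z : C) : Cdiff f z -> Cdiff g z -> Cdiff (fun w => f w * g w) z.
Proof.
intros Hf Hg. assert (Hgc := Cdiff_cont _ _ Hg). apply Cdiff_iff in Hf. apply Cdiff_iff in Hg.
destruct Hf as [p [Hp Hf]], Hg as [q [Hq Hg]]. apply Cdiff_iff.
exists (fun w => p w * g w + f z * q w). split.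
- apply Clim_plus; apply Clim_mult; try assumption. apply Clim_const.
- intros w. rewrite (Hf w), (Hg w). Cring.
Qed.

Lemma Cdiff_opp (f : C -> C) (z : C) : Cdiff f z -> Cdiff (fun w => - f w) z.
Proof.
intros Hf. apply (Cdiff_ext (fun w => -(1) * f w)); [intro; Cring|].
apply Cdiff_mult; [apply Cdiff_const|easy].
Qed.

Lemma Cdiff_minus (f g : C -> C) (z : C) : Cdiff f z -> Cdiff g z -> Cdiff (fun w => f w - g w) z.
Proof. intros Hf Hg. apply Cdiff_plus; [easy|]. now apply Cdiff_opp. Qed.

Lemma Cdiff_inv (f : C -> C) (z : C) : f z <> 0 -> Cdiff f z -> Cdiff (fun w => / f w) z.
Proof.
intros H0 Hf. assert (Hfc := Cdiff_cont _ _ Hf).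
assert (Hn : @locally C_UniformSpace z (fun w => f w <> 0)).
{ generalize (proj1 (Clim_iff f (f z)) Hfc (Cmod (f z)) (proj1 (Cmod_gt_0 _) H0)).
  apply filter_imp. intros w Hw E. rewrite E in Hw.
  replace (0 - f z) with (- f z) in Hw by Cring. rewrite Cmod_opp in Hw. lra. }
apply Cdiff_iff in Hf. destruct Hf as [p [Hp Hf]].
apply (Cdiff_ext_loc (fun w => / f z + (w - z) * (- p w / (f w * f z)))).
- revert Hn. apply filter_imp. intros w Hw.
  assert (E : (w - z) * p w = f w - f z) by (rewrite (Hf w); Cring).
  replace ((w - z) * (- p w / (f w * f z))) with (- ((w - z) * p w) / (f w * f z)) by (Cfield; easy).
  rewrite E. Cfield. easy.
- apply Cdiff_iff. exists (fun w => - p w / (f w * f z)). split.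
  + apply Clim_div; [now apply Cmult_neq_0| now apply Clim_opp|].
    apply Clim_mult; [easy|apply Clim_const].
  + intros. Cring.
Qed.

Lemma Cdiff_div (f g : C -> C) (z : C) : g z <> 0 -> Cdiff f z -> Cdiff g z -> Cdiff (fun w => f w / g w) z.
Proof. intros H0 Hf Hg. apply Cdiff_mult; [easy|]. now apply Cdiff_inv. Qed.

Lemma Cdiff_comp (f g : C -> C) (z : C) : Cdiff g (f z) -> Cdiff f z -> Cdiff (fun w => g (f w)) z.
Proof.
intros Hg Hf. assert (Hfc := Cdiff_cont _ _ Hf). apply Cdiff_iff in Hf. apply Cdiff_iff in Hg.
destruct Hf as [p [Hp Hf]], Hg as [q [Hq Hg]]. apply Cdiff_iff.
exists (fun w => p w * q (f w)). split.
- apply Clim_mult; [easy|]. now apply (Clim_comp q).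
- intros w. rewrite (Hg (f w)) at 1. rewrite (Hf w) at 1. Cring.
Qed.

(** The slope of f is that of f^2 divided by f w + f z, which stays away from 0 near z.
This makes continuous branches of square roots holomorphic. *)
Lemma Cdiff_sqrt (f : C -> C) (z : C) :
  f z <> 0 -> Ccont f z -> Cdiff (fun w => f w * f w) z -> Cdiff f z.
Proof.
intros H0 Hc Hs.
assert (H2 : f z + f z <> 0).
{ intro H. apply H0. replace (f z) with ((f z + f z) / 2) by (Cfield; intro E; apply RtoC_inj in E; lra).
  rewrite H. unfold Cdiv. Cring. }
assert (Hn : @locally C_UniformSpace z (fun w => f w + f z <> 0)).
{ assert (Hl : Clim (fun w => f w + f z) (@locally C_UniformSpace z) (f z + f z)) by (apply Clim_plus; [easy|apply Clim_const]).
  generalize (proj1 (Clim_iff _ _) Hl (Cmod (f z + f z)) (proj1 (Cmod_gt_0 _) H2)).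
  apply filter_imp. intros w Hw E. rewrite E in Hw.
  replace (0 - (f z + f z)) with (- (f z + f z)) in Hw by Cring. rewrite Cmod_opp in Hw. lra. }
apply Cdiff_iff in Hs. destruct Hs as [p [Hp Hs]].
apply (Cdiff_ext_loc (fun w => f z + (w - z) * (p w / (f w + f z)))).
- revert Hn. apply filter_imp. intros w Hw.
  assert (E : (w - z) * p w = f w * f w - f z * f z) by (rewrite (Hs w); Cring).
  replace ((w - z) * (p w / (f w + f z))) with (((w - z) * p w) / (f w + f z)) by (Cfield; easy).
  rewrite E. Cfield. easy.
- apply Cdiff_iff. exists (fun w => p w / (f w + f z)). split.
  + apply Clim_div; [easy|easy|]. apply Clim_plus; [easy|apply Clim_const].
  + intros. Cring.
Qed.

(** * Integrals of complex functions of a real variable *)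

Notation CInt g a b := (@RInt C_R_CompleteNormedModule g a b).
Notation ex_CInt g a b := (@ex_RInt C_R_NormedModule g a b).
Notation is_CInt g a b l := (@is_RInt C_R_NormedModule g a b l).

Definition cont_seg (g : R -> C) (a b : R) : Prop :=
  forall t, (a <= t <= b)%R -> @continuous R_UniformSpace C_UniformSpace g t.

Lemma ex_CInt_cont (g : R -> C) (a b : R) : (a <= b)%R -> cont_seg g a b -> ex_CInt g a b.
Proof.
intros Hab H. apply (@ex_RInt_continuous C_R_CompleteNormedModule).
intros z Hz. apply H. now rewrite Rmin_left, Rmax_right in Hz.
Qed.

Lemma is_CInt_CInt (g : R -> C) (a b : R) : ex_CInt g a b -> is_CInt g a b (CInt g a b).
Proof. apply (@RInt_correct C_R_CompleteNormedModule). Qed.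

Lemma CInt_plus (f g : R -> C) (a b : R) : ex_CInt f a b -> ex_CInt g a b ->
  CInt (fun t => f t + g t) a b = CInt f a b + CInt g a b.
Proof. intros. now apply (@RInt_plus C_R_CompleteNormedModule). Qed.

Lemma CInt_minus (f g : R -> C) (a b : R) : ex_CInt f a b -> ex_CInt g a b ->
  CInt (fun t => f t - g t) a b = CInt f a b - CInt g a b.
Proof. intros. now apply (@RInt_minus C_R_CompleteNormedModule). Qed.

Lemma CInt_Chasles (f : R -> C) (a b c : R) : ex_CInt f a b -> ex_CInt f b c ->
  CInt f a b + CInt f b c = CInt f a c.
Proof. intros. now apply (@RInt_Chasles C_R_CompleteNormedModule). Qed.

Lemma CInt_ext (f g : R -> C) (a b : R) : (a <= b)%R -> (forall t, (a < t < b)%R -> f t = g t) ->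
  CInt f a b = CInt g a b.
Proof.
intros Hab H. apply (@RInt_ext C_R_CompleteNormedModule).
now rewrite Rmin_left, Rmax_right.
Qed.

Lemma is_CInt_scal (f : R -> C) (a b : R) (c l : C) :
  is_CInt f a b l -> is_CInt (fun t => c * f t) a b (c * l).
Proof.
intros H.
assert (H1 := @is_RInt_fct_extend_fst R_NormedModule R_NormedModule f a b l H).
assert (H2 := @is_RInt_fct_extend_snd R_NormedModule R_NormedModule f a b l H).
unfold Cmult. apply (@is_RInt_fct_extend_pair R_NormedModule R_NormedModule).
- apply (@is_RInt_minus R_NormedModule); apply (@is_RInt_scal R_NormedModule); assumption.
- apply (@is_RInt_plus R_NormedModule); apply (@is_RInt_scal R_NormedModule); assumption.
Qed.

Lemma CInt_scal (f : R -> C) (a b : R) (c : C) : ex_CInt f a b ->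
  CInt (fun t => c * f t) a b = c * CInt f a b.
Proof.
intros H. apply (@is_RInt_unique C_R_CompleteNormedModule).
apply is_CInt_scal. now apply is_CInt_CInt.
Qed.

Lemma ex_CInt_scal (f : R -> C) (a b : R) (c : C) : ex_CInt f a b -> ex_CInt (fun t => c * f t) a b.
Proof. intros [l Hl]. exists (c * l). now apply is_CInt_scal. Qed.

Lemma CInt_const (a b : R) (c : C) : CInt (fun _ => c) a b = RtoC (b - a) * c.
Proof.
rewrite (@RInt_const C_R_CompleteNormedModule).
apply injective_projections; simpl; unfold mult, scal; simpl; unfold mult; simpl; ring.
Qed.

Lemma Cmod_CInt_le (g : R -> C) (a b M : R) : (a <= b)%R -> ex_CInt g a b ->
  (forall t, (a <= t <= b)%R -> (Cmod (g t) <= M)%R) -> (Cmod (CInt g a b) <= (b - a) * M)%R.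
Proof.
intros Hab Hex HM.
assert (E : forall z : C, @norm R_AbsRing C_R_NormedModule z = Cmod z).
{ intro z. unfold norm; simpl. unfold prod_norm, Cmod, norm; simpl. unfold abs; simpl.
  assert (Hs : forall x, (Rabs x * (Rabs x * 1) = x * (x * 1))%R).
  { intro x. rewrite !Rmult_1_r. symmetry. apply Rsqr_abs. }
  now rewrite !Hs. }
rewrite <- E. apply (norm_RInt_le_const (V := C_R_NormedModule) g a b); [easy| |now apply is_CInt_CInt].
intros x Hx. rewrite E. now apply HM.
Qed.

Lemma filterlim_prod_fst {T U : UniformSpace} (E : T -> Prop) (x0 : T) (t : U) :
  filterlim fst (filter_prod (within E (locally x0)) (locally t)) (locally x0).
Proof.
intros P HP. apply (filterlim_fst (F := within E (locally x0)) (G := locally t)).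
unfold within. revert HP. apply filter_imp. tauto.
Qed.

(** A limit and an integral commute as soon as the integrand converges locally
uniformly: a Lebesgue number turns the pointwise radii into one radius. *)
Lemma Clim_CInt {T : UniformSpace} (E : T -> Prop) (x0 : T) (g : T -> R -> C) (g0 : R -> C) (a b : R) :
  (a <= b)%R -> cont_seg g0 a b ->
  (forall x, E x -> ex_CInt (g x) a b) ->
  (forall t, (a <= t <= b)%R ->
     Clim (fun p : T * R => g (fst p) (snd p))
       (filter_prod (within E (locally x0)) (locally t)) (g0 t)) ->
  Clim (fun x => CInt (g x) a b) (within E (locally x0)) (CInt g0 a b).
Proof.
intros Hab Hc0 Hex Hlim. apply Clim_iff. intros eps He.
set (e := (eps / (2 * (b - a + 1)))%R).
assert (He' : (0 < e)%R) by (apply Rdiv_lt_0_compat; lra).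
assert (Hdel : forall t, exists d : posreal, (a <= t <= b)%R ->
  forall x t', E x -> ball x0 d x -> (Rabs (t' - t) < d)%R -> (Cmod (g x t' - g0 t') < e)%R).
{ intros t. destruct (Rle_dec a t) as [H1|H1]; [|exists (mkposreal _ Rlt_0_1); lra].
  destruct (Rle_dec t b) as [H2|H2]; [|exists (mkposreal _ Rlt_0_1); lra].
  assert (He2 : (0 < e / 2)%R) by lra.
  destruct (proj1 (Clim_iff _ _) (Hlim t (conj H1 H2)) (e / 2)%R He2) as [P Q HP HQ H].
  destruct HP as [d1 HP]. destruct HQ as [d2 HQ].
  destruct (proj1 (Clim_iff _ _) (Hc0 t (conj H1 H2)) (e / 2)%R He2) as [d3 H3].
  assert (Hd : (0 < Rmin d1 (Rmin d2 d3))%R).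
  { repeat apply Rmin_pos; apply cond_pos. }
  exists (mkposreal _ Hd). intros _ x t' Ex Hx Ht. simpl in Hx, Ht.
  assert (A1 := Rmin_l d1 (Rmin d2 d3)). assert (A2 := Rmin_r d1 (Rmin d2 d3)).
  assert (A3 := Rmin_l d2 d3). assert (A4 := Rmin_r d2 d3).
  replace (g x t' - g0 t') with ((g x t' - g0 t) - (g0 t' - g0 t)) by ring.
  apply Rle_lt_trans with (Cmod (g x t' - g0 t) + Cmod (g0 t' - g0 t))%R.
  { unfold Cminus at 1. rewrite <- (Cmod_opp (g0 t' - g0 t)). apply Cmod_triangle. }
  assert (B1 : (Cmod (g x t' - g0 t) < e / 2)%R).
  { apply (H x t').
    - apply HP; [|easy]. eapply ball_le; [exact A1|exact Hx].
    - apply HQ. change (Rabs (t' - t) < d2)%R. lra. }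
  assert (B2 : (Cmod (g0 t' - g0 t) < e / 2)%R).
  { apply H3. change (Rabs (t' - t) < d3)%R. lra. }
  lra. }
destruct (choice _ Hdel) as [del Hd]. clear Hdel.
destruct (compactness_value_1d a b del) as [d Hcd].
exists d. intros x Hx Ex.
rewrite <- CInt_minus; [|now apply Hex|now apply ex_CInt_cont].
apply Rle_lt_trans with ((b - a) * e)%R.
- apply Cmod_CInt_le; [easy| |].
  + apply (@ex_RInt_minus C_R_NormedModule); [now apply Hex|now apply ex_CInt_cont].
  + intros t Ht. destruct (Rle_dec (Cmod (g x t - g0 t)) e) as [Hle|Hn]; [easy|].
    exfalso. apply (Hcd t Ht). intros [s [Hs [Hts Hds]]]. apply Hn. left.
    apply (Hd s Hs x t Ex); [|easy]. eapply ball_le; [exact Hds|exact Hx].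
- apply Rle_lt_trans with ((b - a + 1) * e)%R.
  + apply Rmult_le_compat_r; lra.
  + unfold e. replace ((b - a + 1) * (eps / (2 * (b - a + 1))))%R with (eps / 2)%R by (field; lra). lra.
Qed.

(** * Cauchy's theorem for rectangles *)

(** Otherwise bisection would yield a nested sequence of rectangles without the
property, whose diameters tend to 0 and which contain a common point. *)
Lemma rect_bisection (P : R -> R -> R -> R -> Prop) (a b c d : R) :
  (a <= b)%R -> (c <= d)%R ->
  (forall a b c d, let m := ((a + b) / 2)%R in let n := ((c + d) / 2)%R in
     (a <= b)%R -> (c <= d)%R ->
     P a m c n -> P m b c n -> P a m n d -> P m b n d -> P a b c d) ->
  (forall x y, (a <= x <= b)%R -> (c <= y <= d)%R -> exists del, (0 < del)%R /\
     forall a' b' c' d', (a <= a' <= x)%R -> (x <= b' <= b)%R -> (c <= c' <= y)%R -> (y <= d' <= d)%R ->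
       (b' - a' < del)%R -> (d' - c' < del)%R -> P a' b' c' d') ->
  P a b c d.
Proof.
intros Hab Hcd Hsplit Hloc.
destruct (Classical_Prop.classic (P a b c d)) as [H|Hbad]; [exact H|exfalso].
set (V := fun q : (R * R) * (R * R) => (fst (fst q) <= snd (fst q))%R /\ (fst (snd q) <= snd (snd q))%R).
set (B := fun q : (R * R) * (R * R) => ~ P (fst (fst q)) (snd (fst q)) (fst (snd q)) (snd (snd q))).
set (half := fun I J : R * R => let m := ((fst I + snd I) / 2)%R in J = (fst I, m) \/ J = (m, snd I)).
assert (Hstep : forall q, exists q', V q -> B q -> half (fst q) (fst q') /\ half (snd q) (snd q') /\ B q').
{ intros [[a0 b0] [c0 d0]]. set (m := ((a0 + b0) / 2)%R). set (n := ((c0 + d0) / 2)%R).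
  destruct (Classical_Prop.classic (B ((a0, m), (c0, n)))) as [H1|H1].
  { exists ((a0, m), (c0, n)). intros; repeat split; [now left|now left|easy]. }
  destruct (Classical_Prop.classic (B ((m, b0), (c0, n)))) as [H2|H2].
  { exists ((m, b0), (c0, n)). intros; repeat split; [now right|now left|easy]. }
  destruct (Classical_Prop.classic (B ((a0, m), (n, d0)))) as [H3|H3].
  { exists ((a0, m), (n, d0)). intros; repeat split; [now left|now right|easy]. }
  exists ((m, b0), (n, d0)). intros [HV1 HV2] HB. repeat split; [now right|now right|].
  intro H4. apply HB. apply Hsplit; try assumption; try (apply Classical_Prop.NNPP; assumption). }
destruct (choice _ Hstep) as [f Hf]. clear Hstep.
set (s := fix s n := match n with O => ((a, b), (c, d)) | S n => f (s n) end).
assert (Hs : forall n, V (s n) /\ B (s n)).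
{ induction n as [|n [IHV IHB]]; [now split|].
  destruct (Hf (s n) IHV IHB) as [H1 [H2 H3]]. simpl. split; [|exact H3].
  destruct IHV as [V1 V2]. split.
  - destruct H1 as [-> | ->]; simpl; lra.
  - destruct H2 as [-> | ->]; simpl; lra. }
assert (Hlim : forall pr : (R * R) * (R * R) -> R * R,
  (forall n, half (pr (s n)) (pr (s (S n)))) -> (forall n, (fst (pr (s n)) <= snd (pr (s n)))%R) ->
  exists x, (forall n, (fst (pr (s n)) <= x <= snd (pr (s n)))%R) /\
    (forall n, (snd (pr (s n)) - fst (pr (s n)) = (snd (pr (s 0%nat)) - fst (pr (s 0%nat))) / 2 ^ n)%R) /\
    forall n, (fst (pr (s 0%nat)) <= fst (pr (s n)))%R /\ (snd (pr (s n)) <= snd (pr (s 0%nat)))%R).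
{ intros pr Hh Hv.
  assert (Hmono : forall n k, (fst (pr (s n)) <= fst (pr (s (n + k)%nat)))%R /\ (snd (pr (s (n + k)%nat)) <= snd (pr (s n)))%R).
  { intros n k. induction k as [|k IH].
    - rewrite Nat.add_0_r. lra.
    - rewrite Nat.add_succ_r. specialize (Hh (n + k)%nat). specialize (Hv (n + k)%nat).
      destruct Hh as [E|E]; rewrite E; simpl fst; simpl snd; lra. }
  assert (Hlen : forall n, (snd (pr (s n)) - fst (pr (s n)) = (snd (pr (s 0%nat)) - fst (pr (s 0%nat))) / 2 ^ n)%R).
  { induction n as [|n IH]; [simpl; field|].
    replace (2 ^ S n)%R with (2 ^ n * 2)%R by (simpl; ring).
    unfold Rdiv. rewrite Rinv_mult, <- Rmult_assoc. unfold Rdiv in IH. rewrite <- IH.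
    destruct (Hh n) as [E|E]; rewrite E; simpl fst; simpl snd; lra. }
  assert (Hub : forall n m, (fst (pr (s n)) <= snd (pr (s m)))%R).
  { intros n m. destruct (Hmono n m) as [H1 _]. destruct (Hmono m n) as [_ H2].
    rewrite Nat.add_comm in H2. specialize (Hv (n + m)%nat). lra. }
  destruct (completeness (fun r => exists n, r = fst (pr (s n)))) as [x [Hx1 Hx2]].
  - exists (snd (pr (s 0%nat))). intros r [n ->]. apply Hub.
  - exists (fst (pr (s 0%nat))). now exists 0%nat.
  - exists x. repeat split.
    + apply Hx1. now exists n.
    + apply Hx2. intros r [m ->]. apply Hub.
    + apply Hlen.
    + apply (Hmono 0%nat n).
    + apply (Hmono 0%nat n). }
destruct (Hlim fst) as [x [Hx1 [Hx2 Hx3]]].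
{ intro n. destruct (Hs n) as [HV HB]. now destruct (Hf _ HV HB). }
{ intro n. now destruct (Hs n) as [[? ?] _]. }
destruct (Hlim snd) as [y [Hy1 [Hy2 Hy3]]].
{ intro n. destruct (Hs n) as [HV HB]. now destruct (Hf _ HV HB) as [? [? ?]]. }
{ intro n. now destruct (Hs n) as [[? ?] _]. }
simpl (fst (s 0%nat)) in *. simpl (snd (s 0%nat)) in *. simpl fst in *. simpl snd in *.
destruct (Hloc x y) as [del [Hdel H]].
{ apply (Hx1 0%nat). } { apply (Hy1 0%nat). }
assert (Hn : exists n, ((b - a) + (d - c) < del * 2 ^ n)%R).
{ destruct (Pow_x_infinity 2 ltac:(rewrite Rabs_right; lra) (((b - a) + (d - c)) / del + 1)%R) as [n Hn].
  exists n. specialize (Hn n (Nat.le_refl n)). rewrite Rabs_right in Hn by (apply Rle_ge, pow_le; lra).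
  apply Rge_le in Hn. apply (Rmult_le_compat_l del) in Hn; [|lra].
  replace (del * (((b - a) + (d - c)) / del + 1))%R with (((b - a) + (d - c)) + del)%R in Hn by (field; lra). lra. }
destruct Hn as [n Hn]. destruct (Hs n) as [_ HB]. apply HB.
assert (H2n : (0 < 2 ^ n)%R) by (apply pow_lt; lra).
specialize (Hx1 n). specialize (Hy1 n). specialize (Hx3 n). specialize (Hy3 n).
apply H; try lra.
- rewrite Hx2. apply Rlt_div_l; lra.
- rewrite Hy2. apply Rlt_div_l; lra.
Qed.

Definition rect_int (h : C -> C) (a b c d : R) : C :=
  CInt (fun x => h (x, c)) a b + Ci * CInt (fun y => h (b, y)) c d
  - CInt (fun x => h (x, d)) a b - Ci * CInt (fun y => h (a, y)) c d.

Definition cont_rect (h : C -> C) (a b c d : R) : Prop :=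
  forall x y : R, (a <= x <= b)%R -> (c <= y <= d)%R -> Ccont h (x, y).

Lemma cont_horizontal (h : C -> C) (x y : R) : Ccont h (x, y) ->
  @continuous R_UniformSpace C_UniformSpace (fun t => h (t, y)) x.
Proof.
intros H. apply (continuous_comp (fun t => ((t, y) : C_UniformSpace)) h x); [|exact H].
apply Clim_pair; [apply continuous_id|apply continuous_const].
Qed.

Lemma cont_vertical (h : C -> C) (x y : R) : Ccont h (x, y) ->
  @continuous R_UniformSpace C_UniformSpace (fun t => h (x, t)) y.
Proof.
intros H. apply (continuous_comp (fun t => ((x, t) : C_UniformSpace)) h y); [|exact H].
apply Clim_pair; [apply continuous_const|apply continuous_id].
Qed.

Lemma ex_CInt_horizontal (h : C -> C) (a b c d a' b' y : R) : cont_rect h a b c d ->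
  (a <= a')%R -> (a' <= b')%R -> (b' <= b)%R -> (c <= y <= d)%R -> ex_CInt (fun x => h (x, y)) a' b'.
Proof.
intros H H1 H2 H3 Hy. apply ex_CInt_cont; [easy|]. intros t Ht. apply cont_horizontal. apply H; lra.
Qed.

Lemma ex_CInt_vertical (h : C -> C) (a b c d c' d' x : R) : cont_rect h a b c d ->
  (c <= c')%R -> (c' <= d')%R -> (d' <= d)%R -> (a <= x <= b)%R -> ex_CInt (fun y => h (x, y)) c' d'.
Proof.
intros H H1 H2 H3 Hy. apply ex_CInt_cont; [easy|]. intros t Ht. apply cont_vertical. apply H; lra.
Qed.

Lemma rect_int_split_x (h : C -> C) (a m b c d : R) : (a <= m <= b)%R -> (c <= d)%R ->
  cont_rect h a b c d -> rect_int h a b c d = rect_int h a m c d + rect_int h m b c d.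
Proof.
intros Hm Hcd H. unfold rect_int.
rewrite <- (CInt_Chasles (fun x => h (x, c)) a m b), <- (CInt_Chasles (fun x => h (x, d)) a m b).
- ring.
- apply (ex_CInt_horizontal h a b c d); tauto || lra.
- apply (ex_CInt_horizontal h a b c d); tauto || lra.
- apply (ex_CInt_horizontal h a b c d); tauto || lra.
- apply (ex_CInt_horizontal h a b c d); tauto || lra.
Qed.

Lemma rect_int_split_y (h : C -> C) (a b c m d : R) : (a <= b)%R -> (c <= m <= d)%R ->
  cont_rect h a b c d -> rect_int h a b c d = rect_int h a b c m + rect_int h a b m d.
Proof.
intros Hm Hcd H. unfold rect_int.
rewrite <- (CInt_Chasles (fun y => h (a, y)) c m d), <- (CInt_Chasles (fun y => h (b, y)) c m d).
- ring.
- apply (ex_CInt_vertical h a b c d); tauto || lra.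
- apply (ex_CInt_vertical h a b c d); tauto || lra.
- apply (ex_CInt_vertical h a b c d); tauto || lra.
- apply (ex_CInt_vertical h a b c d); tauto || lra.
Qed.

Lemma rect_int_plus (h1 h2 : C -> C) (a b c d : R) : (a <= b)%R -> (c <= d)%R ->
  cont_rect h1 a b c d -> cont_rect h2 a b c d ->
  rect_int (fun z => h1 z + h2 z) a b c d = rect_int h1 a b c d + rect_int h2 a b c d.
Proof.
intros Hab Hcd H1 H2. unfold rect_int.
rewrite (CInt_plus (fun x => h1 (x, c)) (fun x => h2 (x, c))), (CInt_plus (fun x => h1 (x, d)) (fun x => h2 (x, d))),
  (CInt_plus (fun y => h1 (a, y)) (fun y => h2 (a, y))), (CInt_plus (fun y => h1 (b, y)) (fun y => h2 (b, y)));
  [ring|..].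
1, 3: apply (ex_CInt_vertical h1 a b c d); tauto || lra.
1, 2: apply (ex_CInt_vertical h2 a b c d); tauto || lra.
1, 3: apply (ex_CInt_horizontal h1 a b c d); tauto || lra.
1, 2: apply (ex_CInt_horizontal h2 a b c d); tauto || lra.
Qed.

Lemma Cmod_rect_int_le (h : C -> C) (a b c d M : R) : (a <= b)%R -> (c <= d)%R ->
  cont_rect h a b c d ->
  (forall x y : R, (a <= x <= b)%R -> (c <= y <= d)%R -> (Cmod (h (x, y)) <= M)%R) ->
  (Cmod (rect_int h a b c d) <= 2 * ((b - a) + (d - c)) * M)%R.
Proof.
intros Hab Hcd H HM. unfold rect_int.
assert (H1 : (Cmod (CInt (fun x => h (x, c)) a b) <= (b - a) * M)%R).
{ apply Cmod_CInt_le; [easy|apply (ex_CInt_horizontal h a b c d); tauto || lra|]. intros; apply HM; lra. }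
assert (H2 : (Cmod (CInt (fun x => h (x, d)) a b) <= (b - a) * M)%R).
{ apply Cmod_CInt_le; [easy|apply (ex_CInt_horizontal h a b c d); tauto || lra|]. intros; apply HM; lra. }
assert (H3 : (Cmod (CInt (fun y => h (b, y)) c d) <= (d - c) * M)%R).
{ apply Cmod_CInt_le; [easy|apply (ex_CInt_vertical h a b c d); tauto || lra|]. intros; apply HM; lra. }
assert (H4 : (Cmod (CInt (fun y => h (a, y)) c d) <= (d - c) * M)%R).
{ apply Cmod_CInt_le; [easy|apply (ex_CInt_vertical h a b c d); tauto || lra|]. intros; apply HM; lra. }
set (I1 := CInt (fun x => h (x, c)) a b) in *. set (I2 := CInt (fun x => h (x, d)) a b) in *.
set (I3 := CInt (fun y => h (b, y)) c d) in *. set (I4 := CInt (fun y => h (a, y)) c d) in *.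
assert (E3 : Cmod (Ci * I3) = Cmod I3) by (rewrite Cmod_mult, Cmod_Ci; ring).
assert (E4 : Cmod (Ci * I4) = Cmod I4) by (rewrite Cmod_mult, Cmod_Ci; ring).
assert (T1 := Cmod_triangle (I1 + Ci * I3 - I2) (- (Ci * I4))). rewrite Cmod_opp in T1.
assert (T2 := Cmod_triangle (I1 + Ci * I3) (- I2)). rewrite Cmod_opp in T2.
assert (T3 := Cmod_triangle I1 (Ci * I3)).
fold (I1 + Ci * I3 - I2) in T2. fold (I1 + Ci * I3 - I2 - Ci * I4) in T1. unfold Cminus in *.
lra.
Qed.

Lemma is_CInt_affine (p q A B a b : R) :
  is_CInt (fun t => ((p + q * t)%R, (A + B * t)%R)) a b
    ((p * (b - a) + q * (b * b - a * a) / 2)%R, (A * (b - a) + B * (b * b - a * a) / 2)%R).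
Proof.
assert (Hr : forall u v : R, is_RInt (fun t => u + v * t)%R a b (u * (b - a) + v * (b * b - a * a) / 2)%R).
{ intros u v.
  replace (u * (b - a) + v * (b * b - a * a) / 2)%R with
    (minus ((fun t => u * t + v * (t * t) / 2)%R b) ((fun t => u * t + v * (t * t) / 2)%R a)).
  2: { unfold minus, plus, opp; simpl. field. }
  apply (is_RInt_derive (V := R_CompleteNormedModule) (fun t => u * t + v * (t * t) / 2)%R).
  - intros x _. auto_derive; [easy|field].
  - intros x _. apply (ex_derive_continuous (fun t => u + v * t)%R). auto_derive. easy. }
apply (@is_RInt_fct_extend_pair R_NormedModule R_NormedModule); apply Hr.
Qed.

Lemma rect_int_affine (A B : C) (a b c d : R) : rect_int (fun z => A + z * B) a b c d = 0.
Proof.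
destruct A as [A1 A2], B as [B1 B2]. unfold rect_int.
assert (Hh : forall y, CInt (fun x => (A1, A2) + (x, y) * (B1, B2)) a b =
  (((A1 - y * B2) * (b - a) + B1 * (b * b - a * a) / 2)%R, ((A2 + y * B1) * (b - a) + B2 * (b * b - a * a) / 2)%R)).
{ intro y. apply (@is_RInt_unique C_R_CompleteNormedModule).
  eapply is_RInt_ext; [|apply is_CInt_affine]. intros x _. unfold Cplus, Cmult; simpl. f_equal; ring. }
assert (Hv : forall x, CInt (fun y => (A1, A2) + (x, y) * (B1, B2)) c d =
  (((A1 + x * B1) * (d - c) + (- B2) * (d * d - c * c) / 2)%R, ((A2 + x * B2) * (d - c) + B1 * (d * d - c * c) / 2)%R)).
{ intro x. apply (@is_RInt_unique C_R_CompleteNormedModule).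
  eapply is_RInt_ext; [|apply is_CInt_affine]. intros y _. unfold Cplus, Cmult; simpl. f_equal; ring. }
rewrite !Hh, !Hv. apply injective_projections; simpl; field.
Qed.

(** The estimate |integral| <= eps * (half perimeter)^2 passes from quarters to the
whole, and holds near a point of differentiability, where the affine part of [h]
does not contribute. *)
Lemma Goursat (h : C -> C) (a b c d : R) : (a <= b)%R -> (c <= d)%R ->
  (forall x y : R, (a <= x <= b)%R -> (c <= y <= d)%R -> Cdiff h (x, y)) ->
  rect_int h a b c d = 0.
Proof.
intros Hab Hcd Hh.
assert (Hc : cont_rect h a b c d) by (intros x y Hx Hy; now apply Cdiff_cont, Hh).
assert (Key : forall eps : R, (0 < eps)%R ->
  (Cmod (rect_int h a b c d) <= eps * ((b - a) + (d - c)) ^ 2)%R).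
{ intros eps He.
  set (P := fun a' b' c' d' => (a <= a')%R -> (b' <= b)%R -> (c <= c')%R -> (d' <= d)%R ->
     (Cmod (rect_int h a' b' c' d') <= eps * ((b' - a') + (d' - c')) ^ 2)%R).
  assert (HP : P a b c d); [|apply HP; lra].
  apply rect_bisection; [easy|easy| |].
  - intros a0 b0 c0 d0 m n Hab0 Hcd0 P1 P2 P3 P4 h1 h2 h3 h4.
    assert (Hm : (a0 <= m <= b0)%R) by (unfold m; lra).
    assert (Hn : (c0 <= n <= d0)%R) by (unfold n; lra).
    rewrite (rect_int_split_y h a0 b0 c0 n d0), (rect_int_split_x h a0 m b0 c0 n), (rect_int_split_x h a0 m b0 n d0);
      try lra; try (intros x y Hx Hy; apply Hc; lra).
    specialize (P1 ltac:(lra) ltac:(lra) ltac:(lra) ltac:(lra)).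
    specialize (P2 ltac:(lra) ltac:(lra) ltac:(lra) ltac:(lra)).
    specialize (P3 ltac:(lra) ltac:(lra) ltac:(lra) ltac:(lra)).
    specialize (P4 ltac:(lra) ltac:(lra) ltac:(lra) ltac:(lra)).
    set (R1 := rect_int h a0 m c0 n) in *. set (R2 := rect_int h m b0 c0 n) in *.
    set (R3 := rect_int h a0 m n d0) in *. set (R4 := rect_int h m b0 n d0) in *.
    assert (T1 := Cmod_triangle (R1 + R2) (R3 + R4)).
    assert (T2 := Cmod_triangle R1 R2). assert (T3 := Cmod_triangle R3 R4).
    replace (m - a0 + (n - c0))%R with ((b0 - a0 + (d0 - c0)) / 2)%R in P1 by (unfold m, n; field).
    replace (b0 - m + (n - c0))%R with ((b0 - a0 + (d0 - c0)) / 2)%R in P2 by (unfold m, n; field).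
    replace (m - a0 + (d0 - n))%R with ((b0 - a0 + (d0 - c0)) / 2)%R in P3 by (unfold m, n; field).
    replace (b0 - m + (d0 - n))%R with ((b0 - a0 + (d0 - c0)) / 2)%R in P4 by (unfold m, n; field).
    set (l := (b0 - a0 + (d0 - c0))%R) in *. nra.
  - intros x y Hx Hy. destruct (proj1 (Cdiff_iff _ _) (Hh x y Hx Hy)) as [phi [Hphi E]].
    destruct (Ccont_eps _ _ Hphi (eps / 2)%R ltac:(lra)) as [del [Hdel Hd]].
    exists (del / 2)%R. split; [lra|].
    intros a' b' c' d' Ha' Hb' Hc' Hd' S1 S2 _ _ _ _.
    set (z := (x, y) : C) in *.
    set (A := h z - z * phi z). set (e := fun w => h w - (A + w * phi z)).
    assert (Ee : forall w, e w = (w - z) * (phi w - phi z)).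
    { intro w. unfold e, A. rewrite (E w). ring. }
    assert (Hec : cont_rect e a' b' c' d').
    { intros x' y' Hx' Hy'. unfold e. apply Clim_minus; [apply Hc; lra|].
      apply Clim_plus; [apply Clim_const|]. apply Clim_mult; [apply Ccont_id|apply Clim_const]. }
    replace (rect_int h a' b' c' d') with (rect_int e a' b' c' d').
    2: { rewrite <- (Cplus_0_r (rect_int e a' b' c' d')), <- (rect_int_affine A (phi z) a' b' c' d').
      rewrite <- rect_int_plus; try lra; [|easy|].
      - unfold rect_int, e. f_equal; [f_equal; [f_equal|]|]; [|f_equal| |f_equal];
          (apply CInt_ext; [lra|intros; ring]).
      - intros x' y' _ _. apply Clim_plus; [apply Clim_const|].
        apply Clim_mult; [apply Ccont_id|apply Clim_const]. }
    apply Rle_trans with (2 * ((b' - a') + (d' - c')) * (((b' - a') + (d' - c')) * (eps / 2)))%R; [|right; field].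
    apply Cmod_rect_int_le; [lra|lra|easy|].
    intros x' y' Hx' Hy'. rewrite Ee, Cmod_mult.
    assert (D : (Cmod ((x', y') - z) <= (b' - a') + (d' - c'))%R).
    { apply Rle_trans with (Rabs (x' - x) + Rabs (y' - y))%R.
      - replace ((x', y') - z) with (RtoC (x' - x) + Ci * RtoC (y' - y)).
        2: { unfold z; apply injective_projections; simpl; ring. }
        eapply Rle_trans; [apply Cmod_triangle|]. rewrite Cmod_mult, Cmod_Ci, !Cmod_R. lra.
      - assert (Rabs (x' - x) <= b' - a')%R by (apply Rabs_le; lra).
        assert (Rabs (y' - y) <= d' - c')%R by (apply Rabs_le; lra). lra. }
    apply Rmult_le_compat; try apply Cmod_ge_0; [easy|]. left. apply Hd. lra. }
destruct (Ceq_dec (rect_int h a b c d) 0) as [H0|H0]; [easy|exfalso].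
apply Cmod_gt_0 in H0. set (l := ((b - a) + (d - c))%R) in *.
assert (Hl : (0 <= l ^ 2)%R) by (apply pow2_ge_0).
assert (He : (0 < Cmod (rect_int h a b c d) / (2 * (l ^ 2 + 1)))%R) by (apply Rdiv_lt_0_compat; lra).
specialize (Key _ He).
assert (Hle : (Cmod (rect_int h a b c d) / (2 * (l ^ 2 + 1)) * l ^ 2 <= Cmod (rect_int h a b c d) / 2)%R).
{ apply Rle_trans with (Cmod (rect_int h a b c d) / (2 * (l ^ 2 + 1)) * (l ^ 2 + 1))%R.
  - apply Rmult_le_compat_l; lra.
  - right. field. lra. }
lra.
Qed.

(** The two horizontal sides contribute nearly opposite amounts and the vertical ones
are short: the integral around a thin rectangle is small. *)
Lemma rect_int_thin (h : C -> C) (a b c d y0 : R) :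
  (a <= b)%R -> cont_rect h a b c d -> (c <= y0 <= d)%R ->
  forall eps : R, (0 < eps)%R -> exists del, (0 < del)%R /\
    forall c' d', (c <= c' <= y0)%R -> (y0 <= d' <= d)%R -> (d' - c' < del)%R ->
      (Cmod (rect_int h a b c' d') < eps)%R.
Proof.
intros Hab Hc Hy eps He.
assert (L : Clim (fun y => CInt (fun x => h (x, y)) a b)
  (within (fun y => (c <= y <= d)%R) (locally y0)) (CInt (fun x => h (x, y0)) a b)).
{ apply (Clim_CInt (T := R_UniformSpace) (fun y => (c <= y <= d)%R) y0 (fun y x => h (x, y))); [easy| | |].
  - intros t Ht. apply cont_horizontal. now apply Hc.
  - intros y Hy'. apply (ex_CInt_horizontal h a b c d); tauto || lra.
  - intros t Ht. apply (Clim_comp h (fun p : R * R => ((snd p, fst p) : C))).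
    + now apply Hc.
    + apply Clim_pair; [apply filterlim_snd|].
      apply (filterlim_prod_fst (T := R_UniformSpace) (U := R_UniformSpace)). }
assert (B : forall x, (a <= x <= b)%R -> exists M del, (0 < del)%R /\ (0 < M)%R /\
  forall y, (Rabs (y - y0) < del)%R -> (Cmod (h (x, y)) <= M)%R).
{ intros x Hx.
  destruct (proj1 (Clim_iff _ _) (cont_vertical h x y0 (Hc x y0 Hx Hy)) 1%R Rlt_0_1) as [del Hd].
  exists (Cmod (h (x, y0)) + 1)%R, del. repeat split; [apply cond_pos| |].
  - assert (K := Cmod_ge_0 (h (x, y0))). lra.
  - intros y Hyy. specialize (Hd y Hyy). change (Cmod (h (x, y) - h (x, y0)) < 1)%R in Hd.
    replace (h (x, y)) with (h (x, y0) + (h (x, y) - h (x, y0))) by ring.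
    eapply Rle_trans; [apply Cmod_triangle|]. lra. }
destruct (B a ltac:(lra)) as [Ma [da [Hda [HMa HBa]]]].
destruct (B b ltac:(lra)) as [Mb [db [Hdb [HMb HBb]]]].
destruct (proj1 (Clim_iff _ _) L (eps / 4)%R ltac:(lra)) as [d1 H1].
set (del := Rmin d1 (Rmin (Rmin da db) (eps / (4 * (Ma + Mb))))).
assert (D1 : (del <= d1)%R) by apply Rmin_l.
assert (D2 : (del <= Rmin (Rmin da db) (eps / (4 * (Ma + Mb))))%R) by apply Rmin_r.
assert (D3 : (Rmin (Rmin da db) (eps / (4 * (Ma + Mb))) <= Rmin da db)%R) by apply Rmin_l.
assert (D4 : (Rmin (Rmin da db) (eps / (4 * (Ma + Mb))) <= eps / (4 * (Ma + Mb)))%R) by apply Rmin_r.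
assert (D5 := Rmin_l da db). assert (D6 := Rmin_r da db).
assert (Hq : (0 < eps / (4 * (Ma + Mb)))%R) by (apply Rdiv_lt_0_compat; lra).
exists del. split.
{ unfold del. repeat apply Rmin_pos; try assumption. apply cond_pos. }
intros c' d' Hc' Hd' Hl. unfold rect_int.
assert (K1 : (Cmod (CInt (fun x => h (x, c')) a b - CInt (fun x => h (x, y0)) a b) < eps / 4)%R).
{ apply H1; [|lra]. change (Rabs (c' - y0) < d1)%R. apply Rabs_lt_between. lra. }
assert (K2 : (Cmod (CInt (fun x => h (x, d')) a b - CInt (fun x => h (x, y0)) a b) < eps / 4)%R).
{ apply H1; [|lra]. change (Rabs (d' - y0) < d1)%R. apply Rabs_lt_between. lra. }
assert (K3 : (Cmod (CInt (fun y => h (a, y)) c' d') <= (d' - c') * Ma)%R).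
{ apply Cmod_CInt_le; [lra|apply (ex_CInt_vertical h a b c d); tauto || lra|].
  intros t Ht. apply HBa. apply Rabs_lt_between. lra. }
assert (K4 : (Cmod (CInt (fun y => h (b, y)) c' d') <= (d' - c') * Mb)%R).
{ apply Cmod_CInt_le; [lra|apply (ex_CInt_vertical h a b c d); tauto || lra|].
  intros t Ht. apply HBb. apply Rabs_lt_between. lra. }
set (X := CInt (fun x => h (x, c')) a b) in *. set (Y := CInt (fun x => h (x, d')) a b) in *.
set (X0 := CInt (fun x => h (x, y0)) a b) in *.
set (Va := CInt (fun y => h (a, y)) c' d') in *. set (Vb := CInt (fun y => h (b, y)) c' d') in *.
replace (X + Ci * Vb - Y - Ci * Va) with (((X - X0) + - (Y - X0)) + (Ci * Vb + - (Ci * Va))) by ring.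
assert (T1 := Cmod_triangle ((X - X0) + - (Y - X0)) (Ci * Vb + - (Ci * Va))).
assert (T2 := Cmod_triangle (X - X0) (- (Y - X0))). rewrite Cmod_opp in T2.
assert (T3 := Cmod_triangle (Ci * Vb) (- (Ci * Va))). rewrite Cmod_opp, !Cmod_mult, Cmod_Ci in T3.
assert (T4 : ((d' - c') * (Ma + Mb) <= eps / 4)%R).
{ apply Rle_trans with (eps / (4 * (Ma + Mb)) * (Ma + Mb))%R; [apply Rmult_le_compat_r; lra|].
  right. field. lra. }
lra.
Qed.

(** Thin strips along the horizontal sides can be cut off at an arbitrarily small cost. *)
Lemma Goursat_open (h : C -> C) (a b c d : R) : (a <= b)%R -> (c <= d)%R -> cont_rect h a b c d ->
  (forall x y : R, (a <= x <= b)%R -> (c < y < d)%R -> Cdiff h (x, y)) ->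
  rect_int h a b c d = 0.
Proof.
intros Hab Hcd Hc Hh.
destruct (Rle_lt_or_eq_dec c d Hcd) as [Hlt | ->].
2: { unfold rect_int. rewrite !(@RInt_point C_R_CompleteNormedModule).
     change (@zero C_R_CompleteNormedModule) with (RtoC 0). ring. }
destruct (Ceq_dec (rect_int h a b c d) 0) as [H0|H0]; [easy|exfalso].
apply Cmod_gt_0 in H0.
destruct (rect_int_thin h a b c d c Hab Hc ltac:(lra) (Cmod (rect_int h a b c d) / 2)%R ltac:(lra)) as [d1 [Hd1 H1]].
destruct (rect_int_thin h a b c d d Hab Hc ltac:(lra) (Cmod (rect_int h a b c d) / 2)%R ltac:(lra)) as [d2 [Hd2 H2]].
set (e := (Rmin (Rmin d1 d2) (d - c) / 3)%R).
assert (E1 := Rmin_l (Rmin d1 d2) (d - c)). assert (E2 := Rmin_r (Rmin d1 d2) (d - c)).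
assert (E3 := Rmin_l d1 d2). assert (E4 := Rmin_r d1 d2).
assert (He : (0 < Rmin (Rmin d1 d2) (d - c))%R) by (repeat apply Rmin_pos; lra).
assert (Ed : (0 < e /\ e < d1 /\ e < d2 /\ 2 * e < d - c)%R) by (unfold e; lra).
clearbody e. clear E1 E2 E3 E4 He.
specialize (H1 c (c + e)%R ltac:(lra) ltac:(lra) ltac:(lra)).
specialize (H2 (d - e)%R d ltac:(lra) ltac:(lra) ltac:(lra)).
assert (E : rect_int h a b c d = rect_int h a b c (c + e) + rect_int h a b (d - e) d).
{ rewrite (rect_int_split_y h a b c (c + e) d), (rect_int_split_y h a b (c + e) (d - e) d);
    try lra; try easy.
  - rewrite (Goursat h a b (c + e) (d - e)); [ring|lra|lra|]. intros x y Hx Hy. apply Hh; lra.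
  - intros x y Hx Hy. apply Hc; lra. }
assert (T := Cmod_triangle (rect_int h a b c (c + e)) (rect_int h a b (d - e) d)).
rewrite <- E in T. lra.
Qed.

(** An exempted line cuts the rectangle into two, for which it is an edge. *)
Lemma Goursat_except (h : C -> C) (a b : R) (l : list R) : (a <= b)%R ->
  forall c d : R, (c <= d)%R -> cont_rect h a b c d ->
  (forall x y : R, (a <= x <= b)%R -> (c < y < d)%R -> ~ In y l -> Cdiff h (x, y)) ->
  rect_int h a b c d = 0.
Proof.
intros Hab. induction l as [|e l IH]; intros c d Hcd Hc Hh.
- apply Goursat_open; try assumption. intros. now apply Hh.
- destruct (Rlt_dec c e) as [H1|H1]; [destruct (Rlt_dec e d) as [H2|H2]|].
  + rewrite (rect_int_split_y h a b c e d); [|lra|lra|easy].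
    rewrite (IH c e), (IH e d); try lra; [ring|..];
      intros x y Hx Hy; try (apply Hc; lra); intros Hn; apply Hh; try lra; intros [E|E]; lra || easy.
  + apply IH; try assumption. intros x y Hx Hy Hn. apply Hh; try lra. intros [E|E]; lra || easy.
  + apply IH; try assumption. intros x y Hx Hy Hn. apply Hh; try lra. intros [E|E]; lra || easy.
Qed.

(** * The complex exponential *)

Definition Cexp (z : C) : C := ((exp (Re z) * cos (Im z))%R, (exp (Re z) * sin (Im z))%R).

Lemma Cexp_plus (z w : C) : Cexp (z + w) = Cexp z * Cexp w.
Proof.
unfold Cexp. rewrite !re_plus, !im_plus, exp_plus, cos_plus, sin_plus.
apply injective_projections; simpl; ring.
Qed.

Lemma Cexp_0 : Cexp 0 = 1.
Proof. unfold Cexp. simpl. rewrite exp_0, cos_0, sin_0. apply injective_projections; simpl; ring. Qed.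

Lemma Cmod_Cexp (z : C) : Cmod (Cexp z) = exp (Re z).
Proof.
unfold Cmod, Cexp; simpl.
replace (exp (Re z) * cos (Im z) * (exp (Re z) * cos (Im z) * 1) +
  exp (Re z) * sin (Im z) * (exp (Re z) * sin (Im z) * 1))%R
  with (exp (Re z) * exp (Re z) * (Rsqr (sin (Im z)) + Rsqr (cos (Im z))))%R by (unfold Rsqr; ring).
rewrite sin2_cos2, Rmult_1_r. apply sqrt_square. left. apply exp_pos.
Qed.

Lemma Rderiv_expansion (f : R -> R) (l : R) : is_derive f 0%R l -> forall eps : R, (0 < eps)%R ->
  exists del, (0 < del)%R /\ forall x, (Rabs x < del)%R -> (Rabs (f x - f 0 - l * x) <= eps * Rabs x)%R.
Proof.
intros [_ H] eps He. specialize (H 0%R (fun P HP => HP) (mkposreal _ He)).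
destruct H as [d Hd]. exists d. split; [apply cond_pos|].
intros x Hx. specialize (Hd x).
assert (Hb : ball 0%R d x) by (change (Rabs (x - 0) < d)%R; now rewrite Rminus_0_r).
specialize (Hd Hb). change (Rabs (f x - f 0%R - (x - 0) * l) <= eps * Rabs (x - 0))%R in Hd.
rewrite Rminus_0_r in Hd. now rewrite (Rmult_comm l x).
Qed.

Lemma Cmod_le_Rabs (x y : R) : (Cmod (x, y) <= Rabs x + Rabs y)%R.
Proof.
replace ((x, y) : C) with (RtoC x + Ci * RtoC y) by (apply injective_projections; simpl; ring).
eapply Rle_trans; [apply Cmod_triangle|]. rewrite Cmod_mult, Cmod_Ci, !Cmod_R. lra.
Qed.

(** It suffices to differentiate at 0, because of the addition theorem. *)
Lemma Cexp_derive_0 : forall eps : R, (0 < eps)%R -> exists del, (0 < del)%R /\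
  forall z, (Cmod z < del)%R -> (Cmod (Cexp z - 1 - z) <= eps * Cmod z)%R.
Proof.
intros eps He. set (e := (eps / 10)%R).
assert (He' : (0 < e)%R) by (unfold e; lra).
assert (Dexp : is_derive exp 0%R 1%R) by (evar_last; [apply is_derive_exp|apply exp_0]).
assert (Dcos : is_derive cos 0%R 0%R) by (evar_last; [apply is_derive_cos|rewrite sin_0; ring]).
assert (Dsin : is_derive sin 0%R 1%R) by (evar_last; [apply is_derive_sin|apply cos_0]).
destruct (Rderiv_expansion _ _ Dexp (Rmin e 1) ltac:(apply Rmin_pos; lra)) as [d1 [Hd1 H1]].
destruct (Rderiv_expansion _ _ Dcos e He') as [d2 [Hd2 H2]].
destruct (Rderiv_expansion _ _ Dsin e He') as [d3 [Hd3 H3]].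
exists (Rmin (Rmin d1 d2) (Rmin d3 (Rmin e 1))). split.
{ repeat apply Rmin_pos; lra. }
intros [x y] Hz.
assert (A1 := Rmin_l (Rmin d1 d2) (Rmin d3 (Rmin e 1))). assert (A2 := Rmin_r (Rmin d1 d2) (Rmin d3 (Rmin e 1))).
assert (A3 := Rmin_l d1 d2). assert (A4 := Rmin_r d1 d2). assert (A5 := Rmin_l d3 (Rmin e 1)).
assert (A6 := Rmin_r d3 (Rmin e 1)). assert (A7 := Rmin_l e 1). assert (A8 := Rmin_r e 1).
assert (Hx : (Rabs x <= Cmod (x, y))%R).
{ eapply Rle_trans; [|apply Rmax_Cmod]. apply Rmax_l. }
assert (Hy : (Rabs y <= Cmod (x, y))%R).
{ eapply Rle_trans; [|apply Rmax_Cmod]. apply Rmax_r. }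
set (m := Cmod (x, y)) in *.
specialize (H1 x ltac:(lra)). specialize (H2 y ltac:(lra)). specialize (H3 y ltac:(lra)).
rewrite exp_0 in H1. rewrite cos_0 in H2. rewrite sin_0 in H3.
assert (Hexp : (Rabs (exp x - 1) <= 2 * Rabs x)%R).
{ replace (exp x - 1)%R with ((exp x - 1 - 1 * x) + x)%R by ring.
  eapply Rle_trans; [apply Rabs_triang|].
  assert (P := Rabs_pos x). nra. }
assert (Hcos : (Rabs (exp x * cos y - 1 - x) <= 4 * e * m)%R).
{ replace (exp x * cos y - 1 - x)%R with ((exp x - 1 - 1 * x) + exp x * (cos y - 1 - 0 * y))%R by ring.
  eapply Rle_trans; [apply Rabs_triang|]. rewrite Rabs_mult, (Rabs_right (exp x)) by (left; apply exp_pos).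
  assert (P := Rabs_pos x). assert (Py := Rabs_pos y). assert (exp x <= 3)%R.
  { apply Rabs_le_between in Hexp. lra. }
  assert (Q := exp_pos x).
  assert (exp x * Rabs (cos y - 1 - 0 * y) <= 3 * (e * Rabs y))%R.
  { apply Rmult_le_compat; try lra; try apply Rabs_pos. }
  assert (e * Rabs y <= e * m)%R by (apply Rmult_le_compat_l; lra).
  assert (Rabs (exp x - 1 - 1 * x) <= e * m)%R.
  { eapply Rle_trans; [exact H1|]. apply Rmult_le_compat; try lra. }
  assert (Rabs (exp x - 1 - 1 * x) + exp x * Rabs (cos y - 1 - 0 * y) <= 4 * e * m)%R by lra. lra. }
assert (Hsin : (Rabs (exp x * sin y - y) <= 5 * e * m)%R).
{ replace (exp x * sin y - y)%R with (exp x * (sin y - 0 - 1 * y) + (exp x - 1) * y)%R by ring.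
  eapply Rle_trans; [apply Rabs_triang|]. rewrite !Rabs_mult, (Rabs_right (exp x)) by (left; apply exp_pos).
  assert (P := Rabs_pos x). assert (Py := Rabs_pos y). assert (exp x <= 3)%R.
  { apply Rabs_le_between in Hexp. lra. }
  assert (Q := exp_pos x).
  assert (exp x * Rabs (sin y - 0 - 1 * y) <= 3 * (e * Rabs y))%R.
  { apply Rmult_le_compat; try lra; try apply Rabs_pos. }
  assert (e * Rabs y <= e * m)%R by (apply Rmult_le_compat_l; lra).
  assert (Rabs (exp x - 1) * Rabs y <= (2 * e) * m)%R.
  { apply Rmult_le_compat; try lra; try apply Rabs_pos. }
  lra. }
replace (Cexp (x, y) - 1 - (x, y)) with (((exp x * cos y - 1 - x)%R, (exp x * sin y - y)%R) : C).
2: { unfold Cexp; apply injective_projections; simpl; ring. }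
eapply Rle_trans; [apply Cmod_le_Rabs|].
replace eps with (10 * e)%R by (unfold e; field).
assert (0 <= m)%R by apply Cmod_ge_0. nra.
Qed.

Lemma Cdiff_Cexp (z : C) : Cdiff Cexp z.
Proof.
apply Cdiff_iff.
exists (fun w => Cexp z * (if Ceq_dec w z then RtoC 1 else (Cexp (w - z) - 1) / (w - z))). split.
- assert (L : Clim (fun w => if Ceq_dec w z then RtoC 1 else (Cexp (w - z) - 1) / (w - z)) (@locally C_UniformSpace z) (RtoC 1)).
  { apply Clim_iff. intros eps He.
    destruct (Cexp_derive_0 (eps / 2)%R ltac:(lra)) as [d [Hd H]].
    apply locally_C_iff. exists d. split; [easy|]. intros w Hw.
    destruct (Ceq_dec w z) as [E|E].
    - replace (1 - 1) with (RtoC 0) by ring. now rewrite Cmod_0.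
    - apply Cminus_neq in E. specialize (H _ Hw).
      replace ((Cexp (w - z) - 1) / (w - z) - 1) with ((Cexp (w - z) - 1 - (w - z)) / (w - z)) by (field; easy).
      rewrite Cmod_div by easy. apply Cmod_gt_0 in E.
      apply Rle_lt_trans with (eps / 2)%R; [|lra]. apply Rle_div_l; lra. }
  unfold continuous. destruct (Ceq_dec z z) as [_|n]; [|now elim n].
  apply Clim_mult; [apply Clim_const|exact L].
- intros w. destruct (Ceq_dec w z) as [->|E]; [ring|].
  replace w with (z + (w - z)) at 1 by ring. rewrite Cexp_plus.
  apply Cminus_neq in E. field. easy.
Qed.

(** * Cauchy's formula on circles *)

Definition circ (r t : R) : C := ((r * cos t)%R, (r * sin t)%R).

Lemma circ_Cexp (x t : R) : circ (exp x) t = Cexp (x, t).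
Proof. reflexivity. Qed.

Lemma Cmod_circ (r t : R) : (0 <= r)%R -> Cmod (circ r t) = r.
Proof.
intros Hr. unfold Cmod, circ; simpl.
replace (r * cos t * (r * cos t * 1) + r * sin t * (r * sin t * 1))%R
  with (r * r * (Rsqr (sin t) + Rsqr (cos t)))%R by (unfold Rsqr; ring).
rewrite sin2_cos2, Rmult_1_r. now apply sqrt_square.
Qed.

Lemma circ_cont (r t : R) : @continuous R_UniformSpace C_UniformSpace (circ r) t.
Proof.
apply Clim_pair.
- apply (ex_derive_continuous (fun t => (r * cos t)%R)). auto_derive. easy.
- apply (ex_derive_continuous (fun t => (r * sin t)%R)). auto_derive. easy.
Qed.

Lemma angle_unique (s t : R) : (0 < s < 2 * PI)%R -> (0 < t < 2 * PI)%R ->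
  cos s = cos t -> sin s = sin t -> s = t.
Proof.
intros Hs Ht Hc Hsin.
assert (H1 : cos (s - t) = 1%R).
{ rewrite cos_minus, Hc, Hsin. assert (K := sin2_cos2 t). unfold Rsqr in K. lra. }
assert (H2 : sin ((s - t) / 2) = 0%R).
{ assert (K := cos_2a_sin ((s - t) / 2)). replace (2 * ((s - t) / 2))%R with (s - t)%R in K by field.
  rewrite H1 in K. nra. }
destruct (Rtotal_order s t) as [H|[H|H]]; [|easy|].
- assert (0 < sin (- ((s - t) / 2)))%R by (apply sin_gt_0; lra). rewrite sin_neg in H0. lra.
- assert (0 < sin ((s - t) / 2))%R by (apply sin_gt_0; lra). lra.
Qed.

(** In logarithmic coordinates circles around 0 are vertical segments of length 2 pi,
so that Cauchy's theorem for rectangles says that the mean over a circle does not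
depend on the radius.  The exempted angles t become horizontal lines. *)
Lemma circle_mean (H : C -> C) (r : R) (l : list R) : (0 < r)%R ->
  (forall w, (Cmod w <= r)%R -> Ccont H w) ->
  (forall s t, (0 < s <= r)%R -> (0 < t < 2 * PI)%R -> ~ In t l -> Cdiff H (circ s t)) ->
  CInt (fun t => H (circ r t)) 0 (2 * PI) = RtoC (2 * PI) * H 0.
Proof.
intros Hr Hc Hd. assert (Hpi := PI_RGT_0).
set (b := ln r). assert (Eb : exp b = r) by now apply exp_ln.
set (h := fun z => H (Cexp z)).
assert (Hhc : forall x y : R, (x <= b)%R -> Ccont h (x, y)).
{ intros x y Hx. apply (Clim_comp H Cexp).
  - apply Hc. rewrite Cmod_Cexp. simpl. rewrite <- Eb.
    destruct Hx as [Hx|Hx]; [left; now apply exp_increasing|rewrite Hx; apply Rle_refl].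
  - apply Cdiff_cont. apply Cdiff_Cexp. }
assert (Heq : forall a, (a <= b)%R -> CInt (fun t => H (circ (exp a) t)) 0 (2 * PI) = CInt (fun t => H (circ r t)) 0 (2 * PI)).
{ intros a Hab. assert (Hrect : rect_int h a b 0 (2 * PI) = 0).
  { apply (Goursat_except h a b l); [easy|lra| |].
    - intros x y Hx _. apply Hhc. lra.
    - intros x y Hx Hy Hl. apply (Cdiff_comp Cexp H); [|apply Cdiff_Cexp].
      rewrite <- circ_Cexp. apply Hd; [|easy|easy].
      split; [apply exp_pos|]. rewrite <- Eb.
      destruct (proj2 Hx) as [Hx'|Hx']; [left; now apply exp_increasing|rewrite Hx'; apply Rle_refl]. }
  unfold rect_int, h in Hrect.
  assert (Hper : forall x, Cexp (x, (2 * PI)%R) = Cexp (x, 0%R)).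
  { intro x. unfold Cexp; simpl. now rewrite cos_2PI, sin_2PI, cos_0, sin_0. }
  rewrite (CInt_ext (fun x => H (Cexp (x, (2 * PI)%R))) (fun x => H (Cexp (x, 0%R)))) in Hrect by (try easy; intros; now rewrite Hper).
  assert (E : Ci * CInt (fun y => H (Cexp (b, y))) 0 (2 * PI) = Ci * CInt (fun y => H (Cexp (a, y))) 0 (2 * PI)).
  { apply Cminus_eq. rewrite <- Hrect. ring. }
  rewrite <- Eb.
  change (CInt (fun y => H (Cexp (a, y))) 0 (2 * PI) = CInt (fun y => H (Cexp (b, y))) 0 (2 * PI)).
  assert (Ei : forall u v, Ci * u = Ci * v -> u = v).
  { intros u v Huv. replace u with (- Ci * (Ci * u)). rewrite Huv.
    all: apply injective_projections; simpl; ring. }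
  symmetry. now apply Ei. }
apply Cminus_eq.
destruct (Ceq_dec (CInt (fun t => H (circ r t)) 0 (2 * PI) - RtoC (2 * PI) * H 0) 0) as [H0|H0]; [easy|exfalso].
apply Cmod_gt_0 in H0. set (m := Cmod (CInt (fun t => H (circ r t)) 0 (2 * PI) - RtoC (2 * PI) * H 0)) in *.
assert (Hm : (0 < m / (4 * PI))%R) by (apply Rdiv_lt_0_compat; lra).
destruct (Ccont_eps _ _ (Hc 0 ltac:(rewrite Cmod_0; lra)) _ Hm) as [del [Hdel Hnear]].
(* on a circle this small H is close to its value at the centre *)
set (a := Rmin b (ln (del / 2))).
assert (Ha : (a <= b)%R) by apply Rmin_l.
assert (Ha2 : (exp a < del)%R).
{ apply Rle_lt_trans with (del / 2)%R; [|lra]. rewrite <- (exp_ln (del / 2)) by lra.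
  destruct (Rmin_r b (ln (del / 2))) as [K|K]; [left; now apply exp_increasing|unfold a; rewrite K; apply Rle_refl]. }
assert (Hseg : ex_CInt (fun t => H (circ (exp a) t)) 0 (2 * PI)).
{ apply ex_CInt_cont; [lra|]. intros t _. apply (cont_vertical h a t). now apply Hhc. }
assert (Hle : (m <= (2 * PI - 0) * (m / (4 * PI)))%R).
{ unfold m at 1. rewrite <- (Heq a Ha).
  replace (RtoC (2 * PI) * H 0) with (CInt (fun _ => H 0) 0 (2 * PI)).
  2: { rewrite CInt_const. f_equal. f_equal. ring. }
  assert (Hk : ex_CInt (fun _ => H 0) 0 (2 * PI)) by apply (@ex_RInt_const C_R_NormedModule).
  rewrite <- CInt_minus by assumption.
  apply Cmod_CInt_le; [lra| |].
  - now apply (@ex_RInt_minus C_R_NormedModule).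
  - intros t _. left. apply Hnear. replace (circ (exp a) t - 0) with (circ (exp a) t) by ring.
    rewrite Cmod_circ; [easy|]. left. apply exp_pos. }
replace ((2 * PI - 0) * (m / (4 * PI)))%R with (m / 2)%R in Hle by (field; lra). lra.
Qed.

Lemma CInt_conj (g : R -> C) (a b : R) : ex_CInt g a b ->
  CInt (fun t => Cconj (g t)) a b = Cconj (CInt g a b).
Proof.
intros H. apply (@is_RInt_unique C_R_CompleteNormedModule).
apply is_CInt_CInt in H.
apply (@is_RInt_fct_extend_pair R_NormedModule R_NormedModule).
- exact (@is_RInt_fct_extend_fst R_NormedModule R_NormedModule g a b _ H).
- apply (@is_RInt_opp R_NormedModule).
  exact (@is_RInt_fct_extend_snd R_NormedModule R_NormedModule g a b _ H).
Qed.

Lemma Cmod_lt_neq (w z : C) : (Cmod z < Cmod w)%R -> w - z <> 0.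
Proof. intros H E. apply Cminus_eq in E. subst. lra. Qed.

Lemma Cconj_neq_0 (z : C) : z <> 0 -> Cconj z <> 0.
Proof. intros H E. apply H. rewrite <- (Cconj_conj z), E. unfold Cconj; apply injective_projections; simpl; ring. Qed.

Lemma circ_neq (r t : R) (z : C) : (Cmod z < r)%R -> circ r t - z <> 0.
Proof. intros H. apply Cmod_lt_neq. rewrite Cmod_circ; [easy|]. assert (K := Cmod_ge_0 z). lra. Qed.

(** On the circle w / (w - z) is the conjugate of 1 / (1 - w conj z / r^2), which is
holomorphic on the whole disc and equals 1 at its centre. *)
Lemma CInt_kernel (r : R) (z : C) : (Cmod z < r)%R ->
  CInt (fun t => circ r t / (circ r t - z)) 0 (2 * PI) = RtoC (2 * PI).
Proof.
intros Hz. assert (Hz0 := Cmod_ge_0 z). assert (Hr : (0 < r)%R) by lra. assert (Hpi := PI_RGT_0).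
set (H := fun w => / (1 - w * (Cconj z / RtoC (r * r)))).
assert (Hrr : RtoC (r * r) <> 0) by (intro E; apply RtoC_inj in E; nra).
assert (Hn : forall w, (Cmod w <= r)%R -> 1 - w * (Cconj z / RtoC (r * r)) <> 0).
{ intros w Hw. apply Cmod_lt_neq. rewrite Cmod_1, Cmod_mult, Cmod_div, Cmod_conj, Cmod_R by easy.
  rewrite Rabs_right by nra.
  apply Rle_lt_trans with (r * (Cmod z / (r * r)))%R.
  - apply Rmult_le_compat_r; [|easy]. apply Rmult_le_pos; [easy|]. left. apply Rinv_0_lt_compat. nra.
  - replace (r * (Cmod z / (r * r)))%R with (Cmod z / r)%R by (field; lra). apply Rlt_div_l; lra. }
assert (Hd : forall w, (Cmod w <= r)%R -> Cdiff H w).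
{ intros w Hw. apply Cdiff_inv; [now apply Hn|]. apply Cdiff_minus; [apply Cdiff_const|].
  apply Cdiff_mult; [apply Cdiff_id|apply Cdiff_const]. }
assert (M : CInt (fun t => H (circ r t)) 0 (2 * PI) = RtoC (2 * PI) * H 0).
{ apply (circle_mean H r nil); [easy| |].
  - intros w Hw. now apply Cdiff_cont, Hd.
  - intros s t Hs _ _. apply Hd. rewrite Cmod_circ; lra. }
rewrite (CInt_ext _ (fun t => Cconj (H (circ r t)))).
- rewrite CInt_conj.
  + rewrite M. unfold H. replace (1 - 0 * (Cconj z / RtoC (r * r))) with (RtoC 1) by ring.
    apply injective_projections; simpl; field.
  + apply ex_CInt_cont; [lra|]. intros t _. apply (Clim_comp H (circ r)); [|apply circ_cont].
    apply Cdiff_cont, Hd. rewrite Cmod_circ; lra.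
- lra.
- intros t _. unfold H.
  assert (Hw : (Cmod (circ r t) <= r)%R) by (rewrite Cmod_circ; lra).
  rewrite Cinv_conj by now apply Hn. rewrite Cminus_conj, Cmult_conj.
  assert (E : Cconj (circ r t) * circ r t = RtoC (r * r)).
  { unfold circ, Cconj; apply injective_projections; simpl; [|ring].
    assert (K := sin2_cos2 t). unfold Rsqr in K. nra. }
  assert (E1 : Cconj (Cconj z / RtoC (r * r)) = z / RtoC (r * r)).
  { unfold Cdiv. rewrite Cmult_conj, Cinv_conj, Cconj_conj by easy. f_equal. f_equal.
    unfold Cconj; apply injective_projections; simpl; ring. }
  rewrite E1.
  assert (Hnz := circ_neq r t z Hz).
  assert (Hw0 : circ r t <> 0).
  { intro E0. assert (K := Cmod_circ r t ltac:(lra)). rewrite E0, Cmod_0 in K. lra. }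
  assert (Hq : Cconj (circ r t) * (z / RtoC (r * r)) = z / circ r t).
  { rewrite <- E. field. split; [easy|now apply Cconj_neq_0]. }
  rewrite Hq. replace (Cconj 1) with (RtoC 1) by (unfold Cconj; apply injective_projections; simpl; ring).
  replace (1 - z / circ r t) with ((circ r t - z) / circ r t) by (field; easy).
  field. now split.
Qed.

Lemma zero_by_density (f : C -> C) (z : C) : Ccont f z ->
  (forall del, (0 < del)%R -> exists z', (Cmod (z' - z) < del)%R /\ f z' = 0) -> f z = 0.
Proof.
intros Hc H. destruct (Ceq_dec (f z) 0) as [H0|H0]; [easy|exfalso].
apply Cmod_gt_0 in H0.
destruct (Ccont_eps _ _ Hc _ H0) as [del [Hdel Hd]].
destruct (H del Hdel) as [z' [Hz' E]]. specialize (Hd z' Hz'). rewrite E in Hd.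
replace (0 - f z) with (- f z) in Hd by ring. rewrite Cmod_opp in Hd. lra.
Qed.

(** The formula is the mean value property of w (F w - F z) / (w - z), which is
continuous on the disc and differentiable off the real line and off the ray through z. *)
Lemma Cauchy_formula_0 (F : C -> C) (r : R) (z : C) :
  (forall w, (Cmod w <= r)%R -> Ccont F w) ->
  (forall w, (Cmod w <= r)%R -> Im w <> 0%R -> Cdiff F w) ->
  (Cmod z < r)%R -> Im z <> 0%R ->
  CInt (fun t => F (circ r t) * (circ r t / (circ r t - z))) 0 (2 * PI) = RtoC (2 * PI) * F z.
Proof.
intros Hc Hd Hz Hi. assert (Hz0 := Cmod_ge_0 z). assert (Hr : (0 < r)%R) by lra. assert (Hpi := PI_RGT_0).
destruct (proj1 (Cdiff_iff _ _) (Hd z ltac:(lra) Hi)) as [phi [Hphi E]].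
assert (Eq : forall w, w <> z -> phi w = (F w - F z) / (w - z)).
{ intros w Hw. rewrite (E w). field. now apply Cminus_neq. }
assert (Hcont : forall w, (Cmod w <= r)%R -> Ccont phi w).
{ intros w Hw. destruct (Ceq_dec w z) as [->|Hn]; [easy|].
  apply (Ccont_ext_loc (fun w => (F w - F z) / (w - z))).
  - assert (Hp : (0 < Cmod (w - z))%R) by now apply Cmod_gt_0, Cminus_neq.
    apply locally_C_iff. exists (Cmod (w - z)). split; [easy|].
    intros w' Hw'. symmetry. apply Eq. intros ->.
    rewrite <- Cmod_opp in Hw'. replace (- (z - w)) with (w - z) in Hw' by ring. lra.
  - apply Clim_div; [now apply Cminus_neq| |].
    + apply Clim_minus; [now apply Hc|apply Clim_const].
    + apply Clim_minus; [apply Ccont_id|apply Clim_const]. }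
assert (Hang : exists t0, forall s t, (0 < s)%R -> (0 < t < 2 * PI)%R -> circ s t = z -> t = t0).
{ destruct (Classical_Prop.classic (exists s t, (0 < s)%R /\ (0 < t < 2 * PI)%R /\ circ s t = z)) as [[s0 [t0 [Hs0 [Ht0 E0]]]]|Hno].
  - exists t0. intros s t Hs Ht Est.
    assert (s = s0).
    { rewrite <- (Cmod_circ s t), <- (Cmod_circ s0 t0) by lra. now rewrite Est, E0. }
    subst s0. rewrite <- E0 in Est. unfold circ in Est. injection Est as E1 E2.
    apply Rmult_eq_reg_l in E1; [|lra]. apply Rmult_eq_reg_l in E2; [|lra].
    now apply angle_unique.
  - exists 0%R. intros s t Hs Ht Est. exfalso. apply Hno. now exists s, t. }
destruct Hang as [t0 Hang].
assert (M : CInt (fun t => circ r t * phi (circ r t)) 0 (2 * PI) = RtoC (2 * PI) * (0 * phi 0)).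
(* t0 is the argument of z, and PI that of the negative half-line *)
{ apply (circle_mean (fun w => w * phi w) r (t0 :: PI :: nil)); [easy| |].
  - intros w Hw. apply Clim_mult; [apply Ccont_id|now apply Hcont].
  - intros s t Hs Ht Hl.
    assert (Hn : circ s t <> z).
    { intro Est. apply Hl. left. symmetry. apply (Hang s t); [lra|easy|easy]. }
    apply Cdiff_mult; [apply Cdiff_id|].
    apply (Cdiff_ext_loc (fun w => (F w - F z) / (w - z))).
    + assert (Hp : (0 < Cmod (circ s t - z))%R) by now apply Cmod_gt_0, Cminus_neq.
      apply locally_C_iff. exists (Cmod (circ s t - z)). split; [easy|].
      intros w' Hw'. symmetry. apply Eq. intros ->.
      rewrite <- Cmod_opp in Hw'. replace (- (z - circ s t)) with (circ s t - z) in Hw' by ring. lra.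
    + apply Cdiff_div; [now apply Cminus_neq| |].
      * apply Cdiff_minus; [|apply Cdiff_const]. apply Hd; [rewrite Cmod_circ; lra|].
        unfold circ; simpl. intro E0. apply Rmult_integral in E0. destruct E0 as [E0|E0]; [lra|].
        apply Hl. right. left.
        destruct (Rtotal_order t PI) as [K|[K|K]]; [|easy|].
        -- assert (0 < sin t)%R by (apply sin_gt_0; lra). lra.
        -- assert (0 < sin (t - PI))%R by (apply sin_gt_0; lra).
           rewrite sin_minus, sin_PI, cos_PI in H. lra.
      * apply Cdiff_minus; [apply Cdiff_id|apply Cdiff_const]. }
assert (Hcirc : forall t, (Cmod (circ r t) <= r)%R) by (intro t; rewrite Cmod_circ; lra).
assert (Hex1 : ex_CInt (fun t => circ r t * phi (circ r t)) 0 (2 * PI)).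
{ apply ex_CInt_cont; [lra|]. intros t _. apply Clim_mult; [apply circ_cont|].
  apply (Clim_comp phi (circ r)); [now apply Hcont|apply circ_cont]. }
assert (Hex2 : ex_CInt (fun t => circ r t / (circ r t - z)) 0 (2 * PI)).
{ apply ex_CInt_cont; [lra|]. intros t _. apply Clim_div; [now apply circ_neq|apply circ_cont|].
  apply Clim_minus; [apply circ_cont|apply Clim_const]. }
rewrite (CInt_ext _ (fun t => circ r t * phi (circ r t) + F z * (circ r t / (circ r t - z)))).
- rewrite CInt_plus; [|assumption|now apply ex_CInt_scal]. rewrite M, CInt_scal, CInt_kernel by assumption. Cring.
- lra.
- intros t _. assert (Hn := circ_neq r t z Hz). rewrite Eq by (intro E0; apply Hn; rewrite E0; apply Cplus_opp_r).
  field. easy.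
Qed.

(** * Cauchy's integral *)

Lemma two_PI_neq : RtoC (2 * PI) <> 0.
Proof. intro E. apply RtoC_inj in E. assert (K := PI_RGT_0). lra. Qed.

(** The Cauchy integral depends continuously on the boundary values and on the point
jointly. *)
Lemma kernel_lim {T : UniformSpace} (E : T -> Prop) (x0 : T) (r : R)
    (Phi : T -> R -> C) (Phi0 : R -> C) (zeta : T -> C) (zeta0 : C) :
  (Cmod zeta0 < r)%R -> (forall x, E x -> (Cmod (zeta x) < r)%R) ->
  Clim zeta (within E (locally x0)) zeta0 ->
  cont_seg Phi0 0 (2 * PI) -> (forall x, E x -> cont_seg (Phi x) 0 (2 * PI)) ->
  (forall t, (0 <= t <= 2 * PI)%R -> Clim (fun p => Phi (fst p) (snd p))
     (filter_prod (within E (locally x0)) (locally t)) (Phi0 t)) ->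
  Clim (fun x => CInt (fun t => Phi x t * (circ r t / (circ r t - zeta x))) 0 (2 * PI))
    (within E (locally x0)) (CInt (fun t => Phi0 t * (circ r t / (circ r t - zeta0))) 0 (2 * PI)).
Proof.
intros Hz0 Hz Hlz H0 HP HL. assert (Hpi := PI_RGT_0).
apply (Clim_CInt E x0 (fun x t => Phi x t * (circ r t / (circ r t - zeta x)))); [lra| | |].
- intros t Ht. apply Clim_mult; [now apply H0|].
  apply Clim_div; [now apply circ_neq|apply circ_cont|].
  apply Clim_minus; [apply circ_cont|apply Clim_const].
- intros x Hx. apply ex_CInt_cont; [lra|]. intros t Ht. apply Clim_mult; [now apply HP|].
  apply Clim_div; [apply circ_neq; now apply Hz|apply circ_cont|].
  apply Clim_minus; [apply circ_cont|apply Clim_const].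
- intros t Ht.
  assert (Hc : Clim (fun p : T * R => circ r (snd p)) (filter_prod (within E (locally x0)) (locally t)) (circ r t)).
  { eapply filterlim_comp; [apply filterlim_snd|apply circ_cont]. }
  apply Clim_mult; [now apply HL|].
  apply Clim_div; [now apply circ_neq|exact Hc|].
  apply Clim_minus; [exact Hc|].
  eapply filterlim_comp; [apply filterlim_fst|exact Hlz].
Qed.

Lemma filterlim_within_nbhd {T U : UniformSpace} (E : T -> Prop) (x0 : T) (f : T -> U) (G : (U -> Prop) -> Prop) :
  locally x0 E -> filterlim f (within E (locally x0)) G -> filterlim f (locally x0) G.
Proof.
intros HE Hf P HP. generalize (filter_and _ _ HE (Hf P HP)). unfold filtermap. apply filter_imp.
intros x [Hx H]. now apply H.
Qed.

Lemma filterlim_within {T U : UniformSpace} (E : T -> Prop) (x0 : T) (f : T -> U) (G : (U -> Prop) -> Prop) :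
  filterlim f (locally x0) G -> filterlim f (within E (locally x0)) G.
Proof. intros Hf P HP. generalize (Hf P HP). unfold filtermap, within. apply filter_imp. tauto. Qed.

Lemma locally_disc (c z : C) (r : R) : (Cmod (z - c) < r)%R ->
  @locally C_UniformSpace z (fun w => (Cmod (w - c) < r)%R).
Proof.
intros H. apply locally_C_iff. exists (r - Cmod (z - c))%R. split; [lra|].
intros w Hw. replace (w - c) with ((w - z) + (z - c)) by ring.
eapply Rle_lt_trans; [apply Cmod_triangle|]. lra.
Qed.

(** Holomorphy inside the circle in a form that survives limits. *)
Definition cauchy_repr (F : C -> C) (c : C) (r : R) : Prop :=
  cont_seg (fun t => F (c + circ r t)) 0 (2 * PI) /\
  forall z, (Cmod (z - c) < r)%R ->
    CInt (fun t => F (c + circ r t) * (circ r t / (circ r t - (z - c)))) 0 (2 * PI) = RtoC (2 * PI) * F z.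

Definition cauchy_slope (F : C -> C) (c : C) (r : R) (z z' : C) : C :=
  / RtoC (2 * PI) *
  CInt (fun t => F (c + circ r t) / (circ r t - (z - c)) * (circ r t / (circ r t - (z' - c)))) 0 (2 * PI).

(** The difference of the Cauchy kernels at z' and z is z' - z times their product over w. *)
Lemma cauchy_slopeE (F : C -> C) (c : C) (r : R) (z z' : C) : cauchy_repr F c r ->
  (Cmod (z - c) < r)%R -> (Cmod (z' - c) < r)%R -> F z' = F z + (z' - z) * cauchy_slope F c r z z'.
Proof.
intros [Hc H] Hz Hz'. assert (Hpi := PI_RGT_0). assert (H2 := two_PI_neq).
assert (Hex : forall u, (Cmod (u - c) < r)%R ->
  ex_CInt (fun t => F (c + circ r t) * (circ r t / (circ r t - (u - c)))) 0 (2 * PI)).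
{ intros u Hu. apply ex_CInt_cont; [lra|]. intros t Ht. apply Clim_mult; [now apply Hc|].
  apply Clim_div; [now apply circ_neq|apply circ_cont|].
  apply Clim_minus; [apply circ_cont|apply Clim_const]. }
assert (E : (z' - z) * CInt (fun t => F (c + circ r t) / (circ r t - (z - c)) * (circ r t / (circ r t - (z' - c)))) 0 (2 * PI)
   = RtoC (2 * PI) * F z' - RtoC (2 * PI) * F z).
{ rewrite <- (H z Hz), <- (H z' Hz'), <- CInt_minus by now apply Hex.
  rewrite <- CInt_scal.
  - apply CInt_ext; [lra|]. intros t _.
    assert (N1 := circ_neq r t _ Hz). assert (N2 := circ_neq r t _ Hz'). field. now split.
  - apply ex_CInt_cont; [lra|]. intros t Ht. apply Clim_mult.
    + apply Clim_div; [now apply circ_neq|now apply Hc|].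
      apply Clim_minus; [apply circ_cont|apply Clim_const].
    + apply Clim_div; [now apply circ_neq|apply circ_cont|].
      apply Clim_minus; [apply circ_cont|apply Clim_const]. }
unfold cauchy_slope.
replace ((z' - z) * (/ RtoC (2 * PI) *
  CInt (fun t => F (c + circ r t) / (circ r t - (z - c)) * (circ r t / (circ r t - (z' - c)))) 0 (2 * PI)))
  with (/ RtoC (2 * PI) * ((z' - z) *
  CInt (fun t => F (c + circ r t) / (circ r t - (z - c)) * (circ r t / (circ r t - (z' - c)))) 0 (2 * PI))) by ring.
rewrite E. field. easy.
Qed.

(** For Osgood's lemma the slope has to be continuous in the point and in a parameter
of the function jointly. *)
Lemma cauchy_slope_lim {T : UniformSpace} (E : T -> Prop) (x0 : T) (G : T -> C -> C) (c : C) (r : R) (z : C) (zeta : T -> C) :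
  (Cmod (z - c) < r)%R -> E x0 -> (forall x, E x -> (Cmod (zeta x - c) < r)%R) ->
  Clim zeta (within E (locally x0)) (zeta x0) ->
  (forall x, E x -> cont_seg (fun t => G x (c + circ r t)) 0 (2 * PI)) ->
  (forall t, (0 <= t <= 2 * PI)%R -> Clim (fun p => G (fst p) (c + circ r (snd p)))
     (filter_prod (within E (locally x0)) (locally t)) (G x0 (c + circ r t))) ->
  Clim (fun x => cauchy_slope (G x) c r z (zeta x)) (within E (locally x0)) (cauchy_slope (G x0) c r z (zeta x0)).
Proof.
intros Hz Ex0 Hzeta Hlz Hc HL. unfold cauchy_slope. apply Clim_mult; [apply Clim_const|].
assert (Hk : forall x, E x -> cont_seg (fun t => G x (c + circ r t) / (circ r t - (z - c))) 0 (2 * PI)).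
{ intros x Hx t Ht. apply Clim_div; [now apply circ_neq|now apply Hc|].
  apply Clim_minus; [apply circ_cont|apply Clim_const]. }
apply (kernel_lim E x0 r (fun x t => G x (c + circ r t) / (circ r t - (z - c)))
  (fun t => G x0 (c + circ r t) / (circ r t - (z - c))) (fun x => zeta x - c)).
- now apply Hzeta.
- exact Hzeta.
- apply Clim_minus; [exact Hlz|apply Clim_const].
- now apply Hk.
- exact Hk.
- intros t Ht. apply Clim_div; [now apply circ_neq|now apply HL|].
  apply Clim_minus; [|apply Clim_const]. eapply filterlim_comp; [apply filterlim_snd|apply circ_cont].
Qed.

Lemma cauchy_repr_diff (F : C -> C) (c : C) (r : R) (z : C) : cauchy_repr F c r ->
  (Cmod (z - c) < r)%R -> Cdiff F z.
Proof.
intros H Hz. assert (Hc := proj1 H).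
apply (Cdiff_ext_loc (fun z' => F z + (z' - z) * cauchy_slope F c r z z')).
- generalize (locally_disc c z r Hz). apply filter_imp. intros w Hw. symmetry.
  now apply cauchy_slopeE.
- apply Cdiff_iff. exists (fun z' => cauchy_slope F c r z z'). split.
  + apply (filterlim_within_nbhd (T := C_UniformSpace) (U := C_UniformSpace) (fun w => (Cmod (w - c) < r)%R) z); [now apply locally_disc|].
    apply (cauchy_slope_lim (T := C_UniformSpace) (fun w => (Cmod (w - c) < r)%R) z (fun _ => F) c r z (fun w => w)); try easy.
    * apply filterlim_within. apply Ccont_id.
    * intros t Ht. apply (filterlim_comp _ _ _ snd (fun t => F (c + circ r t)) _ (locally t) _); [apply filterlim_snd|now apply Hc].
  + intros w. ring.
Qed.

(** * Functions on a disc *)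

Lemma Ccont_comp (g f : C -> C) (z : C) : Ccont g (f z) -> Ccont f z -> Ccont (fun w => g (f w)) z.
Proof. intros Hg Hf. exact (Clim_comp g f (f z) Hg Hf). Qed.

Lemma cont_on_circle (F : C -> C) (c : C) (r : R) : (0 < r)%R ->
  (forall w, (Cmod (w - c) <= r)%R -> Ccont F w) -> cont_seg (fun t => F (c + circ r t)) 0 (2 * PI).
Proof.
intros Hr H t _. apply (Clim_comp F (fun t => c + circ r t)).
- apply H. replace (c + circ r t - c) with (circ r t) by ring. rewrite Cmod_circ; lra.
- apply Clim_plus; [apply Clim_const|apply circ_cont].
Qed.

(** Painleve's theorem for a diameter.  At points z off the diameter Cauchy's formula is
already known; both sides are continuous in z, and such points are dense. *)
Lemma cauchy_repr_disc (F : C -> C) (c : C) (r : R) : (0 < r)%R ->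
  (forall w, (Cmod (w - c) <= r)%R -> Ccont F w) ->
  (forall w, (Cmod (w - c) <= r)%R -> Im w <> Im c -> Cdiff F w) ->
  cauchy_repr F c r.
Proof.
intros Hr Hc Hd. assert (Hcirc := cont_on_circle F c r Hr Hc). split; [exact Hcirc|].
assert (Hnr : forall z, (Cmod (z - c) < r)%R -> Im z <> Im c ->
  CInt (fun t => F (c + circ r t) * (circ r t / (circ r t - (z - c)))) 0 (2 * PI) = RtoC (2 * PI) * F z).
{ intros z Hz Hi.
  replace (F z) with (F (c + (z - c))) by (f_equal; ring).
  apply (Cauchy_formula_0 (fun w => F (c + w)) r (z - c)).
  - intros w Hw. apply (Ccont_comp F (fun w => c + w)).
    + apply Hc. now replace (c + w - c) with w by ring.
    + apply Clim_plus; [apply Clim_const|apply Ccont_id].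
  - intros w Hw Hwi. apply (Cdiff_comp (fun w => c + w) F).
    + apply Hd; [now replace (c + w - c) with w by ring|]. rewrite im_plus. lra.
    + apply Cdiff_plus; [apply Cdiff_const|apply Cdiff_id].
  - exact Hz.
  - change (Im z - Im c <> 0)%R. lra. }
intros z Hz. destruct (Req_dec (Im z) (Im c)) as [Hi|Hi]; [|now apply Hnr].
set (D := fun z => CInt (fun t => F (c + circ r t) * (circ r t / (circ r t - (z - c)))) 0 (2 * PI) - RtoC (2 * PI) * F z).
apply Cminus_eq. change (D z = 0). apply zero_by_density.
- apply Clim_minus; [|apply Clim_mult; [apply Clim_const|apply Hc; lra]].
  apply (filterlim_within_nbhd (T := C_UniformSpace) (U := C_UniformSpace) (fun w => (Cmod (w - c) < r)%R) z); [now apply locally_disc|].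
  apply (kernel_lim (T := C_UniformSpace) (fun w => (Cmod (w - c) < r)%R) z r (fun _ t => F (c + circ r t))
    (fun t => F (c + circ r t)) (fun w => w - c)); try easy.
  + apply filterlim_within. apply Clim_minus; [apply Ccont_id|apply Clim_const].
  + intros t Ht. apply (filterlim_comp _ _ _ snd (fun t => F (c + circ r t)) _ (locally t) _);
      [apply filterlim_snd|now apply Hcirc].
- intros del Hdel.
  set (e := (Rmin del (r - Cmod (z - c)) / 2)%R).
  assert (E1 := Rmin_l del (r - Cmod (z - c))). assert (E2 := Rmin_r del (r - Cmod (z - c))).
  assert (He : (0 < Rmin del (r - Cmod (z - c)))%R) by (apply Rmin_pos; lra).
  assert (Hm : Cmod (Ci * RtoC e) = e).
  { rewrite Cmod_mult, Cmod_Ci, Cmod_R, Rabs_right; unfold e; lra. }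
  exists (z + Ci * RtoC e). split.
  + replace (z + Ci * RtoC e - z) with (Ci * RtoC e) by ring. rewrite Hm. unfold e; lra.
  + unfold D. rewrite Hnr; [ring| |].
    * replace (z + Ci * RtoC e - c) with ((z - c) + Ci * RtoC e) by ring.
      eapply Rle_lt_trans; [apply Cmod_triangle|]. rewrite Hm. unfold e; lra.
    * rewrite im_plus, <- Hi. simpl. unfold e. lra.
Qed.

(** A line is removable for continuous functions: Cauchy's integral has a slope. *)
Lemma Cdiff_line (F : C -> C) (c : C) (r : R) : (0 < r)%R ->
  (forall w, (Cmod (w - c) <= r)%R -> Ccont F w) ->
  (forall w, (Cmod (w - c) <= r)%R -> Im w <> Im c -> Cdiff F w) -> Cdiff F c.
Proof.
intros Hr Hc Hd. apply (cauchy_repr_diff F c r); [now apply cauchy_repr_disc|].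
replace (c - c) with (RtoC 0) by ring. now rewrite Cmod_0.
Qed.

(** Cauchy's estimate, in which the kernel is bounded by r / (r - |z - c|). *)
Lemma cauchy_repr_bound (F : C -> C) (c : C) (r M : R) (z : C) : cauchy_repr F c r ->
  (Cmod (z - c) < r)%R -> (forall t, (0 <= t <= 2 * PI)%R -> (Cmod (F (c + circ r t)%C) <= M)%R) ->
  (Cmod (F z) <= r / (r - Cmod (z - c)) * M)%R.
Proof.
intros [Hc H] Hz HM. assert (Hpi := PI_RGT_0). assert (Hz0 := Cmod_ge_0 (z - c)).
assert (Hex : ex_CInt (fun t => F (c + circ r t) * (circ r t / (circ r t - (z - c)))) 0 (2 * PI)).
{ apply ex_CInt_cont; [lra|]. intros t Ht. apply Clim_mult; [now apply Hc|].
  apply Clim_div; [now apply circ_neq|apply circ_cont|].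
  apply Clim_minus; [apply circ_cont|apply Clim_const]. }
assert (B := Cmod_CInt_le _ 0 (2 * PI) (M * (r / (r - Cmod (z - c)))) ltac:(lra) Hex).
rewrite (H z Hz), Cmod_mult, Cmod_R, (Rabs_right (2 * PI)) in B by lra.
apply (Rmult_le_reg_l (2 * PI)); [lra|].
replace (2 * PI * (r / (r - Cmod (z - c)) * M))%R with ((2 * PI - 0) * (M * (r / (r - Cmod (z - c)))))%R by (field; lra).
apply B. intros t Ht.
assert (Hcm : Cmod (circ r t) = r) by (apply Cmod_circ; lra).
assert (Hn := circ_neq r t _ Hz).
rewrite Cmod_mult. apply Rmult_le_compat; try apply Cmod_ge_0.
- now apply HM.
- rewrite Cmod_div by easy. rewrite Hcm.
  apply Rmult_le_compat_l; [lra|]. apply Rinv_le_contravar; [lra|].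
  assert (T := Cmod_triangle (circ r t - (z - c)) (z - c)).
  replace (circ r t - (z - c) + (z - c)) with (circ r t) in T by ring. lra.
Qed.

(** Cauchy's formula passes to the limit y -> y0, since V is continuous at all points of
the circle. *)
Lemma Cdiff_limit (V : C * C -> C) (P : C -> Prop) (c y0 : C) (r : R) : (0 < r)%R ->
  (forall x, (Cmod (x - c) <= r)%R ->
     Clim V (within (fun p => P (snd p) \/ snd p = y0) (@locally (prod_UniformSpace C_UniformSpace C_UniformSpace) (x, y0))) (V (x, y0))) ->
  (forall x y, (Cmod (x - c) <= r)%R -> P y -> Cdiff (fun x => V (x, y)) x) ->
  (forall del, (0 < del)%R -> exists y, P y /\ (Cmod (y - y0) < del)%R) ->
  forall z, (Cmod (z - c) < r)%R -> Cdiff (fun x => V (x, y0)) z.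
Proof.
intros Hr Hc Hd Hy z Hz.
assert (Hc0 : forall x, (Cmod (x - c) <= r)%R -> Ccont (fun x => V (x, y0)) x).
{ intros x Hx Q HQ. specialize (Hc x Hx Q HQ). unfold filtermap, within in Hc |- *.
  destruct Hc as [e He]. exists e. intros x' Hx'. apply (He (x', y0)); [split; [exact Hx'|apply ball_center]|now right]. }
assert (FP : ProperFilter (within P (@locally C_UniformSpace y0))).
{ constructor; [|apply within_filter, locally_filter].
  intros Q HQ. unfold within in HQ. apply locally_C_iff in HQ. destruct HQ as [del [Hdel HQ]].
  destruct (Hy del Hdel) as [y [HPy Hyd]]. exists y. now apply HQ. }
assert (HcP : forall x, (Cmod (x - c) <= r)%R -> Clim (fun y => V (x, y)) (within P (@locally C_UniformSpace y0)) (V (x, y0))).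
{ intros x Hx Q HQ. specialize (Hc x Hx Q HQ). unfold filtermap, within in Hc |- *.
  destruct Hc as [e He]. exists e. intros y' Hy' HPy. apply (He (x, y')); [split; [apply ball_center|exact Hy']|now left]. }
assert (Hcirc := cont_on_circle _ c r Hr Hc0). cbv beta in Hcirc.
apply (cauchy_repr_diff _ c r); [|exact Hz]. split; [exact Hcirc|].
clear z Hz. intros z Hz. apply Cminus_eq.
eapply (Clim_unique (F := within P (@locally C_UniformSpace y0))
  (fun y => CInt (fun t => V (c + circ r t, y) * (circ r t / (circ r t - (z - c)))) 0 (2 * PI) - RtoC (2 * PI) * V (z, y))).
- apply Clim_minus; [|apply Clim_mult; [apply Clim_const|apply HcP; lra]].
  apply (kernel_lim (T := C_UniformSpace) P y0 r (fun y t => V (c + circ r t, y)) (fun t => V (c + circ r t, y0)) (fun _ => z - c)); try easy.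
  + apply Clim_const.
  + intros y HPy. apply (cont_on_circle (fun x => V (x, y)) c r Hr). intros x Hx. now apply Cdiff_cont, Hd.
  + intros t Ht.
    assert (Hx : (Cmod (c + circ r t - c) <= r)%R).
    { replace (c + circ r t - c) with (circ r t) by ring. rewrite Cmod_circ; lra. }
    apply (filterlim_comp _ _ _ (fun p : C_UniformSpace * R => ((c + circ r (snd p), fst p) : C * C)) V _
      (within (fun p => P (snd p) \/ snd p = y0) (@locally (prod_UniformSpace C_UniformSpace C_UniformSpace) (c + circ r t, y0)))); [|now apply Hc].
    intros Q [e HQ].
    assert (Hcc : @continuous R_UniformSpace C_UniformSpace (fun t => c + circ r t) t).
    { apply Clim_plus; [apply Clim_const|apply circ_cont]. }
    exists (fun y => P y /\ @ball C_UniformSpace y0 e y) (fun s => @ball C_UniformSpace (c + circ r t) e (c + circ r s)).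
    * unfold within. exists e. intros y Hye HPy. now split.
    * apply (Hcc (fun w => @ball C_UniformSpace (c + circ r t) e w)). apply locally_ball.
    * intros y s [HPy Hye] Hs. apply HQ; [now split|now left].
- apply (filterlim_ext_loc (F := within P (@locally C_UniformSpace y0)) (fun _ => RtoC 0)); [|apply Clim_const].
  unfold within. apply filter_forall. intros y HPy.
  destruct (cauchy_repr_disc (fun x => V (x, y)) c r Hr) as [_ E].
  + intros x Hx. now apply Cdiff_cont, Hd.
  + intros x Hx _. now apply Hd.
  + specialize (E z Hz). cbv beta in E. symmetry.
    etransitivity; [exact (f_equal (fun u => u - RtoC (2 * PI) * V (z, y)) E)|apply Cplus_opp_r].
Qed.

(** * The identity principle *)

Lemma Cpow_neq_0 (z : C) (n : nat) : z <> 0 -> z ^ n <> 0.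
Proof. intros H. induction n as [|n IH]; simpl; [exact C1_nz|now apply Cmult_neq_0]. Qed.

Lemma Cdiff_pow (f : C -> C) (n : nat) (z : C) : Cdiff f z -> Cdiff (fun w => f w ^ n) z.
Proof. intros H. induction n as [|n IH]; simpl; [apply Cdiff_const|now apply Cdiff_mult]. Qed.

(** If f vanishes near c then every f / (w - c)^n is holomorphic on the disc, and
Cauchy's estimate bounds f z by a constant times (|z - c| / r)^n. *)
Lemma zero_in_disc (f : C -> C) (c z : C) (r : R) :
  (forall w, (Cmod (w - c) <= r)%R -> Cdiff f w) ->
  @locally C_UniformSpace c (fun w => f w = 0) -> (Cmod (z - c) < r)%R -> f z = 0.
Proof.
intros Hd H0 Hz. assert (Hz0 := Cmod_ge_0 (z - c)).
assert (Hr : (0 < r)%R) by lra.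
apply locally_C_iff in H0. destruct H0 as [rho [Hrho H0]].
destruct (Ceq_dec (f z) 0) as [E|E]; [easy|exfalso].
assert (Hzc : z <> c).
{ intros ->. apply E, H0. replace (c - c) with (RtoC 0) by ring. now rewrite Cmod_0. }
assert (Hzc' : (0 < Cmod (z - c))%R) by now apply Cmod_gt_0, Cminus_neq.
assert (HM : exists M, forall t, (0 <= t <= 2 * PI)%R -> (Cmod (f (c + circ r t)%C) <= M)%R).
{ assert (Hcirc : forall t, continuity_pt (fun t => Cmod (f (c + circ r t))) t).
  { intros t. apply continuity_pt_filterlim.
    apply (Clim_Cmod (F := locally t)). apply (Clim_comp f (fun t => c + circ r t)).
    - apply Cdiff_cont, Hd. replace (c + circ r t - c) with (circ r t) by ring. rewrite Cmod_circ; lra.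
    - apply Clim_plus; [apply Clim_const|apply circ_cont]. }
  destruct (continuity_ab_maj (fun t => Cmod (f (c + circ r t))) 0 (2 * PI)) as [tm [Hm _]].
  { assert (K := PI_RGT_0). lra. } { intros t _. apply Hcirc. }
  now exists (Cmod (f (c + circ r tm))). }
destruct HM as [M HM].
set (q := (Cmod (z - c) / r)%R).
assert (Hq : (0 <= q < 1)%R).
{ split; [apply Rmult_le_pos; [lra|left; now apply Rinv_0_lt_compat]|apply Rlt_div_l; lra]. }
set (B := (r / (r - Cmod (z - c)) * M)%R).
assert (Key : forall n, (Cmod (f z) <= q ^ n * B)%R).
(* g is 0 near c, and also at c itself, because f c = 0 *)
{ intros n. set (g := fun w => f w / (w - c) ^ n).
  assert (Hg : forall w, (Cmod (w - c) <= r)%R -> Cdiff g w).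
  { intros w Hw. destruct (Ceq_dec w c) as [->|Hn].
    - apply (Cdiff_ext_loc (fun _ => 0)); [|apply Cdiff_const].
      apply locally_C_iff. exists rho. split; [easy|]. intros w' Hw'. unfold g. rewrite (H0 w' Hw'). unfold Cdiv. Cring.
    - apply Cdiff_div; [now apply Cpow_neq_0, Cminus_neq|now apply Hd|].
      apply Cdiff_pow. apply Cdiff_minus; [apply Cdiff_id|apply Cdiff_const]. }
  assert (Hrep : cauchy_repr g c r).
  { apply cauchy_repr_disc; [easy| |].
    - intros w Hw. now apply Cdiff_cont, Hg.
    - intros w Hw _. now apply Hg. }
  assert (Hb := cauchy_repr_bound g c r (M / r ^ n) z Hrep Hz).
  assert (Hrn : (0 < r ^ n)%R) by now apply pow_lt.
  assert (Hgz : f z = g z * (z - c) ^ n).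
  { unfold g. field. now apply Cpow_neq_0, Cminus_neq. }
  rewrite Hgz, Cmod_mult, Cmod_pow.
  apply Rle_trans with (r / (r - Cmod (z - c)) * (M / r ^ n) * Cmod (z - c) ^ n)%R.
  - apply Rmult_le_compat_r; [apply pow_le; lra|]. apply Hb. intros t Ht. unfold g.
    replace (c + circ r t - c) with (circ r t) by ring.
    assert (Hcr : Cmod (circ r t) = r) by (apply Cmod_circ; lra).
    rewrite Cmod_div, Cmod_pow, Hcr.
    + apply Rmult_le_compat_r; [left; now apply Rinv_0_lt_compat|now apply HM].
    + apply Cpow_neq_0. intro E0. rewrite E0, Cmod_0 in Hcr. lra.
  - right. unfold B, q, Rdiv. rewrite Rpow_mult_distr, pow_inv. ring. }
apply Cmod_gt_0 in E.
assert (HB : (0 < B)%R). { specialize (Key 0%nat). simpl in Key. lra. }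
destruct (pow_lt_1_zero q ltac:(rewrite Rabs_right; lra) (Cmod (f z) / B)%R) as [n Hn].
{ now apply Rdiv_lt_0_compat. }
specialize (Hn n (Nat.le_refl n)). rewrite Rabs_right in Hn by (apply Rle_ge, pow_le; lra).
apply (Rmult_lt_compat_r B) in Hn; [|easy]. specialize (Key n).
replace (Cmod (f z) / B * B)%R with (Cmod (f z)) in Hn by (field; lra). lra.
Qed.

(** A Lebesgue number for the segment allows one to pass from its beginning to its
end through finitely many overlapping discs of equal size. *)
Lemma zero_along_segment (f : C -> C) (z0 z1 : C) :
  (forall t : R, (0 <= t <= 1)%R -> @locally C_UniformSpace (z0 + RtoC t * (z1 - z0)) (fun w => Cdiff f w)) ->
  @locally C_UniformSpace z0 (fun w => f w = 0) -> f z1 = 0.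
Proof.
intros Hd H0.
set (g := fun t : R => z0 + RtoC t * (z1 - z0)).
set (L := (Cmod (z1 - z0) + 1)%R). assert (HL : (1 <= L)%R) by (unfold L; assert (K := Cmod_ge_0 (z1 - z0)); lra).
assert (Hg : forall s t, (Cmod (g s - g t) <= L * Rabs (s - t))%R).
{ intros s t. replace (g s - g t) with (RtoC (s - t) * (z1 - z0)) by (unfold g; rewrite RtoC_minus; ring).
  rewrite Cmod_mult, Cmod_R, Rmult_comm. apply Rmult_le_compat_r; [apply Rabs_pos|unfold L; lra]. }
assert (Hdel : forall t, exists d : posreal, (0 <= t <= 1)%R ->
  forall w, (Cmod (w - g t) < 3 * L * d)%R -> Cdiff f w).
{ intros t. destruct (Rle_dec 0 t) as [H1|H1]; [|exists (mkposreal _ Rlt_0_1); lra].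
  destruct (Rle_dec t 1) as [H2|H2]; [|exists (mkposreal _ Rlt_0_1); lra].
  destruct (proj1 (locally_C_iff _ _) (Hd t (conj H1 H2))) as [e [He H]].
  assert (He' : (0 < e / (3 * L))%R) by (apply Rdiv_lt_0_compat; lra).
  exists (mkposreal _ He'). intros _ w Hw. apply H. simpl in Hw.
  replace (3 * L * (e / (3 * L)))%R with e in Hw by (field; lra). exact Hw. }
destruct (choice _ Hdel) as [del Hdelta]. clear Hdel.
destruct (compactness_value_1d 0 1 del) as [d Hcd].
assert (Hdisc : forall t, (0 <= t <= 1)%R -> forall w, (Cmod (w - g t) < 2 * L * d)%R -> Cdiff f w).
{ intros t Ht w Hw. apply Classical_Prop.NNPP. intro Hn. apply (Hcd t Ht). intros [s [Hs [Hst Hds]]].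
  apply Hn. apply (Hdelta s Hs).
  replace (w - g s) with ((w - g t) + (g t - g s)) by ring.
  eapply Rle_lt_trans; [apply Cmod_triangle|]. specialize (Hg t s).
  assert (K := cond_pos (del s)). assert (L * Rabs (t - s) < L * del s)%R by (apply Rmult_lt_compat_l; lra).
  assert (2 * L * d <= 2 * L * del s)%R by (apply Rmult_le_compat_l; lra). lra. }
assert (Hdp := cond_pos d).
assert (Step : forall t, (0 <= t <= 1)%R -> @locally C_UniformSpace (g t) (fun w => f w = 0) ->
  forall w, (Cmod (w - g t) < L * d)%R -> f w = 0).
{ intros t Ht Hl w Hw. apply (zero_in_disc f (g t) w (L * d)); try assumption.
  intros w' Hw'. apply (Hdisc t Ht). assert (0 < L * d)%R by (apply Rmult_lt_0_compat; lra). lra. }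
assert (Hind : forall n, forall t, (0 <= t <= 1)%R -> (t <= INR n * (d / 2))%R -> @locally C_UniformSpace (g t) (fun w => f w = 0)).
{ induction n as [|n IH]; intros t Ht Htn.
  - simpl in Htn. replace t with 0%R by lra. unfold g. now replace (z0 + RtoC 0 * (z1 - z0)) with z0 by ring.
  - rewrite S_INR in Htn. destruct (Rle_dec t (INR n * (d / 2))) as [Hle|Hgt]; [now apply IH|].
    assert (Hn := pos_INR n). assert (0 <= INR n * (d / 2))%R by (apply Rmult_le_pos; lra).
    assert (Hs : (0 <= INR n * (d / 2) <= 1)%R) by lra.
    specialize (Step _ Hs (IH _ Hs ltac:(lra))).
    generalize (locally_disc (g (INR n * (d / 2))%R) (g t) (L * d)).
    intros K. unshelve epose proof (K _) as K'; [|revert K'; apply filter_imp; intros w Hw; now apply Step].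
    eapply Rle_lt_trans; [apply Hg|]. apply Rmult_lt_compat_l; [lra|].
    apply Rabs_lt_between. lra. }
destruct (nfloor_ex (2 / d)) as [n [_ Hn]].
{ left. apply Rdiv_lt_0_compat; lra. }
assert (H1 : @locally C_UniformSpace (g 1%R) (fun w => f w = 0)).
{ apply (Hind (S n)); [lra|]. rewrite S_INR.
  apply Rle_trans with (2 / d * (d / 2))%R; [right; field; lra|].
  apply Rmult_le_compat_r; lra. }
apply locally_singleton in H1. unfold g in H1. now replace (z0 + RtoC 1 * (z1 - z0)) with z1 in H1 by ring.
Qed.

(** * Functions of two complex variables *)

Notation C2 := (prod_UniformSpace C_UniformSpace C_UniformSpace).
Notation C2cont f p := (@continuous C2 C_UniformSpace f p).
Notation C2diff f p := (@ex_filterdiff C_AbsRing (prod_NormedModule C_AbsRing C_NormedModule C_NormedModule)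
  C_NormedModule f (@locally C2 p)).

Lemma Cnorm_Cmod (z : C) : @norm C_AbsRing C_NormedModule z = Cmod z.
Proof. reflexivity. Qed.

Lemma norm_C2_fst (h l : C) :
  (Cmod h <= @norm C_AbsRing (prod_NormedModule C_AbsRing C_NormedModule C_NormedModule) (h, l))%R.
Proof.
eapply Rle_trans; [|apply norm_prod]. apply Rmax_l.
Qed.

Lemma norm_C2_snd (h l : C) :
  (Cmod l <= @norm C_AbsRing (prod_NormedModule C_AbsRing C_NormedModule C_NormedModule) (h, l))%R.
Proof.
eapply Rle_trans; [|apply norm_prod]. apply Rmax_r.
Qed.

(** The two-variable form of Caratheodory's criterion. *)
Lemma C2diff_slopes (V A B : C * C -> C) (x y : C) : C2cont A (x, y) -> C2cont B (x, y) ->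
  @locally C2 (x, y) (fun p => V p = V (x, y) + (fst p - x) * A p + (snd p - y) * B p) ->
  C2diff V (x, y).
Proof.
intros HA HB HV.
exists (fun p : C * C => fst p * A (x, y) + snd p * B (x, y)). split.
- split.
  + intros [h1 l1] [h2 l2]. change ((h1 + h2) * A (x, y) + (l1 + l2) * B (x, y) =
      (h1 * A (x, y) + l1 * B (x, y)) + (h2 * A (x, y) + l2 * B (x, y))). ring.
  + intros k [h l]. change ((k * h) * A (x, y) + (k * l) * B (x, y) = k * (h * A (x, y) + l * B (x, y))). ring.
  + exists (Cmod (A (x, y)) + Cmod (B (x, y)) + 1)%R.
    assert (P1 := Cmod_ge_0 (A (x, y))). assert (P2 := Cmod_ge_0 (B (x, y))). split; [lra|].
    intros [h l]. change (Cmod (h * A (x, y) + l * B (x, y)) <= (Cmod (A (x, y)) + Cmod (B (x, y)) + 1) *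
      @norm C_AbsRing (prod_NormedModule C_AbsRing C_NormedModule C_NormedModule) (h, l))%R.
    eapply Rle_trans; [apply Cmod_triangle|]. rewrite !Cmod_mult.
    assert (N1 := norm_C2_fst h l). assert (N2 := norm_C2_snd h l).
    assert (Q1 := Cmod_ge_0 h). assert (Q2 := Cmod_ge_0 l).
    set (N := @norm C_AbsRing (prod_NormedModule C_AbsRing C_NormedModule C_NormedModule) (h, l)) in *.
    assert (Cmod h * Cmod (A (x, y)) <= N * Cmod (A (x, y)))%R by (apply Rmult_le_compat_r; [apply Cmod_ge_0|exact N1]).
    assert (Cmod l * Cmod (B (x, y)) <= N * Cmod (B (x, y)))%R by (apply Rmult_le_compat_r; [apply Cmod_ge_0|exact N2]).
    assert (0 <= N)%R by (eapply Rle_trans; [exact Q1|exact N1]).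
    lra.
- intros p Hp eps.
  assert (p = (x, y)) as ->.
  { symmetry. exact (@is_filter_lim_locally_unique C_AbsRing (prod_NormedModule C_AbsRing C_NormedModule C_NormedModule) (x, y) p Hp). }
  assert (He := cond_pos eps).
  assert (HA' := proj1 (Clim_iff (F := @locally C2 (x, y)) A _) HA (eps / 2)%R ltac:(lra)).
  assert (HB' := proj1 (Clim_iff (F := @locally C2 (x, y)) B _) HB (eps / 2)%R ltac:(lra)).
  generalize (filter_and _ _ HV (filter_and _ _ HA' HB')).
  apply filter_imp. intros [x' y'] [E [H1 H2]]. simpl fst in *. simpl snd in *.
  change (Cmod (V (x', y') - V (x, y) - ((x' - x) * A (x, y) + (y' - y) * B (x, y))) <=
    eps * @norm C_AbsRing (prod_NormedModule C_AbsRing C_NormedModule C_NormedModule) (x' - x, y' - y)%C)%R.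
  rewrite E.
  replace (V (x, y) + (x' - x) * A (x', y') + (y' - y) * B (x', y') - V (x, y) - ((x' - x) * A (x, y) + (y' - y) * B (x, y)))
    with ((A (x', y') - A (x, y)) * (x' - x) + (B (x', y') - B (x, y)) * (y' - y)) by ring.
  eapply Rle_trans; [apply Cmod_triangle|]. rewrite !Cmod_mult.
  set (N := @norm C_AbsRing (prod_NormedModule C_AbsRing C_NormedModule C_NormedModule) (x' - x, y' - y)).
  assert (N1 : (Cmod (x' - x) <= N)%R) by exact (norm_C2_fst (x' - x) (y' - y)).
  assert (N2 : (Cmod (y' - y) <= N)%R) by exact (norm_C2_snd (x' - x) (y' - y)).
  assert (P1 := Cmod_ge_0 (x' - x)). assert (P2 := Cmod_ge_0 (y' - y)).
  assert (P3 := Cmod_ge_0 (A (x', y') - A (x, y))). assert (P4 := Cmod_ge_0 (B (x', y') - B (x, y))).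
  assert (Cmod (A (x', y') - A (x, y)) * Cmod (x' - x) <= eps / 2 * N)%R by (apply Rmult_le_compat; lra).
  assert (Cmod (B (x', y') - B (x, y)) * Cmod (y' - y) <= eps / 2 * N)%R by (apply Rmult_le_compat; lra).
  lra.
Qed.

Lemma C2diff_cont (V : C * C -> C) (p : C * C) : C2diff V p -> C2cont V p.
Proof.
intros H.
apply (@filterdiff_continuous C_AbsRing (prod_NormedModule C_AbsRing C_NormedModule C_NormedModule) C_NormedModule). exact H.
Qed.

Lemma C2_pair_lim {T : Type} {F : (T -> Prop) -> Prop} {FF : Filter F} (f g : T -> C) (x y : C) :
  Clim f F x -> Clim g F y -> filterlim (fun t => (f t, g t)) F (@locally C2 (x, y)).
Proof.
intros Hf Hg. apply filterlim_locally. intros eps.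
generalize (proj1 (filterlim_locally (U := C_UniformSpace) f x) Hf eps).
generalize (proj1 (filterlim_locally (U := C_UniformSpace) g y) Hg eps).
intros H1 H2. generalize (filter_and _ _ H1 H2). apply filter_imp. intros t [Ha Hb]. now split.
Qed.

Lemma C2diff_partials (V : C * C -> C) (x y : C) : C2diff V (x, y) ->
  Cdiff (fun x' => V (x', y)) x /\ Cdiff (fun y' => V (x, y')) y.
Proof.
intros [l [Hl H]]. specialize (H (x, y) (fun P HP => HP)).
assert (Hlin : forall h u v, l (h * u, h * v) = h * l (u, v)).
{ intros h u v. exact (linear_scal l Hl h (u, v)). }
assert (Hnorm : forall h u v, (Cmod u <= 1)%R -> (Cmod v <= 1)%R ->
  (@norm C_AbsRing (prod_NormedModule C_AbsRing C_NormedModule C_NormedModule) (h * u, h * v)%C <= 2 * Cmod h)%R).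
{ intros h u v Hu Hv. eapply Rle_trans; [apply norm_prod|]. rewrite !Cnorm_Cmod, !Cmod_mult.
  assert (P := Cmod_ge_0 h). assert (Hs : (sqrt 2 <= 2)%R).
  { rewrite <- (sqrt_square 2) at 2 by lra. apply sqrt_le_1_alt. lra. }
  assert (Hs0 := sqrt_pos 2).
  apply Rmult_le_compat; [easy| |easy|].
  - eapply Rle_trans; [|apply Rmax_l]. apply Rmult_le_pos; [easy|apply Cmod_ge_0].
  - apply Rmax_lub; nra. }
assert (Key : forall u v, (Cmod u <= 1)%R -> (Cmod v <= 1)%R -> forall t0 eps, (0 < eps)%R ->
  @locally C_UniformSpace t0 (fun t => (Cmod (V (x + (t - t0) * u, y + (t - t0) * v)%C - V (x, y) - (t - t0) * l (u, v)) <= eps * Cmod (t - t0))%R)).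
{ intros u v Hu Hv t0 eps He. assert (He2 : (0 < eps / 2)%R) by lra.
  specialize (H (mkposreal _ He2)). simpl in H.
  assert (L : filterlim (fun t => (x + (t - t0) * u, y + (t - t0) * v)) (@locally C_UniformSpace t0) (@locally C2 (x, y))).
  { replace (x, y) with (x + (t0 - t0) * u, y + (t0 - t0) * v) by (f_equal; ring).
    apply C2_pair_lim; (apply Clim_plus; [apply Clim_const|]; apply Clim_mult; [|apply Clim_const];
      apply Clim_minus; [apply Ccont_id|apply Clim_const]). }
  generalize (L _ H). unfold filtermap. apply filter_imp. intros t Ht.
  change (Cmod (V (x + (t - t0) * u, y + (t - t0) * v)%C - V (x, y) - l (x + (t - t0) * u - x, y + (t - t0) * v - y)%C) <=
    eps / 2 * @norm C_AbsRing (prod_NormedModule C_AbsRing C_NormedModule C_NormedModule) (x + (t - t0) * u - x, y + (t - t0) * v - y)%C)%R in Ht.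
  replace (x + (t - t0) * u - x) with ((t - t0) * u) in Ht by ring.
  replace (y + (t - t0) * v - y) with ((t - t0) * v) in Ht by ring.
  rewrite Hlin in Ht. specialize (Hnorm (t - t0) u v Hu Hv). nra. }
assert (M0 : (Cmod 0 <= 1)%R) by (rewrite Cmod_0; lra). assert (M1 : (Cmod 1 <= 1)%R) by (rewrite Cmod_1; lra).
assert (E1 : forall u t : C, u + (t - u) * 1 = t) by (intros; ring).
assert (E0 : forall u t v : C, u + (t - v) * 0 = u) by (intros; ring).
split.
- apply (Cdiff_eps _ x (l (RtoC 1, RtoC 0))). intros eps He. generalize (Key 1 0 M1 M0 x eps He).
  apply filter_imp. intros t Ht. rewrite E1, E0 in Ht. exact Ht.
- apply (Cdiff_eps _ y (l (RtoC 0, RtoC 1))). intros eps He. generalize (Key 0 1 M0 M1 y eps He).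
  apply filter_imp. intros t Ht. rewrite E1, E0 in Ht. exact Ht.
Qed.

(** Both increments V(x', y') - V(x, y') and V(x, y') - V(x, y) are products with
Cauchy slopes, which are continuous because V is. *)
Lemma Osgood (V : C * C -> C) (x0 y0 : C) (r : R) : (0 < r)%R ->
  (forall x y, (Cmod (x - x0) <= r)%R -> (Cmod (y - y0) <= r)%R ->
     C2cont V (x, y) /\ Cdiff (fun x' => V (x', y)) x /\ Cdiff (fun y' => V (x, y')) y) ->
  C2diff V (x0, y0).
Proof.
intros Hr H.
assert (H00 : (Cmod (x0 - x0) <= r)%R /\ (Cmod (y0 - y0) <= r)%R).
{ replace (x0 - x0) with (RtoC 0) by ring. replace (y0 - y0) with (RtoC 0) by ring. rewrite Cmod_0. lra. }
assert (Hr1 : forall y, (Cmod (y - y0) <= r)%R -> cauchy_repr (fun x => V (x, y)) x0 r).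
{ intros y Hy. apply cauchy_repr_disc; [easy| |].
  - intros x Hx. now apply Cdiff_cont, (H x y).
  - intros x Hx _. now apply (H x y). }
assert (Hr2 : cauchy_repr (fun y => V (x0, y)) y0 r).
{ apply cauchy_repr_disc; [easy| |].
  - intros y Hy. now apply Cdiff_cont, (H x0 y).
  - intros y Hy _. now apply (H x0 y). }
set (E := fun p : C2 => (Cmod (fst p - x0) < r)%R /\ (Cmod (snd p - y0) < r)%R).
assert (HE : @locally C2 (x0, y0) E).
{ assert (K : forall c, @locally C_UniformSpace c (fun w => (Cmod (w - c) < r)%R)).
  { intro c. apply locally_disc. replace (c - c) with (RtoC 0) by ring. now rewrite Cmod_0. }
  destruct (K x0) as [e1 H1], (K y0) as [e2 H2].
  assert (He : (0 < Rmin e1 e2)%R) by (apply Rmin_pos; apply cond_pos).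
  exists (mkposreal _ He). intros [x y] [Hx Hy]. split.
  - apply H1. eapply ball_le; [|exact Hx]. apply Rmin_l.
  - apply H2. eapply ball_le; [|exact Hy]. apply Rmin_r. }
assert (HE0 : E (x0, y0)) by (apply (locally_singleton (T := C2) _ _ HE)).
apply (C2diff_slopes V (fun p => cauchy_slope (fun x => V (x, snd p)) x0 r x0 (fst p))
  (fun p => cauchy_slope (fun y => V (x0, y)) y0 r y0 (snd p))).
- apply (filterlim_within_nbhd (T := C2) (U := C_UniformSpace) E); [exact HE|].
  apply (cauchy_slope_lim (T := C2) E (x0, y0) (fun p x => V (x, snd p)) x0 r x0 fst); try easy.
  + apply (proj1 HE0).
  + now intros p [Hp _].
  + apply filterlim_within. apply continuous_fst.
  + intros [x y] [_ Hp]. apply (Hr1 y). left. exact Hp.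
  + intros t Ht.
    apply (filterlim_comp _ _ _ (fun p : C2 * R => (x0 + circ r (snd p), snd (fst p))) V _ (@locally C2 (x0 + circ r t, y0))).
    * apply C2_pair_lim.
      -- apply Clim_plus; [apply Clim_const|]. eapply filterlim_comp; [apply filterlim_snd|apply circ_cont].
      -- eapply filterlim_comp; [apply (filterlim_prod_fst (T := C2) (U := R_UniformSpace))|apply continuous_snd].
    * apply H; [|lra]. replace (x0 + circ r t - x0) with (circ r t) by ring. rewrite Cmod_circ; lra.
- apply (continuous_comp (U := C2) (V := C_UniformSpace) (W := C_UniformSpace) snd (cauchy_slope (fun y => V (x0, y)) y0 r y0)); [apply continuous_snd|].
  apply (filterlim_within_nbhd (T := C_UniformSpace) (U := C_UniformSpace) (fun w => (Cmod (w - y0) < r)%R) y0).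
  { apply locally_disc. apply (proj2 HE0). }
  apply (cauchy_slope_lim (T := C_UniformSpace) (fun w => (Cmod (w - y0) < r)%R) y0 (fun _ y => V (x0, y)) y0 r y0 (fun w => w)); try easy.
  + apply (proj2 HE0).
  + apply (proj2 HE0).
  + apply filterlim_within. apply Ccont_id.
  + intros w _. exact (proj1 Hr2).
  + intros t Ht. apply (filterlim_comp _ _ _ snd (fun t => V (x0, y0 + circ r t)) _ (locally t) _); [apply filterlim_snd|].
    now apply (proj1 Hr2).
- revert HE. apply filter_imp. intros [x y] [Hx Hy]. simpl fst in *. simpl snd in *.
  assert (E1 := cauchy_slopeE (fun x => V (x, y)) x0 r x0 x (Hr1 y ltac:(lra)) (proj1 HE0) Hx).
  assert (E2 := cauchy_slopeE (fun y => V (x0, y)) y0 r y0 y Hr2 (proj2 HE0) Hy).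
  change (V (x, y) = V (x0, y) + (x - x0) * cauchy_slope (fun x => V (x, y)) x0 r x0 x) in E1.
  change (V (x0, y) = V (x0, y0) + (y - y0) * cauchy_slope (fun y => V (x0, y)) y0 r y0 y) in E2.
  change (V (x, y) = V (x0, y0) + (x - x0) * cauchy_slope (fun x => V (x, y)) x0 r x0 x +
    (y - y0) * cauchy_slope (fun y => V (x0, y)) y0 r y0 y).
  rewrite E1, E2 at 1. ring.
Qed.

(** * The complex sine *)

Definition Ccos (z : C) : C := Csin (z + RtoC (PI / 2)).

Lemma Ci_neq_0 : Ci <> 0.
Proof. intro E. injection E. lra. Qed.

Lemma Ci2 : Ci * Ci = - (1).
Proof. apply injective_projections; simpl; ring. Qed.

Lemma Cexp_neq_0 (z : C) : Cexp z <> 0.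
Proof. intro E. assert (K := Cmod_Cexp z). rewrite E, Cmod_0 in K. assert (P := exp_pos (Re z)). lra. Qed.

Lemma Cexp_opp (z : C) : Cexp (- z) = / Cexp z.
Proof.
assert (N := Cexp_neq_0 z). assert (E : Cexp (- z) * Cexp z = 1).
{ rewrite <- Cexp_plus. replace (- z + z) with (RtoC 0) by ring. apply Cexp_0. }
replace (Cexp (- z)) with (Cexp (- z) * Cexp z / Cexp z) by (field; easy). rewrite E. field. easy.
Qed.

Lemma Csin_Cexp (z : C) : Csin z = (Cexp (Ci * z) - / Cexp (Ci * z)) / (2 * Ci).
Proof.
rewrite <- Cexp_opp.
assert (E : 2 * Ci * Csin z = Cexp (Ci * z) - Cexp (- (Ci * z))).
{ destruct z as [x y]. unfold Csin, Cexp, cosh, sinh. simpl.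
  replace (0 * x - 1 * y)%R with (- y)%R by ring. replace (0 * y + 1 * x)%R with x by ring.
  rewrite !Ropp_involutive, cos_neg, sin_neg. apply injective_projections; simpl; field. }
rewrite <- E. field. exact Ci_neq_0.
Qed.

Lemma Cexp_Ci_PI2 : Cexp (Ci * RtoC (PI / 2)) = Ci.
Proof.
unfold Cexp; simpl. replace (0 * (PI / 2) - 1 * 0)%R with 0%R by ring.
replace (0 * 0 + 1 * (PI / 2))%R with (PI / 2)%R by ring.
rewrite exp_0, cos_PI2, sin_PI2. apply injective_projections; simpl; ring.
Qed.

Lemma two_neq_0 : RtoC 2 <> 0.
Proof. intro E. apply RtoC_inj in E. lra. Qed.

Lemma Ccos_Cexp (z : C) : Ccos z = (Cexp (Ci * z) + / Cexp (Ci * z)) / 2.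
Proof.
unfold Ccos. rewrite Csin_Cexp. replace (Ci * (z + RtoC (PI / 2))) with (Ci * z + Ci * RtoC (PI / 2)) by ring.
rewrite Cexp_plus, Cexp_Ci_PI2. assert (N := Cexp_neq_0 (Ci * z)). assert (N2 := Ci_neq_0). assert (N3 := two_neq_0).
set (E := Cexp (Ci * z)) in *.
replace ((E * Ci - / (E * Ci)) / (2 * Ci)) with ((E - / E / (Ci * Ci)) / 2) by (field; repeat split; assumption).
rewrite Ci2. field. repeat split; try assumption. all: intro K; injection K; lra.
Qed.

Lemma Cdiff_Csin (z : C) : Cdiff Csin z.
Proof.
apply (Cdiff_ext (fun z => (Cexp (Ci * z) - / Cexp (Ci * z)) / (2 * Ci))).
- intro w. symmetry. apply Csin_Cexp.
- assert (H : Cdiff (fun z => Cexp (Ci * z)) z).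
  { apply (Cdiff_comp (fun z => Ci * z) Cexp); [apply Cdiff_Cexp|]. apply Cdiff_mult; [apply Cdiff_const|apply Cdiff_id]. }
  apply Cdiff_mult; [|apply Cdiff_const]. apply Cdiff_minus; [exact H|].
  apply Cdiff_inv; [apply Cexp_neq_0|exact H].
Qed.

Lemma Csin_opp (z : C) : Csin (- z) = - Csin z.
Proof. destruct z as [x y]. unfold Csin; simpl. rewrite sin_neg, cos_neg. unfold cosh, sinh. rewrite Ropp_involutive.
  apply injective_projections; simpl; field. Qed.

Lemma Csin_PI_minus (z : C) : Csin (RtoC PI - z) = Csin z.
Proof.
destruct z as [x y]. unfold Csin; simpl. replace (PI + - x)%R with (PI - x)%R by ring.
rewrite sin_PI_x, cos_minus, cos_PI, sin_PI. unfold cosh, sinh.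
replace (0 + - y)%R with (- y)%R by ring. rewrite Ropp_involutive.
apply injective_projections; simpl; field.
Qed.

Lemma Csin2_Ccos2 (z : C) : Csin z * Csin z + Ccos z * Ccos z = 1.
Proof.
rewrite Csin_Cexp, Ccos_Cexp. assert (N := Cexp_neq_0 (Ci * z)). set (E := Cexp (Ci * z)) in *.
assert (N2 := Ci_neq_0). assert (N3 := two_neq_0).
replace ((E - / E) / (2 * Ci) * ((E - / E) / (2 * Ci))) with ((E - / E) * (E - / E) / (4 * (Ci * Ci))).
2: { field. repeat split; try assumption. }
rewrite Ci2. field. repeat split; try assumption. all: intro K; injection K; lra.
Qed.

(** The zeros of the radicand of 1 / K are visible in this product. *)
Lemma Ccos_Ccos (x y : C) : Ccos (x + y) * Ccos (x - y) = 1 - Csin x * Csin x - Csin y * Csin y.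
Proof.
rewrite !Csin_Cexp, !Ccos_Cexp.
replace (Ci * (x + y)) with (Ci * x + Ci * y) by ring. replace (Ci * (x - y)) with (Ci * x + - (Ci * y)) by ring.
rewrite !Cexp_plus, Cexp_opp.
assert (N := Cexp_neq_0 (Ci * x)). assert (N' := Cexp_neq_0 (Ci * y)).
set (E := Cexp (Ci * x)) in *. set (F := Cexp (Ci * y)) in *.
assert (N2 := Ci_neq_0). assert (N3 := two_neq_0).
replace ((E - / E) / (2 * Ci) * ((E - / E) / (2 * Ci))) with ((E - / E) * (E - / E) / (4 * (Ci * Ci))).
2: { field. repeat split; try assumption. }
replace ((F - / F) / (2 * Ci) * ((F - / F) / (2 * Ci))) with ((F - / F) * (F - / F) / (4 * (Ci * Ci))).
2: { field. repeat split; try assumption. }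
rewrite Ci2. field. repeat split; try assumption. all: intro K; injection K; lra.
Qed.

(** On the domain of U three of the four half-angle factors of cos (x + y) cos (x - y)
avoid the cut of the square root, and the fourth does so after division by its argument. *)
Lemma Ccos_half (w : C) :
  Ccos w = 2 * Csin (RtoC (PI / 4) - w / 2) * Csin (RtoC (PI / 4) + w / 2).
Proof.
assert (N3 := two_neq_0).
rewrite !Csin_Cexp, !Ccos_Cexp.
replace (Ci * (RtoC (PI / 4) - w / 2)) with (Ci * RtoC (PI / 4) + - (Ci * (w / 2))) by ring.
replace (Ci * (RtoC (PI / 4) + w / 2)) with (Ci * RtoC (PI / 4) + Ci * (w / 2)) by ring.
replace (Ci * w) with (Ci * (w / 2) + Ci * (w / 2)) by (field; easy).
rewrite !Cexp_plus, Cexp_opp.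
assert (E0 : Cexp (Ci * RtoC (PI / 4)) * Cexp (Ci * RtoC (PI / 4)) = Ci).
{ rewrite <- Cexp_plus, <- Cmult_plus_distr_l, <- RtoC_plus.
  replace (PI / 4 + PI / 4)%R with (PI / 2)%R by field. apply Cexp_Ci_PI2. }
assert (N := Cexp_neq_0 (Ci * RtoC (PI / 4))). assert (N' := Cexp_neq_0 (Ci * (w / 2))).
set (E := Cexp (Ci * RtoC (PI / 4))) in *. set (F := Cexp (Ci * (w / 2))) in *.
rewrite <- E0.
field_simplify_eq; [|repeat split; assumption].
assert (E4 : E ^ 4 = - (1)). { simpl. rewrite <- Ci2, <- E0. ring. }
replace (E ^ 6) with (E ^ 4 * E ^ 2) by (simpl; ring). rewrite E4. ring.
Qed.

Lemma Cdiff_Ccos (z : C) : Cdiff Ccos z.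
Proof.
apply (Cdiff_comp (fun z => z + RtoC (PI / 2)) Csin); [apply Cdiff_Csin|].
apply Cdiff_plus; [apply Cdiff_id|apply Cdiff_const].
Qed.

(** * The principal square root *)

(** The domain of the principal square root. *)
Definition slit (z : C) : Prop := Im z = 0%R -> (0 < Re z)%R.

(** The direction halfway between those of z and of |z|, rescaled; unlike the polar form
this expression is manifestly continuous. *)
Definition csqrt (z : C) : C := (z + RtoC (Cmod z)) / RtoC (sqrt (2 * (Cmod z + Re z))).

Lemma Cmod2 (z : C) : (Cmod z * Cmod z = Re z * Re z + Im z * Im z)%R.
Proof.
unfold Cmod. rewrite sqrt_sqrt; [simpl; unfold Re, Im; ring|].
assert (H1 := pow2_ge_0 (fst z)). assert (H2 := pow2_ge_0 (snd z)). lra.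
Qed.

Lemma slit_pos (z : C) : slit z <-> (0 < Cmod z + Re z)%R.
Proof.
assert (K := Cmod2 z). assert (K0 := Cmod_ge_0 z). unfold slit. split.
- intros H. destruct (Req_dec (Im z) 0) as [E|E]; [specialize (H E); lra|].
  destruct (Rle_dec (Cmod z + Re z) 0) as [Hn|Hn]; [exfalso|lra].
  assert (0 < Im z * Im z)%R by (destruct (Rtotal_order (Im z) 0) as [?|[?|?]]; nra). nra.
- intros H E. rewrite E in K. destruct (Rle_dec (Re z) 0) as [Hn|Hn]; [exfalso|lra].
  assert (Hle : (Cmod z = - Re z)%R) by nra. lra.
Qed.

Lemma slit_neq_0 (z : C) : slit z -> z <> 0.
Proof. intros H ->. specialize (H eq_refl). simpl in H. lra. Qed.

Lemma csqrt_sqr (z : C) : slit z -> csqrt z * csqrt z = z.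
Proof.
intros H. apply slit_pos in H. unfold csqrt.
assert (Hs : (0 < sqrt (2 * (Cmod z + Re z)))%R) by (apply sqrt_lt_R0; lra).
assert (Hn : RtoC (sqrt (2 * (Cmod z + Re z))) <> 0) by (intro E; apply RtoC_inj in E; lra).
assert (E : RtoC (sqrt (2 * (Cmod z + Re z))) * RtoC (sqrt (2 * (Cmod z + Re z))) = RtoC (2 * (Cmod z + Re z))).
{ rewrite <- RtoC_mult, sqrt_sqrt by lra. easy. }
assert (Hn2 : RtoC (2 * (Cmod z + Re z)) <> 0) by (intro E0; apply RtoC_inj in E0; lra).
assert (E2 : (z + RtoC (Cmod z)) * (z + RtoC (Cmod z)) = z * RtoC (2 * (Cmod z + Re z))).
{ assert (K := Cmod2 z). destruct z as [x y]. set (m := Cmod (x, y)) in *. clearbody m. simpl in K.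
  apply injective_projections; simpl; nra. }
replace ((z + RtoC (Cmod z)) / RtoC (sqrt (2 * (Cmod z + Re z))) * ((z + RtoC (Cmod z)) / RtoC (sqrt (2 * (Cmod z + Re z)))))
  with ((z + RtoC (Cmod z)) * (z + RtoC (Cmod z)) / (RtoC (sqrt (2 * (Cmod z + Re z))) * RtoC (sqrt (2 * (Cmod z + Re z))))) by (field; easy).
rewrite E, E2. field. easy.
Qed.

Lemma csqrt_neq_0 (z : C) : slit z -> csqrt z <> 0.
Proof. intros H E. apply (slit_neq_0 z H). rewrite <- (csqrt_sqr z H), E. ring. Qed.

Lemma csqrt_pos (x : R) : (0 < x)%R -> csqrt (RtoC x) = RtoC (sqrt x).
Proof.
intros Hx. unfold csqrt. rewrite Cmod_R, Rabs_right by lra. simpl.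
replace (2 * (x + x))%R with (2 * 2 * x)%R by ring. rewrite sqrt_mult, sqrt_square by lra.
assert (Hs := sqrt_lt_R0 x Hx). rewrite <- RtoC_plus, <- RtoC_div by lra. f_equal.
replace (x + x)%R with (2 * (sqrt x * sqrt x))%R by (rewrite sqrt_sqrt; lra). field. lra.
Qed.

Lemma csqrt_cont (z : C) : slit z -> Ccont csqrt z.
Proof.
intros H. apply slit_pos in H.
assert (Hs : (0 < sqrt (2 * (Cmod z + Re z)))%R) by (apply sqrt_lt_R0; lra).
assert (Hm := Clim_Cmod (F := @locally C_UniformSpace z) (fun w => w) z (Ccont_id z)).
apply Clim_div.
- intro E; apply RtoC_inj in E; lra.
- apply Clim_plus; [apply Ccont_id|]. now apply Clim_RtoC.
- apply Clim_RtoC. apply (Rlim_comp sqrt); [apply continuous_sqrt|].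
  apply Rlim_mult; [apply filterlim_const|]. apply Rlim_plus; [exact Hm|].
  exact (Clim_Re (F := @locally C_UniformSpace z) (fun w => w) z (Ccont_id z)).
Qed.

Lemma slit_open {T : UniformSpace} (f : T -> C) (x : T) :
  @continuous T C_UniformSpace f x -> slit (f x) -> locally x (fun y => slit (f y)).
Proof.
intros Hf H. apply slit_pos in H.
assert (L : filterlim (fun y => (Cmod (f y) + Re (f y))%R) (locally x) (locally (Cmod (f x) + Re (f x))%R)).
{ apply Rlim_plus; [now apply Clim_Cmod|now apply Clim_Re]. }
generalize (L _ (open_gt 0%R _ H)). unfold filtermap. apply filter_imp. intros y Hy. now apply slit_pos.
Qed.

Lemma csqrt_lim {T : UniformSpace} (f : T -> C) (x : T) :
  @continuous T C_UniformSpace f x -> slit (f x) -> @continuous T C_UniformSpace (fun y => csqrt (f y)) x.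
Proof. intros Hf H. apply (Clim_comp csqrt f); [now apply csqrt_cont|exact Hf]. Qed.

(** * Values of sin z and of sin z / z off the negative half-line *)

Lemma cosh_pos (y : R) : (0 < cosh y)%R.
Proof. unfold cosh. assert (H1 := exp_pos y). assert (H2 := exp_pos (- y)). lra. Qed.

Lemma sinh_pos (y : R) : (0 < y)%R -> (0 < sinh y)%R.
Proof. intros H. unfold sinh. assert (K : (exp (- y) < exp y)%R) by (apply exp_increasing; lra). lra. Qed.

Lemma sinh_neg (y : R) : (y < 0)%R -> (sinh y < 0)%R.
Proof. intros H. unfold sinh. assert (K : (exp y < exp (- y))%R) by (apply exp_increasing; lra). lra. Qed.

(** sin (x + i y) is real only if y = 0 or cos x = 0; in the latter case it is cosh y for
x = pi/2, the only such abscissa in the range. *)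
Lemma slit_Csin (z : C) : (- (PI / 2) < Re z < 3 * PI / 2)%R -> (Im z = 0%R -> (0 < Re z < PI)%R) -> slit (Csin z).
Proof.
destruct z as [x y]. simpl. intros Hx Hy E. simpl in *. assert (Hc := cosh_pos y).
destruct (Req_dec y 0) as [H0|H0].
- apply Rmult_lt_0_compat; [|easy]. apply sin_gt_0; apply Hy; exact H0.
- assert (Hs : sinh y <> 0%R).
  { destruct (Rtotal_order y 0) as [K|[K|K]]; [apply sinh_neg in K|easy|apply sinh_pos in K]; lra. }
  apply Rmult_integral in E. destruct E as [E|E]; [|easy].
  assert (Hx2 : x = (PI / 2)%R).
  { destruct (Rtotal_order x (PI / 2)) as [K|[K|K]]; [|easy|].
    - assert (0 < cos x)%R by (apply cos_gt_0; lra). lra.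
    - assert (cos x < 0)%R by (apply cos_lt_0; lra). lra. }
  rewrite Hx2, sin_PI2. lra.
Qed.

Definition sinc (z : C) : C := if Ceq_dec z 0 then RtoC 1 else Csin z / z.

Lemma sincE (z : C) : sinc z * z = Csin z.
Proof.
unfold sinc. destruct (Ceq_dec z 0) as [->|H]; [|field; easy].
unfold Csin; simpl. unfold sinh. rewrite sin_0, Ropp_0. apply injective_projections; simpl; field.
Qed.

(** If sin z = t z with real t and 0 < |Re z| < pi, the real parts give t > 0; on the
imaginary axis the imaginary parts do. *)
Lemma slit_sinc (z : C) : (Rabs (Re z) < PI)%R -> slit (sinc z).
Proof.
intros H E. assert (K := sincE z).
unfold sinc in *. destruct (Ceq_dec z 0) as [H0|H0]; [simpl; lra|].
set (s := Csin z / z) in *. clearbody s. destruct s as [t t']. destruct z as [x y]. simpl in E. subst t'.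
unfold Csin in K. simpl in K. injection K as K1 K2. simpl in *.
assert (Hc := cosh_pos y). apply Rabs_def2 in H.
destruct (Rtotal_order x 0) as [Hx|[Hx|Hx]].
- assert (sin x < 0)%R by (apply sin_lt_0_var; lra). nra.
- subst x. rewrite cos_0 in K2.
  destruct (Rtotal_order y 0) as [Hy|[Hy|Hy]].
  + apply sinh_neg in Hy as Hs. nra.
  + subst y. now elim H0.
  + apply sinh_pos in Hy as Hs. nra.
- assert (0 < sin x)%R by (apply sin_gt_0; lra). nra.
Qed.

Lemma sinc_cont_0 : Ccont sinc (RtoC 0).
Proof.
apply (Clim_iff (F := @locally C_UniformSpace (RtoC 0))). intros eps He.
destruct (Cexp_derive_0 (eps / 2)%R ltac:(lra)) as [d [Hd H]].
apply locally_C_iff. exists d. split; [easy|]. intros z Hz.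
replace (z - 0) with z in Hz by ring.
unfold sinc. destruct (Ceq_dec 0 0) as [_|n]; [|now elim n].
destruct (Ceq_dec z 0) as [E|E].
- replace (RtoC 1 - 1) with (RtoC 0) by ring. now rewrite Cmod_0.
- assert (N2 := Ci_neq_0). assert (N3 := two_neq_0).
  assert (H1 := H (Ci * z)). assert (H2 := H (- (Ci * z))).
  rewrite Cmod_opp in H2. rewrite Cmod_mult, Cmod_Ci, Rmult_1_l in H1, H2.
  specialize (H1 Hz). specialize (H2 Hz).
  replace (Csin z / z - 1) with (((Cexp (Ci * z) - 1 - Ci * z) - (Cexp (- (Ci * z)) - 1 - - (Ci * z))) / (2 * Ci * z)).
  2: { rewrite Csin_Cexp, Cexp_opp. field. repeat split; try assumption. apply Cexp_neq_0. }
  rewrite Cmod_div by (repeat apply Cmult_neq_0; assumption).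
  rewrite !Cmod_mult, Cmod_Ci, Cmod_R, Rabs_right, Rmult_1_r by lra.
  assert (T := Cmod_triangle (Cexp (Ci * z) - 1 - Ci * z) (- (Cexp (- (Ci * z)) - 1 - - (Ci * z)))).
  rewrite Cmod_opp in T. apply Cmod_gt_0 in E.
  fold ((Cexp (Ci * z) - 1 - Ci * z) - (Cexp (- (Ci * z)) - 1 - - (Ci * z))) in T.
  apply Rlt_div_l; [lra|].
  apply Rle_lt_trans with (eps * Cmod z)%R; [unfold Cminus in *; lra|]. nra.
Qed.

(** The origin lies on a line off which the function is holomorphic, and it is
continuous there, so that the singularity is removable. *)
Lemma Cdiff_sinc (z : C) : Cdiff sinc z.
Proof.
assert (Hd : forall z : C, z <> 0 -> Cdiff sinc z).
{ clear z. intros z Hz. apply (Cdiff_ext_loc (fun z => Csin z / z)).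
  - apply locally_C_iff. exists (Cmod z). apply Cmod_gt_0 in Hz as Hz'. split; [easy|].
    intros w Hw. unfold sinc. destruct (Ceq_dec w 0) as [E|E]; [|easy].
    rewrite E in Hw. replace (0 - z) with (- z) in Hw by ring. rewrite Cmod_opp in Hw. lra.
  - apply Cdiff_div; [easy|apply Cdiff_Csin|apply Cdiff_id]. }
destruct (Ceq_dec z 0) as [->|Hz]; [|now apply Hd].
apply (Cdiff_line sinc 0 1); [lra| |].
- intros w _. destruct (Ceq_dec w 0) as [->|Hw]; [apply sinc_cont_0|]. now apply Cdiff_cont, Hd.
- intros w _ Hw. apply Hd. intros ->. now apply Hw.
Qed.

(** * Square roots along paths *)

Definition unit_seg (t : R) : Prop := (0 <= t <= 1)%R.

Lemma unit_seg_clamp (t : R) : unit_seg (Rmax 0 (Rmin 1 t)).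
Proof. unfold unit_seg. split; [apply Rmax_l|]. apply Rmax_lub; [lra|apply Rmin_l]. Qed.

Lemma clamp_continuous (f : R -> R) :
  @continuous_on R_UniformSpace R_UniformSpace unit_seg f ->
  continuity (fun t => f (Rmax 0 (Rmin 1 t))).
Proof.
intros H t. apply continuity_pt_filterlim.
set (cl := fun t => Rmax 0 (Rmin 1 t)).
apply (filterlim_comp _ _ _ cl f _ (within unit_seg (locally (cl t))) _); [|apply H, unit_seg_clamp].
assert (Hcl : forall s, (Rabs (cl s - cl t) <= Rabs (s - t))%R).
{ intros s. unfold cl, Rmax, Rmin. repeat destruct (Rle_dec _ _); unfold Rabs; repeat destruct (Rcase_abs _); lra. }
intros P [e HP]. exists e. intros s Hs. apply HP; [|apply unit_seg_clamp].
change (Rabs (cl s - cl t) < e)%R. change (Rabs (s - t) < e)%R in Hs. specialize (Hcl s). lra.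
Qed.

Lemma Cmult_integral (z w : C) : z * w = 0 -> z = 0 \/ w = 0.
Proof.
intros H. destruct (Ceq_dec z 0) as [|Hz]; [now left|right].
replace w with (z * w / z) by (field; easy). rewrite H. field. easy.
Qed.

(** By continuity the real part cannot jump from 1 to -1. *)
Lemma path_sign (rho : R -> C) :
  @continuous_on R_UniformSpace C_UniformSpace unit_seg rho ->
  (forall t, unit_seg t -> rho t * rho t = 1) -> rho 0%R = 1 -> rho 1%R = 1.
Proof.
intros Hc Hs H0.
assert (Hpm : forall t, unit_seg t -> rho t = 1 \/ rho t = - (1)).
{ intros t Ht. specialize (Hs t Ht).
  assert (E : (rho t - 1) * (rho t + 1) = 0) by (replace ((rho t - 1) * (rho t + 1)) with (rho t * rho t - 1) by ring; rewrite Hs; ring).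
  apply Cmult_integral in E. destruct E as [E|E]; [left|right]; apply Cminus_eq; rewrite <- E; ring. }
destruct (Hpm 1%R) as [E|E]; [unfold unit_seg; lra|easy|exfalso].
set (f := fun t => Re (rho (Rmax 0 (Rmin 1 t)))).
assert (Hf : continuity f).
{ apply (clamp_continuous (fun t => Re (rho t))). intros t Ht. apply Clim_Re. now apply Hc. }
assert (F0 : f 0%R = 1%R). { unfold f. rewrite (Rmin_right 1 0), Rmax_left by lra. now rewrite H0. }
assert (F1 : f 1%R = (- 1)%R). { unfold f. rewrite (Rmin_left 1 1), Rmax_right by lra. rewrite E. simpl. ring. }
destruct (IVT_cor f 0 1 Hf ltac:(lra)) as [t [Ht Hz]]; [rewrite F0, F1; lra|].
unfold f in Hz. destruct (Hpm _ (unit_seg_clamp t)) as [E'|E']; rewrite E' in Hz; simpl in Hz; lra.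
Qed.

(** The ratio of the two roots is a continuous square root of 1. *)
Lemma path_root (p q : R -> C) :
  @continuous_on R_UniformSpace C_UniformSpace unit_seg p ->
  @continuous_on R_UniformSpace C_UniformSpace unit_seg q ->
  (forall t, unit_seg t -> p t * p t = q t * q t /\ q t <> 0) -> p 0%R = q 0%R -> p 1%R = q 1%R.
Proof.
intros Hp Hq H H0.
assert (E : p 1%R / q 1%R = 1).
{ apply (path_sign (fun t => p t / q t)).
  - intros t Ht. apply Clim_div; [now apply H|now apply Hp|now apply Hq].
  - intros t Ht. destruct (H t Ht) as [E Hn].
    replace (p t / q t * (p t / q t)) with (p t * p t / (q t * q t)) by (field; easy). rewrite E. field. easy.
  - rewrite H0. field. apply (H 0%R). unfold unit_seg; lra. }
assert (Hn : q 1%R <> 0) by (apply (H 1%R); unfold unit_seg; lra).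
replace (p 1%R) with (p 1%R / q 1%R * q 1%R) by (field; easy). rewrite E. ring.
Qed.

(** * The strips in rectified coordinates *)

(** The curve [Gamma] is the graph Re z = gcurve k (Im z). *)
Definition gcurve (k : C) (y : R) : R := (- atan (Re k / Im k * tanh y))%R.

(** All curves of the problem are level sets of this horizontal displacement from
[Gamma], and all strips are regions between such level sets. *)
Definition ucoord (k : C) (z : C) : R := (Re z - gcurve k (Im z))%R.

Definition upoint (k : C) (u y : R) : C := ((gcurve k y + u)%R, y).

Lemma ucoord_upoint (k : C) (u y : R) : ucoord k (upoint k u y) = u.
Proof. unfold ucoord, upoint. simpl. ring. Qed.

Lemma upoint_ucoord (k : C) (z : C) : upoint k (ucoord k z) (Im z) = z.
Proof. unfold ucoord, upoint. destruct z as [x y]. apply injective_projections; simpl; ring. Qed.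

Lemma gcurve_bound (k : C) (y : R) : (- (PI / 2) < gcurve k y < PI / 2)%R.
Proof. unfold gcurve. assert (K := atan_bound (Re k / Im k * tanh y)). lra. Qed.

Lemma gcurve_opp (k : C) (y : R) : gcurve k (- y) = (- gcurve k y)%R.
Proof.
unfold gcurve. assert (E : tanh (- y) = (- tanh y)%R).
{ unfold tanh, sinh, cosh. rewrite Ropp_involutive.
  assert (H1 := exp_pos y). assert (H2 := exp_pos (- y)). field. lra. }
rewrite E, Ropp_mult_distr_r_reverse, atan_opp. easy.
Qed.

Lemma gcurve_0 (k : C) : gcurve k 0 = 0%R.
Proof. assert (K := gcurve_opp k 0). rewrite Ropp_0 in K. lra. Qed.

Lemma gcurve_continuous (k : C) (y : R) : continuous (gcurve k) y.
Proof.
assert (Hc := cosh_pos y). apply (ex_derive_continuous (gcurve k)). unfold gcurve, tanh, sinh, cosh.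
auto_derive. unfold cosh in Hc. lra.
Qed.

Lemma ucoord_lim {T : Type} {F : (T -> Prop) -> Prop} {FF : Filter F} (k : C) (f : T -> C) (z : C) :
  Clim f F z -> filterlim (fun t => ucoord k (f t)) F (locally (ucoord k z)).
Proof.
intros H. apply Rlim_plus; [now apply Clim_Re|]. apply Rlim_opp.
apply (Rlim_comp (gcurve k)); [apply gcurve_continuous|now apply Clim_Im].
Qed.

Lemma upoint_lim {T : Type} {F : (T -> Prop) -> Prop} {FF : Filter F} (k : C) (f g : T -> R) (u y : R) :
  filterlim f F (locally u) -> filterlim g F (locally y) ->
  Clim (fun t => upoint k (f t) (g t)) F (upoint k u y).
Proof.
intros Hf Hg. apply Clim_pair; [|easy]. apply Rlim_plus; [|easy].
apply (Rlim_comp (gcurve k)); [apply gcurve_continuous|easy].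
Qed.

Lemma ucoord_opp (k : C) (z : C) : ucoord k (- z) = (- ucoord k z)%R.
Proof. destruct z as [x y]. unfold ucoord. simpl. rewrite gcurve_opp. ring. Qed.

Lemma ucoord_plus_R (k : C) (z : C) (r : R) : ucoord k (z + RtoC r) = (ucoord k z + r)%R.
Proof. unfold ucoord. rewrite im_plus, re_plus. simpl. rewrite Rplus_0_r. ring. Qed.

Lemma im_minus_R (z : C) (r : R) : Im (z - RtoC r) = Im z.
Proof. simpl. unfold Im. ring. Qed.

Lemma re_minus_R (z : C) (r : R) : Re (z - RtoC r) = (Re z - r)%R.
Proof. reflexivity. Qed.

Lemma ucoord_minus_R (k : C) (z : C) (r : R) : ucoord k (z - RtoC r) = (ucoord k z - r)%R.
Proof. unfold Cminus. rewrite <- RtoC_opp, ucoord_plus_R. ring. Qed.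

Lemma ucoord_R_minus (k : C) (z : C) (r : R) : ucoord k (RtoC r - z) = (r - ucoord k z)%R.
Proof. replace (RtoC r - z) with (- z + RtoC r) by ring. rewrite ucoord_plus_R, ucoord_opp. ring. Qed.

Lemma ucoord_R (k : C) (r : R) : ucoord k (RtoC r) = r.
Proof. unfold ucoord. simpl. rewrite gcurve_0. ring. Qed.

(** When x + y is real the heights of x and y are opposite, and so are the abscissae of
[Gamma] at these heights. *)
Lemma Re_plus_real (k x y : C) : Im (x + y) = 0%R -> Re (x + y) = (ucoord k x + ucoord k y)%R.
Proof.
unfold ucoord. rewrite im_plus, re_plus. intros H. replace (Im y) with (- Im x)%R by lra.
rewrite gcurve_opp. ring.
Qed.

Lemma Re_minus_real (k x y : C) : Im (x - y) = 0%R -> Re (x - y) = (ucoord k x - ucoord k y)%R.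
Proof. intros H. unfold Cminus in *. rewrite (Re_plus_real k); [|easy]. rewrite ucoord_opp. ring. Qed.

Lemma Re_bounds (k z : C) : (ucoord k z - PI / 2 < Re z < ucoord k z + PI / 2)%R.
Proof. unfold ucoord. assert (K := gcurve_bound k (Im z)). lra. Qed.

(** The vector (Im k, - Re k tanh y) is a multiple of (cos g, sin g), where g is the
abscissa of [Gamma] at height y. *)
Lemma Im_k_Csin (k z : C) : (Im k <> 0)%R ->
  Im (k * Csin z) = (Im k * cosh (Im z) / cos (gcurve k (Im z)) * sin (ucoord k z))%R.
Proof.
intros Hk. destruct z as [x y]. unfold ucoord; simpl.
assert (Hg := gcurve_bound k y). set (g := gcurve k y) in *.
assert (Hcos : (0 < cos g)%R) by (apply cos_gt_0; lra).
assert (Htan : (sin g = - (Re k / Im k * tanh y) * cos g)%R).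
{ assert (E : tan g = (- (Re k / Im k * tanh y))%R).
  { unfold g, gcurve. rewrite tan_neg, tan_atan. easy. }
  rewrite <- E. unfold tan. field. lra. }
rewrite sin_minus, Htan. assert (Hc := cosh_pos y). unfold tanh.
destruct k as [k1 k2]. simpl in *. field. repeat split; lra.
Qed.

Section Branch.

Context (k : C) (a : C -> C) (hRe : (0 < Re k)%R) (hIm : (0 < Im k)%R) (ha : angular_branch k a).

Let k_neq_0 : k <> 0.
Proof. intro E. rewrite E in hRe. simpl in hRe. lra. Qed.

Lemma Im_k_Csin_sign (z : C) : exists c, (0 < c)%R /\ Im (k * Csin z) = (c * sin (ucoord k z))%R.
Proof.
exists (Im k * cosh (Im z) / cos (gcurve k (Im z)))%R. split; [|apply Im_k_Csin; lra].
assert (Hg := gcurve_bound k (Im z)). assert (Hc := cosh_pos (Im z)).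
apply Rdiv_lt_0_compat; [now apply Rmult_lt_0_compat|apply cos_gt_0; lra].
Qed.

Lemma Im_k_Ccos_sign (z : C) : exists c, (0 < c)%R /\ Im (k * Ccos z) = (c * cos (ucoord k z))%R.
Proof.
unfold Ccos. destruct (Im_k_Csin_sign (z + RtoC (PI / 2))) as [c [Hc E]].
exists c. split; [easy|]. rewrite E, ucoord_plus_R. f_equal.
now rewrite sin_plus, cos_PI2, sin_PI2, Rmult_0_r, Rplus_0_l, Rmult_1_r.
Qed.

Lemma square_real (w : C) (xi : R) : w * w = RtoC xi * RtoC xi -> Im w = 0%R.
Proof.
intros H. assert (E : (w - RtoC xi) * (w + RtoC xi) = 0).
{ replace ((w - RtoC xi) * (w + RtoC xi)) with (w * w - RtoC xi * RtoC xi) by ring. rewrite H. ring. }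
apply Cmult_integral in E. destruct E as [E|E].
- apply Cminus_eq in E. now rewrite E.
- assert (E' : Im (w + RtoC xi) = 0%R) by now rewrite E. rewrite im_plus in E'. simpl in E'. lra.
Qed.

(** The sign of Im eta decides between the two curves. *)
Lemma cut_iff (eta : C) : h_plus k eta \/ h_minus k eta <->
  Im eta <> 0%R /\ exists xi : R, eta * eta = k * k - RtoC xi * RtoC xi.
Proof.
split.
- intros [[xi [E H]]|[xi [E H]]]; (split; [unfold Im in *; simpl in H; lra|]); exists xi.
  + replace (eta * eta) with (eta ^ 2) by (simpl; ring). rewrite E. simpl. ring.
  + replace (eta * eta) with ((- eta) ^ 2) by (simpl; ring). rewrite E. simpl. ring.
- intros [H [xi E]]. destruct (Rlt_dec 0 (Im eta)) as [Hp|Hn].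
  + left. exists xi. split; [|easy]. simpl. replace (eta * (eta * 1)) with (eta * eta) by ring. rewrite E. ring.
  + right. exists xi. split; [|unfold Im in *; simpl; lra]. simpl. replace (- eta * (- eta * 1)) with (eta * eta) by ring. rewrite E. ring.
Qed.

(** On the cuts k sin z has the square k^2 - xi^2, so that k cos z is real: this happens
only where z lies half a period away from [Gamma]. *)
Lemma Csin_not_cut (z : C) : (Rabs (ucoord k z) < PI / 2)%R ->
  ~ h_plus k (k * Csin z) /\ ~ h_minus k (k * Csin z).
Proof.
intros Hu. assert (Hn : ~ (h_plus k (k * Csin z) \/ h_minus k (k * Csin z))); [|tauto].
rewrite cut_iff. intros [_ [xi E]].
assert (E2 : k * Ccos z * (k * Ccos z) = RtoC xi * RtoC xi).
{ replace (k * Ccos z * (k * Ccos z)) with (k * k * (Csin z * Csin z + Ccos z * Ccos z) - k * Csin z * (k * Csin z)) by ring.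
  rewrite Csin2_Ccos2, E. ring. }
apply square_real in E2. destruct (Im_k_Ccos_sign z) as [c [Hc Ec]]. rewrite E2 in Ec.
apply Rabs_def2 in Hu. assert (Hp : (0 < cos (ucoord k z))%R) by (apply cos_gt_0; lra).
apply (Rmult_lt_compat_l c) in Hp; [lra|easy].
Qed.

Lemma cut_of_edge (z : C) : cos (ucoord k z) = 0%R ->
  h_plus k (k * Csin z) \/ h_minus k (k * Csin z).
Proof.
intros Hu. apply cut_iff.
destruct (Im_k_Ccos_sign z) as [c [Hc Ec]]. rewrite Hu, Rmult_0_r in Ec.
set (w := k * Ccos z) in *.
assert (Hw : w = RtoC (Re w)) by (destruct w as [w1 w2]; simpl in *; now subst).
assert (E : k * Csin z * (k * Csin z) = k * k - RtoC (Re w) * RtoC (Re w)).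
{ rewrite <- Hw. unfold w.
  replace (k * Csin z * (k * Csin z)) with (k * k * (Csin z * Csin z + Ccos z * Ccos z) - k * Ccos z * (k * Ccos z)) by ring.
  rewrite Csin2_Ccos2. ring. }
split; [|now exists (Re w)].
intros H0. set (v := k * Csin z) in *.
assert (Hv : Im (v * v) = 0%R) by (clearbody v; destruct v as [v1 v2]; simpl in *; subst v2; ring).
rewrite E in Hv. destruct k as [k1 k2]. simpl in *. nra.
Qed.

Lemma a_0 : a 0 = 0.
Proof. apply ha. Qed.

(** Along the ray to z, in rectified coordinates, let b be the value of [a] at k sin.  The
sines of b and of the point agree by the definition of [a], hence so do the cosines, as
continuous roots of the same function without zeros.  So b minus the point is a continuous
function with values in 2 pi Z, which is 0 at the origin. *)
Lemma a_Csin (z : C) : (Rabs (ucoord k z) < PI / 2)%R -> a (k * Csin z) = z.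
Proof.
intros Hu. set (u := ucoord k z) in *. set (y := Im z).
assert (Hpi := PI_RGT_0).
set (gam := fun t : R => upoint k (t * u) (t * y)).
assert (Hg0 : gam 0%R = 0).
{ unfold gam, upoint. rewrite !Rmult_0_l, gcurve_0. apply injective_projections; simpl; ring. }
assert (Hg1 : gam 1%R = z).
{ unfold gam. rewrite !Rmult_1_l. apply upoint_ucoord. }
assert (Hgc : forall t, @continuous R_UniformSpace C_UniformSpace gam t).
{ intros t. apply upoint_lim;
    [apply (ex_derive_continuous (fun t => (t * u)%R)) | apply (ex_derive_continuous (fun t => (t * y)%R))]; auto_derive; easy. }
assert (Hgu : forall t, unit_seg t -> (Rabs (ucoord k (gam t)) < PI / 2)%R).
{ intros t [Ht0 Ht1]. unfold gam. rewrite ucoord_upoint, Rabs_mult, (Rabs_right t) by lra.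
  assert (K := Rabs_pos u). nra. }
set (b := fun t : R => a (k * Csin (gam t))).
assert (Hb : forall t, unit_seg t -> @continuous R_UniformSpace C_UniformSpace b t /\ Csin (b t) = Csin (gam t)).
{ intros t Ht. destruct (Csin_not_cut (gam t) (Hgu t Ht)) as [N1 N2].
  destruct (proj2 ha _ N1 N2) as [Hd E]. split.
  - apply (Clim_comp a (fun t => k * Csin (gam t))); [now apply Cdiff_cont|].
    apply Clim_mult; [apply Clim_const|]. apply (Clim_comp Csin gam); [apply Cdiff_cont, Cdiff_Csin|apply Hgc].
  - unfold b. replace (Csin (a (k * Csin (gam t)))) with (k * Csin (a (k * Csin (gam t))) / k) by (field; easy).
    rewrite E. field. easy. }
assert (Hcos_neq : forall t, unit_seg t -> Ccos (gam t) <> 0).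
{ intros t Ht E. destruct (Im_k_Ccos_sign (gam t)) as [c [Hc Ec]]. rewrite E, Cmult_0_r in Ec.
  specialize (Hgu t Ht). apply Rabs_def2 in Hgu.
  assert (0 < cos (ucoord k (gam t)))%R by (apply cos_gt_0; lra). simpl in Ec. nra. }
assert (Hb0 : b 0%R = 0).
{ unfold b. rewrite Hg0. replace (k * Csin 0) with (RtoC 0); [apply a_0|].
  unfold Csin; simpl. unfold sinh. rewrite sin_0, Ropp_0. apply injective_projections; simpl; field. }
(* the cosines agree all along the path, as their ratio is a root of 1 *)
assert (Hcos : forall s, unit_seg s -> Ccos (b s) = Ccos (gam s)).
{ intros s [Hs0 Hs1].
  assert (Hsc : forall t, unit_seg t -> unit_seg (t * s)%R) by (unfold unit_seg; intros t Ht; nra).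
  assert (Hcs : forall t, @continuous R_UniformSpace R_UniformSpace (fun t => (t * s)%R) t).
  { intros t. apply (ex_derive_continuous (fun t => (t * s)%R)). auto_derive. easy. }
  rewrite <- (Rmult_1_l s).
  apply (path_root (fun t => Ccos (b (t * s)%R)) (fun t => Ccos (gam (t * s)%R))).
  - intros t Ht. apply (filterlim_within (T := R_UniformSpace) (U := C_UniformSpace)).
    apply (Clim_comp Ccos); [apply Cdiff_cont, Cdiff_Ccos|].
    apply (continuous_comp (U := R_UniformSpace) (V := R_UniformSpace) (W := C_UniformSpace) (fun t => (t * s)%R) b); [apply Hcs|now apply Hb, Hsc].
  - intros t Ht. apply (filterlim_within (T := R_UniformSpace) (U := C_UniformSpace)).
    apply (Clim_comp Ccos); [apply Cdiff_cont, Cdiff_Ccos|].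
    apply (continuous_comp (U := R_UniformSpace) (V := R_UniformSpace) (W := C_UniformSpace) (fun t => (t * s)%R) gam); [apply Hcs|apply Hgc].
  - intros t Ht. split; [|now apply Hcos_neq, Hsc].
    assert (E1 := Csin2_Ccos2 (b (t * s)%R)). assert (E2 := Csin2_Ccos2 (gam (t * s)%R)).
    rewrite (proj2 (Hb _ (Hsc t Ht))) in E1. set (S := Csin (gam (t * s)%R)) in *.
    replace (Ccos (b (t * s)%R) * Ccos (b (t * s)%R)) with ((S * S + Ccos (b (t * s)%R) * Ccos (b (t * s)%R)) - S * S) by ring.
    rewrite E1, <- E2. ring.
  - rewrite Rmult_0_l. now rewrite Hb0, Hg0. }
set (del := fun t => b t - gam t).
assert (Hdel : forall t, unit_seg t -> Cexp (Ci * del t) = 1).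
{ intros t Ht. unfold del. replace (Ci * (b t - gam t)) with (Ci * b t + - (Ci * gam t)) by ring.
  rewrite Cexp_plus, Cexp_opp.
  assert (Hexp : forall w, Cexp (Ci * w) = Ccos w + Ci * Csin w).
  { intro w. rewrite Ccos_Cexp, Csin_Cexp. field. repeat split; [apply Cexp_neq_0|apply Ci_neq_0]. }
  rewrite !Hexp, (proj2 (Hb t Ht)), (Hcos t Ht), <- Hexp. field. apply Cexp_neq_0. }
assert (Hval : forall t, unit_seg t -> Im (del t) = 0%R /\ cos (Re (del t)) = 1%R).
{ intros t Ht. specialize (Hdel t Ht). assert (K := Cmod_Cexp (Ci * del t)). rewrite Hdel, Cmod_1 in K.
  destruct (del t) as [d1 d2]. simpl in K. unfold Cexp in Hdel. simpl in Hdel.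
  replace (0 * d1 - 1 * d2)%R with (- d2)%R in * by ring. replace (0 * d2 + 1 * d1)%R with d1 in Hdel by ring.
  assert (d2 = 0%R).
  { rewrite <- exp_0 in K. apply exp_inv in K. lra. }
  subst d2. rewrite Ropp_0, exp_0 in Hdel. injection Hdel as E1 E2. simpl. split; [easy|lra]. }
assert (H1 : unit_seg 1) by (unfold unit_seg; lra). assert (H0 : unit_seg 0) by (unfold unit_seg; lra).
assert (Hre : Re (del 1%R) = 0%R).
{ destruct (Req_dec (Re (del 1%R)) 0) as [E|E]; [easy|exfalso].
  set (f := fun t => Re (del (Rmax 0 (Rmin 1 t)))).
  assert (Hf : continuity f).
  { apply (clamp_continuous (fun t => Re (del t))). intros t Ht. apply Clim_Re. apply Clim_minus.
    - apply (filterlim_within (T := R_UniformSpace) (U := C_UniformSpace)). now apply Hb.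
    - apply (filterlim_within (T := R_UniformSpace) (U := C_UniformSpace)). apply Hgc. }
  assert (F0 : f 0%R = 0%R).
  { unfold f. rewrite (Rmin_right 1 0), Rmax_left by lra. unfold del. rewrite Hb0, Hg0. simpl. ring. }
  assert (F1 : f 1%R = Re (del 1%R)) by (unfold f; now rewrite (Rmin_left 1 1), Rmax_right by lra).
  destruct (Hval 1%R H1) as [_ C1]. set (v := Re (del 1%R)) in *.
  assert (Hfv : forall t, cos (f t) = 1%R) by (intros t; apply Hval, unit_seg_clamp).
  assert (Hsm : forall w, (0 < w < 2 * PI)%R -> cos w <> 1%R).
  { intros w Hw Ew. assert (K := cos_2a_sin (w / 2)). replace (2 * (w / 2))%R with w in K by field.
    assert (0 < sin (w / 2))%R by (apply sin_gt_0; lra). nra. }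
  destruct (Rlt_dec 0 v) as [Hv|Hv].
  - destruct (Rlt_dec v (2 * PI)) as [Hv2|Hv2]; [now apply (Hsm v)|].
    destruct (IVT_cor (fun t => f t - PI)%R 0 1) as [t [Ht Hz]].
    + apply continuity_minus; [easy|]. apply continuity_const. now intros ? ?.
    + lra.
    + rewrite F0, F1. nra.
    + apply (Hsm PI); [lra|]. rewrite <- (Hfv t). f_equal. lra.
  - destruct (Rlt_dec (- v) (2 * PI)) as [Hv2|Hv2]; [apply (Hsm (- v)%R); [lra|now rewrite cos_neg]|].
    destruct (IVT_cor (fun t => f t + PI)%R 0 1) as [t [Ht Hz]].
    + apply continuity_plus; [easy|]. apply continuity_const. now intros ? ?.
    + lra.
    + rewrite F0, F1. nra.
    + apply (Hsm PI); [lra|]. rewrite <- (Hfv t), <- cos_neg. f_equal. lra. }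
destruct (Hval 1%R H1) as [Him _].
assert (E : del 1%R = 0) by (apply injective_projections; [exact Hre|exact Him]).
unfold del in E. apply Cminus_eq in E. rewrite Hg1 in E. transitivity (b 1%R); [unfold b; now rewrite Hg1|exact E].
Qed.

(** Reduce u modulo 2 pi into [-pi/2, 3 pi/2) and reflect the part beyond pi/2. *)
Lemma strip_reduction (z : C) : exists z', (Rabs (ucoord k z') <= PI / 2)%R /\ Csin z' = Csin z.
Proof.
assert (Hpi := PI_RGT_0).
assert (Hper : forall (n : nat) w, Csin (w - RtoC (2 * INR n * PI)) = Csin w).
{ intros n w. unfold Csin. rewrite im_minus_R, re_minus_R.
  rewrite <- (sin_period (Re w - 2 * INR n * PI) n), <- (cos_period (Re w - 2 * INR n * PI) n).
  now replace (Re w - 2 * INR n * PI + 2 * INR n * PI)%R with (Re w) by ring. }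
assert (Hpos : forall w, (- (PI / 2) <= ucoord k w)%R -> exists z', (Rabs (ucoord k z') <= PI / 2)%R /\ Csin z' = Csin w).
{ intros w Hw. destruct (nfloor_ex ((ucoord k w + PI / 2) / (2 * PI))) as [n [Hn1 Hn2]].
  { apply Rmult_le_pos; [lra|]. left. apply Rinv_0_lt_compat. lra. }
  apply Rle_div_r in Hn1; [|lra]. apply Rlt_div_l in Hn2; [|lra].
  set (v := w - RtoC (2 * INR n * PI)).
  assert (Ev : ucoord k v = (ucoord k w - 2 * INR n * PI)%R) by apply ucoord_minus_R.
  destruct (Rle_dec (ucoord k v) (PI / 2)) as [H|H].
  - exists v. split; [apply Rabs_le; nra|apply Hper].
  - exists (RtoC PI - v). split; [rewrite ucoord_R_minus; apply Rabs_le; nra|]. rewrite Csin_PI_minus. apply Hper. }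
destruct (Rle_dec (- (PI / 2)) (ucoord k z)) as [H|H]; [now apply Hpos|].
destruct (Hpos (RtoC PI - z)) as [z' [H1 H2]]; [rewrite ucoord_R_minus; lra|].
exists z'. split; [easy|]. now rewrite H2, Csin_PI_minus.
Qed.

(** The point of the closed slab with the same sine cannot lie on its edge, which is
mapped to the cuts; so [a_Csin] applies to it. *)
Lemma a_in_strip (xi : C) : ~ h_plus k xi -> ~ h_minus k xi ->
  (Rabs (ucoord k (a xi)) < PI / 2)%R /\ k * Csin (a xi) = xi.
Proof.
intros N1 N2. destruct (proj2 ha xi N1 N2) as [_ E]. split; [|easy].
destruct (strip_reduction (a xi)) as [z [Hz Ez]].
assert (E' : k * Csin z = xi) by now rewrite Ez.
destruct Hz as [Hz|Hz].
- rewrite <- E', a_Csin by easy. easy.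
- exfalso. assert (Hc : cos (ucoord k z) = 0%R).
  { unfold Rabs in Hz. destruct (Rcase_abs (ucoord k z)); [rewrite <- cos_neg|]; rewrite Hz; apply cos_PI2. }
  apply cut_of_edge in Hc. rewrite E' in Hc. tauto.
Qed.

End Branch.

(** * Curves, strips and domains in rectified coordinates *)

Lemma C_PI2 : PI / 2 = RtoC (PI / 2).
Proof. symmetry. apply RtoC_div. lra. Qed.

Lemma C_2PI : 2 * PI = RtoC (2 * PI).
Proof. symmetry. apply RtoC_mult. Qed.

Lemma K_radicandE (k x y : C) : K_radicand k (x, y) = k * k * (Ccos (x + y) * Ccos (x - y)).
Proof. unfold K_radicand. rewrite Ccos_Ccos. simpl. ring. Qed.

Lemma Ccos_R (v : R) : Ccos (RtoC v) = RtoC (cos v).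
Proof.
unfold Ccos, Csin. rewrite <- RtoC_plus. simpl. unfold cosh, sinh. rewrite Ropp_0, exp_0.
replace (v + PI / 2)%R with (PI / 2 + v)%R by ring. rewrite <- cos_sin.
apply injective_projections; simpl; field.
Qed.

Lemma Ccos_eq_0 (w : C) : Ccos w = 0 <-> Im w = 0%R /\ cos (Re w) = 0%R.
Proof.
split.
- intros H. assert (E : w = RtoC (Re w)).
  { apply injective_projections; [easy|]. simpl.
    unfold Ccos, Csin in H. rewrite re_plus, im_plus in H. simpl in H. injection H as H1 H2.
    rewrite Rplus_0_r in H1, H2. assert (Hc := cosh_pos (Im w)).
    assert (Hs : sin (Re w + PI / 2) = 0%R) by nra.
    assert (Hcs : cos (Re w + PI / 2) <> 0%R).
    { intro E0. assert (S := sin2_cos2 (Re w + PI / 2)). rewrite Hs, E0 in S. unfold Rsqr in S. lra. }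
    apply Rmult_integral in H2. destruct H2 as [H2|H2]; [easy|].
    destruct (Rtotal_order (Im w) 0) as [Hy|[Hy|Hy]]; [apply sinh_neg in Hy; lra|exact Hy|apply sinh_pos in Hy; lra]. }
  rewrite E in H. rewrite Ccos_R in H. apply RtoC_inj in H. split; [rewrite E; easy|exact H].
- intros [H1 H2]. assert (E : w = RtoC (Re w)) by (apply injective_projections; [easy|exact H1]).
  rewrite E, Ccos_R, H2. easy.
Qed.

Section Sets.

Context (k : C) (a : C -> C) (hRe : (0 < Re k)%R) (hIm : (0 < Im k)%R) (ha : angular_branch k a).
Notation u := (ucoord k).

Lemma not_cut_real (xi : C) : Im xi = 0%R -> ~ h_plus k xi /\ ~ h_minus k xi.
Proof.
intros H. split.
- intros [x [_ Hx]]. lra.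
- intros [x [_ Hx]]. rewrite im_opp in Hx. lra.
Qed.

Lemma sin_sign (v : R) : (Rabs v < PI / 2)%R -> ((0 <= sin v)%R <-> (0 <= v)%R) /\ ((sin v <= 0)%R <-> (v <= 0)%R).
Proof.
intros H. apply Rabs_def2 in H.
destruct (Rtotal_order v 0) as [Hv|[Hv|Hv]].
- assert (sin v < 0)%R by (apply sin_lt_0_var; lra). lra.
- subst. rewrite sin_0. lra.
- assert (0 < sin v)%R by (apply sin_gt_0; lra). lra.
Qed.

Lemma Gamma_iff (z : C) : Gamma a z <-> u z = 0%R.
Proof.
split.
- intros [xi ->]. destruct (not_cut_real (RtoC xi) eq_refl) as [N1 N2].
  destruct (a_in_strip k a hRe hIm ha _ N1 N2) as [Hu E].
  destruct (Im_k_Csin_sign k hIm (a (RtoC xi))) as [c [Hc Ec]]. rewrite E in Ec. simpl in Ec.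
  assert (Hs : sin (u (a (RtoC xi))) = 0%R) by nra.
  destruct (sin_sign _ Hu) as [S1 S2]. rewrite Hs in S1, S2. lra.
- intros H. exists (Re (k * Csin z)).
  destruct (Im_k_Csin_sign k hIm z) as [c [Hc Ec]]. rewrite H, sin_0, Rmult_0_r in Ec.
  replace (RtoC (Re (k * Csin z))) with (k * Csin z).
  + symmetry. apply (a_Csin k a hRe hIm ha). rewrite H, Rabs_R0. assert (K := PI_RGT_0). lra.
  + apply injective_projections; [easy|exact Ec].
Qed.

Lemma M_plus_iff (z : C) : M_plus k a z <-> (0 <= u z < PI / 2)%R.
Proof.
split.
- intros [xi [H [N1 ->]]].
  assert (N2 : ~ h_minus k xi). { intros [x [_ Hx]]. rewrite im_opp in Hx. lra. }
  destruct (a_in_strip k a hRe hIm ha _ N1 N2) as [Hu E].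
  destruct (Im_k_Csin_sign k hIm (a xi)) as [c [Hc Ec]]. rewrite E in Ec.
  destruct (sin_sign _ Hu) as [S1 _]. apply Rabs_def2 in Hu. split; [|lra]. apply S1. nra.
- intros H. exists (k * Csin z).
  assert (Hu : (Rabs (u z) < PI / 2)%R) by (apply Rabs_def1; lra).
  destruct (Im_k_Csin_sign k hIm z) as [c [Hc Ec]]. destruct (sin_sign _ Hu) as [S1 _].
  repeat split.
  + rewrite Ec. apply Rmult_le_pos; [lra|]. now apply S1.
  + now apply Csin_not_cut.
  + symmetry. now apply (a_Csin k a hRe hIm ha).
Qed.

Lemma M_minus_iff (z : C) : M_minus k a z <-> (- (PI / 2) < u z <= 0)%R.
Proof.
split.
- intros [xi [H [N2 ->]]].
  assert (N1 : ~ h_plus k xi). { intros [x [_ Hx]]. lra. }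
  destruct (a_in_strip k a hRe hIm ha _ N1 N2) as [Hu E].
  destruct (Im_k_Csin_sign k hIm (a xi)) as [c [Hc Ec]]. rewrite E in Ec.
  destruct (sin_sign _ Hu) as [_ S2]. apply Rabs_def2 in Hu. split; [lra|]. apply S2. nra.
- intros H. exists (k * Csin z).
  assert (Hu : (Rabs (u z) < PI / 2)%R) by (apply Rabs_def1; lra).
  destruct (Im_k_Csin_sign k hIm z) as [c [Hc Ec]]. destruct (sin_sign _ Hu) as [_ S2].
  repeat split.
  + rewrite Ec. assert (sin (u z) <= 0)%R by now apply S2. nra.
  + now apply Csin_not_cut.
  + symmetry. now apply (a_Csin k a hRe hIm ha).
Qed.

Lemma strip_iff (z : C) : strip k a z <-> (- (PI / 2) < u z < PI / 2)%R.
Proof. assert (K := PI_RGT_0). unfold strip, cup. rewrite M_plus_iff, M_minus_iff. lra. Qed.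

Lemma m_plus_iff (z : C) : m_plus a z <-> u z = (PI / 2)%R.
Proof. unfold m_plus, shift. rewrite C_PI2, Gamma_iff, ucoord_minus_R. lra. Qed.

Lemma m_minus_iff (z : C) : m_minus a z <-> u z = (- (PI / 2))%R.
Proof. unfold m_minus, shift. rewrite C_PI2, <- RtoC_opp, Gamma_iff, ucoord_minus_R. lra. Qed.

Lemma m_minus_shift_iff (z : C) : shift (2 * PI) (m_minus a) z <-> u z = (3 * PI / 2)%R.
Proof. unfold shift. rewrite C_2PI, m_minus_iff, ucoord_minus_R. lra. Qed.

(** ** Domains *)

Definition edge (v : R) : Prop := v = (- (PI / 2))%R \/ v = (3 * PI / 2)%R.

Lemma singular_edge_iff (x y : C) : singular_edge k a (x, y) <->
  (edge (u x) \/ edge (u y)) /\ Ccos (x + y) * Ccos (x - y) = 0.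
Proof.
unfold singular_edge, cup, edge. simpl. rewrite !m_minus_iff, !m_minus_shift_iff, K_radicandE.
assert (Hk : k * k <> 0).
{ assert (k <> 0) by (intro E; rewrite E in hRe; simpl in hRe; lra). now apply Cmult_neq_0. }
split; intros [H1 H2]; (split; [exact H1|]).
- apply Cmult_integral in H2. tauto.
- rewrite H2. ring.
Qed.

(** A cosine vanishes at real points only, where sums and differences are those of the
rectified coordinates. *)
Lemma singular_edge_cases (x y : C) : singular_edge k a (x, y) <->
  (edge (u x) \/ edge (u y)) /\
  ((Im (x + y) = 0%R /\ cos (u x + u y) = 0%R) \/ (Im (x - y) = 0%R /\ cos (u x - u y) = 0%R)).
Proof.
rewrite singular_edge_iff. split; intros [H1 H2]; (split; [exact H1|]).
- apply Cmult_integral in H2. destruct H2 as [H2|H2]; apply Ccos_eq_0 in H2; destruct H2 as [H2 H3].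
  + left. split; [easy|]. now rewrite <- Re_plus_real.
  + right. split; [easy|]. now rewrite <- Re_minus_real.
- destruct H2 as [[H2 H3]|[H2 H3]].
  + rewrite (proj2 (Ccos_eq_0 (x + y))); [ring|]. split; [easy|]. now rewrite (Re_plus_real k).
  + rewrite (proj2 (Ccos_eq_0 (x - y))); [ring|]. split; [easy|]. now rewrite (Re_minus_real k).
Qed.

Lemma singular_edge_swap (x y : C) : singular_edge k a (x, y) <-> singular_edge k a (y, x).
Proof.
rewrite !singular_edge_iff. replace (x + y) with (y + x) by ring. replace (x - y) with (- (y - x)) by ring.
assert (E : forall w, Ccos (- w) = Ccos w).
{ intro w. rewrite !Ccos_Cexp. replace (Ci * - w) with (- (Ci * w)) by ring. rewrite Cexp_opp.
  assert (N := Cexp_neq_0 (Ci * w)). field. easy. }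
rewrite E. tauto.
Qed.

Lemma interior_regular (x y : C) : (- (PI / 2) < u x < 3 * PI / 2)%R -> (- (PI / 2) < u y < 3 * PI / 2)%R ->
  ~ singular_edge k a (x, y).
Proof. intros Hx Hy H. apply singular_edge_iff in H. destruct H as [[[H|H]|[H|H]] _]; lra. Qed.

Lemma dom_W_iff (x y : C) : dom_W k a (x, y) <->
  ((0 <= u x \/ 0 <= u y) /\ - (PI / 2) < u x < PI / 2 /\ - (PI / 2) < u y < PI / 2)%R.
Proof.
assert (K := PI_RGT_0). unfold dom_W, cup, prodset. simpl. rewrite !M_plus_iff, !strip_iff. lra.
Qed.

Lemma dom_U_iff (x y : C) : dom_U k a (x, y) <->
  (- (PI / 2) < u x <= 0 /\ - (PI / 2) < u y <= 0)%R.
Proof. unfold dom_U, prodset. simpl. now rewrite !M_minus_iff. Qed.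

Lemma dom_W_closed_iff (x y : C) : dom_W_closed k a (x, y) <->
  ((0 <= u x \/ 0 <= u y) /\ - (PI / 2) <= u x <= PI / 2 /\ - (PI / 2) <= u y <= PI / 2)%R /\
  ~ singular_edge k a (x, y).
Proof.
assert (K := PI_RGT_0). unfold dom_W_closed, cup, prodset. simpl fst. simpl snd.
rewrite !M_plus_iff, !strip_iff, !m_plus_iff, !m_minus_iff. split; intros [H1 H2]; (split; [lra|exact H2]).
Qed.

Lemma dom_U_closed_iff (x y : C) : dom_U_closed k a (x, y) <->
  (- (PI / 2) <= u x <= 0 /\ - (PI / 2) <= u y <= 0)%R /\ ~ singular_edge k a (x, y).
Proof.
assert (K := PI_RGT_0). unfold dom_U_closed, cup, prodset. simpl fst. simpl snd.
rewrite !M_minus_iff, !m_minus_iff. split; intros [H1 H2]; (split; [lra|exact H2]).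
Qed.

Lemma Omega_all_iff (x y : C) : Omega_all k a (x, y) <->
  (- (PI / 2) < u x < 3 * PI / 2 /\ - (PI / 2) < u y < 3 * PI / 2)%R.
Proof.
assert (K := PI_RGT_0). unfold Omega_all, cup, prodset, pi_minus. simpl fst. simpl snd.
rewrite !strip_iff, !m_plus_iff, !ucoord_R_minus. lra.
Qed.

Lemma Omega_all_closed_iff (x y : C) : Omega_all_closed k a (x, y) <->
  (- (PI / 2) <= u x <= 3 * PI / 2 /\ - (PI / 2) <= u y <= 3 * PI / 2)%R /\ ~ singular_edge k a (x, y).
Proof.
assert (K := PI_RGT_0). unfold Omega_all_closed, cup, prodset, pi_minus. simpl fst. simpl snd.
rewrite !strip_iff, !m_plus_iff, !m_minus_iff, !ucoord_R_minus. split; intros [H1 H2]; (split; [lra|exact H2]).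
Qed.

Lemma corner_iff (b1 b2 : bool) (x y : C) : corner a b1 b2 (x, y) <->
  u x = (if b1 then 3 * PI / 2 else - (PI / 2))%R /\ u y = (if b2 then 3 * PI / 2 else - (PI / 2))%R.
Proof.
unfold corner, prodset. simpl. destruct b1, b2; rewrite ?m_minus_shift_iff, ?m_minus_iff; tauto.
Qed.

End Sets.

(** * Continuity on pieces *)

Lemma continuous_on_eq {T U : UniformSpace} (D : T -> Prop) (f g : T -> U) :
  (forall p, D p -> f p = g p) -> continuous_on D f -> continuous_on D g.
Proof.
intros E H p Hp. rewrite <- (E p Hp).
apply (filterlim_ext_loc f); [|now apply H].
unfold within. apply filter_forall. exact E.
Qed.

Lemma continuous_on_sub {T U : UniformSpace} (D D' : T -> Prop) (f : T -> U) :
  (forall p, D' p -> D p) -> continuous_on D f -> continuous_on D' f.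
Proof.
intros E H p Hp P HP. generalize (H p (E p Hp) P HP). unfold filtermap, within.
apply filter_imp. intros q Hq Hd. apply Hq. now apply E.
Qed.

Lemma continuous_on_comp_cont {T S U : UniformSpace} (D : T -> Prop) (D' : S -> Prop) (g : T -> S) (f : S -> U) :
  (forall p, D p -> D' (g p)) -> (forall p, D p -> continuous g p) -> continuous_on D' f ->
  continuous_on D (fun p => f (g p)).
Proof.
intros Hg Hc Hf p Hp P HP.
generalize (Hc p Hp _ (Hf (g p) (Hg p Hp) P HP)). unfold filtermap, within.
apply filter_imp. intros q Hq Hd. apply Hq. now apply Hg.
Qed.

Lemma continuous_on_nbhd {T U : UniformSpace} (D : T -> Prop) (f : T -> U) (p : T) :
  continuous_on D f -> locally p D -> continuous f p.
Proof.
intros H HD. apply (filterlim_within_nbhd D); [exact HD|]. apply H. now apply locally_singleton.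
Qed.

Lemma continuous_continuous_on {T U : UniformSpace} (D : T -> Prop) (f : T -> U) :
  (forall p, D p -> continuous f p) -> continuous_on D f.
Proof. intros H p Hp. apply filterlim_within. now apply H. Qed.

(** This is how functions defined on both sides of a curve are pasted together. *)
Lemma continuous_on_split {T U : UniformSpace} (D : T -> Prop) (h : T -> R) (c : R) (f : T -> U) :
  (forall p, continuous h p) ->
  continuous_on (fun p => D p /\ (h p <= c)%R) f -> continuous_on (fun p => D p /\ (c <= h p)%R) f ->
  continuous_on D f.
Proof.
intros Hh H1 H2 p Hp P HP.
assert (K1 : (h p <= c)%R -> within (fun p => D p /\ (h p <= c)%R) (locally p) (fun q => P (f q))).
{ intros K. now apply H1. }
assert (K2 : (c <= h p)%R -> within (fun p => D p /\ (c <= h p)%R) (locally p) (fun q => P (f q))).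
{ intros K. now apply H2. }
unfold filtermap, within in *.
destruct (Rtotal_order (h p) c) as [K|[K|K]].
- specialize (K1 ltac:(lra)). assert (L : locally p (fun q => h q < c)%R) by exact (Hh p _ (open_lt c _ K)).
  generalize (filter_and _ _ L K1).
  apply filter_imp. intros q [Hq Hq'] Hd. apply Hq'. split; [easy|]. lra.
- specialize (K1 ltac:(lra)). specialize (K2 ltac:(lra)). generalize (filter_and _ _ K1 K2).
  apply filter_imp. intros q [Hq Hq'] Hd.
  destruct (Rle_dec (h q) c); [apply Hq; split; [easy|lra]|apply Hq'; split; [easy|lra]].
- specialize (K2 ltac:(lra)). assert (L : locally p (fun q => c < h q)%R) by exact (Hh p _ (open_gt c _ K)).
  generalize (filter_and _ _ L K2).
  apply filter_imp. intros q [Hq Hq'] Hd. apply Hq'. split; [easy|]. lra.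
Qed.

Lemma continuous_on_zero {T : UniformSpace} (D : T -> Prop) (f : T -> C) (p : T) :
  @continuous_on T C_UniformSpace D f -> D p ->
  (forall e : posreal, exists q, D q /\ ball p e q /\ f q = 0) -> f p = 0.
Proof.
intros Hc Hp H. destruct (Ceq_dec (f p) 0) as [H0|H0]; [easy|exfalso].
apply Cmod_gt_0 in H0. destruct (proj1 (Clim_iff (F := within D (locally p)) f (f p)) (Hc p Hp) _ H0) as [e He].
destruct (H e) as [q [Hq [Hb E]]]. specialize (He q Hb Hq). rewrite E in He.
replace (0 - f p) with (- f p) in He by ring. rewrite Cmod_opp in He. lra.
Qed.

Lemma ball_shift_R (z : C) (e : posreal) (t : R) : (Rabs t < e)%R -> @ball C_UniformSpace z e (z + RtoC t).
Proof.
intros H. apply ball_C_Cmod. replace (z + RtoC t - z) with (RtoC t) by ring. now rewrite Cmod_R.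
Qed.

(** * Uniqueness and continuation across the curves *)

Section Curves.

Context (k : C) (a : C -> C) (hRe : (0 < Re k)%R) (hIm : (0 < Im k)%R) (ha : angular_branch k a).
Notation u := (ucoord k).

Lemma ucoord_cont (z : C) : @continuous C_UniformSpace R_UniformSpace u z.
Proof. exact (ucoord_lim (F := @locally C_UniformSpace z) k (fun w => w) z (Ccont_id z)). Qed.

Lemma u_gt_open (z : C) (al : R) : (al < u z)%R -> @locally C_UniformSpace z (fun w => (al < u w)%R).
Proof. intros H. exact (ucoord_cont z _ (open_gt al _ H)). Qed.

Lemma u_lt_open (z : C) (be : R) : (u z < be)%R -> @locally C_UniformSpace z (fun w => (u w < be)%R).
Proof. intros H. exact (ucoord_cont z _ (open_lt be _ H)). Qed.

Lemma u_between_open (z : C) (al be : R) : (al < u z < be)%R ->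
  @locally C_UniformSpace z (fun w => (al < u w < be)%R).
Proof.
intros [H1 H2]. generalize (filter_and _ _ (u_gt_open z al H1) (u_lt_open z be H2)).
apply filter_imp. tauto.
Qed.

(** A cut point satisfies Re eta Im eta = Re k Im k, so that the cuts keep away from
bounded parts of the real axis. *)
Lemma not_cut_near_real (x : R) : exists r, (0 < r)%R /\
  forall xi, (Cmod (xi - RtoC x) <= r)%R -> ~ h_plus k xi /\ ~ h_minus k xi.
Proof.
set (r := Rmin 1 (Re k * Im k / (2 * (Rabs x + 1)))).
assert (Hx := Rabs_pos x). assert (Hk : (0 < Re k * Im k)%R) by now apply Rmult_lt_0_compat.
assert (Hq : (0 < Re k * Im k / (2 * (Rabs x + 1)))%R) by (apply Rdiv_lt_0_compat; lra).
exists r. split; [apply Rmin_pos; lra|].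
intros xi Hxi. assert (Hn : ~ (h_plus k xi \/ h_minus k xi)); [|tauto].
rewrite (cut_iff k). intros [_ [t E]].
assert (R1 := Rmin_l 1 (Re k * Im k / (2 * (Rabs x + 1)))). assert (R2 := Rmin_r 1 (Re k * Im k / (2 * (Rabs x + 1)))).
fold r in R1, R2.
assert (B1 : (Rabs (Re xi - x) <= r)%R).
{ eapply Rle_trans; [|exact Hxi]. eapply Rle_trans; [|apply Rmax_Cmod]. simpl. apply Rmax_l. }
assert (B2 : (Rabs (Im xi) <= r)%R).
{ eapply Rle_trans; [|exact Hxi]. eapply Rle_trans; [|apply Rmax_Cmod]. simpl.
  replace (snd xi + - 0)%R with (Im xi) by (unfold Im; ring). apply Rmax_r. }
assert (E2 : (Re xi * Im xi = Re k * Im k)%R).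
{ assert (K : Im (xi * xi) = Im (k * k - RtoC t * RtoC t)) by now rewrite E.
  destruct xi as [x1 x2], k as [k1 k2]. simpl in *. lra. }
assert (B3 : (Rabs (Re xi) <= Rabs x + 1)%R).
{ replace (Re xi) with (x + (Re xi - x))%R by ring. eapply Rle_trans; [apply Rabs_triang|]. lra. }
assert (B4 : (Re k * Im k <= (Rabs x + 1) * r)%R).
{ rewrite <- E2. eapply Rle_trans; [apply Rle_abs|]. rewrite Rabs_mult.
  apply Rmult_le_compat; try apply Rabs_pos; lra. }
assert (B5 : ((Rabs x + 1) * r <= Re k * Im k / 2)%R).
{ apply Rle_trans with ((Rabs x + 1) * (Re k * Im k / (2 * (Rabs x + 1))))%R; [apply Rmult_le_compat_l; lra|].
  right. field. lra. }
lra.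
Qed.

(** Painleve's theorem on a translate of [Gamma]: [a] is a holomorphic change of
variables, with inverse k sin, that maps a piece of the real line onto [Gamma]. *)
Lemma Cdiff_curve (f : C -> C) (z : C) :
  @locally C_UniformSpace z (fun w => Ccont f w) ->
  @locally C_UniformSpace z (fun w => u w <> u z -> Cdiff f w) -> Cdiff f z.
Proof.
intros Hc Hd. set (b := u z) in *. assert (Hpi := PI_RGT_0).
set (z0 := z - RtoC b). assert (Hu0 : u z0 = 0%R) by (unfold z0; rewrite ucoord_minus_R; unfold b; ring).
set (xi0 := k * Csin z0).
assert (Hi0 : Im xi0 = 0%R).
{ destruct (Im_k_Csin_sign k hIm z0) as [c [_ E]]. unfold xi0. rewrite E, Hu0, sin_0. ring. }
assert (Ex : xi0 = RtoC (Re xi0)) by (apply injective_projections; [easy|exact Hi0]).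
destruct (not_cut_near_real (Re xi0)) as [r1 [Hr1 Hcut]]. rewrite <- Ex in Hcut.
assert (Ea : a xi0 = z0) by (apply (a_Csin k a hRe hIm ha); rewrite Hu0, Rabs_R0; lra).
(* the straightening map, shifted to the curve through z *)
set (psi := fun xi => a xi + RtoC b).
assert (Hpsi : forall xi, (Cmod (xi - xi0) <= r1)%R -> Cdiff psi xi).
{ intros xi Hxi. apply Cdiff_plus; [|apply Cdiff_const]. apply ha; now apply Hcut. }
assert (Epsi : psi xi0 = z) by (unfold psi; rewrite Ea; unfold z0; ring).
assert (Hnear : @locally C_UniformSpace xi0 (fun xi => Ccont f (psi xi) /\ (u (psi xi) <> b -> Cdiff f (psi xi)))).
{ assert (L : Ccont psi xi0).
  { apply Cdiff_cont, Hpsi. replace (xi0 - xi0) with (RtoC 0) by ring. rewrite Cmod_0. lra. }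
  unfold continuous in L. rewrite Epsi in L. exact (L _ (filter_and _ _ Hc Hd)). }
apply locally_C_iff in Hnear. destruct Hnear as [r2 [Hr2 Hnear]].
set (r := (Rmin r1 r2 / 2)%R). assert (R1 := Rmin_l r1 r2). assert (R2 := Rmin_r r1 r2).
assert (Hm : (0 < Rmin r1 r2)%R) by now apply Rmin_pos.
assert (HF : Cdiff (fun xi => f (psi xi)) xi0).
{ apply (Cdiff_line _ xi0 r); [unfold r; lra| |].
  - intros w Hw. apply (Ccont_comp f psi).
    + apply (Hnear w). unfold r in Hw; lra.
    + apply Cdiff_cont, Hpsi. unfold r in Hw; lra.
  - intros w Hw Hiw. apply (Cdiff_comp psi f).
    + apply (Hnear w); [unfold r in Hw; lra|]. unfold psi. rewrite ucoord_plus_R. intros E.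
      apply Hiw. rewrite Hi0.
      assert (Hcw : (Cmod (w - xi0) <= r1)%R) by (unfold r in Hw; lra).
      destruct (a_in_strip k a hRe hIm ha w) as [_ Ew]; [now apply Hcut|now apply Hcut|].
      destruct (Im_k_Csin_sign k hIm (a w)) as [c [_ Ec]]. rewrite Ew in Ec. rewrite Ec.
      replace (u (a w)) with 0%R by lra. rewrite sin_0. ring.
    + apply Hpsi. unfold r in Hw; lra. }
apply (Cdiff_ext_loc (fun w => f (psi (k * Csin (w - RtoC b))))).
- assert (Hz : (b - PI / 2 < u z < b + PI / 2)%R) by (unfold b; lra).
  generalize (u_between_open z _ _ Hz). apply filter_imp. intros w Hw. f_equal.
  unfold psi. rewrite (a_Csin k a hRe hIm ha); [ring|].
  rewrite ucoord_minus_R. apply Rabs_def1; lra.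
- apply (Cdiff_comp (fun w => k * Csin (w - RtoC b)) (fun xi => f (psi xi))).
  + exact HF.
  + apply Cdiff_mult; [apply Cdiff_const|].
    apply (Cdiff_comp (fun w => w - RtoC b) Csin); [apply Cdiff_Csin|].
    apply Cdiff_minus; [apply Cdiff_id|apply Cdiff_const].
Qed.

(** The function extends by 0 beyond the curve; the extension is holomorphic by
Painleve's theorem and zero on an open set. *)
Lemma boundary_uniqueness (f : C -> C) (al be : R) (z : C) :
  @continuous_on C_UniformSpace C_UniformSpace (fun w => (al < u w <= be)%R) f ->
  (forall w, (al < u w < be)%R -> Cdiff f w) ->
  (forall w, u w = be -> f w = 0) -> (al < u z <= be)%R -> f z = 0.
Proof.
intros Hc Hd H0 Hz. destruct (Req_dec (u z) be) as [E|E]; [now apply H0|].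
set (F := fun w => if Rlt_dec (u w) be then f w else 0).
assert (FE1 : forall w, (u w <= be)%R -> F w = f w).
{ intros w Hw. unfold F. destruct (Rlt_dec (u w) be); [easy|]. symmetry. apply H0. lra. }
assert (FE2 : forall w, (be <= u w)%R -> F w = 0).
{ intros w Hw. unfold F. destruct (Rlt_dec (u w) be); [lra|easy]. }
assert (HFc : @continuous_on C_UniformSpace C_UniformSpace (fun w => (al < u w)%R) F).
{ apply (continuous_on_split _ u be).
  - exact ucoord_cont.
  - apply (continuous_on_eq (T := C_UniformSpace) (U := C_UniformSpace) _ f); [intros w Hw; symmetry; apply FE1; apply Hw|].
    apply (continuous_on_sub (T := C_UniformSpace) (U := C_UniformSpace) (fun w => (al < u w <= be)%R)); [tauto|exact Hc].
  - apply (continuous_on_eq (T := C_UniformSpace) (U := C_UniformSpace) _ (fun _ => RtoC 0)); [intros w Hw; symmetry; apply FE2; apply Hw|].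
    intros w _. apply Clim_const. }
assert (HFcont : forall w, (al < u w)%R -> Ccont F w).
{ intros w Hw. apply (continuous_on_nbhd (T := C_UniformSpace) (U := C_UniformSpace) (fun w => (al < u w)%R)); [exact HFc|].
  now apply u_gt_open. }
assert (HFd : forall w, (al < u w)%R -> u w <> be -> Cdiff F w).
{ intros w Hw Hn. destruct (Rlt_dec (u w) be) as [K|K].
  - apply (Cdiff_ext_loc f); [|now apply Hd].
    generalize (u_between_open w al be (conj Hw K)). apply filter_imp. intros v Hv. symmetry. apply FE1. lra.
  - apply (Cdiff_ext_loc (fun _ => 0)); [|apply Cdiff_const].
    assert (K' : (be < u w < u w + 1)%R) by lra.
    generalize (u_between_open w _ _ K'). apply filter_imp. intros v Hv. symmetry. apply FE2. lra. }
assert (HFall : forall w, (al < u w)%R -> Cdiff F w).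
{ intros w Hw. assert (Hloc := u_gt_open w al Hw).
  destruct (Req_dec (u w) be) as [Eb|Eb]; [|now apply HFd].
  apply Cdiff_curve; revert Hloc; apply filter_imp.
  - intros v Hv. now apply HFcont.
  - intros v Hv Hn. apply HFd; [easy|]. now rewrite <- Eb. }
rewrite <- FE1 by lra.
(* a horizontal segment, starting beyond the curve *)
apply (zero_along_segment F (z + RtoC (be - u z + 1)) z).
- intros t Ht. replace (z + RtoC (be - u z + 1) + RtoC t * (z - (z + RtoC (be - u z + 1))))
    with (z + RtoC ((be - u z + 1) * (1 - t))) by (rewrite RtoC_mult, RtoC_minus; ring).
  set (w := z + RtoC ((be - u z + 1) * (1 - t))).
  assert (Hw : (al < u w)%R).
  { unfold w. rewrite ucoord_plus_R. assert (0 <= (be - u z + 1) * (1 - t))%R by (apply Rmult_le_pos; lra). lra. }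
  generalize (u_gt_open w al Hw). apply filter_imp. exact HFall.
- set (w := z + RtoC (be - u z + 1)).
  assert (Hw : (be < u w < u w + 1)%R) by (unfold w; rewrite ucoord_plus_R; lra).
  generalize (u_between_open w _ _ Hw). apply filter_imp. intros v Hv. apply FE2. lra.
Qed.

Lemma boundary_uniqueness_left (f : C -> C) (al be : R) (z : C) :
  @continuous_on C_UniformSpace C_UniformSpace (fun w => (al <= u w < be)%R) f ->
  (forall w, (al < u w < be)%R -> Cdiff f w) ->
  (forall w, u w = al -> f w = 0) -> (al <= u z < be)%R -> f z = 0.
Proof.
intros Hc Hd H0 Hz. replace z with (- (- z)) by ring.
apply (boundary_uniqueness (fun w => f (- w)) (- be) (- al) (- z)).
- apply (continuous_on_comp_cont (T := C_UniformSpace) (S := C_UniformSpace) (U := C_UniformSpace) _ (fun w => (al <= u w < be)%R)).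
  + intros w Hw. rewrite ucoord_opp. lra.
  + intros w _. apply (Clim_opp (F := @locally C_UniformSpace w)). apply Ccont_id.
  + exact Hc.
- intros w Hw. apply (Cdiff_comp (fun w => - w) f); [apply Hd; rewrite ucoord_opp; lra|]. apply Cdiff_opp, Cdiff_id.
- intros w Hw. apply H0. rewrite ucoord_opp. lra.
- rewrite ucoord_opp. lra.
Qed.

End Curves.

(** * Branches of the square roots *)

Lemma Cdiff_csqrt (f : C -> C) (z : C) : slit (f z) -> Cdiff f z -> Cdiff (fun w => csqrt (f w)) z.
Proof.
intros H Hf. apply (Cdiff_comp f csqrt); [|exact Hf].
apply Cdiff_sqrt; [now apply csqrt_neq_0|now apply csqrt_cont|].
apply (Cdiff_ext_loc (fun w => w)); [|apply Cdiff_id].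
generalize (slit_open (T := C_UniformSpace) (fun w => w) (f z) (Ccont_id _) H).
apply filter_imp. intros w Hw. symmetry. now apply csqrt_sqr.
Qed.

(** The four factors of the radicand of StF1, normalised to be positive at the origin.
The only one that takes values on the cut of the square root near the corner m- x m- is
the first. *)
Definition fac1 (p : C * C) : C := fst p + snd p + RtoC (PI / 2).
Definition fac2 (p : C * C) : C := RtoC (5 * PI / 2) - (fst p + snd p).
Definition fac3 (p : C * C) : C := RtoC (3 * PI / 2) - (fst p - snd p).
Definition fac4 (p : C * C) : C := RtoC (3 * PI / 2) + (fst p - snd p).

Lemma radicand_fac (p : C * C) : radicand p = fac1 p * fac2 p * fac3 p * fac4 p.
Proof.
destruct p as [x y]. unfold radicand, fac1, fac2, fac3, fac4. simpl fst. simpl snd.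
rewrite !RtoC_div, !RtoC_mult by lra. field.
Qed.

(** The half-angle factors of cos (x + y) cos (x - y) / (x + y + pi/2).  The zero on
x + y = -pi/2 is divided out of the last one. *)
Definition sfac1 (p : C * C) : C := Csin (RtoC (PI / 4) - (fst p - snd p) / 2).
Definition sfac2 (p : C * C) : C := Csin (RtoC (PI / 4) + (fst p - snd p) / 2).
Definition sfac3 (p : C * C) : C := Csin (RtoC (PI / 4) - (fst p + snd p) / 2).
Definition sfac4 (p : C * C) : C := sinc (RtoC (PI / 4) + (fst p + snd p) / 2).

Lemma Ccos_fac (p : C * C) :
  Ccos (fst p + snd p) * Ccos (fst p - snd p) =
  2 * sfac1 p * sfac2 p * sfac3 p * sfac4 p * fac1 p.
Proof.
rewrite !Ccos_half. unfold sfac1, sfac2, sfac3, sfac4, fac1.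
assert (E := sincE (RtoC (PI / 4) + (fst p + snd p) / 2)). rewrite <- E.
assert (E2 : fst p + snd p + RtoC (PI / 2) = 2 * (RtoC (PI / 4) + (fst p + snd p) / 2)).
{ replace (PI / 2)%R with (2 * (PI / 4))%R by field. rewrite RtoC_mult. field. }
rewrite E2. ring.
Qed.

(** The branch of radicand^(1/2) on [dom_W_closed] is [root_tail] times the principal root
of [fac1]; on the corner m- x m- that root is continued above the branch point.  The
branch of (cos (x + y) cos (x - y) / radicand)^(1/2) on [dom_U_closed] is [root_cos]
divided by [root_tail]. *)
Definition root_tail (p : C * C) : C := csqrt (fac2 p) * csqrt (fac3 p) * csqrt (fac4 p).
Definition root_main (p : C * C) : C := csqrt (fac1 p) * root_tail p.
Definition root_corner (p : C * C) : C := Ci * csqrt (- fac1 p) * root_tail p.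
Definition root_cos (p : C * C) : C :=
  RtoC (sqrt 2) * csqrt (sfac1 p) * csqrt (sfac2 p) * csqrt (sfac3 p) * csqrt (sfac4 p).

Definition slit_tail (p : C * C) : Prop := slit (fac2 p) /\ slit (fac3 p) /\ slit (fac4 p).
Definition slit_cos (p : C * C) : Prop :=
  slit (sfac1 p) /\ slit (sfac2 p) /\ slit (sfac3 p) /\ slit (sfac4 p).

Lemma root_tail_sqr (p : C * C) : slit_tail p ->
  root_tail p * root_tail p = fac2 p * fac3 p * fac4 p.
Proof.
intros [H2 [H3 H4]]. unfold root_tail.
replace (csqrt (fac2 p) * csqrt (fac3 p) * csqrt (fac4 p) * (csqrt (fac2 p) * csqrt (fac3 p) * csqrt (fac4 p)))
  with ((csqrt (fac2 p) * csqrt (fac2 p)) * (csqrt (fac3 p) * csqrt (fac3 p)) * (csqrt (fac4 p) * csqrt (fac4 p))) by ring.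
now rewrite !csqrt_sqr.
Qed.

Lemma root_main_sqr (p : C * C) : slit (fac1 p) -> slit_tail p -> root_main p * root_main p = radicand p.
Proof.
intros H1 Ht. unfold root_main.
replace (csqrt (fac1 p) * root_tail p * (csqrt (fac1 p) * root_tail p))
  with ((csqrt (fac1 p) * csqrt (fac1 p)) * (root_tail p * root_tail p)) by ring.
rewrite csqrt_sqr, root_tail_sqr, radicand_fac by assumption. ring.
Qed.

Lemma root_corner_sqr (p : C * C) : slit (- fac1 p) -> slit_tail p -> root_corner p * root_corner p = radicand p.
Proof.
intros H1 Ht. unfold root_corner.
replace (Ci * csqrt (- fac1 p) * root_tail p * (Ci * csqrt (- fac1 p) * root_tail p))
  with ((Ci * Ci) * (csqrt (- fac1 p) * csqrt (- fac1 p)) * (root_tail p * root_tail p)) by ring.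
rewrite Ci2, csqrt_sqr, root_tail_sqr, radicand_fac by assumption. ring.
Qed.

Lemma root_cos_sqr (p : C * C) : slit_cos p ->
  root_cos p * root_cos p * fac1 p = Ccos (fst p + snd p) * Ccos (fst p - snd p).
Proof.
intros [H1 [H2 [H3 H4]]]. rewrite Ccos_fac. unfold root_cos.
assert (E : RtoC (sqrt 2) * RtoC (sqrt 2) = 2) by (rewrite <- RtoC_mult, sqrt_sqrt by lra; easy).
replace (RtoC (sqrt 2) * csqrt (sfac1 p) * csqrt (sfac2 p) * csqrt (sfac3 p) * csqrt (sfac4 p) *
  (RtoC (sqrt 2) * csqrt (sfac1 p) * csqrt (sfac2 p) * csqrt (sfac3 p) * csqrt (sfac4 p)) * fac1 p)
  with ((RtoC (sqrt 2) * RtoC (sqrt 2)) * (csqrt (sfac1 p) * csqrt (sfac1 p)) * (csqrt (sfac2 p) * csqrt (sfac2 p)) *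
   (csqrt (sfac3 p) * csqrt (sfac3 p)) * (csqrt (sfac4 p) * csqrt (sfac4 p)) * fac1 p) by ring.
rewrite E, !csqrt_sqr by assumption. ring.
Qed.

Lemma root_tail_neq_0 (p : C * C) : slit_tail p -> root_tail p <> 0.
Proof. intros [H2 [H3 H4]]. unfold root_tail.
apply Cmult_neq_0; [apply Cmult_neq_0|]; now apply csqrt_neq_0. Qed.

Lemma root_main_neq_0 (p : C * C) : slit (fac1 p) -> slit_tail p -> root_main p <> 0.
Proof. intros H1 Ht. apply Cmult_neq_0; [now apply csqrt_neq_0|now apply root_tail_neq_0]. Qed.

Lemma root_corner_neq_0 (p : C * C) : slit (- fac1 p) -> slit_tail p -> root_corner p <> 0.
Proof.
intros H1 Ht. apply Cmult_neq_0; [|now apply root_tail_neq_0].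
apply Cmult_neq_0; [apply Ci_neq_0|now apply csqrt_neq_0].
Qed.

Lemma root_cos_neq_0 (p : C * C) : slit_cos p -> root_cos p <> 0.
Proof.
intros [H1 [H2 [H3 H4]]]. unfold root_cos.
apply Cmult_neq_0; [apply Cmult_neq_0; [apply Cmult_neq_0; [apply Cmult_neq_0|]|]|]; try now apply csqrt_neq_0.
assert (K := sqrt_lt_R0 2 ltac:(lra)). intro E. apply RtoC_inj in E. lra.
Qed.

(** Both coordinates enter through the sum and the difference only, hence the common
form of all regularity statements: a point that moves with a parameter. *)
Section Regularity.

Context {T : UniformSpace} (f g : T -> C) (x : T)
  (Hf : @continuous T C_UniformSpace f x) (Hg : @continuous T C_UniformSpace g x).

Let Hs : @continuous T C_UniformSpace (fun t => f t + g t) x := Clim_plus f g _ _ Hf Hg.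
Let Hd : @continuous T C_UniformSpace (fun t => f t - g t) x := Clim_minus f g _ _ Hf Hg.

Lemma fac1_lim : @continuous T C_UniformSpace (fun t => fac1 (f t, g t)) x.
Proof. apply Clim_plus; [exact Hs|apply Clim_const]. Qed.
Lemma fac2_lim : @continuous T C_UniformSpace (fun t => fac2 (f t, g t)) x.
Proof. apply Clim_minus; [apply Clim_const|exact Hs]. Qed.
Lemma fac3_lim : @continuous T C_UniformSpace (fun t => fac3 (f t, g t)) x.
Proof. apply Clim_minus; [apply Clim_const|exact Hd]. Qed.
Lemma fac4_lim : @continuous T C_UniformSpace (fun t => fac4 (f t, g t)) x.
Proof. apply Clim_plus; [apply Clim_const|exact Hd]. Qed.

Lemma sfac1_lim : @continuous T C_UniformSpace (fun t => sfac1 (f t, g t)) x.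
Proof.
apply (Clim_comp Csin); [apply Cdiff_cont, Cdiff_Csin|].
apply Clim_minus; [apply Clim_const|]. apply Clim_mult; [exact Hd|apply Clim_const].
Qed.
Lemma sfac2_lim : @continuous T C_UniformSpace (fun t => sfac2 (f t, g t)) x.
Proof.
apply (Clim_comp Csin); [apply Cdiff_cont, Cdiff_Csin|].
apply Clim_plus; [apply Clim_const|]. apply Clim_mult; [exact Hd|apply Clim_const].
Qed.
Lemma sfac3_lim : @continuous T C_UniformSpace (fun t => sfac3 (f t, g t)) x.
Proof.
apply (Clim_comp Csin); [apply Cdiff_cont, Cdiff_Csin|].
apply Clim_minus; [apply Clim_const|]. apply Clim_mult; [exact Hs|apply Clim_const].
Qed.
Lemma sfac4_lim : @continuous T C_UniformSpace (fun t => sfac4 (f t, g t)) x.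
Proof.
apply (Clim_comp sinc); [apply Cdiff_cont, Cdiff_sinc|].
apply Clim_plus; [apply Clim_const|]. apply Clim_mult; [exact Hs|apply Clim_const].
Qed.

Lemma root_tail_lim : slit_tail (f x, g x) -> @continuous T C_UniformSpace (fun t => root_tail (f t, g t)) x.
Proof.
intros [H2 [H3 H4]]. apply Clim_mult; [apply Clim_mult|].
- apply (csqrt_lim (fun t => fac2 (f t, g t)) x fac2_lim H2).
- apply (csqrt_lim (fun t => fac3 (f t, g t)) x fac3_lim H3).
- apply (csqrt_lim (fun t => fac4 (f t, g t)) x fac4_lim H4).
Qed.

Lemma root_main_lim : slit (fac1 (f x, g x)) -> slit_tail (f x, g x) ->
  @continuous T C_UniformSpace (fun t => root_main (f t, g t)) x.
Proof. intros H1 Ht. apply Clim_mult; [apply (csqrt_lim (fun t => fac1 (f t, g t)) x fac1_lim H1)|now apply root_tail_lim]. Qed.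

Lemma root_corner_lim : slit (- fac1 (f x, g x)) -> slit_tail (f x, g x) ->
  @continuous T C_UniformSpace (fun t => root_corner (f t, g t)) x.
Proof.
intros H1 Ht. apply Clim_mult; [|now apply root_tail_lim]. apply Clim_mult; [apply Clim_const|].
apply (csqrt_lim (fun t => - fac1 (f t, g t)) x); [apply (Clim_opp (F := locally x)), fac1_lim|exact H1].
Qed.

Lemma root_cos_lim : slit_cos (f x, g x) -> @continuous T C_UniformSpace (fun t => root_cos (f t, g t)) x.
Proof.
intros [H1 [H2 [H3 H4]]]. apply Clim_mult; [apply Clim_mult; [apply Clim_mult; [apply Clim_mult; [apply Clim_const|]|]|]|].
- apply (csqrt_lim (fun t => sfac1 (f t, g t)) x sfac1_lim H1).
- apply (csqrt_lim (fun t => sfac2 (f t, g t)) x sfac2_lim H2).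
- apply (csqrt_lim (fun t => sfac3 (f t, g t)) x sfac3_lim H3).
- apply (csqrt_lim (fun t => sfac4 (f t, g t)) x sfac4_lim H4).
Qed.

End Regularity.

Section Differentiability.

Context (f g : C -> C) (x : C) (Hf : Cdiff f x) (Hg : Cdiff g x).

Let Hs : Cdiff (fun t => f t + g t) x := Cdiff_plus f g x Hf Hg.
Let Hd : Cdiff (fun t => f t - g t) x := Cdiff_minus f g x Hf Hg.

Lemma root_tail_diff : slit_tail (f x, g x) -> Cdiff (fun t => root_tail (f t, g t)) x.
Proof.
intros [H2 [H3 H4]]. apply Cdiff_mult; [apply Cdiff_mult|].
- apply (Cdiff_csqrt (fun t => fac2 (f t, g t))); [exact H2|]. apply Cdiff_minus; [apply Cdiff_const|exact Hs].
- apply (Cdiff_csqrt (fun t => fac3 (f t, g t))); [exact H3|]. apply Cdiff_minus; [apply Cdiff_const|exact Hd].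
- apply (Cdiff_csqrt (fun t => fac4 (f t, g t))); [exact H4|]. apply Cdiff_plus; [apply Cdiff_const|exact Hd].
Qed.

Lemma root_main_diff : slit (fac1 (f x, g x)) -> slit_tail (f x, g x) -> Cdiff (fun t => root_main (f t, g t)) x.
Proof.
intros H1 Ht. apply Cdiff_mult; [|now apply root_tail_diff].
apply (Cdiff_csqrt (fun t => fac1 (f t, g t))); [exact H1|]. apply Cdiff_plus; [exact Hs|apply Cdiff_const].
Qed.

Lemma root_cos_diff : slit_cos (f x, g x) -> Cdiff (fun t => root_cos (f t, g t)) x.
Proof.
intros [H1 [H2 [H3 H4]]]. apply Cdiff_mult; [apply Cdiff_mult; [apply Cdiff_mult; [apply Cdiff_mult; [apply Cdiff_const|]|]|]|].
- apply (Cdiff_csqrt (fun t => sfac1 (f t, g t))); [exact H1|].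
  apply (Cdiff_comp (fun t => RtoC (PI / 4) - (f t - g t) / 2) Csin); [apply Cdiff_Csin|].
  apply Cdiff_minus; [apply Cdiff_const|]. apply Cdiff_mult; [exact Hd|apply Cdiff_const].
- apply (Cdiff_csqrt (fun t => sfac2 (f t, g t))); [exact H2|].
  apply (Cdiff_comp (fun t => RtoC (PI / 4) + (f t - g t) / 2) Csin); [apply Cdiff_Csin|].
  apply Cdiff_plus; [apply Cdiff_const|]. apply Cdiff_mult; [exact Hd|apply Cdiff_const].
- apply (Cdiff_csqrt (fun t => sfac3 (f t, g t))); [exact H3|].
  apply (Cdiff_comp (fun t => RtoC (PI / 4) - (f t + g t) / 2) Csin); [apply Cdiff_Csin|].
  apply Cdiff_minus; [apply Cdiff_const|]. apply Cdiff_mult; [exact Hs|apply Cdiff_const].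
- apply (Cdiff_csqrt (fun t => sfac4 (f t, g t))); [exact H4|].
  apply (Cdiff_comp (fun t => RtoC (PI / 4) + (f t + g t) / 2) sinc); [apply Cdiff_sinc|].
  apply Cdiff_plus; [apply Cdiff_const|]. apply Cdiff_mult; [exact Hs|apply Cdiff_const].
Qed.

End Differentiability.

Lemma slit_open2 (p : C * C) (h : C * C -> C) : C2cont h p -> slit (h p) -> @locally C2 p (fun q => slit (h q)).
Proof. apply (slit_open (T := C2)). Qed.

Lemma slit_fac1_open (p : C * C) : slit (fac1 p) -> @locally C2 p (fun q => slit (fac1 q)).
Proof.
apply slit_open2. apply (continuous_ext (T := C2) (U := C_UniformSpace) (fun q => fac1 (fst q, snd q))); [now intros [? ?]|].
apply (fac1_lim (T := C2)); [apply continuous_fst|apply continuous_snd].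
Qed.

Lemma slit_tail_open (p : C * C) : slit_tail p -> @locally C2 p slit_tail.
Proof.
intros [H2 [H3 H4]]. repeat apply filter_and; apply slit_open2; try assumption.
- apply (continuous_ext (T := C2) (U := C_UniformSpace) (fun q => fac2 (fst q, snd q))); [now intros [? ?]|].
  apply (fac2_lim (T := C2)); [apply continuous_fst|apply continuous_snd].
- apply (continuous_ext (T := C2) (U := C_UniformSpace) (fun q => fac3 (fst q, snd q))); [now intros [? ?]|].
  apply (fac3_lim (T := C2)); [apply continuous_fst|apply continuous_snd].
- apply (continuous_ext (T := C2) (U := C_UniformSpace) (fun q => fac4 (fst q, snd q))); [now intros [? ?]|].
  apply (fac4_lim (T := C2)); [apply continuous_fst|apply continuous_snd].
Qed.

Lemma slit_cos_open (p : C * C) : slit_cos p -> @locally C2 p slit_cos.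
Proof.
intros [H1 [H2 [H3 H4]]]. repeat apply filter_and; apply slit_open2; try assumption.
- apply (continuous_ext (T := C2) (U := C_UniformSpace) (fun q => sfac1 (fst q, snd q))); [now intros [? ?]|].
  apply (sfac1_lim (T := C2)); [apply continuous_fst|apply continuous_snd].
- apply (continuous_ext (T := C2) (U := C_UniformSpace) (fun q => sfac2 (fst q, snd q))); [now intros [? ?]|].
  apply (sfac2_lim (T := C2)); [apply continuous_fst|apply continuous_snd].
- apply (continuous_ext (T := C2) (U := C_UniformSpace) (fun q => sfac3 (fst q, snd q))); [now intros [? ?]|].
  apply (sfac3_lim (T := C2)); [apply continuous_fst|apply continuous_snd].
- apply (continuous_ext (T := C2) (U := C_UniformSpace) (fun q => sfac4 (fst q, snd q))); [now intros [? ?]|].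
  apply (sfac4_lim (T := C2)); [apply continuous_fst|apply continuous_snd].
Qed.

(** The reflection of one coordinate at pi/2 permutes the factors. *)
Lemma root_main_reflect_x (x y : C) : root_main (RtoC PI - x, y) = root_main (x, y).
Proof.
unfold root_main, root_tail, fac1, fac2, fac3, fac4. simpl fst. simpl snd.
replace (RtoC PI - x + y + RtoC (PI / 2)) with (RtoC (3 * PI / 2) - (x - y)).
2: { replace (3 * PI / 2)%R with (PI + PI / 2)%R by field. rewrite RtoC_plus. ring. }
replace (RtoC (5 * PI / 2) - (RtoC PI - x + y)) with (RtoC (3 * PI / 2) + (x - y)).
2: { replace (5 * PI / 2)%R with (PI + 3 * PI / 2)%R by field. rewrite RtoC_plus. ring. }
replace (RtoC (3 * PI / 2) - (RtoC PI - x - y)) with (x + y + RtoC (PI / 2)).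
2: { replace (3 * PI / 2)%R with (PI + PI / 2)%R by field. rewrite RtoC_plus. ring. }
replace (RtoC (3 * PI / 2) + (RtoC PI - x - y)) with (RtoC (5 * PI / 2) - (x + y)).
2: { replace (5 * PI / 2)%R with (PI + 3 * PI / 2)%R by field. rewrite RtoC_plus. ring. }
ring.
Qed.

Lemma root_main_swap (x y : C) : root_main (x, y) = root_main (y, x).
Proof.
unfold root_main, root_tail, fac1, fac2, fac3, fac4. simpl fst. simpl snd.
replace (y + x) with (x + y) by ring. replace (RtoC (3 * PI / 2) - (y - x)) with (RtoC (3 * PI / 2) + (x - y)) by ring.
replace (RtoC (3 * PI / 2) + (y - x)) with (RtoC (3 * PI / 2) - (x - y)) by ring. ring.
Qed.

Lemma radicand_reflect (b1 b2 : bool) (p : C * C) : radicand (reflect b1 b2 p) = radicand p.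
Proof.
destruct p as [x y]. unfold reflect, radicand. destruct b1, b2; simpl fst; simpl snd; field.
Qed.

(** * The branches on the domains *)

Section Branches.

Context (k : C) (a : C -> C) (hRe : (0 < Re k)%R) (hIm : (0 < Im k)%R) (ha : angular_branch k a).
Notation u := (ucoord k).

(** Only real values of x + y matter for the cut. *)
Lemma slit_fac1_real (x y : C) : (Im (x + y) = 0%R -> (- (PI / 2) < u x + u y)%R) -> slit (fac1 (x, y)).
Proof.
intros H E. unfold fac1 in *. simpl fst in *. simpl snd in *.
rewrite re_plus. rewrite im_plus in E.
assert (E' : Im (x + y) = 0%R) by (simpl in E |- *; lra).
specialize (H E'). rewrite (Re_plus_real k) by exact E'. simpl. lra.
Qed.

Lemma slit_fac1_opp (x y : C) : (Im (x + y) = 0%R -> (u x + u y < - (PI / 2))%R) -> slit (- fac1 (x, y)).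
Proof.
intros H E. unfold fac1 in *. simpl fst in *. simpl snd in *.
rewrite im_opp, im_plus in E. rewrite re_opp, re_plus.
assert (E' : Im (x + y) = 0%R) by (simpl in E |- *; lra).
specialize (H E'). rewrite (Re_plus_real k) by exact E'. simpl. lra.
Qed.

Lemma slit_tail_real (x y : C) :
  (Im (x + y) = 0%R -> (u x + u y < 5 * PI / 2)%R) ->
  (Im (x - y) = 0%R -> (- (3 * PI / 2) < u x - u y < 3 * PI / 2)%R) -> slit_tail (x, y).
Proof.
intros Hs Hd. repeat split; intros E; unfold fac2, fac3, fac4 in *; simpl fst in *; simpl snd in *.
- assert (E' : Im (x + y) = 0%R) by (simpl in E |- *; lra).
  specialize (Hs E'). replace (Re (RtoC (5 * PI / 2) - (x + y))) with (5 * PI / 2 - Re (x + y))%R by (simpl; ring).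
  rewrite (Re_plus_real k) by exact E'. lra.
- assert (E' : Im (x - y) = 0%R) by (simpl in E |- *; lra).
  specialize (Hd E'). replace (Re (RtoC (3 * PI / 2) - (x - y))) with (3 * PI / 2 - Re (x - y))%R by (simpl; ring).
  rewrite (Re_minus_real k) by exact E'. lra.
- assert (E' : Im (x - y) = 0%R) by (simpl in E |- *; lra).
  specialize (Hd E'). rewrite re_plus, (Re_minus_real k) by exact E'. simpl. lra.
Qed.

Lemma Re_half (v : R) (w : C) : Re (RtoC v + w / 2) = (v + Re w / 2)%R.
Proof. destruct w as [w1 w2]. simpl. field. Qed.
Lemma Im_half (v : R) (w : C) : Im (RtoC v + w / 2) = (Im w / 2)%R.
Proof. destruct w as [w1 w2]. simpl. field. Qed.
Lemma Re_half_minus (v : R) (w : C) : Re (RtoC v - w / 2) = (v - Re w / 2)%R.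
Proof. destruct w as [w1 w2]. simpl. field. Qed.
Lemma Im_half_minus (v : R) (w : C) : Im (RtoC v - w / 2) = (- Im w / 2)%R.
Proof. destruct w as [w1 w2]. simpl. field. Qed.

(** On [dom_U_closed] the only candidates for zeros of cos (x - y) are on the edge, where
they are singular points. *)
Lemma slit_cos_dom_U (x y : C) : dom_U_closed k a (x, y) -> slit_cos (x, y) /\ slit_tail (x, y).
Proof.
intros H. apply (dom_U_closed_iff k a hRe hIm ha) in H. destruct H as [[Hx Hy] Hns].
rewrite (singular_edge_cases k a hRe hIm ha) in Hns.
assert (Hpi := PI_RGT_0). assert (Bx := Re_bounds k x). assert (By := Re_bounds k y).
assert (Hd : Im (x - y) = 0%R -> (- (PI / 2) < u x - u y < PI / 2)%R).
{ intros E. split.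
  - destruct (Req_dec (u x - u y) (- (PI / 2))) as [E'|E']; [exfalso|lra].
    apply Hns. split; [left; left; lra|]. right. split; [exact E|]. rewrite E', cos_neg. apply cos_PI2.
  - destruct (Req_dec (u x - u y) (PI / 2)) as [E'|E']; [exfalso|lra].
    apply Hns. split; [right; left; lra|]. right. split; [exact E|]. rewrite E'. apply cos_PI2. }
split; [repeat split|].
- unfold sfac1. simpl fst. simpl snd. apply slit_Csin.
  + rewrite Re_half_minus. change (Re (x - y)) with (Re x - Re y)%R. lra.
  + rewrite Im_half_minus, Re_half_minus. intros E. assert (E' : Im (x - y) = 0%R) by lra.
    specialize (Hd E'). rewrite (Re_minus_real k) by exact E'. lra.
- unfold sfac2. simpl fst. simpl snd. apply slit_Csin.
  + rewrite Re_half. change (Re (x - y)) with (Re x - Re y)%R. lra.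
  + rewrite Im_half, Re_half. intros E. assert (E' : Im (x - y) = 0%R) by lra.
    specialize (Hd E'). rewrite (Re_minus_real k) by exact E'. lra.
- unfold sfac3. simpl fst. simpl snd. apply slit_Csin.
  + rewrite Re_half_minus, re_plus. lra.
  + rewrite Im_half_minus, Re_half_minus. intros E. assert (E' : Im (x + y) = 0%R) by lra.
    rewrite (Re_plus_real k) by exact E'. lra.
- unfold sfac4. simpl fst. simpl snd. apply slit_sinc.
  rewrite Re_half, re_plus. apply Rabs_def1; lra.
- apply slit_tail_real; [lra|]. intros E. specialize (Hd E). lra.
Qed.

(** As one coordinate is in M+ or on m+, the sum u x + u y is at least -pi/2, with equality
only on the edge, where the point is singular if x + y is real. *)
Lemma slit_dom_W (x y : C) : dom_W_closed k a (x, y) -> slit (fac1 (x, y)) /\ slit_tail (x, y).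
Proof.
intros H. apply (dom_W_closed_iff k a hRe hIm ha) in H. destruct H as [[H0 [Hx Hy]] Hns].
rewrite (singular_edge_cases k a hRe hIm ha) in Hns. assert (Hpi := PI_RGT_0). split.
- apply slit_fac1_real. intros E.
  destruct (Req_dec (u x + u y) (- (PI / 2))) as [E'|E']; [exfalso|lra].
  apply Hns. split; [unfold edge; lra|]. left. split; [exact E|]. rewrite E', cos_neg. apply cos_PI2.
- apply slit_tail_real; intros _; lra.
Qed.

Lemma dom_W_closed_of_dom_W (p : C * C) : dom_W k a p -> dom_W_closed k a p.
Proof.
destruct p as [x y]. rewrite (dom_W_iff k a hRe hIm ha), (dom_W_closed_iff k a hRe hIm ha). intros H.
split; [lra|]. apply (interior_regular k a hRe hIm ha); lra.
Qed.

Lemma dom_U_closed_of_dom_U (p : C * C) : dom_U k a p -> dom_U_closed k a p.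
Proof.
assert (Hpi := PI_RGT_0). destruct p as [x y]. rewrite (dom_U_iff k a hRe hIm ha), (dom_U_closed_iff k a hRe hIm ha). intros H.
split; [lra|]. apply (interior_regular k a hRe hIm ha); lra.
Qed.

(** Here u x + u y lies in [-pi, -pi/2) and |u x - u y| < pi/2, so that no cosine vanishes. *)
Lemma m_minus_regular (x y : C) : u x = (- (PI / 2))%R -> (- (PI / 2) <= u y < 0)%R -> ~ singular_edge k a (x, y).
Proof.
intros Hx Hy H. apply (singular_edge_cases k a hRe hIm ha) in H. destruct H as [_ [[_ H]|[_ H]]].
- assert (cos (u x + u y) < 0)%R; [|lra]. rewrite <- cos_neg. apply cos_lt_0; lra.
- assert (0 < cos (u x - u y))%R; [|lra]. apply cos_gt_0; lra.
Qed.

Lemma slit_corner (x y : C) : u x = (- (PI / 2))%R -> u y = (- (PI / 2))%R ->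
  slit (- fac1 (x, y)) /\ slit_tail (x, y) /\ slit_cos (x, y).
Proof.
intros Hx Hy. assert (Hpi := PI_RGT_0). split; [|split].
- apply slit_fac1_opp. intros _. lra.
- apply slit_tail_real; intros _; lra.
- apply slit_cos_dom_U. apply (dom_U_closed_iff k a hRe hIm ha). split; [lra|]. apply m_minus_regular; lra.
Qed.

(** ** Determination of signs by rays to a reference point *)

(** A segment in rectified coordinates.  It stays in every product of slabs that contains
its ends, unlike a segment of the plane. *)
Definition ray (v : R) (x y : C) (t : R) : C * C :=
  (upoint k ((1 - t) * v + t * u x) (t * Im x), upoint k ((1 - t) * v + t * u y) (t * Im y)).

Lemma ray_0 (v : R) (x y : C) : ray v x y 0 = (RtoC v, RtoC v).
Proof.
unfold ray. rewrite !Rmult_0_l. unfold upoint. rewrite gcurve_0.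
apply injective_projections; apply injective_projections; simpl; ring.
Qed.

Lemma ray_1 (v : R) (x y : C) : ray v x y 1 = (x, y).
Proof.
unfold ray. rewrite !Rmult_1_l. replace ((1 - 1) * v + u x)%R with (u x) by ring.
replace ((1 - 1) * v + u y)%R with (u y) by ring. now rewrite !upoint_ucoord.
Qed.

Lemma ray_cont (v : R) (x y : C) (t : R) : @continuous R_UniformSpace C2 (ray v x y) t.
Proof.
assert (L : forall p q : R, continuous (fun t => ((1 - t) * p + t * q)%R) t).
{ intros p q. apply (ex_derive_continuous (fun t => ((1 - t) * p + t * q)%R)). auto_derive. easy. }
assert (L' : forall q : R, continuous (fun t => (t * q)%R) t).
{ intros q. apply (ex_derive_continuous (fun t => (t * q)%R)). auto_derive. easy. }
apply C2_pair_lim; apply upoint_lim; first [apply L|apply L'].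
Qed.

Lemma roots_agree (D : C * C -> Prop) (r1 r2 : C * C -> C) (v : R) (x y : C) :
  (forall t, unit_seg t -> D (ray v x y t)) ->
  @continuous_on C2 C_UniformSpace D r1 -> @continuous_on C2 C_UniformSpace D r2 ->
  (forall p, D p -> r1 p * r1 p = r2 p * r2 p /\ r2 p <> 0) ->
  r1 (RtoC v, RtoC v) = r2 (RtoC v, RtoC v) -> r1 (x, y) = r2 (x, y).
Proof.
intros HD H1 H2 Hsq H0. rewrite <- (ray_1 v x y).
apply (path_root (fun t => r1 (ray v x y t)) (fun t => r2 (ray v x y t))).
- apply (continuous_on_comp_cont (T := R_UniformSpace) (S := C2) (U := C_UniformSpace) unit_seg D (ray v x y) r1); [exact HD|intros t _; apply ray_cont|exact H1].
- apply (continuous_on_comp_cont (T := R_UniformSpace) (S := C2) (U := C_UniformSpace) unit_seg D (ray v x y) r2); [exact HD|intros t _; apply ray_cont|exact H2].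
- intros t Ht. now apply Hsq, HD.
- now rewrite ray_0.
Qed.

Lemma ray_dom_W (x y : C) (t : R) : dom_W_closed k a (x, y) -> unit_seg t -> dom_W_closed k a (ray (PI / 2) x y t).
Proof.
intros H [Ht0 Ht1]. destruct (Req_dec t 1) as [->|Ht]; [now rewrite ray_1|].
apply (dom_W_closed_iff k a hRe hIm ha) in H. destruct H as [[H0 [Hx Hy]] _].
assert (Hpi := PI_RGT_0). unfold ray. apply (dom_W_closed_iff k a hRe hIm ha).
rewrite !ucoord_upoint.
assert (Cx : (- (PI / 2) < (1 - t) * (PI / 2) + t * u x <= PI / 2)%R) by nra.
assert (Cy : (- (PI / 2) < (1 - t) * (PI / 2) + t * u y <= PI / 2)%R) by nra.
split.
- split; [|lra]. destruct H0 as [H0|H0]; [left|right]; nra.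
- apply (interior_regular k a hRe hIm ha); rewrite ucoord_upoint; lra.
Qed.

Definition positive (z : C) : Prop := exists r : R, (0 < r)%R /\ z = RtoC r.

Lemma positive_mult (z w : C) : positive z -> positive w -> positive (z * w).
Proof.
intros [r [Hr ->]] [s [Hs ->]]. exists (r * s)%R. split; [now apply Rmult_lt_0_compat|]. now rewrite RtoC_mult.
Qed.

Lemma positive_csqrt (z : C) : positive z -> positive (csqrt z).
Proof. intros [r [Hr ->]]. exists (sqrt r). split; [now apply sqrt_lt_R0|now apply csqrt_pos]. Qed.

Lemma positive_sqr_1 (z : C) : positive z -> z * z = 1 -> z = 1.
Proof.
intros [r [Hr ->]] H. rewrite <- RtoC_mult in H. apply RtoC_inj in H. f_equal. nra.
Qed.

Lemma Csin_R (v : R) : Csin (RtoC v) = RtoC (sin v).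
Proof. unfold Csin. simpl. unfold cosh, sinh. rewrite Ropp_0, exp_0. apply injective_projections; simpl; field. Qed.

Lemma positive_sinc (v : R) : (Rabs v < PI)%R -> positive (sinc (RtoC v)).
Proof.
intros H. unfold sinc. destruct (Ceq_dec (RtoC v) 0) as [E|E]; [exists 1%R; split; [lra|easy]|].
assert (Hv : v <> 0%R) by (intros ->; now apply E).
exists (sin v / v)%R. rewrite Csin_R, <- RtoC_div by easy. split; [|easy].
apply Rabs_def2 in H. destruct (Rtotal_order v 0) as [K|[K|K]]; [|easy|].
- replace (sin v / v)%R with (- sin v / - v)%R by (field; easy).
  apply Rdiv_lt_0_compat; [|lra]. assert (sin v < 0)%R by (apply sin_lt_0_var; lra). lra.
- apply Rdiv_lt_0_compat; [|lra]. apply sin_gt_0; lra.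
Qed.

Lemma positive_root_cos (v : R) : (- (3 * PI / 4) < v < PI / 4)%R -> positive (root_cos (RtoC v, RtoC v)).
Proof.
intros Hv. assert (Hpi := PI_RGT_0).
assert (E1 : (RtoC v - RtoC v) / 2 = RtoC 0) by (unfold Cminus; rewrite Cplus_opp_r; unfold Cdiv; ring).
assert (E2 : (RtoC v + RtoC v) / 2 = RtoC v) by (field).
unfold root_cos, sfac1, sfac2, sfac3, sfac4. simpl fst. simpl snd. rewrite E1, E2.
rewrite <- !RtoC_plus, <- !RtoC_minus, !Csin_R.
apply positive_mult; [apply positive_mult; [apply positive_mult; [apply positive_mult|]|]|]; try apply positive_csqrt.
- exists (sqrt 2). split; [apply sqrt_lt_R0; lra|easy].
- exists (sin (PI / 4 - 0)). split; [apply sin_gt_0; lra|easy].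
- exists (sin (PI / 4 + 0)). split; [apply sin_gt_0; lra|easy].
- exists (sin (PI / 4 - v)). split; [apply sin_gt_0; lra|easy].
- apply positive_sinc. apply Rabs_def1; lra.
Qed.

(** ** Comparison with the kernel *)

Context (K : C * C -> C) (hK : K_branch k a K).

Let k_neq_0 : k <> 0.
Proof. intro E. rewrite E in hRe. simpl in hRe. lra. Qed.

Lemma K_sqr (x y : C) : (u x = 0 /\ u y = 0)%R \/ (u x = - (PI / 2) /\ u y = - (PI / 2))%R ->
  K (x, y) * K (x, y) * (k * k * (Ccos (x + y) * Ccos (x - y))) = 1.
Proof.
intros H. rewrite <- K_radicandE. replace (K (x, y) * K (x, y)) with (K (x, y) ^ 2) by (simpl; ring).
apply hK. destruct H as [[Hx Hy]|[Hx Hy]]; [left|right]; split; simpl;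
  rewrite ?(Gamma_iff k a hRe hIm ha), ?(m_minus_iff k a hRe hIm ha); assumption.
Qed.

(** Both sides are continuous square roots of the same function; at the origin both are
1 / k, since the product of the two principal roots there is positive with square 1. *)
Lemma K_Gamma (x y : C) : u x = 0%R -> u y = 0%R ->
  K (x, y) = / (k * root_cos (x, y) * csqrt (fac1 (x, y))).
Proof.
intros Hx Hy. assert (Hpi := PI_RGT_0).
set (D := fun p : C2 => (u (fst p) = 0 /\ u (snd p) = 0)%R).
assert (HD : forall p, D p -> slit_cos p /\ slit (fac1 p)).
{ intros [p q] [Hp Hq]. simpl in Hp, Hq. split.
  - apply slit_cos_dom_U. apply dom_U_closed_of_dom_U. apply (dom_U_iff k a hRe hIm ha). lra.
  - apply slit_dom_W. apply dom_W_closed_of_dom_W. apply (dom_W_iff k a hRe hIm ha). lra. }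
assert (Hnz : forall p, D p -> k * root_cos p * csqrt (fac1 p) <> 0).
{ intros p Hp. destruct (HD p Hp) as [S1 S2].
  apply Cmult_neq_0; [apply Cmult_neq_0; [exact k_neq_0|now apply root_cos_neq_0]|now apply csqrt_neq_0]. }
apply (roots_agree D K (fun p => / (k * root_cos p * csqrt (fac1 p))) 0 x y).
- intros t _. unfold D, ray. simpl. rewrite !ucoord_upoint, Hx, Hy. lra.
- apply (continuous_on_sub (T := C2) (U := C_UniformSpace) (prodset (Gamma a) (Gamma a))); [|apply hK].
  intros [p q] [Hp Hq]. split; simpl; now apply (Gamma_iff k a hRe hIm ha).
- apply continuous_continuous_on. intros [p q] Hp. destruct (HD _ Hp) as [S1 S2].
  apply (Clim_inv (F := @locally C2 (p, q))); [now apply Hnz|]. apply Clim_mult; [apply Clim_mult; [apply Clim_const|]|].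
  + apply (filterlim_ext (fun t : C2 => root_cos (fst t, snd t))); [now intros [? ?]|].
    apply (root_cos_lim (T := C2) fst snd (p, q)); [apply continuous_fst|apply continuous_snd|exact S1].
  + apply (filterlim_ext (fun t : C2 => csqrt (fac1 (fst t, snd t)))); [now intros [? ?]|].
    apply (csqrt_lim (T := C2) (fun t => fac1 (fst t, snd t)) (p, q)); [|exact S2].
    apply (fac1_lim (T := C2)); [apply continuous_fst|apply continuous_snd].
- intros [p q] Hp. destruct (HD _ Hp) as [S1 S2]. specialize (Hnz _ Hp).
  assert (E1 := K_sqr p q (or_introl Hp)). assert (E2 := root_cos_sqr _ S1). simpl in E2.
  assert (E3 := csqrt_sqr _ S2).
  split; [|intro E0; cbv beta in E0; apply C1_nz; rewrite <- (Cinv_r _ Hnz), E0; ring].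
  set (M := k * root_cos (p, q) * csqrt (fac1 (p, q))) in *.
  assert (EM : M * M = k * k * (Ccos (p + q) * Ccos (p - q))).
  { unfold M. rewrite <- E2.
    replace (k * root_cos (p, q) * csqrt (fac1 (p, q)) * (k * root_cos (p, q) * csqrt (fac1 (p, q))))
      with (k * k * (root_cos (p, q) * root_cos (p, q) * (csqrt (fac1 (p, q)) * csqrt (fac1 (p, q))))) by ring.
    now rewrite E3. }
  rewrite <- EM in E1. replace (K (p, q) * K (p, q)) with (K (p, q) * K (p, q) * (M * M) / (M * M)) by (field; easy).
  rewrite E1. field. easy.
- replace (K (RtoC 0, RtoC 0)) with (/ k) by (symmetry; apply hK). f_equal.
  assert (H00 : D (RtoC 0, RtoC 0)) by (unfold D; simpl; rewrite !ucoord_R; lra).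
  destruct (HD _ H00) as [S1 S2].
  assert (E : root_cos (RtoC 0, RtoC 0) * csqrt (fac1 (RtoC 0, RtoC 0)) = 1).
  { apply positive_sqr_1.
    - apply positive_mult; [apply positive_root_cos; lra|]. apply positive_csqrt. exists (PI / 2)%R.
      split; [lra|]. unfold fac1; simpl fst; simpl snd. ring.
    - assert (E2 := root_cos_sqr _ S1). assert (E3 := csqrt_sqr _ S2). simpl fst in E2. simpl snd in E2.
      replace (RtoC 0 + RtoC 0) with (RtoC 0) in E2 by ring. replace (RtoC 0 - RtoC 0) with (RtoC 0) in E2 by ring.
      rewrite Ccos_R, cos_0 in E2. set (O := (RtoC 0, RtoC 0)) in *.
      replace (root_cos O * csqrt (fac1 O) * (root_cos O * csqrt (fac1 O)))
        with (root_cos O * root_cos O * (csqrt (fac1 O) * csqrt (fac1 O))) by ring.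
      rewrite E3, E2. ring. }
  rewrite <- Cmult_assoc, E. ring.
Qed.
End Branches.

Section Corner.

Context (k : C) (a : C -> C) (hRe : (0 < Re k)%R) (hIm : (0 < Im k)%R) (ha : angular_branch k a).
Notation u := (ucoord k).
Context (K : C * C -> C) (hK : K_branch k a K).

Let k_neq_0 : k <> 0.
Proof. intro E. rewrite E in hRe. simpl in hRe. lra. Qed.

(** As on Gamma x Gamma, but at the reference point the product of the principal roots is
that of [root_cos] and of the root of the opposite of [fac1].  The factor i is the effect
of turning the root of [fac1] above the branch point, and it accounts for the value -i/k. *)
Lemma K_corner (x y : C) : u x = (- (PI / 2))%R -> u y = (- (PI / 2))%R ->
  K (x, y) = / (k * root_cos (x, y) * (Ci * csqrt (- fac1 (x, y)))).
Proof.
intros Hx Hy. assert (Hpi := PI_RGT_0).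
set (D := fun p : C2 => (u (fst p) = - (PI / 2) /\ u (snd p) = - (PI / 2))%R).
assert (HD : forall p, D p -> slit_cos p /\ slit (- fac1 p)).
{ intros [p q] [Hp Hq]. simpl in Hp, Hq. split; now apply (slit_corner k a hRe hIm ha). }
assert (Hnz : forall p, D p -> k * root_cos p * (Ci * csqrt (- fac1 p)) <> 0).
{ intros p Hp. destruct (HD p Hp) as [S1 S2].
  apply Cmult_neq_0; [apply Cmult_neq_0; [exact k_neq_0|now apply root_cos_neq_0]|].
  apply Cmult_neq_0; [apply Ci_neq_0|now apply csqrt_neq_0]. }
apply (roots_agree k D K (fun p => / (k * root_cos p * (Ci * csqrt (- fac1 p)))) (- (PI / 2)) x y).
- intros t _. unfold D, ray. simpl fst. simpl snd. rewrite !ucoord_upoint, Hx, Hy. lra.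
- apply (continuous_on_sub (T := C2) (U := C_UniformSpace) (prodset (m_minus a) (m_minus a))); [|apply hK].
  intros [p q] [Hp Hq]. split; simpl; now apply (m_minus_iff k a hRe hIm ha).
- apply continuous_continuous_on. intros [p q] Hp. destruct (HD _ Hp) as [S1 S2].
  apply (Clim_inv (F := @locally C2 (p, q))); [now apply Hnz|].
  apply Clim_mult; [apply Clim_mult; [apply Clim_const|]|apply Clim_mult; [apply Clim_const|]].
  + apply (filterlim_ext (fun t : C2 => root_cos (fst t, snd t))); [now intros [? ?]|].
    apply (root_cos_lim (T := C2) fst snd (p, q)); [apply continuous_fst|apply continuous_snd|exact S1].
  + apply (filterlim_ext (fun t : C2 => csqrt (- fac1 (fst t, snd t)))); [now intros [? ?]|].
    apply (csqrt_lim (T := C2) (fun t => - fac1 (fst t, snd t)) (p, q)); [|exact S2].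
    apply (Clim_opp (F := @locally C2 (p, q))). apply (fac1_lim (T := C2)); [apply continuous_fst|apply continuous_snd].
- intros [p q] Hp. destruct (HD _ Hp) as [S1 S2]. specialize (Hnz _ Hp).
  assert (E1 := K_sqr k a hRe hIm ha K hK p q (or_intror Hp)). assert (E2 := root_cos_sqr _ S1). simpl fst in E2; simpl snd in E2.
  assert (E3 := csqrt_sqr _ S2).
  split; [|intro E0; cbv beta in E0; apply C1_nz; rewrite <- (Cinv_r _ Hnz), E0; ring].
  set (M := k * root_cos (p, q) * (Ci * csqrt (- fac1 (p, q)))) in *.
  assert (EM : M * M = k * k * (Ccos (p + q) * Ccos (p - q))).
  { unfold M. rewrite <- E2.
    replace (k * root_cos (p, q) * (Ci * csqrt (- fac1 (p, q))) * (k * root_cos (p, q) * (Ci * csqrt (- fac1 (p, q)))))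
      with (k * k * (root_cos (p, q) * root_cos (p, q) * ((Ci * Ci) * (csqrt (- fac1 (p, q)) * csqrt (- fac1 (p, q)))))) by ring.
    rewrite E3, Ci2. ring. }
  rewrite <- EM in E1. replace (K (p, q) * K (p, q)) with (K (p, q) * K (p, q) * (M * M) / (M * M)) by (field; easy).
  rewrite E1. field. easy.
- assert (Eref : (- (PI / 2), - (PI / 2)) = (RtoC (- (PI / 2)), RtoC (- (PI / 2)))).
  { now rewrite RtoC_opp, C_PI2. }
  assert (EK : K (RtoC (- (PI / 2)), RtoC (- (PI / 2))) = - Ci / k) by (rewrite <- Eref; apply hK).
  rewrite EK.
  assert (H00 : D (RtoC (- (PI / 2)), RtoC (- (PI / 2)))) by (unfold D; simpl fst; simpl snd; rewrite !ucoord_R; lra).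
  destruct (HD _ H00) as [S1 S2]. set (O := (RtoC (- (PI / 2)), RtoC (- (PI / 2)))) in *.
  assert (Ef : - fac1 O = RtoC (PI / 2)).
  { unfold fac1, O. simpl fst. simpl snd. rewrite RtoC_opp. ring. }
  assert (E : root_cos O * csqrt (- fac1 O) = 1).
  { apply positive_sqr_1.
    - apply positive_mult; [apply positive_root_cos; lra|]. apply positive_csqrt. exists (PI / 2)%R.
      split; [lra|exact Ef].
    - assert (E2 := root_cos_sqr _ S1). assert (E3 := csqrt_sqr _ S2). unfold O in E2 at 4 5 6 7. simpl fst in E2. simpl snd in E2.
      rewrite <- RtoC_plus, <- RtoC_minus, !Ccos_R in E2.
      replace (- (PI / 2) + - (PI / 2))%R with (- PI)%R in E2 by field.
      replace (- (PI / 2) - - (PI / 2))%R with 0%R in E2 by field.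
      rewrite cos_neg, cos_PI, cos_0, <- RtoC_mult in E2.
      replace (root_cos O * csqrt (- fac1 O) * (root_cos O * csqrt (- fac1 O)))
        with (root_cos O * root_cos O * (csqrt (- fac1 O) * csqrt (- fac1 O))) by ring.
      rewrite E3. replace (root_cos O * root_cos O * - fac1 O) with (- (root_cos O * root_cos O * fac1 O)) by ring.
      rewrite E2. apply injective_projections; simpl; ring. }
  replace (k * root_cos O * (Ci * csqrt (- fac1 O))) with (k * Ci * (root_cos O * csqrt (- fac1 O))) by ring.
  rewrite E. assert (N := Ci_neq_0).
  replace (- Ci / k) with (- (Ci * Ci) / (k * Ci)) by (field; repeat split; assumption).
  rewrite Ci2. field; repeat split; assumption.
Qed.

(** ** Continuation along the bypass *)

Definition exp_i_PI4 : C := (1 + Ci) / RtoC (sqrt 2).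

(** The branch of the square root whose cut is the negative imaginary half-line, so that
it can be followed through the upper half-plane. *)
Definition csqrt_up (z : C) : C := exp_i_PI4 * csqrt (- Ci * z).

Lemma sqrt2_neq_0 : RtoC (sqrt 2) <> 0.
Proof. assert (H := sqrt_lt_R0 2 ltac:(lra)). intro E. apply RtoC_inj in E. lra. Qed.

Lemma exp_i_PI4_sqr : exp_i_PI4 * exp_i_PI4 = Ci.
Proof.
assert (N := sqrt2_neq_0). unfold exp_i_PI4.
assert (E : RtoC (sqrt 2) * RtoC (sqrt 2) = 2) by (rewrite <- RtoC_mult, sqrt_sqrt by lra; easy).
replace ((1 + Ci) / RtoC (sqrt 2) * ((1 + Ci) / RtoC (sqrt 2))) with ((1 + Ci) * (1 + Ci) / (RtoC (sqrt 2) * RtoC (sqrt 2))) by (field; easy).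
rewrite E. replace ((1 + Ci) * (1 + Ci)) with (1 + 2 * Ci + Ci * Ci) by ring. rewrite Ci2. field.
Qed.

Lemma csqrt_imag (x s : R) : (0 < x)%R -> (s = 1 \/ s = - 1)%R ->
  csqrt (RtoC s * Ci * RtoC x) = RtoC (sqrt x) * (1 + RtoC s * Ci) / RtoC (sqrt 2).
Proof.
intros Hx Hs. unfold csqrt.
assert (Em : Cmod (RtoC s * Ci * RtoC x) = x).
{ rewrite !Cmod_mult, Cmod_Ci, !Cmod_R, (Rabs_right x) by lra.
  destruct Hs as [-> | ->]; [rewrite Rabs_right by lra|rewrite Rabs_left by lra]; ring. }
rewrite Em. replace (Re (RtoC s * Ci * RtoC x)) with 0%R by (simpl; ring).
rewrite Rplus_0_r, sqrt_mult by lra. assert (N := sqrt2_neq_0).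
assert (Nx : RtoC (sqrt x) <> 0).
{ assert (H := sqrt_lt_R0 x Hx). intro E. apply RtoC_inj in E. lra. }
rewrite RtoC_mult.
replace (RtoC s * Ci * RtoC x + RtoC x) with (RtoC (sqrt x) * RtoC (sqrt x) * (1 + RtoC s * Ci)).
2: { rewrite <- RtoC_mult, sqrt_sqrt by lra. ring. }
field. now split.
Qed.

Lemma sqrt2_sqr : RtoC (sqrt 2) * RtoC (sqrt 2) = 2.
Proof. rewrite <- RtoC_mult, sqrt_sqrt by lra; easy. Qed.

Lemma csqrt_up_pos (x : R) : (0 < x)%R -> csqrt_up (RtoC x) = csqrt (RtoC x).
Proof.
intros Hx. assert (Em : RtoC (- 1) = - (1)) by (apply injective_projections; simpl; ring). unfold csqrt_up, exp_i_PI4. replace (- Ci * RtoC x) with (RtoC (- 1) * Ci * RtoC x) by (rewrite Em; ring).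
rewrite csqrt_imag, csqrt_pos by tauto. assert (N := sqrt2_neq_0).
replace ((1 + Ci) / RtoC (sqrt 2) * (RtoC (sqrt x) * (1 + RtoC (- 1) * Ci) / RtoC (sqrt 2)))
  with (RtoC (sqrt x) * (1 - Ci * Ci) / (RtoC (sqrt 2) * RtoC (sqrt 2))) by (rewrite Em; field; easy).
rewrite sqrt2_sqr, Ci2. field.
Qed.

Lemma csqrt_up_neg (x : R) : (0 < x)%R -> csqrt_up (- RtoC x) = Ci * csqrt (RtoC x).
Proof.
intros Hx. unfold csqrt_up, exp_i_PI4. replace (- Ci * - RtoC x) with (RtoC 1 * Ci * RtoC x) by ring.
rewrite csqrt_imag, csqrt_pos by tauto. assert (N := sqrt2_neq_0).
replace ((1 + Ci) / RtoC (sqrt 2) * (RtoC (sqrt x) * (1 + RtoC 1 * Ci) / RtoC (sqrt 2)))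
  with (RtoC (sqrt x) * (1 + 2 * Ci + Ci * Ci) / (RtoC (sqrt 2) * RtoC (sqrt 2))) by (field; easy).
rewrite sqrt2_sqr, Ci2. field.
Qed.

Lemma csqrt_up_sqr (z : C) : slit (- Ci * z) -> csqrt_up z * csqrt_up z = z.
Proof.
intros H. unfold csqrt_up.
replace (exp_i_PI4 * csqrt (- Ci * z) * (exp_i_PI4 * csqrt (- Ci * z))) with ((exp_i_PI4 * exp_i_PI4) * (csqrt (- Ci * z) * csqrt (- Ci * z))) by ring.
rewrite csqrt_sqr, exp_i_PI4_sqr by easy. replace (Ci * (- Ci * z)) with (- (Ci * Ci) * z) by ring. rewrite Ci2. ring.
Qed.

Definition root_bypass (eps t : R) : C := csqrt_up (fac1 (bypass eps t)) * root_tail (bypass eps t).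

Lemma bypass_sum (eps t : R) :
  fst (bypass eps t) + snd (bypass eps t) = ((PI * cos (PI * t))%R, (2 * eps * sin (PI * t))%R).
Proof. unfold bypass. simpl fst. simpl snd. apply injective_projections; simpl; field. Qed.

Lemma bypass_diff (eps t : R) : fst (bypass eps t) - snd (bypass eps t) = 0.
Proof. unfold bypass. simpl fst. simpl snd. ring. Qed.

Lemma sin_PI_t (t : R) : unit_seg t -> (0 <= sin (PI * t))%R /\ (sin (PI * t) = 0%R -> t = 0%R \/ t = 1%R).
Proof.
intros [H0 H1]. assert (Hpi := PI_RGT_0). split.
- apply sin_ge_0; nra.
- intros E. destruct (Req_dec t 0) as [|N0]; [now left|]. destruct (Req_dec t 1) as [|N1]; [now right|].
  assert (0 < sin (PI * t))%R by (apply sin_gt_0; nra). lra.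
Qed.

(** x + y + pi/2 has positive imaginary part inside the bypass and is a non-zero real
number at its ends, so it never meets the lower imaginary half-line. *)
Lemma slit_bypass (eps t : R) : (0 < eps)%R -> unit_seg t ->
  slit (- Ci * fac1 (bypass eps t)) /\ slit_tail (bypass eps t).
Proof.
intros He Ht. destruct (sin_PI_t t Ht) as [Hs0 Hs]. assert (Hpi := PI_RGT_0).
unfold slit_tail, fac1, fac2, fac3, fac4. rewrite bypass_sum, bypass_diff.
assert (Hc := COS_bound (PI * t)).
repeat split; intros E; simpl in E |- *; try lra.
- assert (0 <= eps * sin (PI * t))%R by (apply Rmult_le_pos; lra).
  destruct (Req_dec (sin (PI * t)) 0) as [E0|E0]; [|nra].
  exfalso. destruct (Hs E0) as [-> | ->].
  + rewrite Rmult_0_r, cos_0 in E. lra.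
  + rewrite Rmult_1_r, cos_PI in E. lra.
- nra.
Qed.
End Corner.

Notation ref_in := (RtoC (PI / 2), RtoC (PI / 2)).
Notation ref_out := (RtoC (- (PI / 2)), RtoC (- (PI / 2))).

Lemma bypass_0 (eps : R) : bypass eps 0 = ref_in.
Proof.
unfold bypass. rewrite Rmult_0_r, cos_0, sin_0, !Rmult_0_r, !Rmult_1_r.
apply injective_projections; apply injective_projections; simpl; ring.
Qed.

Lemma bypass_1 (eps : R) : bypass eps 1 = ref_out.
Proof.
unfold bypass. rewrite Rmult_1_r, cos_PI, sin_PI, !Rmult_0_r.
apply injective_projections; apply injective_projections; simpl; ring.
Qed.

Lemma bypass_cont (eps t : R) : @continuous R_UniformSpace C2 (bypass eps) t.
Proof.
assert (L : @continuous R_UniformSpace C_UniformSpace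
  (fun t => RtoC (PI / 2 * cos (PI * t)) + Ci * RtoC (eps * sin (PI * t))) t).
{ apply Clim_plus; [|apply Clim_mult; [apply Clim_const|]]; apply Clim_RtoC.
  - apply (ex_derive_continuous (fun t => (PI / 2 * cos (PI * t))%R)). auto_derive. easy.
  - apply (ex_derive_continuous (fun t => (eps * sin (PI * t))%R)). auto_derive. easy. }
exact (C2_pair_lim _ _ _ _ L L).
Qed.

Lemma root_bypass_cont (eps t : R) : (0 < eps)%R -> unit_seg t ->
  @continuous R_UniformSpace C_UniformSpace (root_bypass eps) t.
Proof.
intros He Ht. destruct (slit_bypass eps t He Ht) as [S1 S2].
assert (L1 : @continuous R_UniformSpace C_UniformSpace (fun t => fst (bypass eps t)) t).
{ apply (continuous_comp (U := R_UniformSpace) (V := C2) (W := C_UniformSpace) (bypass eps) fst); [apply bypass_cont|apply continuous_fst]. }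
assert (L2 : @continuous R_UniformSpace C_UniformSpace (fun t => snd (bypass eps t)) t).
{ apply (continuous_comp (U := R_UniformSpace) (V := C2) (W := C_UniformSpace) (bypass eps) snd); [apply bypass_cont|apply continuous_snd]. }
apply Clim_mult.
- apply Clim_mult; [apply Clim_const|].
  apply (csqrt_lim (T := R_UniformSpace) (fun t => - Ci * fac1 (bypass eps t)) t); [|exact S1].
  apply (Clim_mult (F := locally t)); [apply Clim_const|].
  apply (filterlim_ext (fun t => fac1 (fst (bypass eps t), snd (bypass eps t)))); [now intro t0; destruct (bypass eps t0)|].
  exact (fac1_lim (T := R_UniformSpace) _ _ t L1 L2).
- apply (filterlim_ext (fun t => root_tail (fst (bypass eps t), snd (bypass eps t)))); [now intro t0; destruct (bypass eps t0)|].
  exact (root_tail_lim (T := R_UniformSpace) _ _ t L1 L2 S2).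
Qed.

Lemma root_bypass_sqr (eps t : R) : (0 < eps)%R -> unit_seg t ->
  root_bypass eps t * root_bypass eps t = radicand (bypass eps t) /\ root_bypass eps t <> 0.
Proof.
intros He Ht. destruct (slit_bypass eps t He Ht) as [S1 S2].
assert (E1 := csqrt_up_sqr _ S1). assert (E2 := root_tail_sqr _ S2). unfold root_bypass.
split.
- rewrite radicand_fac.
  replace (csqrt_up (fac1 (bypass eps t)) * root_tail (bypass eps t) * (csqrt_up (fac1 (bypass eps t)) * root_tail (bypass eps t)))
    with ((csqrt_up (fac1 (bypass eps t)) * csqrt_up (fac1 (bypass eps t))) * (root_tail (bypass eps t) * root_tail (bypass eps t))) by ring.
  rewrite E1, E2. ring.
- apply Cmult_neq_0; [|now apply root_tail_neq_0]. intro E. rewrite E in E1.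
  apply (slit_neq_0 _ S1). rewrite <- E1. ring.
Qed.

Lemma root_bypass_0 (eps : R) : root_bypass eps 0 = root_main ref_in.
Proof.
assert (Hpi := PI_RGT_0). unfold root_bypass, root_main. rewrite bypass_0. f_equal.
replace (fac1 ref_in) with (RtoC (3 * PI / 2)).
- apply csqrt_up_pos. lra.
- unfold fac1. simpl fst. simpl snd. rewrite <- !RtoC_plus. f_equal. field.
Qed.

(** x + y + pi/2 is negative at the end of the bypass, where the root continued through
the upper half-plane is i times a positive number. *)
Lemma root_bypass_1 (eps : R) : root_bypass eps 1 = root_corner ref_out.
Proof.
assert (Hpi := PI_RGT_0). unfold root_bypass, root_corner. rewrite bypass_1. f_equal.
replace (fac1 ref_out) with (- RtoC (PI / 2)).
- replace (- - RtoC (PI / 2)) with (RtoC (PI / 2)) by ring. apply csqrt_up_neg. lra.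
- unfold fac1. simpl fst. simpl snd. rewrite RtoC_opp. ring.
Qed.

Lemma bypass_end (eps : R) (rho : R -> C) (sg : C) : (0 < eps)%R -> sg * sg = 1 ->
  @continuous_on R_UniformSpace C_UniformSpace unit_seg rho ->
  (forall t, unit_seg t -> rho t * rho t = radicand (bypass eps t)) ->
  rho 0%R = sg * root_main ref_in -> rho 1%R = sg * root_corner ref_out.
Proof.
intros He Hsg Hc Hs H0. rewrite <- (root_bypass_1 eps).
assert (Hsg0 : sg <> 0) by (intros ->; apply C1_nz; rewrite <- Hsg; ring).
apply (path_root rho (fun t => sg * root_bypass eps t)).
- exact Hc.
- intros t Ht. apply filterlim_within with (f := fun t => sg * root_bypass eps t).
  apply (Clim_mult (F := locally t)); [apply Clim_const|now apply root_bypass_cont].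
- intros t Ht. destruct (root_bypass_sqr eps t He Ht) as [E N]. split; [|now apply Cmult_neq_0].
  rewrite Hs by easy. rewrite <- E.
  replace (sg * root_bypass eps t * (sg * root_bypass eps t)) with ((sg * sg) * (root_bypass eps t * root_bypass eps t)) by ring.
  rewrite Hsg. ring.
- now rewrite root_bypass_0.
Qed.

Lemma reflect_ref_in (b1 b2 : bool) : reflect b1 b2 ref_in = ref_in.
Proof.
assert (E : PI - RtoC (PI / 2) = RtoC (PI / 2)) by (rewrite <- RtoC_minus; f_equal; field).
unfold reflect. destruct b1, b2; simpl fst; simpl snd; now rewrite ?E.
Qed.

Lemma reflect_reflect (b1 b2 : bool) (p : C * C) : reflect b1 b2 (reflect b1 b2 p) = p.
Proof.
assert (E : forall z : C, PI - (PI - z) = z) by (intro; ring).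
destruct p as [x y]. unfold reflect. destruct b1, b2; simpl fst; simpl snd; now rewrite ?E.
Qed.

Lemma reflect_cont (b1 b2 : bool) (p : C2) : @continuous C2 C2 (reflect b1 b2) p.
Proof.
assert (L : forall (b : bool) (h : C2 -> C), C2cont h p -> C2cont (fun q => if b then PI - h q else h q) p).
{ intros [|] h H; [|exact H]. apply (Clim_minus (F := @locally C2 p)); [apply Clim_const|exact H]. }
destruct p as [x y].
apply (C2_pair_lim (F := @locally C2 (x, y)) (fun q => if b1 then PI - fst q else fst q) (fun q => if b2 then PI - snd q else snd q)).
- apply (L b1 fst). apply continuous_fst.
- apply (L b2 snd). apply continuous_snd.
Qed.

(** * The branch on the stencil set *)

Section Canonical.

Context (k : C) (a : C -> C) (hRe : (0 < Re k)%R) (hIm : (0 < Im k)%R) (ha : angular_branch k a).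
Notation u := (ucoord k).

Lemma corner_reflect (b1 b2 : bool) (p : C * C) : corner a false false p <-> corner a b1 b2 (reflect b1 b2 p).
Proof.
assert (Hpi := PI_RGT_0). destruct p as [x y]. unfold reflect. simpl fst. simpl snd.
rewrite !(corner_iff k a hRe hIm ha). destruct b1, b2; rewrite ?ucoord_R_minus; lra.
Qed.

Lemma root_main_continuous : @continuous_on C2 C_UniformSpace (dom_W_closed k a) root_main.
Proof.
apply continuous_continuous_on. intros [x y] H. destruct (slit_dom_W k a hRe hIm ha x y H) as [S1 S2].
apply (filterlim_ext (fun t : C2 => root_main (fst t, snd t))); [now intros [? ?]|].
apply (root_main_lim (T := C2) fst snd (x, y)); [apply continuous_fst|apply continuous_snd|exact S1|exact S2].
Qed.

Lemma root_corner_continuous : @continuous_on C2 C_UniformSpace (corner a false false) root_corner.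
Proof.
apply continuous_continuous_on. intros [x y] H. apply (corner_iff k a hRe hIm ha) in H. destruct H as [Hx Hy].
destruct (slit_corner k a hRe hIm ha x y Hx Hy) as [S1 [S2 _]].
apply (filterlim_ext (fun t : C2 => root_corner (fst t, snd t))); [now intros [? ?]|].
apply (root_corner_lim (T := C2) fst snd (x, y)); [apply continuous_fst|apply continuous_snd|exact S1|exact S2].
Qed.

(** The sign is that of the ratio at (pi/2, pi/2).  It propagates along rays over
[dom_W_closed], along the reflected bypasses to the reference points, and along rays again
over the corners. *)
Lemma root_branch_unique (r : C * C -> C) : root_branch k a r -> exists sg : C, sg * sg = 1 /\
  (forall p, dom_W_closed k a p -> r p = sg * root_main p) /\
  (forall b1 b2 p, corner a false false p -> r (reflect b1 b2 p) = sg * root_corner p).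
Proof.
intros [Hsq [Hc Hcor]]. assert (Hpi := PI_RGT_0).
assert (Hsq' : forall p, stencil_set k a p -> r p * r p = radicand p).
{ intros p Hp. rewrite <- (Hsq p Hp). simpl. ring. }
assert (Hin : dom_W_closed k a ref_in).
{ apply (dom_W_closed_iff k a hRe hIm ha). rewrite !ucoord_R. split; [lra|].
  apply (interior_regular k a hRe hIm ha); rewrite ucoord_R; lra. }
destruct (slit_dom_W k a hRe hIm ha _ _ Hin) as [S1 S2].
set (sg := r ref_in / root_main ref_in).
assert (Nm := root_main_neq_0 _ S1 S2).
assert (Hsg : sg * sg = 1).
{ unfold sg. replace (r ref_in / root_main ref_in * (r ref_in / root_main ref_in))
    with (r ref_in * r ref_in / (root_main ref_in * root_main ref_in)) by (field; easy).
  rewrite (Hsq' ref_in (or_introl Hin)), root_main_sqr by assumption. apply Cinv_r.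
  rewrite <- root_main_sqr by assumption. now apply Cmult_neq_0. }
assert (Hsg0 : sg <> 0) by (intro E; apply C1_nz; rewrite <- Hsg, E; ring).
assert (Eref : r ref_in = sg * root_main ref_in) by (unfold sg; field; easy).
exists sg. split; [exact Hsg|]. split.
- intros [x y] Hp. apply (roots_agree k (dom_W_closed k a) r (fun p => sg * root_main p) (PI / 2)).
  + intros t Ht. now apply (ray_dom_W k a hRe hIm ha).
  + exact Hc.
  + intros p Hp'. apply Clim_mult; [apply Clim_const|]. now apply root_main_continuous.
  + intros [x' y'] Hp'. destruct (slit_dom_W k a hRe hIm ha _ _ Hp') as [T1 T2].
    split; [|apply Cmult_neq_0; [easy|now apply root_main_neq_0]].
    rewrite Hsq' by (now left).
    replace (sg * root_main (x', y') * (sg * root_main (x', y'))) with ((sg * sg) * (root_main (x', y') * root_main (x', y'))) by ring.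
    rewrite Hsg, root_main_sqr by assumption. ring.
  + exact Eref.
- intros b1 b2 [x y] Hp. destruct (Hcor b1 b2) as [Hcc [eps0 [He0 Hby]]].
  assert (Eout : r (reflect b1 b2 ref_out) = sg * root_corner ref_out).
  { destruct (Hby (eps0 / 2)%R ltac:(lra)) as [rho [Hrc [Hrs [Hr0 Hr1]]]].
    rewrite bypass_1 in Hr1. rewrite <- Hr1. apply (bypass_end (eps0 / 2)); [lra|easy|exact Hrc| |].
    - intros t Ht. rewrite <- (radicand_reflect b1 b2). specialize (Hrs t Ht).
      rewrite <- Hrs. simpl. ring.
    - rewrite Hr0, bypass_0, reflect_ref_in. exact Eref. }
  apply (roots_agree k (corner a false false) (fun p => r (reflect b1 b2 p)) (fun p => sg * root_corner p) (- (PI / 2))).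
  + intros t _. apply (corner_iff k a hRe hIm ha) in Hp. destruct Hp as [Hx Hy]. unfold ray.
    apply (corner_iff k a hRe hIm ha). rewrite !ucoord_upoint, Hx, Hy. lra.
  + apply (continuous_on_comp_cont (T := C2) (S := C2) (U := C_UniformSpace) _ (corner a b1 b2) (reflect b1 b2) r).
    * intros p. apply corner_reflect.
    * intros p _. apply reflect_cont.
    * exact Hcc.
  + intros p Hp'. apply Clim_mult; [apply Clim_const|]. now apply root_corner_continuous.
  + intros [x' y'] Hp'. assert (Hq := Hp'). apply (corner_iff k a hRe hIm ha) in Hq as [Hx' Hy'].
    destruct (slit_corner k a hRe hIm ha x' y' Hx' Hy') as [T1 [T2 _]].
    split; [|apply Cmult_neq_0; [easy|now apply root_corner_neq_0]].
    rewrite Hsq'.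
    * rewrite radicand_reflect.
      replace (sg * root_corner (x', y') * (sg * root_corner (x', y'))) with ((sg * sg) * (root_corner (x', y') * root_corner (x', y'))) by ring.
      rewrite Hsg, root_corner_sqr by assumption. ring.
    * right. exists b1, b2. apply -> corner_reflect. exact Hp'.
  + exact Eout.
Qed.

(** A corner point is reflected into m- x m- first, because all four bypasses are
reflections of one. *)
Definition root_all (p : C * C) : C :=
  let far z := if Req_EM_T (u z) (3 * PI / 2) then true else false in
  let q := reflect (far (fst p)) (far (snd p)) p in
  if Req_EM_T (u (fst q)) (- (PI / 2)) then
    if Req_EM_T (u (snd q)) (- (PI / 2)) then root_corner q else root_main p
  else root_main p.

Lemma far_eq (v : R) (b : bool) : v = (if b then 3 * PI / 2 else - (PI / 2))%R ->
  (if Req_EM_T v (3 * PI / 2) then true else false) = b.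
Proof.
assert (Hpi := PI_RGT_0). intros E. destruct (Req_EM_T v (3 * PI / 2)), b; try reflexivity; exfalso; lra.
Qed.

Lemma root_all_corner (b1 b2 : bool) (p : C * C) : corner a false false p ->
  root_all (reflect b1 b2 p) = root_corner p.
Proof.
assert (Hpi := PI_RGT_0). destruct p as [x y]. intros Hp.
apply (corner_iff k a hRe hIm ha) in Hp as [Hx Hy].
assert (F1 : (if Req_EM_T (u (fst (reflect b1 b2 (x, y)))) (3 * PI / 2) then true else false) = b1).
{ apply far_eq. unfold reflect. simpl fst. destruct b1; rewrite ?ucoord_R_minus, Hx; lra. }
assert (F2 : (if Req_EM_T (u (snd (reflect b1 b2 (x, y)))) (3 * PI / 2) then true else false) = b2).
{ apply far_eq. unfold reflect. simpl snd. destruct b2; rewrite ?ucoord_R_minus, Hy; lra. }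
unfold root_all. cbv zeta. rewrite F1, F2, reflect_reflect. simpl fst. simpl snd. rewrite Hx, Hy.
now destruct (Req_EM_T (- (PI / 2)) (- (PI / 2))).
Qed.

Lemma root_all_main (p : C * C) : dom_W_closed k a p -> root_all p = root_main p.
Proof.
assert (Hpi := PI_RGT_0). destruct p as [x y]. intros Hp.
apply (dom_W_closed_iff k a hRe hIm ha) in Hp as [[H0 [Hx Hy]] _].
assert (F1 : (if Req_EM_T (u x) (3 * PI / 2) then true else false) = false) by (match goal with |- (if ?c then _ else _) = _ => destruct c end; [exfalso; lra|reflexivity]).
assert (F2 : (if Req_EM_T (u y) (3 * PI / 2) then true else false) = false) by (match goal with |- (if ?c then _ else _) = _ => destruct c end; [exfalso; lra|reflexivity]).
unfold root_all. cbv zeta. simpl fst. simpl snd. rewrite F1, F2. change (reflect false false (x, y)) with (x, y). simpl fst. simpl snd.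
destruct (Req_EM_T (u x) (- (PI / 2))) as [E1|E1]; [|reflexivity].
destruct (Req_EM_T (u y) (- (PI / 2))) as [E2|E2]; [|reflexivity].
exfalso. lra.
Qed.

Lemma root_all_branch : root_branch k a root_all.
Proof.
assert (Hpi := PI_RGT_0). repeat split.
- intros p [Hp|[b1 [b2 Hp]]].
  + rewrite root_all_main by easy. destruct p as [x y]. destruct (slit_dom_W k a hRe hIm ha _ _ Hp) as [S1 S2].
    rewrite <- root_main_sqr by assumption. simpl. ring.
  + rewrite <- (reflect_reflect b1 b2 p) in Hp |- *. apply corner_reflect in Hp.
    rewrite root_all_corner by easy. rewrite radicand_reflect.
    destruct (reflect b1 b2 p) as [x y]. apply (corner_iff k a hRe hIm ha) in Hp as [Hx Hy].
    destruct (slit_corner k a hRe hIm ha x y Hx Hy) as [S1 [S2 _]].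
    rewrite <- root_corner_sqr by assumption. simpl. ring.
- apply (continuous_on_eq (T := C2) (U := C_UniformSpace) _ root_main); [intros p Hp; symmetry; now apply root_all_main|].
  exact root_main_continuous.
- apply (continuous_on_eq (T := C2) (U := C_UniformSpace) _ (fun p => root_corner (reflect b1 b2 p))).
  + intros p Hp. rewrite <- (reflect_reflect b1 b2 p) in Hp. apply corner_reflect in Hp.
    rewrite <- (root_all_corner b1 b2) by easy. now rewrite reflect_reflect.
  + apply (continuous_on_comp_cont (T := C2) (S := C2) (U := C_UniformSpace) _ (corner a false false) (reflect b1 b2) root_corner).
    * intros p Hp. rewrite <- (reflect_reflect b1 b2 p) in Hp. now apply corner_reflect in Hp.
    * intros p _. apply reflect_cont.
    * exact root_corner_continuous.
- exists 1%R. split; [lra|]. intros eps He. exists (root_bypass eps). repeat split.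
  + intros t Ht. apply filterlim_within with (f := root_bypass eps). apply root_bypass_cont; [lra|exact Ht].
  + intros t Ht. rewrite radicand_reflect. destruct (root_bypass_sqr eps t ltac:(lra) Ht) as [E _].
    rewrite <- E. simpl. ring.
  + rewrite bypass_0, reflect_ref_in, root_bypass_0. symmetry. apply root_all_main.
    apply (dom_W_closed_iff k a hRe hIm ha). rewrite !ucoord_R. split; [lra|].
    apply (interior_regular k a hRe hIm ha); rewrite ucoord_R; lra.
  + rewrite bypass_1, root_bypass_1. symmetry. apply root_all_corner.
    apply (corner_iff k a hRe hIm ha). rewrite !ucoord_R. split; reflexivity.
Qed.

End Canonical.

(** * Slices of functions of two variables *)

Lemma slice_x_cont (y x : C) : @continuous C_UniformSpace C2 (fun x => (x, y)) x.
Proof. apply (C2_pair_lim (F := @locally C_UniformSpace x) (fun w => w) (fun _ => y)); [apply Ccont_id|apply Clim_const]. Qed.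

Lemma slice_y_cont (x y : C) : @continuous C_UniformSpace C2 (fun y => (x, y)) y.
Proof. apply (C2_pair_lim (F := @locally C_UniformSpace y) (fun _ => x) (fun w => w)); [apply Clim_const|apply Ccont_id]. Qed.

Lemma slice_x (D : C * C -> Prop) (V : C * C -> C) (y : C) : @continuous_on C2 C_UniformSpace D V ->
  @continuous_on C_UniformSpace C_UniformSpace (fun x => D (x, y)) (fun x => V (x, y)).
Proof.
intros H. apply (continuous_on_comp_cont (T := C_UniformSpace) (S := C2) (U := C_UniformSpace) _ D (fun x => (x, y)) V); [easy| |exact H].
intros x _. apply slice_x_cont.
Qed.

Lemma slice_y (D : C * C -> Prop) (V : C * C -> C) (x : C) : @continuous_on C2 C_UniformSpace D V ->
  @continuous_on C_UniformSpace C_UniformSpace (fun y => D (x, y)) (fun y => V (x, y)).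
Proof.
intros H. apply (continuous_on_comp_cont (T := C_UniformSpace) (S := C2) (U := C_UniformSpace) _ D (fun y => (x, y)) V); [easy| |exact H].
intros y _. apply slice_y_cont.
Qed.

Definition swap (p : C * C) : C * C := (snd p, fst p).

Lemma swap_cont (p : C2) : @continuous C2 C2 swap p.
Proof.
destruct p as [x y]. apply (C2_pair_lim (F := @locally C2 (x, y)) snd fst); [apply continuous_snd|apply continuous_fst].
Qed.

Lemma C2cont_fst (p : C2) : C2cont fst p.
Proof. apply continuous_fst. Qed.

Lemma C2cont_snd (p : C2) : C2cont snd p.
Proof. apply continuous_snd. Qed.

Lemma locally_C2_prod (P Q : C -> Prop) (x y : C) : @locally C_UniformSpace x P -> @locally C_UniformSpace y Q ->
  @locally C2 (x, y) (fun p => P (fst p) /\ Q (snd p)).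
Proof.
intros HP HQ. apply filter_and.
- exact (C2cont_fst (x, y) _ HP).
- exact (C2cont_snd (x, y) _ HQ).
Qed.

Lemma locally_closed_disc (P : C -> Prop) (x : C) : @locally C_UniformSpace x P ->
  exists r, (0 < r)%R /\ forall x', (Cmod (x' - x) <= r)%R -> P x'.
Proof.
intros H. apply locally_C_iff in H. destruct H as [d [Hd H]].
exists (d / 2)%R. split; [lra|]. intros x' Hx'. apply H. lra.
Qed.

Lemma C2diff_open (P Q : C -> Prop) (V : C * C -> C) :
  (forall x, P x -> @locally C_UniformSpace x P) -> (forall y, Q y -> @locally C_UniformSpace y Q) ->
  (forall x y, P x -> Q y -> C2cont V (x, y) /\ Cdiff (fun x => V (x, y)) x /\ Cdiff (fun y => V (x, y)) y) ->
  forall x y, P x -> Q y -> C2diff V (x, y).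
Proof.
intros HP HQ H x y Hx Hy.
destruct (locally_closed_disc P x (HP x Hx)) as [r1 [Hr1 H1]].
destruct (locally_closed_disc Q y (HQ y Hy)) as [r2 [Hr2 H2]].
assert (R1 := Rmin_l r1 r2). assert (R2 := Rmin_r r1 r2).
apply (Osgood V x y (Rmin r1 r2)); [now apply Rmin_pos|].
intros x' y' Hx' Hy'. apply H; [apply H1|apply H2]; lra.
Qed.

Lemma analytic_on_partials (A : C * C -> Prop) (f : C * C -> C) (x y : C) : analytic_on A f -> A (x, y) ->
  (@locally C_UniformSpace x (fun x' => A (x', y)) -> Cdiff (fun x => f (x, y)) x) /\
  (@locally C_UniformSpace y (fun y' => A (x, y')) -> Cdiff (fun y => f (x, y)) y).
Proof.
intros [O [F [HO [HAO [HF E]]]]] HA.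
destruct (C2diff_partials F x y (HF _ (HAO _ HA))) as [Dx Dy].
split; intros Hl.
- apply (Cdiff_ext_loc (fun x => F (x, y))); [|exact Dx]. revert Hl. apply filter_imp. intros x' Hx'. now apply E.
- apply (Cdiff_ext_loc (fun y => F (x, y))); [|exact Dy]. revert Hl. apply filter_imp. intros y' Hy'. now apply E.
Qed.

(** The global form of [Cdiff_limit], in which y0 may lie on the boundary of P. *)
Lemma Cdiff_limit_on (V : C * C -> C) (P D : C -> Prop) (y0 : C) :
  (forall x, D x -> @locally C_UniformSpace x D) ->
  @continuous_on C2 C_UniformSpace (fun p => D (fst p) /\ (P (snd p) \/ snd p = y0)) V ->
  (forall x y, D x -> P y -> Cdiff (fun x => V (x, y)) x) ->
  (forall del, (0 < del)%R -> exists y, P y /\ (Cmod (y - y0) < del)%R) ->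
  forall x, D x -> Cdiff (fun x => V (x, y0)) x.
Proof.
intros HD Hc Hd Hy x Hx. destruct (locally_closed_disc D x (HD x Hx)) as [r [Hr H]].
apply (Cdiff_limit V P x y0 r); try easy.
- intros x' Hx' Q HQ. specialize (Hc (x', y0) (conj (H x' Hx') (or_intror eq_refl)) Q HQ).
  assert (Hl : @locally C2 (x', y0) (fun p => D (fst p))).
  { exact (C2cont_fst (x', y0) _ (HD x' (H x' Hx'))). }
  unfold filtermap, within in Hc |- *. generalize (filter_and _ _ Hc Hl). apply filter_imp. tauto.
- intros x' y' Hx' HP. apply Hd; [now apply H|easy].
- replace (x - x) with (RtoC 0) by ring. now rewrite Cmod_0.
Qed.

(** * Uniqueness on products of strips *)

Section Tools.

Context (k : C) (a : C -> C) (hRe : (0 < Re k)%R) (hIm : (0 < Im k)%R) (ha : angular_branch k a).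
Notation u := (ucoord k).

(** Points near y0 on a chosen side of its curve, for passages to the limit. *)
Lemma approx_shift (P : C -> Prop) (y0 : C) (s v : R) : (0 < v)%R -> (s = 1 \/ s = - 1)%R ->
  (forall t, (0 < t < v)%R -> P (y0 + RtoC (s * t))) ->
  forall del, (0 < del)%R -> exists y, P y /\ (Cmod (y - y0) < del)%R.
Proof.
intros Hv Hs H del Hdel.
assert (M1 := Rmin_l v del). assert (M2 := Rmin_r v del). assert (Hm : (0 < Rmin v del)%R) by now apply Rmin_pos.
exists (y0 + RtoC (s * (Rmin v del / 2))). split; [apply H; lra|].
replace (y0 + RtoC (s * (Rmin v del / 2)) - y0) with (RtoC (s * (Rmin v del / 2))) by ring.
rewrite Cmod_R. destruct Hs as [-> | ->]; [rewrite Rabs_right|rewrite Rabs_left]; lra.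
Qed.

(** Boundary uniqueness up to the far edge, from which some points may be missing: the
values on the edge are limits of values inside. *)
Lemma strip_zero (f : C -> C) (N : C -> Prop) (al be : R) (z : C) : (al < be)%R ->
  @continuous_on C_UniformSpace C_UniformSpace (fun w => (al <= u w <= be)%R /\ N w) f ->
  (forall w, (al < u w <= be)%R -> N w) ->
  (forall w, (al < u w < be)%R -> Cdiff f w) ->
  (forall w, u w = be -> f w = 0) -> (al <= u z <= be)%R -> N z -> f z = 0.
Proof.
intros Hab Hc HN Hd H0 Hz HNz.
assert (Hin : forall w, (al < u w <= be)%R -> f w = 0).
{ intros w Hw. apply (boundary_uniqueness k a hRe hIm ha f al be); try assumption.
  apply (continuous_on_sub (T := C_UniformSpace) (U := C_UniformSpace) (fun w => (al <= u w <= be)%R /\ N w)); [|exact Hc].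
  intros v Hv. split; [lra|now apply HN]. }
destruct (Req_dec (u z) al) as [E|E]; [|apply Hin; lra].
apply (continuous_on_zero (T := C_UniformSpace) (fun w => (al <= u w <= be)%R /\ N w) f z Hc); [easy|].
intros e. assert (He := cond_pos e). set (t := (Rmin e (be - al) / 2)%R).
assert (M1 := Rmin_l e (be - al)). assert (M2 := Rmin_r e (be - al)).
assert (Hm : (0 < Rmin e (be - al))%R) by (apply Rmin_pos; lra).
assert (Hu : (al < u (z + RtoC t) <= be)%R) by (rewrite ucoord_plus_R, E; unfold t; lra).
exists (z + RtoC t). split; [split; [lra|now apply HN]|split; [|now apply Hin]].
apply ball_shift_R. rewrite Rabs_right; unfold t; lra.
Qed.

Definition in_T (z : C) : Prop := (- (PI / 2) < u z < 3 * PI / 2)%R.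

Lemma in_T_open (z : C) : in_T z -> @locally C_UniformSpace z in_T.
Proof. apply u_between_open. Qed.

(** For fixed y off m+ the three curves are removable in x by Painleve's theorem; for y on
m+ the slice is a limit of such slices. *)
Lemma separate_Cdiff (V : C * C -> C) :
  (forall x y, in_T x -> in_T y -> C2cont V (x, y)) ->
  (forall x y, in_T x -> in_T y -> u x <> 0%R -> u x <> (PI / 2)%R -> u x <> PI -> u y <> (PI / 2)%R ->
     Cdiff (fun x => V (x, y)) x) ->
  forall x y, in_T x -> in_T y -> Cdiff (fun x => V (x, y)) x.
Proof.
intros Hc Hd. assert (Hpi := PI_RGT_0).
assert (H1 : forall x y, in_T x -> in_T y -> u y <> (PI / 2)%R -> Cdiff (fun x => V (x, y)) x).
{ intros x y Hx Hy Hy2.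
  destruct (Req_dec (u x) 0) as [E0|E0]; [|destruct (Req_dec (u x) (PI / 2)) as [E1|E1];
    [|destruct (Req_dec (u x) PI) as [E2|E2]; [|now apply Hd]]].
  all: apply (Cdiff_curve k a hRe hIm ha).
  1, 3, 5: generalize (in_T_open x Hx); apply filter_imp; intros w Hw;
    apply (continuous_comp (U := C_UniformSpace) (V := C2) (W := C_UniformSpace) (fun x => (x, y)) V); [apply slice_x_cont|now apply Hc].
  all: assert (Hn : (u x - PI / 2 < u x < u x + PI / 2)%R) by lra;
    generalize (filter_and _ _ (in_T_open x Hx) (u_between_open k x _ _ Hn)); apply filter_imp;
    intros w [Hw Hw2] Hne; apply Hd; try assumption; lra. }
intros x y Hx Hy. destruct (Req_dec (u y) (PI / 2)) as [E|E]; [|now apply H1].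
apply (Cdiff_limit_on V (fun y => in_T y /\ u y <> (PI / 2)%R) in_T y).
- exact in_T_open.
- apply continuous_continuous_on. intros [x' y'] [Hx' Hy']. simpl in Hx', Hy'. apply Hc; [easy|].
  destruct Hy' as [[Hy' _]|Hy']; [easy|now subst].
- intros x' y' Hx' [Hy' Hn]. now apply H1.
- apply (approx_shift _ y 1 (PI / 2)); [lra|now left|]. intros t Ht. unfold in_T.
  rewrite !ucoord_plus_R, E. split; lra.
- exact Hx.
Qed.

Lemma singular_edge_reflect_x (x y : C) : singular_edge k a (RtoC PI - x, y) <-> singular_edge k a (x, y).
Proof.
rewrite !(singular_edge_iff k a hRe hIm ha), !Ccos_Ccos, Csin_PI_minus, ucoord_R_minus.
unfold edge. split; intros [H1 H2]; (split; [lra|exact H2]).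
Qed.

(** For x on m+ both sides are holomorphic in y, as limits of slices with x in M+, and
they agree for y in m+, which is a boundary curve of the strip. *)
Lemma reflection_spreads (F : C * C -> C) :
  @continuous_on C2 C_UniformSpace (dom_W_closed k a) F ->
  (forall x y, (0 <= u x < PI / 2)%R -> (- (PI / 2) < u y < PI / 2)%R -> Cdiff (fun y => F (x, y)) y) ->
  (forall x y, u x = (PI / 2)%R -> u y = (PI / 2)%R -> F (x, y) = F (RtoC PI - x, y)) ->
  forall x y, u x = (PI / 2)%R -> dom_W_closed k a (x, y) -> F (x, y) = F (RtoC PI - x, y).
Proof.
intros Hc Hd H0 x y Hx Hxy. assert (Hpi := PI_RGT_0).
assert (Hlim : forall x, u x = (PI / 2)%R -> forall y, (- (PI / 2) < u y < PI / 2)%R -> Cdiff (fun y => F (x, y)) y).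
{ intros x0 Hx0. apply (Cdiff_limit_on (fun p => F (swap p)) (fun x => (0 <= u x < PI / 2)%R) (fun y => (- (PI / 2) < u y < PI / 2)%R) x0).
  - intros y0. apply u_between_open.
  - apply (continuous_on_comp_cont (T := C2) (S := C2) (U := C_UniformSpace) _ (dom_W_closed k a) swap F).
    + intros [y' x'] [Hy' Hx']. simpl in Hy', Hx'. unfold swap. simpl.
      assert (Hux : (0 <= u x' <= PI / 2)%R) by (destruct Hx' as [Hx'|Hx']; [lra|subst; lra]).
      apply (dom_W_closed_iff k a hRe hIm ha). split; [lra|]. apply (interior_regular k a hRe hIm ha); lra.
    + intros p _. apply swap_cont.
    + exact Hc.
  - intros y' x' Hy' Hx'. exact (Hd x' y' Hx' Hy').
  - apply (approx_shift _ x0 (- 1) (PI / 2)); [lra|now right|]. intros t Ht. rewrite ucoord_plus_R, Hx0. lra. }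
assert (Hx' : u (RtoC PI - x) = (PI / 2)%R) by (rewrite ucoord_R_minus, Hx; lra).
apply (dom_W_closed_iff k a hRe hIm ha) in Hxy as [Hxy Hns].
assert (Hdom : forall w, (- (PI / 2) <= u w <= PI / 2)%R /\ ~ singular_edge k a (x, w) ->
  dom_W_closed k a (x, w) /\ dom_W_closed k a (RtoC PI - x, w)).
{ intros w [Hw Hw']. split; apply (dom_W_closed_iff k a hRe hIm ha).
  - split; [lra|easy].
  - rewrite singular_edge_reflect_x. split; [lra|easy]. }
apply Cminus_eq.
apply (strip_zero (fun y => F (x, y) - F (RtoC PI - x, y)) (fun y => ~ singular_edge k a (x, y)) (- (PI / 2)) (PI / 2)); try easy.
- lra.
- intros w Hw. apply Clim_minus.
  + apply (continuous_on_sub (T := C_UniformSpace) (U := C_UniformSpace) (fun w => dom_W_closed k a (x, w)) _ (fun w => F (x, w))); [|now apply slice_y|exact Hw].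
    intros v Hv. now apply Hdom.
  + apply (continuous_on_sub (T := C_UniformSpace) (U := C_UniformSpace) (fun w => dom_W_closed k a (RtoC PI - x, w)) _ (fun w => F (RtoC PI - x, w))); [|now apply slice_y|exact Hw].
    intros v Hv. now apply Hdom.
- intros w Hw. apply (interior_regular k a hRe hIm ha); lra.
- intros w Hw. apply Cdiff_minus; now apply Hlim.
- intros w Hw. rewrite H0 by assumption. apply Cplus_opp_r.
Qed.

(** For x on m- the slice in y vanishes on its boundary curve, hence near it.  So for those
y the slice in x vanishes on its boundary curve, hence on T.  Then the identity principle
applies in y. *)
Lemma corner_uniqueness (D : C * C -> C) :
  @continuous_on C2 C_UniformSpace (Omega_all_closed k a) D ->
  (forall x y, in_T x -> in_T y -> Cdiff (fun x => D (x, y)) x /\ Cdiff (fun y => D (x, y)) y) ->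
  (forall x y, u x = (- (PI / 2))%R -> u y = (- (PI / 2))%R -> D (x, y) = 0) ->
  forall x y, in_T x -> in_T y -> D (x, y) = 0.
Proof.
intros Hc Hd H0. assert (Hpi := PI_RGT_0).
assert (Hdom1 : forall x y, (- (PI / 2) <= u x < 3 * PI / 2)%R -> (- (PI / 2) <= u y < 0)%R ->
   ((- (PI / 2) < u y)%R \/ u x = (- (PI / 2))%R) -> Omega_all_closed k a (x, y)).
{ intros x y Hx Hy H. apply (Omega_all_closed_iff k a hRe hIm ha). split; [lra|].
  destruct (Req_dec (u x) (- (PI / 2))) as [E|E]; [now apply (m_minus_regular k a hRe hIm ha)|].
  apply (interior_regular k a hRe hIm ha); lra. }
assert (Hd1 : forall x, u x = (- (PI / 2))%R -> forall y, (- (PI / 2) < u y < 0)%R -> Cdiff (fun y => D (x, y)) y).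
{ intros x0 Hx0. apply (Cdiff_limit_on (fun p => D (swap p)) (fun x => (- (PI / 2) < u x < 0)%R) (fun y => (- (PI / 2) < u y < 0)%R) x0).
  - intros y0. apply u_between_open.
  - apply (continuous_on_comp_cont (T := C2) (S := C2) (U := C_UniformSpace) _ (Omega_all_closed k a) swap D).
    + intros [y' x'] [Hy' Hx']. simpl in Hy', Hx'. unfold swap. simpl. apply Hdom1; [|lra|left; lra].
      destruct Hx' as [Hx'|Hx']; [lra|subst; lra].
    + intros p _. apply swap_cont.
    + exact Hc.
  - intros y' x' Hy' Hx'. assert (Tx : in_T x') by (unfold in_T; lra). assert (Ty : in_T y') by (unfold in_T; lra).
    exact (proj2 (Hd x' y' Tx Ty)).
  - apply (approx_shift _ x0 1 (PI / 2)); [lra|now left|]. intros t Ht. rewrite ucoord_plus_R, Hx0. lra. }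
assert (Z1 : forall x y, u x = (- (PI / 2))%R -> (- (PI / 2) <= u y < 0)%R -> D (x, y) = 0).
{ intros x y Hx Hy. apply (boundary_uniqueness_left k a hRe hIm ha (fun y => D (x, y)) (- (PI / 2)) 0); try assumption.
  - apply (continuous_on_sub (T := C_UniformSpace) (U := C_UniformSpace) (fun w => Omega_all_closed k a (x, w))); [|now apply slice_y].
    intros w Hw. apply Hdom1; [lra|easy|now right].
  - now apply Hd1.
  - intros w Hw. now apply H0. }
assert (Z2 : forall x y, in_T x -> (- (PI / 2) < u y < 0)%R -> D (x, y) = 0).
{ intros x y Hx Hy. unfold in_T in Hx.
  apply (boundary_uniqueness_left k a hRe hIm ha (fun x => D (x, y)) (- (PI / 2)) (3 * PI / 2)); [| | |lra].
  - apply (continuous_on_sub (T := C_UniformSpace) (U := C_UniformSpace) (fun w => Omega_all_closed k a (w, y))); [|now apply slice_x].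
    intros w Hw. apply Hdom1; [lra|lra|left; lra].
  - intros w Hw. assert (Tx : in_T w) by (unfold in_T; lra). assert (Ty : in_T y) by (unfold in_T; lra).
    exact (proj1 (Hd w y Tx Ty)).
  - intros w Hw. apply Z1; lra. }
intros x y Hx Hy. unfold in_T in Hy.
set (y0 := y + RtoC (- (PI / 4) - u y)).
assert (Hy0 : u y0 = (- (PI / 4))%R) by (unfold y0; rewrite ucoord_plus_R; ring).
(* y0 lies in the middle of the slab on which D is already known to vanish *)
apply (zero_along_segment (fun y => D (x, y)) y0 y).
- intros t Ht. replace (y0 + RtoC t * (y - y0)) with (y + RtoC ((1 - t) * (- (PI / 4) - u y))).
  2: { unfold y0. rewrite RtoC_mult, RtoC_minus. ring. }
  assert (HT : in_T (y + RtoC ((1 - t) * (- (PI / 4) - u y)))).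
  { unfold in_T. rewrite ucoord_plus_R. nra. }
  generalize (in_T_open _ HT). apply filter_imp. intros w Hw. now apply Hd.
- assert (Hn : (- (PI / 2) < u y0 < 0)%R) by lra.
  generalize (u_between_open k y0 _ _ Hn). apply filter_imp. intros w Hw. now apply Z2.
Qed.

End Tools.

(** * From ASF to StF *)

Section Forward.

Context (k : C) (a : C -> C) (hRe : (0 < Re k)%R) (hIm : (0 < Im k)%R) (ha : angular_branch k a).
Context (K : C * C -> C) (hK : K_branch k a K).
Context (W U : C * C -> C) (H1 : ASF1 k a W) (H2 : ASF2 a W) (H3 : ASF3 k a K W U).
Notation u := (ucoord k).
Notation inT := (in_T k).

Let k_neq_0 : k <> 0.
Proof. intro E. rewrite E in hRe. simpl in hRe. lra. Qed.

(** V as W sees it, and as U sees it: with U = - i K W and K = 1 / (k [root_cos] times the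
root of [fac1]) the latter root cancels, and what remains is defined on M- x M-. *)
Definition V_of_W (p : C * C) : C := W p / root_main p.
Definition V_of_U (p : C * C) : C := Ci * k * U p * (root_cos p / root_tail p).

Lemma V_of_W_cont : @continuous_on C2 C_UniformSpace (dom_W_closed k a) V_of_W.
Proof.
intros [x y] Hp. destruct (slit_dom_W k a hRe hIm ha x y Hp) as [S1 S2].
apply Clim_div; [now apply root_main_neq_0| |].
- now apply (proj2 H1).
- now apply (root_main_continuous k a hRe hIm ha).
Qed.

Lemma V_of_U_cont : @continuous_on C2 C_UniformSpace (dom_U_closed k a) V_of_U.
Proof.
intros [x y] Hp. destruct (slit_cos_dom_U k a hRe hIm ha x y Hp) as [S1 S2].
apply Clim_mult; [apply Clim_mult; [apply Clim_const|now apply H3]|].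
apply Clim_div; [now apply root_tail_neq_0| |]; apply (filterlim_within (T := C2) (U := C_UniformSpace)).
- apply (filterlim_ext (fun t : C2 => root_cos (fst t, snd t))); [now intros [? ?]|].
  apply (root_cos_lim (T := C2) fst snd (x, y)); [apply continuous_fst|apply continuous_snd|exact S1].
- apply (filterlim_ext (fun t : C2 => root_tail (fst t, snd t))); [now intros [? ?]|].
  apply (root_tail_lim (T := C2) fst snd (x, y)); [apply continuous_fst|apply continuous_snd|exact S2].
Qed.

Lemma V_of_W_diff (x y : C) : dom_W k a (x, y) ->
  ((0 < u x \/ 0 <= u y)%R -> Cdiff (fun x => V_of_W (x, y)) x) /\
  ((0 <= u x \/ 0 < u y)%R -> Cdiff (fun y => V_of_W (x, y)) y).
Proof.
intros Hp. destruct (analytic_on_partials _ _ x y (proj1 H1) Hp) as [Dx Dy].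
destruct (slit_dom_W k a hRe hIm ha x y (dom_W_closed_of_dom_W k a hRe hIm ha _ Hp)) as [S1 S2].
apply (dom_W_iff k a hRe hIm ha) in Hp as [H0 [Hx Hy]].
split; intros Hc; apply Cdiff_div; try now apply root_main_neq_0.
- apply Dx. destruct Hc as [Hc|Hc].
  + generalize (filter_and _ _ (u_gt_open k x 0 Hc) (u_between_open k x _ _ Hx)). apply filter_imp.
    intros w [Hw1 Hw2]. apply (dom_W_iff k a hRe hIm ha). lra.
  + generalize (u_between_open k x _ _ Hx). apply filter_imp. intros w Hw. apply (dom_W_iff k a hRe hIm ha). lra.
- apply (root_main_diff (fun x => x) (fun _ => y) x); [apply Cdiff_id|apply Cdiff_const|exact S1|exact S2].
- apply Dy. destruct Hc as [Hc|Hc].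
  + generalize (u_between_open k y _ _ Hy). apply filter_imp. intros w Hw. apply (dom_W_iff k a hRe hIm ha). lra.
  + generalize (filter_and _ _ (u_gt_open k y 0 Hc) (u_between_open k y _ _ Hy)). apply filter_imp.
    intros w [Hw1 Hw2]. apply (dom_W_iff k a hRe hIm ha). lra.
- apply (root_main_diff (fun _ => x) (fun y => y) y); [apply Cdiff_const|apply Cdiff_id|exact S1|exact S2].
Qed.

Lemma V_of_U_diff (x y : C) : dom_U k a (x, y) ->
  ((u x < 0)%R -> Cdiff (fun x => V_of_U (x, y)) x) /\
  ((u y < 0)%R -> Cdiff (fun y => V_of_U (x, y)) y).
Proof.
intros Hp. destruct (analytic_on_partials _ _ x y (proj1 (proj2 H3)) Hp) as [Dx Dy].
destruct (slit_cos_dom_U k a hRe hIm ha x y (dom_U_closed_of_dom_U k a hRe hIm ha _ Hp)) as [S1 S2].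
apply (dom_U_iff k a hRe hIm ha) in Hp as [Hx Hy].
split; intros Hc; (apply Cdiff_mult; [apply Cdiff_mult; [apply Cdiff_const|]|apply Cdiff_div; [now apply root_tail_neq_0| |]]).
- apply Dx. assert (Hx' : (- (PI / 2) < u x < 0)%R) by lra.
  generalize (u_between_open k x _ _ Hx'). apply filter_imp. intros w Hw. apply (dom_U_iff k a hRe hIm ha). lra.
- apply (root_cos_diff (fun x => x) (fun _ => y) x); [apply Cdiff_id|apply Cdiff_const|exact S1].
- apply (root_tail_diff (fun x => x) (fun _ => y) x); [apply Cdiff_id|apply Cdiff_const|exact S2].
- apply Dy. assert (Hy' : (- (PI / 2) < u y < 0)%R) by lra.
  generalize (u_between_open k y _ _ Hy'). apply filter_imp. intros w Hw. apply (dom_U_iff k a hRe hIm ha). lra.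
- apply (root_cos_diff (fun _ => x) (fun y => y) y); [apply Cdiff_const|apply Cdiff_id|exact S1].
- apply (root_tail_diff (fun _ => x) (fun y => y) y); [apply Cdiff_const|apply Cdiff_id|exact S2].
Qed.

Lemma V_agree_Gamma (x y : C) : u x = 0%R -> u y = 0%R -> V_of_W (x, y) = V_of_U (x, y).
Proof.
intros Hx Hy. assert (Hpi := PI_RGT_0). unfold V_of_W, V_of_U.
rewrite (proj1 H3) by now apply (Gamma_iff k a hRe hIm ha).
rewrite (K_Gamma k a hRe hIm ha K hK x y Hx Hy).
assert (HW : dom_W_closed k a (x, y)).
{ apply (dom_W_closed_of_dom_W k a hRe hIm ha). apply (dom_W_iff k a hRe hIm ha). lra. }
assert (HU : dom_U_closed k a (x, y)).
{ apply (dom_U_closed_of_dom_U k a hRe hIm ha). apply (dom_U_iff k a hRe hIm ha). lra. }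
destruct (slit_dom_W k a hRe hIm ha x y HW) as [S1 S2]. destruct (slit_cos_dom_U k a hRe hIm ha x y HU) as [S3 _].
assert (N1 := csqrt_neq_0 _ S1). assert (N2 := root_tail_neq_0 _ S2). assert (N3 := root_cos_neq_0 _ S3).
unfold root_main.
replace (Ci * k * (- Ci * / (k * root_cos (x, y) * csqrt (fac1 (x, y))) * W (x, y)) * (root_cos (x, y) / root_tail (x, y)))
  with (- (Ci * Ci) * (W (x, y) / (csqrt (fac1 (x, y)) * root_tail (x, y)))).
- rewrite Ci2. ring.
- field. repeat split; assumption.
Qed.

(** The difference of the two vanishes on Gamma x Gamma, hence on Gamma x M- and M- x Gamma
by uniqueness in the coordinate that runs through M-. *)
Lemma V_agree (x y : C) : dom_W_closed k a (x, y) -> dom_U_closed k a (x, y) -> V_of_W (x, y) = V_of_U (x, y).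
Proof.
intros HW HU. assert (Hpi := PI_RGT_0). assert (HW' := HW). assert (HU' := HU).
apply (dom_W_closed_iff k a hRe hIm ha) in HW' as [[H0 _] Hns]. apply (dom_U_closed_iff k a hRe hIm ha) in HU' as [[Hx Hy] _].
assert (Hor : (u x = 0 \/ u y = 0)%R) by lra. apply Cminus_eq. destruct Hor as [E|E].
- assert (Hdom : forall w, (- (PI / 2) <= u w <= 0)%R /\ ~ singular_edge k a (x, w) ->
    dom_W_closed k a (x, w) /\ dom_U_closed k a (x, w)).
  { intros w [Hw Hw']. split.
    - apply (dom_W_closed_iff k a hRe hIm ha). split; [lra|easy].
    - apply (dom_U_closed_iff k a hRe hIm ha). split; [lra|easy]. }
  apply (strip_zero k a hRe hIm ha (fun w => V_of_W (x, w) - V_of_U (x, w)) (fun w => ~ singular_edge k a (x, w)) (- (PI / 2)) 0); try easy.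
  + lra.
  + intros w Hw. apply Clim_minus.
    * apply (continuous_on_sub (T := C_UniformSpace) (U := C_UniformSpace) (fun w => dom_W_closed k a (x, w)) _ (fun w => V_of_W (x, w)));
        [intros v Hv; now apply Hdom|apply slice_y, V_of_W_cont|exact Hw].
    * apply (continuous_on_sub (T := C_UniformSpace) (U := C_UniformSpace) (fun w => dom_U_closed k a (x, w)) _ (fun w => V_of_U (x, w)));
        [intros v Hv; now apply Hdom|apply slice_y, V_of_U_cont|exact Hw].
  + intros w Hw. apply (interior_regular k a hRe hIm ha); lra.
  + intros w Hw. apply Cdiff_minus.
    * refine (proj2 (V_of_W_diff x w _) _); [apply (dom_W_iff k a hRe hIm ha)|]; lra.
    * refine (proj2 (V_of_U_diff x w _) _); [apply (dom_U_iff k a hRe hIm ha)|]; lra.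
  + intros w Hw. rewrite V_agree_Gamma by assumption. apply Cplus_opp_r.
- assert (Hdom : forall w, (- (PI / 2) <= u w <= 0)%R /\ ~ singular_edge k a (w, y) ->
    dom_W_closed k a (w, y) /\ dom_U_closed k a (w, y)).
  { intros w [Hw Hw']. split.
    - apply (dom_W_closed_iff k a hRe hIm ha). split; [lra|easy].
    - apply (dom_U_closed_iff k a hRe hIm ha). split; [lra|easy]. }
  apply (strip_zero k a hRe hIm ha (fun w => V_of_W (w, y) - V_of_U (w, y)) (fun w => ~ singular_edge k a (w, y)) (- (PI / 2)) 0); try easy.
  + lra.
  + intros w Hw. apply Clim_minus.
    * apply (continuous_on_sub (T := C_UniformSpace) (U := C_UniformSpace) (fun w => dom_W_closed k a (w, y)) _ (fun w => V_of_W (w, y)));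
        [intros v Hv; now apply Hdom|apply slice_x, V_of_W_cont|exact Hw].
    * apply (continuous_on_sub (T := C_UniformSpace) (U := C_UniformSpace) (fun w => dom_U_closed k a (w, y)) _ (fun w => V_of_U (w, y)));
        [intros v Hv; now apply Hdom|apply slice_x, V_of_U_cont|exact Hw].
  + intros w Hw. apply (interior_regular k a hRe hIm ha); lra.
  + intros w Hw. apply Cdiff_minus.
    * refine (proj1 (V_of_W_diff w y _) _); [apply (dom_W_iff k a hRe hIm ha)|]; lra.
    * refine (proj1 (V_of_U_diff w y _) _); [apply (dom_U_iff k a hRe hIm ha)|]; lra.
  + intros w Hw. rewrite V_agree_Gamma by assumption. apply Cplus_opp_r.
Qed.

Definition V_base (p : C * C) : C :=
  if Rle_dec 0 (u (fst p)) then V_of_W p else if Rle_dec 0 (u (snd p)) then V_of_W p else V_of_U p.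

Definition dom_base (p : C * C) : Prop :=
  (- (PI / 2) <= u (fst p) <= PI / 2 /\ - (PI / 2) <= u (snd p) <= PI / 2)%R /\ ~ singular_edge k a p.

Lemma V_base_W (p : C * C) : dom_W_closed k a p -> V_base p = V_of_W p.
Proof.
destruct p as [x y]. intros H. unfold V_base. simpl fst. simpl snd.
destruct (Rle_dec 0 (u x)); [easy|]. destruct (Rle_dec 0 (u y)); [easy|].
apply (dom_W_closed_iff k a hRe hIm ha) in H. lra.
Qed.

Lemma V_base_U (p : C * C) : dom_U_closed k a p -> V_base p = V_of_U p.
Proof.
assert (Hpi := PI_RGT_0). destruct p as [x y]. intros H. assert (H' := H).
apply (dom_U_closed_iff k a hRe hIm ha) in H' as [Hu Hns]. unfold V_base. simpl fst. simpl snd.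
destruct (Rle_dec 0 (u x)) as [Hx|Hx]; [|destruct (Rle_dec 0 (u y)) as [Hy|Hy]; [|easy]];
  (apply V_agree; [|exact H]; apply (dom_W_closed_iff k a hRe hIm ha); split; [lra|exact Hns]).
Qed.

Lemma u_fst_cont (p : C2) : @continuous C2 R_UniformSpace (fun p => u (fst p)) p.
Proof. apply (ucoord_lim (F := @locally C2 p) k fst). apply C2cont_fst. Qed.

Lemma u_snd_cont (p : C2) : @continuous C2 R_UniformSpace (fun p => u (snd p)) p.
Proof. apply (ucoord_lim (F := @locally C2 p) k snd). apply C2cont_snd. Qed.

Lemma V_base_cont : @continuous_on C2 C_UniformSpace dom_base V_base.
Proof.
assert (Hpi := PI_RGT_0).
assert (HW : forall D : C2 -> Prop, (forall p, D p -> dom_base p /\ (0 <= u (fst p) \/ 0 <= u (snd p))%R) ->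
  @continuous_on C2 C_UniformSpace D V_base).
{ intros D HD. apply (continuous_on_sub (T := C2) (U := C_UniformSpace) (dom_W_closed k a)).
  - intros [x y] Hp. destruct (HD _ Hp) as [[Hu Hns] H0]. simpl fst in *. simpl snd in *.
    apply (dom_W_closed_iff k a hRe hIm ha). split; [lra|exact Hns].
  - apply (continuous_on_eq (T := C2) (U := C_UniformSpace) _ V_of_W); [intros p Hp; symmetry; now apply V_base_W|exact V_of_W_cont]. }
apply (continuous_on_split (T := C2) (U := C_UniformSpace) dom_base (fun p => u (fst p)) 0); [exact u_fst_cont| |].
- apply (continuous_on_split (T := C2) (U := C_UniformSpace) _ (fun p => u (snd p)) 0); [exact u_snd_cont| |].
  + apply (continuous_on_sub (T := C2) (U := C_UniformSpace) (dom_U_closed k a)).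
    * intros [x y] [[[Hu Hns] Hx] Hy]. simpl fst in *. simpl snd in *.
      apply (dom_U_closed_iff k a hRe hIm ha). split; [lra|exact Hns].
    * apply (continuous_on_eq (T := C2) (U := C_UniformSpace) _ V_of_U); [intros p Hp; symmetry; now apply V_base_U|exact V_of_U_cont].
  + apply HW. intros p [[Hb _] Hy]. split; [exact Hb|now right].
- apply HW. intros p [Hb Hx]. split; [exact Hb|now left].
Qed.

(** The curve u = 0 is left out, where the two definitions meet. *)
Lemma V_base_diff (x y : C) : (- (PI / 2) < u x < PI / 2)%R -> (- (PI / 2) < u y < PI / 2)%R ->
  (u x <> 0%R -> Cdiff (fun x => V_base (x, y)) x) /\ (u y <> 0%R -> Cdiff (fun y => V_base (x, y)) y).
Proof.
intros Hx Hy. assert (Hpi := PI_RGT_0).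
assert (HbW : forall x y, (- (PI / 2) < u x < PI / 2)%R -> (- (PI / 2) < u y < PI / 2)%R -> (0 <= u x \/ 0 <= u y)%R ->
  V_base (x, y) = V_of_W (x, y)).
{ intros x' y' A B H. apply V_base_W, (dom_W_closed_of_dom_W k a hRe hIm ha), (dom_W_iff k a hRe hIm ha). lra. }
assert (HbU : forall x y, (- (PI / 2) < u x <= 0)%R -> (- (PI / 2) < u y <= 0)%R -> V_base (x, y) = V_of_U (x, y)).
{ intros x' y' A B. apply V_base_U, (dom_U_closed_of_dom_U k a hRe hIm ha), (dom_U_iff k a hRe hIm ha). lra. }
split; intros Hn.
- destruct (Rlt_dec 0 (u x)) as [P|P]; [|destruct (Rle_dec 0 (u y)) as [Q|Q]].
  + apply (Cdiff_ext_loc (fun x => V_of_W (x, y))).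
    * assert (Hx' : (0 < u x < PI / 2)%R) by lra.
      generalize (u_between_open k x _ _ Hx'). apply filter_imp. intros w Hw. symmetry. apply HbW; lra.
    * refine (proj1 (V_of_W_diff x y _) _); [apply (dom_W_iff k a hRe hIm ha)|]; lra.
  + apply (Cdiff_ext_loc (fun x => V_of_W (x, y))).
    * generalize (u_between_open k x _ _ Hx). apply filter_imp. intros w Hw. symmetry. apply HbW; lra.
    * refine (proj1 (V_of_W_diff x y _) _); [apply (dom_W_iff k a hRe hIm ha)|]; lra.
  + apply (Cdiff_ext_loc (fun x => V_of_U (x, y))).
    * assert (Hx' : (- (PI / 2) < u x < 0)%R) by lra.
      generalize (u_between_open k x _ _ Hx'). apply filter_imp. intros w Hw. symmetry. apply HbU; lra.
    * refine (proj1 (V_of_U_diff x y _) _); [apply (dom_U_iff k a hRe hIm ha)|]; lra.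
- destruct (Rlt_dec 0 (u y)) as [P|P]; [|destruct (Rle_dec 0 (u x)) as [Q|Q]].
  + apply (Cdiff_ext_loc (fun y => V_of_W (x, y))).
    * assert (Hy' : (0 < u y < PI / 2)%R) by lra.
      generalize (u_between_open k y _ _ Hy'). apply filter_imp. intros w Hw. symmetry. apply HbW; lra.
    * refine (proj2 (V_of_W_diff x y _) _); [apply (dom_W_iff k a hRe hIm ha)|]; lra.
  + apply (Cdiff_ext_loc (fun y => V_of_W (x, y))).
    * generalize (u_between_open k y _ _ Hy). apply filter_imp. intros w Hw. symmetry. apply HbW; lra.
    * refine (proj2 (V_of_W_diff x y _) _); [apply (dom_W_iff k a hRe hIm ha)|]; lra.
  + apply (Cdiff_ext_loc (fun y => V_of_U (x, y))).
    * assert (Hy' : (- (PI / 2) < u y < 0)%R) by lra.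
      generalize (u_between_open k y _ _ Hy'). apply filter_imp. intros w Hw. symmetry. apply HbU; lra.
    * refine (proj2 (V_of_U_diff x y _) _); [apply (dom_U_iff k a hRe hIm ha)|]; lra.
Qed.

Lemma W_diff_x (x y : C) : (- (PI / 2) < u x < PI / 2)%R -> (0 <= u y < PI / 2)%R -> Cdiff (fun x => W (x, y)) x.
Proof.
intros Hx Hy. assert (Hpi := PI_RGT_0).
assert (Hp : dom_W k a (x, y)) by (apply (dom_W_iff k a hRe hIm ha); lra).
apply (analytic_on_partials _ _ x y (proj1 H1) Hp).
generalize (u_between_open k x _ _ Hx). apply filter_imp. intros w Hw. apply (dom_W_iff k a hRe hIm ha). lra.
Qed.

Lemma W_diff_y (x y : C) : (0 <= u x < PI / 2)%R -> (- (PI / 2) < u y < PI / 2)%R -> Cdiff (fun y => W (x, y)) y.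
Proof.
intros Hx Hy. assert (Hpi := PI_RGT_0).
assert (Hp : dom_W k a (x, y)) by (apply (dom_W_iff k a hRe hIm ha); lra).
apply (analytic_on_partials _ _ x y (proj1 H1) Hp).
generalize (u_between_open k y _ _ Hy). apply filter_imp. intros w Hw. apply (dom_W_iff k a hRe hIm ha). lra.
Qed.

Lemma dom_W_closed_swap (x y : C) : dom_W_closed k a (x, y) <-> dom_W_closed k a (y, x).
Proof.
rewrite !(dom_W_closed_iff k a hRe hIm ha), (singular_edge_swap k a hRe hIm ha x y).
split; intros [A B]; (split; [lra|exact B]).
Qed.

Lemma W_reflect_x (x y : C) : u x = (PI / 2)%R -> dom_W_closed k a (x, y) -> W (x, y) = W (RtoC PI - x, y).
Proof.
apply (reflection_spreads k a hRe hIm ha W (proj2 H1)).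
- exact W_diff_y.
- intros x' y' Hx Hy. apply H2; now apply (m_plus_iff k a hRe hIm ha).
Qed.

(** Exchanging the coordinates reduces this to [reflection_spreads]. *)
Lemma W_reflect_y (x y : C) : u y = (PI / 2)%R -> dom_W_closed k a (x, y) -> W (x, y) = W (x, RtoC PI - y).
Proof.
intros Hy Hp.
apply (reflection_spreads k a hRe hIm ha (fun p => W (swap p))) with (x := y) (y := x).
- apply (continuous_on_comp_cont (T := C2) (S := C2) (U := C_UniformSpace) _ (dom_W_closed k a) swap W).
  + intros [x' y'] Hp'. now apply dom_W_closed_swap.
  + intros p _. apply swap_cont.
  + exact (proj2 H1).
- intros y' x' Hy' Hx'. exact (W_diff_x x' y' Hx' Hy').
- intros y' x' Hy' Hx'. apply H2; now apply (m_plus_iff k a hRe hIm ha).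
- exact Hy.
- now apply dom_W_closed_swap.
Qed.

(** On m+ the symmetry of V is that of W, as the root is symmetric too. *)
Lemma V_base_reflect_x (x y : C) : u x = (PI / 2)%R -> dom_base (x, y) -> V_base (RtoC PI - x, y) = V_base (x, y).
Proof.
intros Hx [Hu Hns]. assert (Hpi := PI_RGT_0). simpl fst in *. simpl snd in *.
assert (Hx' : u (RtoC PI - x) = (PI / 2)%R) by (rewrite ucoord_R_minus, Hx; lra).
assert (Hp : dom_W_closed k a (x, y)) by (apply (dom_W_closed_iff k a hRe hIm ha); split; [lra|exact Hns]).
assert (Hp' : dom_W_closed k a (RtoC PI - x, y)).
{ apply (dom_W_closed_iff k a hRe hIm ha). rewrite (singular_edge_reflect_x k a hRe hIm ha). split; [lra|exact Hns]. }
rewrite !V_base_W by assumption. unfold V_of_W. rewrite root_main_reflect_x, <- W_reflect_x by assumption. reflexivity.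
Qed.

Lemma V_base_reflect_y (x y : C) : u y = (PI / 2)%R -> dom_base (x, y) -> V_base (x, RtoC PI - y) = V_base (x, y).
Proof.
intros Hy [Hu Hns]. assert (Hpi := PI_RGT_0). simpl fst in *. simpl snd in *.
assert (Hy' : u (RtoC PI - y) = (PI / 2)%R) by (rewrite ucoord_R_minus, Hy; lra).
assert (Hp : dom_W_closed k a (x, y)) by (apply (dom_W_closed_iff k a hRe hIm ha); split; [lra|exact Hns]).
assert (Hp' : dom_W_closed k a (x, RtoC PI - y)).
{ apply (dom_W_closed_iff k a hRe hIm ha).
  rewrite (singular_edge_swap k a hRe hIm ha), (singular_edge_reflect_x k a hRe hIm ha), (singular_edge_swap k a hRe hIm ha).
  split; [lra|exact Hns]. }
rewrite !V_base_W by assumption. unfold V_of_W.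
rewrite (root_main_swap x (RtoC PI - y)), root_main_reflect_x, (root_main_swap y x), <- W_reflect_y by assumption. reflexivity.
Qed.

(** ** The function V on the double strip *)

Definition fold_pi (z : C) : C := if Rle_dec (u z) (PI / 2) then z else RtoC PI - z.

Definition V_full (p : C * C) : C := V_base (fold_pi (fst p), fold_pi (snd p)).

Lemma singular_edge_reflect (b1 b2 : bool) (p : C * C) : singular_edge k a (reflect b1 b2 p) <-> singular_edge k a p.
Proof.
destruct p as [x y]. unfold reflect. simpl fst. simpl snd.
assert (Ry : forall v w, singular_edge k a (v, PI - w) <-> singular_edge k a (v, w)).
{ intros v w. rewrite (singular_edge_swap k a hRe hIm ha v (PI - w)), (singular_edge_reflect_x k a hRe hIm ha).
  apply (singular_edge_swap k a hRe hIm ha). }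
destruct b1, b2; rewrite ?Ry, ?(singular_edge_reflect_x k a hRe hIm ha); tauto.
Qed.

(** Both truth values are admitted on m+, so that the pieces of the double strip are
closed and can be pasted. *)
Definition side (b : bool) (z : C) : Prop := if b then (PI / 2 <= u z)%R else (u z <= PI / 2)%R.

Lemma fold_pi_side (b : bool) (z : C) : side b z ->
  fold_pi z = (if b then PI - z else z) \/ (u z = (PI / 2)%R /\ fold_pi z = z /\ b = true).
Proof.
unfold side, fold_pi. destruct b; destruct (Rle_dec (u z) (PI / 2)); intros H; auto; try lra.
right. repeat split; lra.
Qed.

(** On m+ the choice of the piece does not matter by the reflection symmetry. *)
Lemma V_full_piece (b1 b2 : bool) (x y : C) : Omega_all_closed k a (x, y) -> side b1 x -> side b2 y ->
  V_full (x, y) = V_base (reflect b1 b2 (x, y)).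
Proof.
intros Hp Hs1 Hs2. assert (Hpi := PI_RGT_0). apply (Omega_all_closed_iff k a hRe hIm ha) in Hp as [Hu Hns].
assert (Hdb : forall c1 c2, side c1 x -> side c2 y -> dom_base (reflect c1 c2 (x, y))).
{ intros c1 c2 A B. split; [|now rewrite singular_edge_reflect].
  unfold reflect. simpl fst. simpl snd. unfold side in A, B.
  destruct c1, c2; rewrite ?ucoord_R_minus; lra. }
unfold V_full. simpl fst. simpl snd. unfold reflect. simpl fst. simpl snd.
transitivity (V_base (if b1 then PI - x else x, fold_pi y)).
- destruct (fold_pi_side b1 x Hs1) as [-> | [E [-> ->]]]; [reflexivity|].
  symmetry. apply V_base_reflect_x; [exact E|].
  assert (Hs : side false x) by (unfold side; lra).
  destruct (fold_pi_side b2 y Hs2) as [-> | [E' [-> ->]]].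
  + exact (Hdb false b2 Hs Hs2).
  + assert (Hs' : side false y) by (unfold side; lra). exact (Hdb false false Hs Hs').
- destruct (fold_pi_side b2 y Hs2) as [-> | [E [-> ->]]]; [reflexivity|].
  symmetry. apply V_base_reflect_y; [exact E|].
  assert (Hs : side false y) by (unfold side; lra). exact (Hdb b1 false Hs1 Hs).
Qed.

Lemma dom_base_reflect (b1 b2 : bool) (x y : C) : Omega_all_closed k a (x, y) -> side b1 x -> side b2 y ->
  dom_base (reflect b1 b2 (x, y)).
Proof.
intros Hp Hs1 Hs2. apply (Omega_all_closed_iff k a hRe hIm ha) in Hp as [Hu Hns].
split; [|now rewrite singular_edge_reflect].
unfold reflect. simpl fst. simpl snd. unfold side in Hs1, Hs2.
destruct b1, b2; rewrite ?ucoord_R_minus; lra.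
Qed.

Lemma V_full_cont : @continuous_on C2 C_UniformSpace (Omega_all_closed k a) V_full.
Proof.
assert (Hpiece : forall b1 b2 (D : C2 -> Prop),
  (forall p, D p -> Omega_all_closed k a p /\ side b1 (fst p) /\ side b2 (snd p)) -> @continuous_on C2 C_UniformSpace D V_full).
{ intros b1 b2 D HD. apply (continuous_on_eq (T := C2) (U := C_UniformSpace) _ (fun p => V_base (reflect b1 b2 p))).
  - intros [x y] Hp. destruct (HD _ Hp) as [A [B E]]. symmetry. now apply V_full_piece.
  - apply (continuous_on_comp_cont (T := C2) (S := C2) (U := C_UniformSpace) _ dom_base (reflect b1 b2) V_base).
    + intros [x y] Hp. destruct (HD _ Hp) as [A [B E]]. now apply dom_base_reflect.
    + intros p _. apply reflect_cont.
    + exact V_base_cont. }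
apply (continuous_on_split (T := C2) (U := C_UniformSpace) _ (fun p => u (fst p)) (PI / 2)); [exact u_fst_cont| |];
  (apply (continuous_on_split (T := C2) (U := C_UniformSpace) _ (fun p => u (snd p)) (PI / 2)); [exact u_snd_cont| |]).
- apply (Hpiece false false). intros p [[A B] E]. now split.
- apply (Hpiece false true). intros p [[A B] E]. now split.
- apply (Hpiece true false). intros p [[A B] E]. now split.
- apply (Hpiece true true). intros p [[A B] E]. now split.
Qed.

Lemma in_T_Omega (x y : C) : inT x -> inT y -> Omega_all_closed k a (x, y).
Proof.
intros Hx Hy. unfold in_T in Hx, Hy. apply (Omega_all_closed_iff k a hRe hIm ha). split; [lra|].
now apply (interior_regular k a hRe hIm ha).
Qed.

Lemma V_full_C2cont (x y : C) : inT x -> inT y -> C2cont V_full (x, y).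
Proof.
intros Hx Hy. apply (continuous_on_nbhd (T := C2) (U := C_UniformSpace) (Omega_all_closed k a)); [exact V_full_cont|].
generalize (locally_C2_prod _ _ x y (in_T_open k x Hx) (in_T_open k y Hy)). apply filter_imp.
intros [x' y'] [Hx' Hy']. now apply in_T_Omega.
Qed.

Lemma side_locally (z : C) : inT z -> u z <> (PI / 2)%R -> exists b,
  side b z /\ (- (PI / 2) < u (if b then PI - z else z) < PI / 2)%R /\
  @locally C_UniformSpace z (fun w => inT w /\ side b w).
Proof.
intros HT H. assert (Hpi := PI_RGT_0). assert (HT' := HT). unfold in_T in HT'.
destruct (Rlt_dec (u z) (PI / 2)) as [Hlt|Hge].
- exists false. split; [unfold side; lra|]. split; [lra|].
  generalize (filter_and _ _ (in_T_open k z HT) (u_lt_open k z _ Hlt)). apply filter_imp.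
  intros w [A B]. split; [exact A|]. unfold side. lra.
- exists true. assert (Hgt : (PI / 2 < u z)%R) by lra. split; [unfold side; lra|].
  split; [rewrite ucoord_R_minus; lra|].
  generalize (filter_and _ _ (in_T_open k z HT) (u_gt_open k z _ Hgt)). apply filter_imp.
  intros w [A B]. split; [exact A|]. unfold side. lra.
Qed.

(** Off m+ the function is locally one reflected copy of [V_base], whose exceptional curve
u = 0 becomes u = 0 or u = pi. *)
Lemma V_full_regular_diff (x y : C) : inT x -> inT y -> u x <> (PI / 2)%R -> u y <> (PI / 2)%R ->
  (u x <> 0%R -> u x <> PI -> Cdiff (fun x => V_full (x, y)) x) /\
  (u y <> 0%R -> u y <> PI -> Cdiff (fun y => V_full (x, y)) y).
Proof.
intros Hx Hy Nx Ny.
destruct (side_locally x Hx Nx) as [b1 [S1 [B1 L1]]]. destruct (side_locally y Hy Ny) as [b2 [S2 [B2 L2]]].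
assert (Hdiff : forall b z, Cdiff (fun z => if b : bool then PI - z else z) z).
{ intros [|] z; [apply Cdiff_minus; [apply Cdiff_const|apply Cdiff_id]|apply Cdiff_id]. }
assert (Hnz : forall (b : bool) z, u z <> 0%R -> u z <> PI -> u (if b then PI - z else z) <> 0%R).
{ intros [|] z A B; rewrite ?ucoord_R_minus; lra. }
destruct (V_base_diff _ _ B1 B2) as [Dx Dy].
split; intros N0 NPI.
- apply (Cdiff_ext_loc (fun x => V_base (if b1 then PI - x else x, if b2 then PI - y else y))).
  + revert L1. apply filter_imp. intros w [Tw Sw]. symmetry.
    exact (V_full_piece b1 b2 w y (in_T_Omega w y Tw Hy) Sw S2).
  + apply (Cdiff_comp (fun x => if b1 then PI - x else x) (fun x => V_base (x, if b2 then PI - y else y))); [|apply Hdiff].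
    exact (Dx (Hnz b1 x N0 NPI)).
- apply (Cdiff_ext_loc (fun y => V_base (if b1 then PI - x else x, if b2 then PI - y else y))).
  + revert L2. apply filter_imp. intros w [Tw Sw]. symmetry.
    exact (V_full_piece b1 b2 x w (in_T_Omega x w Hx Tw) S1 Sw).
  + apply (Cdiff_comp (fun y => if b2 then PI - y else y) (fun y => V_base (if b1 then PI - x else x, y))); [|apply Hdiff].
    exact (Dy (Hnz b2 y N0 NPI)).
Qed.

Lemma V_full_partials (x y : C) : inT x -> inT y ->
  Cdiff (fun x => V_full (x, y)) x /\ Cdiff (fun y => V_full (x, y)) y.
Proof.
intros Hx Hy. split.
- apply (separate_Cdiff k a hRe hIm ha V_full); [exact V_full_C2cont| |exact Hx|exact Hy].
  intros x' y' A B N1 N2 N3 N4. exact (proj1 (V_full_regular_diff x' y' A B N2 N4) N1 N3).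
- refine (separate_Cdiff k a hRe hIm ha (fun p => V_full (swap p)) _ _ y x Hy Hx).
  + intros y' x' A B. apply (continuous_comp (U := C2) (V := C2) (W := C_UniformSpace) swap V_full); [apply swap_cont|].
    exact (V_full_C2cont x' y' B A).
  + intros y' x' A B N1 N2 N3 N4. exact (proj2 (V_full_regular_diff x' y' B A N4 N2) N1 N3).
Qed.

Lemma V_full_analytic : analytic_on (Omega_all k a) V_full.
Proof.
exists (fun p => inT (fst p) /\ inT (snd p)), V_full. split; [|split; [|split]].
- intros [x y] [Hx Hy]. exact (locally_C2_prod _ _ x y (in_T_open k x Hx) (in_T_open k y Hy)).
- intros [x y] Hp. apply (Omega_all_iff k a hRe hIm ha) in Hp. exact Hp.
- intros [x y] [Hx Hy]. apply (C2diff_open inT inT V_full); [exact (in_T_open k)|exact (in_T_open k)| |exact Hx|exact Hy].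
  intros x' y' A B. split; [now apply V_full_C2cont|now apply V_full_partials].
- reflexivity.
Qed.

Lemma V_full_W (p : C * C) : dom_W_closed k a p -> V_full p = V_of_W p.
Proof.
assert (Hpi := PI_RGT_0). destruct p as [x y]. intros Hp. assert (Hp' := Hp).
apply (dom_W_closed_iff k a hRe hIm ha) in Hp' as [Hu Hns].
rewrite (V_full_piece false false); [now apply V_base_W| | |].
- apply (Omega_all_closed_iff k a hRe hIm ha). split; [lra|exact Hns].
- unfold side. lra.
- unfold side. lra.
Qed.

Lemma V_full_U (p : C * C) : dom_U_closed k a p -> V_full p = V_of_U p.
Proof.
assert (Hpi := PI_RGT_0). destruct p as [x y]. intros Hp. assert (Hp' := Hp).
apply (dom_U_closed_iff k a hRe hIm ha) in Hp' as [Hu Hns].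
rewrite (V_full_piece false false); [now apply V_base_U| | |].
- apply (Omega_all_closed_iff k a hRe hIm ha). split; [lra|exact Hns].
- unfold side. lra.
- unfold side. lra.
Qed.

Lemma V_full_corner (b1 b2 : bool) (x y : C) : u x = (- (PI / 2))%R -> u y = (- (PI / 2))%R ->
  V_full (reflect b1 b2 (x, y)) = V_of_U (x, y).
Proof.
intros Hx Hy. assert (Hpi := PI_RGT_0).
assert (Hns : ~ singular_edge k a (x, y)) by (apply (m_minus_regular k a hRe hIm ha); lra).
assert (E : V_full (reflect b1 b2 (x, y)) = V_base (reflect b1 b2 (reflect b1 b2 (x, y)))).
{ assert (Hns' : ~ singular_edge k a (reflect b1 b2 (x, y))) by now rewrite singular_edge_reflect.
  destruct (reflect b1 b2 (x, y)) as [x' y'] eqn:Er.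
  assert (Hx' : u x' = u (if b1 then PI - x else x)) by (unfold reflect in Er; simpl in Er; injection Er as <- <-; reflexivity).
  assert (Hy' : u y' = u (if b2 then PI - y else y)) by (unfold reflect in Er; simpl in Er; injection Er as <- <-; reflexivity).
  assert (Hx2 : u x' = if b1 then (3 * PI / 2)%R else (- (PI / 2))%R).
  { rewrite Hx'. destruct b1; rewrite ?ucoord_R_minus; lra. }
  assert (Hy2 : u y' = if b2 then (3 * PI / 2)%R else (- (PI / 2))%R).
  { rewrite Hy'. destruct b2; rewrite ?ucoord_R_minus; lra. }
  apply V_full_piece.
  - apply (Omega_all_closed_iff k a hRe hIm ha). split; [destruct b1, b2; lra|exact Hns'].
  - unfold side. destruct b1; lra.
  - unfold side. destruct b2; lra. }
rewrite E, reflect_reflect. apply V_base_U. apply (dom_U_closed_iff k a hRe hIm ha). split; [lra|exact Hns].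
Qed.

(** ** The four stencil conditions *)

Definition W_full (p : C * C) : C := root_all k p * V_full p.

Lemma W_full_eq (p : C * C) : dom_W_closed k a p -> W_full p = W p.
Proof.
intros Hp. unfold W_full. rewrite (root_all_main k a hRe hIm ha) by exact Hp. rewrite V_full_W by exact Hp.
destruct p as [x y]. destruct (slit_dom_W k a hRe hIm ha x y Hp) as [S1 S2].
unfold V_of_W. field. now apply root_main_neq_0.
Qed.

Lemma W_full_corner (b1 b2 : bool) (x y : C) : u x = (- (PI / 2))%R -> u y = (- (PI / 2))%R ->
  W_full (reflect b1 b2 (x, y)) = root_corner (x, y) * V_of_U (x, y).
Proof.
intros Hx Hy. unfold W_full. rewrite V_full_corner by assumption.
rewrite (root_all_corner k a hRe hIm ha); [reflexivity|].
apply (corner_iff k a hRe hIm ha). split; assumption.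
Qed.

(** The corner values of W satisfy U = - i K W because K on m- x m- is the continuation of
the kernel along the bypass. *)
Lemma W_full_corner_U (x y : C) : u x = (- (PI / 2))%R -> u y = (- (PI / 2))%R ->
  U (x, y) = - Ci * K (x, y) * W_full (x, y).
Proof.
intros Hx Hy.
assert (E0 : W_full (x, y) = root_corner (x, y) * V_of_U (x, y)) by exact (W_full_corner false false x y Hx Hy).
rewrite E0.
destruct (slit_corner k a hRe hIm ha x y Hx Hy) as [S1 [S2 S3]].
rewrite (K_corner k a hRe hIm ha K hK x y Hx Hy). unfold root_corner, V_of_U.
assert (N1 := csqrt_neq_0 _ S1). assert (N2 := root_tail_neq_0 _ S2). assert (N3 := root_cos_neq_0 _ S3).
assert (N4 := Ci_neq_0).
replace (- Ci * / (k * root_cos (x, y) * (Ci * csqrt (- fac1 (x, y)))) *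
  (Ci * csqrt (- fac1 (x, y)) * root_tail (x, y) * (Ci * k * U (x, y) * (root_cos (x, y) / root_tail (x, y)))))
  with (- (Ci * Ci) * U (x, y)).
- rewrite Ci2. ring.
- field. repeat split; assumption.
Qed.

(** At all four corners the root and V take the value that they have at the reflected
point of m- x m-. *)
Lemma ASF_StF3 : StF3 a W_full.
Proof.
intros x y Hx Hy. apply (m_minus_iff k a hRe hIm ha) in Hx. apply (m_minus_iff k a hRe hIm ha) in Hy.
assert (E0 : W_full (x, y) = root_corner (x, y) * V_of_U (x, y)) by exact (W_full_corner false false x y Hx Hy).
rewrite E0. split; [|split]; symmetry.
- exact (W_full_corner true false x y Hx Hy).
- exact (W_full_corner false true x y Hx Hy).
- exact (W_full_corner true true x y Hx Hy).
Qed.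

(** On the domain of W a value rho V has the modulus of W.  On M- x M- the number rho V is
a w with U = - i kappa w, for kappa = [root_tail] / (k rho [root_cos]); only for rho = 0
there is no such kappa, but then rho V = 0. *)
Lemma ASF_StF4 : ASF5 k a W U -> StF4 k a V_full.
Proof.
intros [mu H]. exists mu. intros a1 a2 b1 b2 Hb. destruct (H a1 a2 b1 b2 Hb) as [L0 HL]. exists L0.
intros L HL0 HLL w [Hdom [rho [Hrho Hw]]]. specialize (HL L HL0 HLL).
set (p := (RtoC a1 + Ci * RtoC (L * b1), RtoC a2 + Ci * RtoC (L * b2))) in *.
assert (Hrho' : rho * rho = radicand p) by (rewrite <- Hrho; simpl; ring).
destruct Hdom as [Hp|Hp].
- assert (Hpc := dom_W_closed_of_dom_W k a hRe hIm ha p Hp).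
  assert (Hsl : slit (fac1 p) /\ slit_tail p) by (destruct p as [x y]; exact (slit_dom_W k a hRe hIm ha x y Hpc)).
  destruct Hsl as [S1 S2].
  assert (N := root_main_neq_0 p S1 S2). assert (E := root_main_sqr p S1 S2).
  assert (Em : Cmod rho = Cmod (root_main p)).
  { assert (K1 : (Cmod rho * Cmod rho = Cmod (root_main p) * Cmod (root_main p))%R).
    { rewrite <- !Cmod_mult. now rewrite Hrho', E. }
    assert (P1 := Cmod_ge_0 rho). assert (P2 := Cmod_ge_0 (root_main p)). nra. }
  replace (Cmod w) with (Cmod (W p)); [apply HL; now left|].
  rewrite Hw, V_full_W by exact Hpc. unfold V_of_W. rewrite Cmod_mult, Cmod_div, Em by exact N.
  field. apply Cmod_gt_0 in N. lra.
- destruct (Ceq_dec rho 0) as [E0|N0].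
  { rewrite Hw, E0, Cmult_0_l, Cmod_0. apply exp_pos. }
  assert (Hpc := dom_U_closed_of_dom_U k a hRe hIm ha p Hp).
  assert (Hsl : slit_cos p /\ slit_tail p) by (destruct p as [x y]; exact (slit_cos_dom_U k a hRe hIm ha x y Hpc)).
  destruct Hsl as [S1 S2].
  assert (N1 := root_cos_neq_0 p S1). assert (N2 := root_tail_neq_0 p S2).
  assert (E1 := root_cos_sqr p S1). assert (E2 := root_tail_sqr p S2).
  apply HL. right. split; [exact Hp|].
  (* the kappa for which - i kappa rho V = U *)
  exists (root_tail p / (k * rho * root_cos p)).
  assert (Hk : K_radicand k p = k * k * (Ccos (fst p + snd p) * Ccos (fst p - snd p))).
  { destruct p as [x y]. apply K_radicandE. }
  rewrite radicand_fac in Hrho'.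
  assert (E3 : rho * rho = fac1 p * (root_tail p * root_tail p)) by (rewrite Hrho', E2; ring).
  split.
  + rewrite Hk, <- E1.
    replace ((root_tail p / (k * rho * root_cos p)) ^ 2 * (k * k * (root_cos p * root_cos p * fac1 p)))
      with (fac1 p * (root_tail p * root_tail p) / (rho * rho)) by (simpl; field; repeat split; assumption).
    rewrite <- E3. field. assumption.
  + rewrite Hw, V_full_U by exact Hpc. unfold V_of_U.
    replace (- Ci * (root_tail p / (k * rho * root_cos p)) * (rho * (Ci * k * U p * (root_cos p / root_tail p))))
      with (- (Ci * Ci) * U p) by (field; repeat split; assumption).
    rewrite Ci2. ring.
Qed.

End Forward.

(** ** The symmetry of the kernel on the corner *)

Section Symmetry.

Context (k : C) (a : C -> C) (hRe : (0 < Re k)%R) (hIm : (0 < Im k)%R) (ha : angular_branch k a).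
Context (K : C * C -> C) (hK : K_branch k a K).
Notation u := (ucoord k).

Lemma Csin_mPI_minus (z : C) : Csin (- PI - z) = Csin z.
Proof.
replace (- PI - z) with (- (PI - - z)) by ring. rewrite Csin_opp, Csin_PI_minus, Csin_opp. ring.
Qed.

Lemma ucoord_mPI_minus (z : C) : u z = (- (PI / 2))%R -> u (- PI - z) = (- (PI / 2))%R.
Proof. intros H. rewrite <- RtoC_opp, ucoord_R_minus, H. field. Qed.

(** The symmetries fix the reference point and the radicand. *)
Lemma K_symmetric (b1 b2 : bool) (x y : C) : u x = (- (PI / 2))%R -> u y = (- (PI / 2))%R ->
  K (if b1 then - PI - x else x, if b2 then - PI - y else y) = K (x, y).
Proof.
intros Hx Hy.
set (sym := fun p : C * C => (if b1 then - PI - fst p else fst p, if b2 then - PI - snd p else snd p)).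
set (D := fun p : C2 => (u (fst p) = - (PI / 2) /\ u (snd p) = - (PI / 2))%R).
change (K (sym (x, y)) = K (x, y)).
assert (HDs : forall p, D p -> D (sym p)).
{ intros p [A B]. unfold D, sym. simpl fst. simpl snd.
  split; [destruct b1|destruct b2]; try assumption; now apply ucoord_mPI_minus. }
assert (HDm : forall p, D p -> prodset (m_minus a) (m_minus a) p).
{ intros p [A B]. split; now apply (m_minus_iff k a hRe hIm ha). }
assert (HKc : @continuous_on C2 C_UniformSpace D K).
{ apply (continuous_on_sub (T := C2) (U := C_UniformSpace) (prodset (m_minus a) (m_minus a))); [exact HDm|apply hK]. }
apply (roots_agree k D (fun p => K (sym p)) K (- (PI / 2))).
- intros t _. unfold D, ray. simpl fst. simpl snd. rewrite !ucoord_upoint, Hx, Hy. lra.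
- apply (continuous_on_comp_cont (T := C2) (S := C2) (U := C_UniformSpace) D D sym K); [exact HDs| |exact HKc].
  intros [x' y'] _.
  assert (L : forall (b : bool) (h : C2 -> C) p, C2cont h p -> C2cont (fun q => if b then - PI - h q else h q) p).
  { intros [|] h p Hh; [|exact Hh]. apply (Clim_minus (F := @locally C2 p)); [apply Clim_const|exact Hh]. }
  apply (C2_pair_lim (F := @locally C2 (x', y'))); apply L; [apply C2cont_fst|apply C2cont_snd].
- exact HKc.
- intros [x' y'] Hp. assert (Hs := HDs _ Hp). destruct Hp as [A B].
  assert (E1 := K_sqr k a hRe hIm ha K hK x' y' (or_intror (conj A B))).
  destruct Hs as [A' B'].
  pose (X := (if b1 then - PI - x' else x') : C). pose (Y := (if b2 then - PI - y' else y') : C).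
  assert (E2 := K_sqr k a hRe hIm ha K hK X Y (or_intror (conj A' B'))).
  change (sym (x', y')) with (X, Y). change (fst (x', y')) with x' in *. change (snd (x', y')) with y' in *.
  rewrite Ccos_Ccos in E1, E2.
  assert (Es1 : Csin X = Csin x') by (unfold X; destruct b1; [apply Csin_mPI_minus|reflexivity]).
  assert (Es2 : Csin Y = Csin y') by (unfold Y; destruct b2; [apply Csin_mPI_minus|reflexivity]).
  rewrite Es1, Es2 in E2.
  set (R := k * k * (1 - Csin x' * Csin x' - Csin y' * Csin y')) in *.
  assert (NR : R <> 0) by (intro E; rewrite E in E1; apply C1_nz; rewrite <- E1; ring).
  split.
  + set (K2 := K (X, Y)) in *.
    replace (K2 * K2) with (K2 * K2 * R / R) by (field; exact NR). rewrite E2, <- E1. field. exact NR.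
  + intros E. rewrite E in E1. apply C1_nz. rewrite <- E1. ring.
- f_equal. unfold sym. simpl fst. simpl snd.
  assert (E : - PI - RtoC (- (PI / 2)) = RtoC (- (PI / 2))).
  { rewrite <- RtoC_opp, <- RtoC_minus. f_equal. field. }
  destruct b1, b2; now rewrite ?E.
Qed.

Lemma K_neq_0 (x y : C) : u x = (- (PI / 2))%R -> u y = (- (PI / 2))%R -> K (x, y) <> 0.
Proof.
intros Hx Hy E. assert (E1 := K_sqr k a hRe hIm ha K hK x y (or_intror (conj Hx Hy))).
rewrite E in E1. apply C1_nz. rewrite <- E1. ring.
Qed.

(** Shifts by 2 pi become, by StF3, the symmetries of m-, and - i K is a common factor. *)
Lemma ASF4_iff_StF2 (W U : C * C -> C) :
  (forall x y, u x = (- (PI / 2))%R -> u y = (- (PI / 2))%R -> U (x, y) = - Ci * K (x, y) * W (x, y)) ->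
  StF3 a W -> (ASF4 a U <-> StF2 a W).
Proof.
intros HU H3.
assert (Hsh : forall x y, u x = (- (PI / 2))%R -> u y = (- (PI / 2))%R ->
  W (2 * PI + x, 2 * PI + y) = W (- PI - x, - PI - y) /\ W (x, 2 * PI + y) = W (x, - PI - y) /\
  W (2 * PI + x, y) = W (- PI - x, y)).
{ intros x y Hx Hy. assert (E : forall z : C, 2 * PI + z = PI - (- PI - z)) by (intro; ring).
  assert (Hx' := ucoord_mPI_minus x Hx). assert (Hy' := ucoord_mPI_minus y Hy). rewrite !E.
  destruct (H3 (- PI - x) (- PI - y)) as [_ [_ E3]]; [now apply (m_minus_iff k a hRe hIm ha)..|].
  destruct (H3 x (- PI - y)) as [_ [E2 _]]; [now apply (m_minus_iff k a hRe hIm ha)..|].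
  destruct (H3 (- PI - x) y) as [E1 _]; [now apply (m_minus_iff k a hRe hIm ha)..|].
  now rewrite <- E1, <- E2, <- E3. }
assert (Key : forall x y, u x = (- (PI / 2))%R -> u y = (- (PI / 2))%R ->
  U (x, y) + U (- PI - x, - PI - y) - (U (x, - PI - y) + U (- PI - x, y)) =
  - Ci * K (x, y) * (W (x, y) + W (2 * PI + x, 2 * PI + y) - W (x, 2 * PI + y) - W (2 * PI + x, y))).
{ intros x y Hx Hy. destruct (Hsh x y Hx Hy) as [-> [-> ->]].
  assert (Hx' := ucoord_mPI_minus x Hx). assert (Hy' := ucoord_mPI_minus y Hy).
  rewrite !HU by assumption.
  assert (E1 := K_symmetric true true x y Hx Hy). assert (E2 := K_symmetric false true x y Hx Hy).
  assert (E3 := K_symmetric true false x y Hx Hy). simpl in E1, E2, E3. rewrite E1, E2, E3. ring. }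
split.
- intros H4 x y Hx Hy. assert (H := H4 x y Hx Hy).
  apply (m_minus_iff k a hRe hIm ha) in Hx. apply (m_minus_iff k a hRe hIm ha) in Hy.
  assert (E := Key x y Hx Hy). rewrite H in E. unfold Cminus at 1 in E. rewrite Cplus_opp_r in E. symmetry in E.
  apply Cmult_integral in E. destruct E as [E|E]; [exfalso|exact E].
  apply Cmult_integral in E. destruct E as [E|E]; [|now apply (K_neq_0 x y)].
  apply Ci_neq_0. replace Ci with (- - Ci) by ring. rewrite E. ring.
- intros H2 x y Hx Hy. assert (H := H2 x y Hx Hy).
  apply (m_minus_iff k a hRe hIm ha) in Hx. apply (m_minus_iff k a hRe hIm ha) in Hy.
  assert (E := Key x y Hx Hy). rewrite H, Cmult_0_r in E. now apply Cminus_eq.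
Qed.

Lemma ASF_StF (W : C * C -> C) : ASF k a K W ->
  exists W' : C * C -> C, (forall p, dom_W_closed k a p -> W' p = W p) /\ StF k a W'.
Proof.
intros [H1 [H2 [U [H3 [H4 H5]]]]].
exists (W_full k W U). split.
- intros p Hp. eapply W_full_eq; eassumption.
- assert (HS3 : StF3 a (W_full k W U)) by (eapply ASF_StF3; eassumption).
  exists (root_all k), (V_full k W U).
  split; [exact (root_all_branch k a hRe hIm ha)|]. split; [split; [|split]|split; [|split]].
  + intros p _. reflexivity.
  + eapply V_full_analytic; eassumption.
  + eapply V_full_cont; eassumption.
  + apply (ASF4_iff_StF2 (W_full k W U) U); [|exact HS3|exact H4].
    intros x y Hx Hy. eapply W_full_corner_U; eassumption.
  + exact HS3.
  + eapply ASF_StF4; eassumption.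
Qed.

End Symmetry.

(** * From StF to ASF *)

Lemma C2diff_open_set (O : C2 -> Prop) (V : C * C -> C) :
  (forall p, O p -> @locally C2 p O) ->
  (forall x y, O (x, y) -> C2cont V (x, y) /\ Cdiff (fun x => V (x, y)) x /\ Cdiff (fun y => V (x, y)) y) ->
  forall p, O p -> C2diff V p.
Proof.
intros HO H [x y] Hp. destruct (HO _ Hp) as [e He]. assert (Hep := cond_pos e).
apply (Osgood V x y (e / 2)); [lra|].
intros x' y' Hx' Hy'. apply H. apply He. split; apply ball_C_Cmod; simpl; lra.
Qed.

(** The factor g is given on an open set, where Osgood's lemma makes it holomorphic, so
that the product extends f's holomorphic continuation. *)
Lemma analytic_on_mult (A A' B : C * C -> Prop) (f g : C * C -> C) :
  analytic_on A f -> (forall p, A' p -> A p /\ B p) -> (forall p, B p -> @locally C2 p B) ->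
  (forall x y, B (x, y) -> C2cont g (x, y) /\ Cdiff (fun x => g (x, y)) x /\ Cdiff (fun y => g (x, y)) y) ->
  analytic_on A' (fun p => g p * f p).
Proof.
intros [O [F [HO [HAO [HF E]]]]] HA HB Hg.
exists (fun p => O p /\ B p), (fun p => g p * F p). split; [|split; [|split]].
- intros p [H1 H2]. apply filter_and; [now apply HO|now apply HB].
- intros p Hp. destruct (HA p Hp) as [H1 H2]. split; [now apply HAO|exact H2].
- apply C2diff_open_set.
  + intros p [H1 H2]. apply filter_and; [now apply HO|now apply HB].
  + intros x y [H1 H2]. destruct (Hg x y H2) as [G1 [G2 G3]]. assert (HFp := HF _ H1).
    destruct (C2diff_partials F x y HFp) as [F1 F2]. assert (F0 := C2diff_cont F (x, y) HFp).
    split; [|split].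
    * exact (Clim_mult (F := @locally C2 (x, y)) g F _ _ G1 F0).
    * exact (Cdiff_mult (fun x => g (x, y)) (fun x => F (x, y)) x G2 F1).
    * exact (Cdiff_mult (fun y => g (x, y)) (fun y => F (x, y)) y G3 F2).
- intros p Hp. destruct (HA p Hp) as [H1 _]. now rewrite (E p H1).
Qed.

Lemma analytic_on_eq (A : C * C -> Prop) (f g : C * C -> C) :
  (forall p, A p -> f p = g p) -> analytic_on A f -> analytic_on A g.
Proof.
intros H [O [F [HO [HAO [HF E]]]]]. exists O, F. repeat split; try assumption.
intros p Hp. rewrite <- H by exact Hp. now apply E.
Qed.

Lemma root_main_regular (x y : C) : slit (fac1 (x, y)) /\ slit_tail (x, y) ->
  C2cont root_main (x, y) /\ Cdiff (fun x => root_main (x, y)) x /\ Cdiff (fun y => root_main (x, y)) y.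
Proof.
intros [S1 S2]. split; [|split].
- apply (filterlim_ext (fun t : C2 => root_main (fst t, snd t))); [now intros [? ?]|].
  exact (root_main_lim (T := C2) fst snd (x, y) (C2cont_fst _) (C2cont_snd _) S1 S2).
- exact (root_main_diff (fun x => x) (fun _ => y) x (Cdiff_id x) (Cdiff_const y x) S1 S2).
- exact (root_main_diff (fun _ => x) (fun y => y) y (Cdiff_const x y) (Cdiff_id y) S1 S2).
Qed.

Lemma root_tail_regular (x y : C) : slit_tail (x, y) ->
  C2cont root_tail (x, y) /\ Cdiff (fun x => root_tail (x, y)) x /\ Cdiff (fun y => root_tail (x, y)) y.
Proof.
intros S2. split; [|split].
- apply (filterlim_ext (fun t : C2 => root_tail (fst t, snd t))); [now intros [? ?]|].
  exact (root_tail_lim (T := C2) fst snd (x, y) (C2cont_fst _) (C2cont_snd _) S2).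
- exact (root_tail_diff (fun x => x) (fun _ => y) x (Cdiff_id x) (Cdiff_const y x) S2).
- exact (root_tail_diff (fun _ => x) (fun y => y) y (Cdiff_const x y) (Cdiff_id y) S2).
Qed.

Lemma root_cos_regular (x y : C) : slit_cos (x, y) ->
  C2cont root_cos (x, y) /\ Cdiff (fun x => root_cos (x, y)) x /\ Cdiff (fun y => root_cos (x, y)) y.
Proof.
intros S2. split; [|split].
- apply (filterlim_ext (fun t : C2 => root_cos (fst t, snd t))); [now intros [? ?]|].
  exact (root_cos_lim (T := C2) fst snd (x, y) (C2cont_fst _) (C2cont_snd _) S2).
- exact (root_cos_diff (fun x => x) (fun _ => y) x (Cdiff_id x) (Cdiff_const y x) S2).
- exact (root_cos_diff (fun _ => x) (fun y => y) y (Cdiff_const x y) (Cdiff_id y) S2).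
Qed.

Section Backward.

Context (k : C) (a : C -> C) (hRe : (0 < Re k)%R) (hIm : (0 < Im k)%R) (ha : angular_branch k a).
Context (K : C * C -> C) (hK : K_branch k a K).
Context (W r V : C * C -> C) (sg : C) (Hsg : sg * sg = 1)
  (Hrm : forall p, dom_W_closed k a p -> r p = sg * root_main p)
  (Hrc : forall b1 b2 p, corner a false false p -> r (reflect b1 b2 p) = sg * root_corner p)
  (H1 : StF1 k a r W V) (H2 : StF2 a W) (H3 : StF3 a W) (H4 : StF4 k a V).
Notation u := (ucoord k).

Let k_neq_0 : k <> 0.
Proof. intro E. rewrite E in hRe. simpl in hRe. lra. Qed.

Let sg_neq_0 : sg <> 0.
Proof. intro E. apply C1_nz. rewrite <- Hsg, E. ring. Qed.

Lemma W_main (p : C * C) : dom_W_closed k a p -> W p = sg * root_main p * V p.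
Proof. intros Hp. rewrite (proj1 H1) by now left. now rewrite Hrm. Qed.

Lemma W_corner (b1 b2 : bool) (p : C * C) : corner a false false p ->
  W (reflect b1 b2 p) = sg * root_corner p * V (reflect b1 b2 p).
Proof.
intros Hp. rewrite (proj1 H1).
- now rewrite (Hrc b1 b2 p Hp).
- right. exists b1, b2. now apply (corner_reflect k a hRe hIm ha).
Qed.

(** This is - i K W on Gamma x Gamma: the root of [fac1] in W cancels against that in K. *)
Definition U_of_V (p : C * C) : C := - Ci * sg * (/ k) * (root_tail p / root_cos p) * V p.

Lemma dom_W_closed_Omega (p : C * C) : dom_W_closed k a p -> Omega_all_closed k a p.
Proof.
assert (Hpi := PI_RGT_0). destruct p as [x y]. rewrite (dom_W_closed_iff k a hRe hIm ha), (Omega_all_closed_iff k a hRe hIm ha).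
intros [A B]. split; [lra|exact B].
Qed.

Lemma dom_U_closed_Omega (p : C * C) : dom_U_closed k a p -> Omega_all_closed k a p.
Proof.
assert (Hpi := PI_RGT_0). destruct p as [x y]. rewrite (dom_U_closed_iff k a hRe hIm ha), (Omega_all_closed_iff k a hRe hIm ha).
intros [A B]. split; [lra|exact B].
Qed.

Lemma StF_ASF1 : ASF1 k a W.
Proof.
assert (Hpi := PI_RGT_0). split.
- apply (analytic_on_eq _ (fun p => (sg * root_main p) * V p)).
  { intros p Hp. symmetry. apply W_main. now apply (dom_W_closed_of_dom_W k a hRe hIm ha). }
  apply (analytic_on_mult (Omega_all k a) _ (fun p => slit (fac1 p) /\ slit_tail p)).
  + apply H1.
  + intros [x y] Hp. split.
    * apply (Omega_all_iff k a hRe hIm ha). apply (dom_W_iff k a hRe hIm ha) in Hp. lra.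
    * apply (slit_dom_W k a hRe hIm ha). now apply (dom_W_closed_of_dom_W k a hRe hIm ha).
  + intros p [A B]. apply filter_and; [now apply slit_fac1_open|now apply slit_tail_open].
  + intros x y Hp. destruct (root_main_regular x y Hp) as [A [B E]]. split; [|split].
    * exact (Clim_mult (F := @locally C2 (x, y)) _ _ _ _ (Clim_const sg) A).
    * exact (Cdiff_mult (fun _ => sg) _ x (Cdiff_const sg x) B).
    * exact (Cdiff_mult (fun _ => sg) _ y (Cdiff_const sg y) E).
- apply (continuous_on_eq (T := C2) (U := C_UniformSpace) _ (fun p => (sg * root_main p) * V p)).
  { intros p Hp. symmetry. now apply W_main. }
  intros p Hp. apply Clim_mult; [apply Clim_mult; [apply Clim_const|now apply (root_main_continuous k a hRe hIm ha)]|].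
  apply (continuous_on_sub (T := C2) (U := C_UniformSpace) (Omega_all_closed k a)); [exact dom_W_closed_Omega|apply H1|exact Hp].
Qed.

Lemma V_partials (x y : C) : in_T k x -> in_T k y ->
  Cdiff (fun x => V (x, y)) x /\ Cdiff (fun y => V (x, y)) y.
Proof.
intros Hx Hy.
assert (HO : Omega_all k a (x, y)) by (apply (Omega_all_iff k a hRe hIm ha); split; assumption).
destruct (analytic_on_partials _ _ x y (proj1 (proj2 H1)) HO) as [Dx Dy]. split.
- apply Dx. generalize (in_T_open k x Hx). apply filter_imp. intros w Hw. apply (Omega_all_iff k a hRe hIm ha). split; assumption.
- apply Dy. generalize (in_T_open k y Hy). apply filter_imp. intros w Hw. apply (Omega_all_iff k a hRe hIm ha). split; assumption.
Qed.

Lemma Omega_reflect (b1 b2 : bool) (p : C * C) : Omega_all_closed k a p -> Omega_all_closed k a (reflect b1 b2 p).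
Proof.
destruct p as [x y]. intros Hp. apply (Omega_all_closed_iff k a hRe hIm ha) in Hp as [Hu Hns].
assert (Hns' : ~ singular_edge k a (reflect b1 b2 (x, y))) by (rewrite (singular_edge_reflect k a hRe hIm ha); exact Hns).
unfold reflect in *. simpl fst in *. simpl snd in *. apply (Omega_all_closed_iff k a hRe hIm ha).
split; [destruct b1, b2; rewrite ?ucoord_R_minus; lra|exact Hns'].
Qed.

Lemma in_T_reflect (b : bool) (z : C) : in_T k z -> in_T k (if b then PI - z else z).
Proof. assert (Hpi := PI_RGT_0). unfold in_T. destruct b; rewrite ?ucoord_R_minus; lra. Qed.

(** The symmetry of W on m- x m- is one of V, because the values of the root at
corresponding corner points coincide; from there it spreads by uniqueness. *)
Lemma V_symmetric (b1 b2 : bool) :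
  (forall x y, m_minus a x -> m_minus a y -> W (x, y) = W (reflect b1 b2 (x, y))) ->
  forall x y, in_T k x -> in_T k y -> V (x, y) = V (reflect b1 b2 (x, y)).
Proof.
intros HW x y Hx Hy. apply Cminus_eq.
apply (corner_uniqueness k a hRe hIm ha (fun p => V p - V (reflect b1 b2 p))); [| | |exact Hx|exact Hy].
- intros p Hp. apply Clim_minus; [now apply H1|].
  apply (continuous_on_comp_cont (T := C2) (S := C2) (U := C_UniformSpace) _ (Omega_all_closed k a) (reflect b1 b2) V); [|intros; apply reflect_cont|apply H1|exact Hp].
  intros q. apply Omega_reflect.
- intros x' y' Hx' Hy'. destruct (V_partials x' y' Hx' Hy') as [A B].
  destruct (V_partials _ _ (in_T_reflect b1 x' Hx') (in_T_reflect b2 y' Hy')) as [A' B'].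
  assert (Hdiff : forall b z, Cdiff (fun z => if b : bool then PI - z else z) z).
  { intros [|] z; [apply Cdiff_minus; [apply Cdiff_const|apply Cdiff_id]|apply Cdiff_id]. }
  split.
  + exact (Cdiff_minus _ _ x' A (Cdiff_comp (fun x => if b1 then PI - x else x) (fun x => V (x, if b2 then PI - y' else y')) x' A' (Hdiff b1 x'))).
  + exact (Cdiff_minus _ _ y' B (Cdiff_comp (fun y => if b2 then PI - y else y) (fun y => V (if b1 then PI - x' else x', y)) y' B' (Hdiff b2 y'))).
- intros x' y' Hx' Hy'.
  assert (Hp : corner a false false (x', y')) by (apply (corner_iff k a hRe hIm ha); split; assumption).
  assert (E := HW x' y' (proj2 (m_minus_iff k a hRe hIm ha x') Hx') (proj2 (m_minus_iff k a hRe hIm ha y') Hy')).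
  rewrite (W_corner b1 b2 _ Hp) in E.
  assert (E0 : W (x', y') = sg * root_corner (x', y') * V (x', y')) by exact (W_corner false false _ Hp).
  rewrite E0 in E. destruct (slit_corner k a hRe hIm ha x' y' Hx' Hy') as [S1 [S2 _]].
  assert (N := root_corner_neq_0 _ S1 S2).
  assert (N' : sg * root_corner (x', y') <> 0) by now apply Cmult_neq_0.
  replace (V (x', y')) with (sg * root_corner (x', y') * V (x', y') / (sg * root_corner (x', y'))) by (field; split; assumption).
  rewrite E. field. split; assumption.
Qed.

Lemma StF_ASF2 : ASF2 a W.
Proof.
assert (Hpi := PI_RGT_0). intros x y Hx Hy.
apply (m_plus_iff k a hRe hIm ha) in Hx. apply (m_plus_iff k a hRe hIm ha) in Hy.
assert (Hdom : forall x y, u x = (PI / 2)%R -> u y = (PI / 2)%R -> dom_W_closed k a (x, y)).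
{ intros x' y' A B. apply (dom_W_closed_iff k a hRe hIm ha). split; [lra|]. apply (interior_regular k a hRe hIm ha); lra. }
assert (Hx' : u (PI - x) = (PI / 2)%R) by (rewrite ucoord_R_minus; lra).
assert (Hy' : u (PI - y) = (PI / 2)%R) by (rewrite ucoord_R_minus; lra).
assert (Tx : in_T k x) by (unfold in_T; lra). assert (Ty : in_T k y) by (unfold in_T; lra).
split; rewrite !W_main by now apply Hdom.
- rewrite root_main_reflect_x.
  rewrite (V_symmetric true false (fun x y A B => proj1 (H3 x y A B)) x y Tx Ty). reflexivity.
- rewrite (root_main_swap x (PI - y)), root_main_reflect_x, (root_main_swap y x).
  rewrite (V_symmetric false true (fun x y A B => proj1 (proj2 (H3 x y A B))) x y Tx Ty). reflexivity.
Qed.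

Lemma StF_ASF3 : ASF3 k a K W U_of_V.
Proof.
assert (Hpi := PI_RGT_0). split; [|split].
- intros x y Hx Hy. apply (Gamma_iff k a hRe hIm ha) in Hx. apply (Gamma_iff k a hRe hIm ha) in Hy.
  assert (HW : dom_W_closed k a (x, y)).
  { apply (dom_W_closed_of_dom_W k a hRe hIm ha). apply (dom_W_iff k a hRe hIm ha). lra. }
  assert (HU : dom_U_closed k a (x, y)).
  { apply (dom_U_closed_of_dom_U k a hRe hIm ha). apply (dom_U_iff k a hRe hIm ha). lra. }
  rewrite W_main, (K_Gamma k a hRe hIm ha K hK x y Hx Hy) by exact HW. unfold U_of_V, root_main.
  destruct (slit_dom_W k a hRe hIm ha x y HW) as [S1 S2]. destruct (slit_cos_dom_U k a hRe hIm ha x y HU) as [S3 _].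
  assert (N1 := csqrt_neq_0 _ S1). assert (N3 := root_cos_neq_0 _ S3).
  field. repeat split; assumption.
- apply (analytic_on_mult (Omega_all k a) _ (fun p => slit_cos p /\ slit_tail p)).
  + apply H1.
  + intros [x y] Hp. split.
    * apply (Omega_all_iff k a hRe hIm ha). apply (dom_U_iff k a hRe hIm ha) in Hp. lra.
    * apply (slit_cos_dom_U k a hRe hIm ha). now apply (dom_U_closed_of_dom_U k a hRe hIm ha).
  + intros p [A B]. apply filter_and; [now apply slit_cos_open|now apply slit_tail_open].
  + intros x y [S1 S2]. destruct (root_cos_regular x y S1) as [A [B E]]. destruct (root_tail_regular x y S2) as [A' [B' E']].
    assert (N := root_cos_neq_0 _ S1). split; [|split].
    * exact (Clim_mult (F := @locally C2 (x, y)) _ _ _ _ (Clim_const (- Ci * sg * / k)) (Clim_div _ _ _ _ N A' A)).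
    * exact (Cdiff_mult _ _ x (Cdiff_const (- Ci * sg * / k) x) (Cdiff_div _ _ x N B' B)).
    * exact (Cdiff_mult _ _ y (Cdiff_const (- Ci * sg * / k) y) (Cdiff_div _ _ y N E' E)).
- intros [x y] Hp. destruct (slit_cos_dom_U k a hRe hIm ha x y Hp) as [S1 S2].
  apply Clim_mult.
  + apply Clim_mult; [apply Clim_const|].
    apply Clim_div; [now apply root_cos_neq_0| |]; apply (filterlim_within (T := C2) (U := C_UniformSpace)).
    * apply (root_tail_regular x y S2).
    * apply (root_cos_regular x y S1).
  + apply (continuous_on_sub (T := C2) (U := C_UniformSpace) (Omega_all_closed k a)); [exact dom_U_closed_Omega|apply H1|exact Hp].
Qed.

(** The relation U = - i K W holds on m- x m- as well, since K and the root of [fac1] are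
continued along the same bypass. *)
Lemma StF_ASF4 : ASF4 a U_of_V.
Proof.
apply (ASF4_iff_StF2 k a hRe hIm ha K hK W U_of_V); [|exact H3|exact H2].
intros x y Hx Hy. destruct (slit_corner k a hRe hIm ha x y Hx Hy) as [S1 [S2 S3]].
assert (Hp : corner a false false (x, y)) by (apply (corner_iff k a hRe hIm ha); split; assumption).
assert (E0 : W (x, y) = sg * root_corner (x, y) * V (x, y)) by exact (W_corner false false _ Hp).
rewrite E0, (K_corner k a hRe hIm ha K hK x y Hx Hy). unfold U_of_V, root_corner.
assert (N1 := csqrt_neq_0 _ S1). assert (N3 := root_cos_neq_0 _ S3). assert (N4 := Ci_neq_0).
field. repeat split; assumption.
Qed.

(** The values that ASF5 bounds are of the form rho V: with rho the given root on the
domain of W, and with rho = [root_tail] / (k kappa [root_cos]), up to the sign, on M- x M-. *)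
Lemma StF_ASF5 : ASF5 k a W U_of_V.
Proof.
destruct H4 as [mu H]. exists mu. intros a1 a2 b1 b2 Hb. destruct (H a1 a2 b1 b2 Hb) as [L0 HL]. exists L0.
intros L HL0 HLL w Hw. apply (HL L HL0 HLL).
set (p := (RtoC a1 + Ci * RtoC (L * b1), RtoC a2 + Ci * RtoC (L * b2))) in *.
destruct Hw as [[Hp Hw]|[Hp [kappa [Hk Hw]]]].
- split; [now left|]. assert (Hpc := dom_W_closed_of_dom_W k a hRe hIm ha p Hp).
  exists (sg * root_main p). split; [|now rewrite Hw, W_main].
  assert (Hsl : slit (fac1 p) /\ slit_tail p) by (destruct p as [x y]; exact (slit_dom_W k a hRe hIm ha x y Hpc)).
  rewrite <- (root_main_sqr p (proj1 Hsl) (proj2 Hsl)).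
  replace ((sg * root_main p) ^ 2) with ((sg * sg) * (root_main p * root_main p)) by (simpl; ring). rewrite Hsg. ring.
- split; [now right|]. assert (Hpc := dom_U_closed_of_dom_U k a hRe hIm ha p Hp).
  assert (Hsl : slit_cos p /\ slit_tail p) by (destruct p as [x y]; exact (slit_cos_dom_U k a hRe hIm ha x y Hpc)).
  destruct Hsl as [S1 S2]. assert (N1 := root_cos_neq_0 p S1). assert (N2 := root_tail_neq_0 p S2).
  assert (E1 := root_cos_sqr p S1). assert (E2 := root_tail_sqr p S2).
  assert (HKr : K_radicand k p = k * k * (Ccos (fst p + snd p) * Ccos (fst p - snd p))).
  { destruct p as [x y]. apply K_radicandE. }
  rewrite HKr, <- E1 in Hk.
  assert (Nk : kappa <> 0) by (intros ->; apply C1_nz; rewrite <- Hk; simpl; ring).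
  exists (sg * root_tail p / (k * root_cos p * kappa)). split.
  + rewrite radicand_fac.
    replace ((sg * root_tail p / (k * root_cos p * kappa)) ^ 2)
      with ((sg * sg) * (root_tail p * root_tail p) / (k * root_cos p * kappa * (k * root_cos p * kappa)))
      by (simpl; field; repeat split; assumption).
    rewrite Hsg, E2.
    replace (1 * (fac2 p * fac3 p * fac4 p) / (k * root_cos p * kappa * (k * root_cos p * kappa)))
      with ((kappa ^ 2 * (k * k * (root_cos p * root_cos p * fac1 p))) * (fac2 p * fac3 p * fac4 p) / (k * root_cos p * kappa * (k * root_cos p * kappa)))
      by (rewrite Hk; reflexivity).
    simpl. field. repeat split; assumption.
  + unfold U_of_V in Hw. assert (N4 := Ci_neq_0).
    replace w with (- Ci * kappa * w / (- Ci * kappa)).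
    * rewrite <- Hw. field. repeat split; try assumption; intro E; apply N4; replace Ci with (- - Ci) by ring; rewrite E; ring.
    * field. repeat split; try assumption; intro E; apply N4; replace Ci with (- - Ci) by ring; rewrite E; ring.
Qed.

End Backward.

Lemma StF_ASF (k : C) (a : C -> C) (K : C * C -> C) (hRe : (0 < Re k)%R) (hIm : (0 < Im k)%R)
    (ha : angular_branch k a) (hK : K_branch k a K) (W : C * C -> C) : StF k a W -> ASF k a K W.
Proof.
intros [r [V [Hr [H1 [H2 [H3 H4]]]]]].
destruct (root_branch_unique k a hRe hIm ha r Hr) as [sg [Hsg [Hrm Hrc]]].
split; [eapply StF_ASF1; eassumption|]. split; [eapply StF_ASF2; eassumption|].
exists (U_of_V k V sg). split; [eapply StF_ASF3; eassumption|].
split; [eapply StF_ASF4; eassumption|eapply StF_ASF5; eassumption].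
Qed.

Theorem proposition3p3 (k : C) (a : C -> C) (K : C * C -> C)
    (hRe : (0 < Re k)%R) (hIm : (0 < Im k)%R)
    (ha : angular_branch k a) (hK : K_branch k a K) :
  (forall W : C * C -> C, ASF k a K W ->
     exists W' : C * C -> C,
       (forall p : C * C, dom_W_closed k a p -> W' p = W p) /\ StF k a W') /\
  (forall W : C * C -> C, StF k a W -> ASF k a K W).
Proof.
split.
- intros W. now apply ASF_StF.
- intros W. now apply StF_ASF.
Qed.
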